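(* Let $(u_{ex},f_{ex})$ be an exact solution of the inverse problem (1)–(4) described in the context, corresponding to the exact data $I_{ex}=(\varphi_{ex},X^{ex},u_0^{ex},u_0^{*ex},u_T^{ex})$, and assume $$u_{ex}\in (C^2([0,T];L^2(\Omega))\cap L^2(0,T;H^2(\Omega)))^2,\quad f_{ex}=(f_{1ex},f_{2ex})\in (L^2(\Omega))^2,\quad \varphi_{ex}\in L^1(0,T)\setminus\{0\}.$$ For each $\varepsilon\in(0,e^{-1})$ let $I_\varepsilon=(\varphi,X,u_0,u_0^*,u_T)$ be data (depending on $\varepsilon$) such that $\|\varphi-\varphi_{ex}\|_{L^1(0,T)}\le\varepsilon$ and, for $j\in\{1,2\}$, $$\|X_j-X_j^{ex}\|_{L^1(0,T;L^1(\partial\Omega))}\le\varepsilon,\quad \|u_{0j}-u_{0j}^{ex}\|_{L^1(\Omega)}\le\varepsilon,\quad \|u_{0j}^*-u_{0j}^{*ex}\|_{L^1(\Omega)}\le\varepsilon,\quad \|u_{Tj}-u_{Tj}^{ex}\|_{L^1(\Omega)}\le\varepsilon .$$ Let $f_\varepsilon=(f_{1\varepsilon},f_{2\varepsilon})$ be the regularized solution constructed from $I_\varepsilon$ as in the context, i.e. the function whose Fourier transform is $$F(f_{j\varepsilon})(\alpha)=\chi_{B(0,R_\varepsilon)}(\alpha)\,\frac{g_j(I_\varepsilon)(\alpha)\,D(I_\varepsilon)(\alpha)}{\delta_\varepsilon+(D(I_\varepsilon)(\alpha))^2},\qquad \alpha\in\mathbb R^2\setminus\{0\}.$$ Then $f_\varepsilon\in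 (C(\overline\Omega))^2$ and $$\lim_{\varepsilon\to0}\|f_{j\varepsilon}-f_{jex}\|_{L^2(\Omega)}=0,\qquad \forall j\in\{1,2\}.$$ If, in addition, $f_{ex}\in(H^1(\Omega))^2$, then for all $\varepsilon>0$ small enough $$\|f_{j\varepsilon}-f_{jex}\|_{L^2(\Omega)}^2\le 63\,e\,T\left(66\,\|f_{jex}\|_{H^1(\Omega)}^2+(2\pi)^{-2}\right)\frac{\ln(\ln(\varepsilon^{-1}))}{\ln(\varepsilon^{-1})},\qquad\forall j\in\{1,2\}.$$
   Context: Setting. $\Omega=(0,1)\times(0,1)$, $T>0$, and $\lambda,\mu$ are real constants with $\mu>0$ and $\lambda+2\mu>0$; $n=(n_1,n_2)$ is the outward unit normal of $\partial\Omega$; $d\omega$ is the surface (arc length) measure on $\partial\Omega$; all functions are real-valued; $\xi\cdot\zeta$ and $|\xi|$ are the Euclidean inner product and norm on $\mathbb R^2$; $\|w\|_{H^1(\Omega)}^2=\|w\|_{L^2(\Omega)}^2+\|\nabla w\|_{L^2(\Omega)}^2$. Data. Data are $I=(\varphi,X,u_0,u_0^*,u_T)$ with $\varphi\in L^1(0,T)$, $X=(X_1,X_2)\in (L^1(0,T;L^1(\partial\Omega)))^2$, and $u_0=(u_{01},u_{02})$, $u_0^*=(u_{01}^*,u_{02}^* )$, $u_T=(u_{T1},u_{T2})$ in $(L^1(\Omega))^2$. Inverse problem (1)–(4). A pair $(u,f)$, $u=(u_1,u_2)(x,t)$, $f=(f_1,f_2)(x)$, satisfies (1)–(4) corresponding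 to the data $I$ if: (1) $\dfrac{\partial^2u_j}{\partial t^2}=\mu\Delta u_j+(\lambda+\mu)\dfrac{\partial}{\partial x_j}\mathrm{div}(u)+\varphi(t)f_j(x)$ in $\Omega\times(0,T)$, $j\in\{1,2\}$; (2) $u(x,t)=(0,0)$ for $x\in\partial\Omega$, $t\in(0,T)$; (3) $u(x,0)=u_0(x)$, $\dfrac{\partial u}{\partial t}(x,0)=u_0^*(x)$, $u(x,T)=u_T(x)$ in $\Omega$; (4) $n_1\sigma_1+n_2\tau=X_1$ and $n_2\sigma_2+n_1\tau=X_2$ on $\partial\Omega\times(0,T)$, where $\tau=\mu\left(\frac{\partial u_1}{\partial x_2}+\frac{\partial u_2}{\partial x_1}\right)$ and $\sigma_j=\lambda\,\mathrm{div}(u)+2\mu\frac{\partial u_j}{\partial x_j}$. The functions $D(I)$ and $g_j(I)$. For data $I$ and $\alpha=(\alpha_1,\alpha_2)\in\mathbb R^2\setminus\{0\}$ put $$D_1(I)=\int_0^T\varphi(T-t)\sin(\sqrt{\lambda+2\mu}\,|\alpha|t)\,dt,\qquad D_2(I)=\int_0^T\varphi(T-t)\sin(\sqrt{\mu}\,|\alpha|t)\,dt,$$ $$D(I)=D_1(I)D_2(I),\qquad g_j(I)=\frac{2}{|\alpha|^2}\left(\alpha_jD_2(I)h_0(I)+D_1(I)h_j(I)\right),\ j\in\{1,2\},$$ where $$\begin{aligned}h_0(I)=&-\sin(\sqrt{\lambda+2\mu}|\alpha|T)\int_\Omega(\alpha\cdot u_0^* )\cos(\alpha\cdot x)dx+\sqrt{\lambda+2\mu}\,|\alpha|\int_\Omega(\alpha\cdot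 u_T)\cos(\alpha\cdot x)dx\\&-\sqrt{\lambda+2\mu}\,|\alpha|\cos(\sqrt{\lambda+2\mu}|\alpha|T)\int_\Omega(\alpha\cdot u_0)\cos(\alpha\cdot x)dx\\&-\int_0^T\int_{\partial\Omega}\sin(\sqrt{\lambda+2\mu}|\alpha|(T-t))(\alpha\cdot X)\cos(\alpha\cdot x)\,d\omega\,dt,\end{aligned}$$ $$\begin{aligned}h_j(I)=&-\sin(\sqrt\mu|\alpha|T)\int_\Omega(|\alpha|^2u_{0j}^*-\alpha_j(\alpha\cdot u_0^* ))\cos(\alpha\cdot x)dx\\&+\sqrt\mu\,|\alpha|\int_\Omega(|\alpha|^2u_{Tj}-\alpha_j(\alpha\cdot u_T))\cos(\alpha\cdot x)dx\\&-\sqrt\mu\,|\alpha|\cos(\sqrt\mu|\alpha|T)\int_\Omega(|\alpha|^2u_{0j}-\alpha_j(\alpha\cdot u_0))\cos(\alpha\cdot x)dx\\&-\int_0^T\int_{\partial\Omega}\sin(\sqrt\mu|\alpha|(T-t))(|\alpha|^2X_j-\alpha_j(\alpha\cdot X))\cos(\alpha\cdot x)\,d\omega\,dt .\end{aligned}$$ Regularization. $q=\frac17$, $\delta_\varepsilon=\varepsilon^{(1+6q)/2}$, $R_\varepsilon=\dfrac{q}{9eT}\cdot\dfrac{\ln(\varepsilon^{-1})}{\ln(\ln(\varepsilon^{-1}))}$; $B(0,R)$ is the open ball in $\mathbb R^2$ and $\chi_A$ the indicator function of $A$. The Fourier transform in $\mathbb R^2$ is $F(w)(\alpha)=\int_{\mathbb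 R^2}w(x)e^{-i\alpha\cdot x}dx$. The regularized solution is explicitly $$f_{j\varepsilon}(\xi)=\frac1{4\pi^2}\int_{B(0,R_\varepsilon)}\frac{g_j(I_\varepsilon)(\alpha)D(I_\varepsilon)(\alpha)}{\delta_\varepsilon+(D(I_\varepsilon)(\alpha))^2}\,e^{i\xi\cdot\alpha}\,d\alpha .$$ *)

(* Defs.v *)
From HB Require Import structures.
From mathcomp Require Import all_boot all_order all_algebra.
From mathcomp Require Import all_classical all_reals all_analysis.
From mathcomp Require Import complex.

Set Implicit Arguments.
Unset Strict Implicit.
Unset Printing Implicit Defensive.
Import Order.TTheory GRing.Theory Num.Theory.
Import numFieldNormedType.Exports.

Local Open Scope classical_set_scope.
Local Open Scope ring_scope.

(* Functions on Omega (or on its boundary, or time-dependent functions) are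
   total functions; values off the domain are irrelevant because norms,
   integrals and "a.e." all refer to the restricted measures below. *)

Section plane.
Context {R : realType}.
Implicit Types a x : R * R.

Definition crd (j : 'I_2) x : R := if j == 0 then x.1 else x.2.
Definition basis_vec (j : 'I_2) : R * R := ((j == 0)%:R, (j == 1)%:R).
Definition dot a x : R := \sum_(j < 2) crd j a * crd j x.
Definition enorm a : R := Num.sqrt (dot a a).

Definition Omega : set (R * R) := `]0, 1[%classic `*` `]0, 1[%classic.

(* Outward unit normal of the boundary, except at the four corners, which are
   negligible for the arc length. *)
Definition unit_normal (j : 'I_2) x : R := (crd j x == 1)%:R - (crd j x == 0)%:R.

Lemma measurable_Omega :
  measurable (Omega : set (measurableTypeR R * measurableTypeR R)).
Proof. by apply: measurableX; exact: measurable_itv. Qed.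

Lemma measurable_square : measurable
  (`[0, 1]%classic `*` `[0, 1]%classic :
     set (measurableTypeR R * measurableTypeR R)).
Proof. by apply: measurableX; exact: measurable_itv. Qed.

Lemma measurable_interval (T : R) :
  measurable (`]0, T[%classic : set (measurableTypeR R)).
Proof. exact: measurable_itv. Qed.

Definition leb2 :
    {measure set (measurableTypeR R * measurableTypeR R) -> \bar R} :=
  (@lebesgue_measure R \x @lebesgue_measure R)%E.

Definition lebO :
    {measure set (measurableTypeR R * measurableTypeR R) -> \bar R} :=
  mrestr leb2 measurable_Omega.

Definition lebT (T : R) : {measure set (measurableTypeR R) -> \bar R} :=
  mrestr (@lebesgue_measure R) (measurable_interval T).

(* The lines x_1 = 0, x_1 = 1, x_2 = 0 and x_2 = 1 with their arc length. *)
Definition line_measure (k : nat) :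
    {measure set (measurableTypeR R * measurableTypeR R) -> \bar R} :=
  match k with
  | 0%N => (@dirac _ (measurableTypeR R) 0%R R \x @lebesgue_measure R)%E
  | 1%N => (@dirac _ (measurableTypeR R) 1%R R \x @lebesgue_measure R)%E
  | 2%N => (@lebesgue_measure R \x @dirac _ (measurableTypeR R) 0%R R)%E
  | _ => (@lebesgue_measure R \x @dirac _ (measurableTypeR R) 1%R R)%E
  end.

(* Arc length on the boundary of Omega, as a measure on the plane. *)
Definition boundary_measure :
    {measure set (measurableTypeR R * measurableTypeR R) -> \bar R} :=
  mrestr (msum line_measure 4) measurable_square.

Definition normL2 (w : R * R -> R) : \bar R := ('N[lebO]_(2%:E)[EFin \o w])%E.
Definition normL1 (w : R * R -> R) : \bar R := ('N[lebO]_1[EFin \o w])%E.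
Definition normL1b (w : R * R -> R) : \bar R := ('N[boundary_measure]_1[EFin \o w])%E.
Definition normL2b (w : R * R -> R) : \bar R := ('N[boundary_measure]_(2%:E)[EFin \o w])%E.

Definition L2 : set (R * R -> R) := [set w | w \in Lfun lebO 2%:E].
Definition L1 : set (R * R -> R) := [set w | w \in Lfun lebO 1%E].
Definition L2b : set (R * R -> R) := [set w | w \in Lfun boundary_measure 2%:E].
Definition L1b : set (R * R -> R) := [set w | w \in Lfun boundary_measure 1%E].

End plane.

Section sobolev.
Context {R : realType}.
Implicit Types (w v : R * R -> R) (k : 'I_2).

Definition pderiv k w : R * R -> R := fun x => 'D_(basis_vec k) w x.

Definition smooth w := forall s : seq 'I_2,
  continuous (foldr pderiv w s) /\
  forall k x, derivable (foldr pderiv w s) x (basis_vec k).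

Definition test_function w :=
  [/\ smooth w, compact (closure [set x | w x != 0]) &
      closure [set x | w x != 0] `<=` Omega].

Definition is_wderiv k w v := [/\ L2 w, L2 v &
  forall phi, test_function phi ->
    \int[lebO]_x (w x * pderiv k phi x) = - \int[lebO]_x (v x * phi x)].

(* The L^2(Omega) weak derivative, unique up to null sets when it exists. *)
Definition wderiv k w : R * R -> R := get [set v | is_wderiv k w v].

Definition H1 : set (R * R -> R) :=
  [set w | L2 w /\ forall k, exists v, is_wderiv k w v].

Definition H2 : set (R * R -> R) := [set w | H1 w /\ forall k, H1 (wderiv k w)].

Definition sqnormH1 w : \bar R :=
  (normL2 w ^+ 2 + \sum_(k < 2) normL2 (wderiv k w) ^+ 2)%E.

Definition normH1 w : \bar R := (sqnormH1 w `^ 2^-1)%E.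

Definition normH2 w : \bar R :=
  ((normL2 w ^+ 2 + \sum_(k < 2) sqnormH1 (wderiv k w)) `^ 2^-1)%E.

(* The trace operator is the continuous extension to H^1(Omega) of the
   restriction to the boundary of functions smooth up to the boundary. *)
Definition is_trace w g := [/\ H1 w, L2b g &
  exists phi : nat -> R * R -> R, [/\ forall n, smooth (phi n),
    normH1 (phi n \- w) @[n --> \oo] --> 0%E &
    normL2b (phi n \- g) @[n --> \oo] --> 0%E]].

End sobolev.

Section time_dependent.
Context {R : realType}.
Variable T : R.
Implicit Types (v w : R -> R * R -> R) (N : (R * R -> R) -> \bar R)
  (E : set (R * R -> R)).

Definition C0L2 v := forall t, `[0, T]%classic t ->
  L2 (v t) /\ normL2 (v s \- v t) @[s --> within `[0, T]%classic (nbhs t)] --> 0%E.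

(* Derivative in L^2(Omega) at every point of [0, T], one-sided at the ends. *)
Definition is_tderiv v w := forall t, `[0, T]%classic t -> L2 (w t) /\
  normL2 (fun x => h^-1 * (v (t + h) x - v t x) - w t x)
    @[h --> within [set h | `[0, T]%classic (t + h)] 0^'] --> 0%E.

Definition tderiv v : R -> R * R -> R := get [set w | is_tderiv v w].

Definition C2L2 v := [/\ C0L2 v, is_tderiv v (tderiv v), C0L2 (tderiv v),
  is_tderiv (tderiv v) (tderiv (tderiv v)) & C0L2 (tderiv (tderiv v))].

(* Almost everywhere limit of E-valued simple functions for the norm N. *)
Definition strongly_measurable E N v :=
  exists (m : nat -> nat) (A : nat -> nat -> set R) (c : nat -> nat -> R * R -> R),
  [/\ forall n i, measurable (A n i), forall n i, E (c n i) &
  \forall t \ae lebT T,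
    N (fun x => v t x - \sum_(i < m n) \1_(A n i) t * c n i x) @[n --> \oo] --> 0%E].

(* L^p(0, T; E) for the space E with norm N. *)
Definition normLp (p : \bar R) N v : \bar R := ('N[lebT T]_p[N \o v])%E.
Definition bochnerLp (p : \bar R) E N v :=
  [/\ strongly_measurable E N v, \forall t \ae lebT T, E (v t) &
      (normLp p N v < +oo)%E].

Definition L2H2 v := bochnerLp 2%:E H2 normH2 v.
Definition L1L1b v := bochnerLp 1%E L1b normL1b v.

End time_dependent.

Record data (R : realType) := Data {
  phi : R -> R;
  bX : 'I_2 -> R -> R * R -> R;
  u0 : 'I_2 -> R * R -> R;
  u0s : 'I_2 -> R * R -> R;
  uT : 'I_2 -> R * R -> R }.

Section inverse_problem.
Context {R : realType}.
Variables (T lam mu : R).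
Implicit Types (I J : data R) (a x : R * R) (j : 'I_2).

Definition is_data I := phi I \in Lfun (lebT T) 1%E /\
  forall j, [/\ L1L1b T (bX I j), L1 (u0 I j), L1 (u0s I j) & L1 (uT I j)].

Definition data_close (eps : R) I J :=
  ('N[lebT T]_1[EFin \o (phi I \- phi J)%R] <= eps%:E)%E /\
  forall j, [/\
    (normLp T 1 normL1b (fun t => bX I j t \- bX J j t)%R <= eps%:E)%E,
    (normL1 (u0 I j \- u0 J j)%R <= eps%:E)%E,
    (normL1 (u0s I j \- u0s J j)%R <= eps%:E)%E &
    (normL1 (uT I j \- uT J j)%R <= eps%:E)%E].

Definition divergence (w : 'I_2 -> R * R -> R) : R * R -> R :=
  fun x => \sum_(k < 2) wderiv k (w k) x.

Definition laplacian (w : R * R -> R) : R * R -> R :=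
  fun x => \sum_(k < 2) wderiv k (wderiv k w) x.

Definition sigma j (w : 'I_2 -> R * R -> R) : R * R -> R :=
  fun x => lam * divergence w x + 2 * mu * wderiv j (w j) x.

Definition tau (w : 'I_2 -> R * R -> R) : R * R -> R :=
  fun x => mu * (wderiv 1 (w 0) x + wderiv 0 (w 1) x).

Definition lame_equation I (u : 'I_2 -> R -> R * R -> R) (f : 'I_2 -> R * R -> R) :=
  forall j, \forall t \ae lebT T, \forall x \ae lebO,
    tderiv T (tderiv T (u j)) t x =
      mu * laplacian (u j t) x
      + (lam + mu) * wderiv j (divergence (fun k => u k t)) x
      + phi I t * f j x.

Definition clamped (u : 'I_2 -> R -> R * R -> R) :=
  forall j, \forall t \ae lebT T, is_trace (u j t) (cst 0).

Definition initial_final I (u : 'I_2 -> R -> R * R -> R) :=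
  forall j, \forall x \ae lebO, [/\ u j 0 x = u0 I j x,
    tderiv T (u j) 0 x = u0s I j x & u j T x = uT I j x].

Definition traction I (u : 'I_2 -> R -> R * R -> R) :=
  \forall t \ae lebT T, exists (s : 'I_2 -> R * R -> R) (r : R * R -> R),
  [/\ forall j, is_trace (sigma j (fun k => u k t)) (s j),
      is_trace (tau (fun k => u k t)) r &
      \forall x \ae boundary_measure,
        unit_normal 0 x * s 0 x + unit_normal 1 x * r x = bX I 0 t x /\
        unit_normal 1 x * s 1 x + unit_normal 0 x * r x = bX I 1 t x].

Definition inverse_solution I u f :=
  [/\ lame_equation I u f, clamped u, initial_final I u & traction I u].

Definition D1 I a : R :=
  \int[lebT T]_t (phi I (T - t) * sin (Num.sqrt (lam + 2 * mu) * enorm a * t)).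

Definition D2 I a : R :=
  \int[lebT T]_t (phi I (T - t) * sin (Num.sqrt mu * enorm a * t)).

Definition D I a : R := D1 I a * D2 I a.

(* alpha . w *)
Definition along a (w : 'I_2 -> R * R -> R) : R * R -> R :=
  fun x => \sum_(k < 2) crd k a * w k x.

(* |alpha|^2 w_j - alpha_j (alpha . w) *)
Definition across j a (w : 'I_2 -> R * R -> R) : R * R -> R :=
  fun x => enorm a ^+ 2 * w j x - crd j a * along a w x.

(* The common shape of h_0 (c = sqrt (lambda + 2 mu), P = along a) and of h_j
   (c = sqrt mu, P = across j a). *)
Definition hgen (c : R) (P : ('I_2 -> R * R -> R) -> R * R -> R) I a : R :=
  - sin (c * enorm a * T) * \int[lebO]_x (P (u0s I) x * cos (dot a x))
  + c * enorm a * \int[lebO]_x (P (uT I) x * cos (dot a x))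
  - c * enorm a * cos (c * enorm a * T)
      * \int[lebO]_x (P (u0 I) x * cos (dot a x))
  - \int[lebT T]_t \int[boundary_measure]_x
      (sin (c * enorm a * (T - t)) * P (fun k => bX I k t) x * cos (dot a x)).

Definition h0 I a : R := hgen (Num.sqrt (lam + 2 * mu)) (along a) I a.
Definition hj j I a : R := hgen (Num.sqrt mu) (across j a) I a.

Definition gj j I a : R :=
  2 / enorm a ^+ 2 * (crd j a * D2 I a * h0 I a + D1 I a * hj j I a).

Definition delta (eps : R) : R := eps `^ ((1 + 6 * (1 / 7)) / 2).

Definition Reps (eps : R) : R :=
  (1 / 7) / (9 * expR 1 * T) * (ln eps^-1 / ln (ln eps^-1)).

Definition expi (t : R) : R[i] := (cos t +i* sin t)%C.

Definition Cintegral (A : set (R * R)) (F : R * R -> R[i]) : R[i] :=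
  ((\int[leb2]_(x in A) complex.Re (F x))
    +i* (\int[leb2]_(x in A) complex.Im (F x)))%C.

Definition freg j I (eps : R) (xi : R * R) : R[i] :=
  ((1 / (4 * pi ^+ 2))%:C)%C * Cintegral [set a | enorm a < Reps eps]
    (fun a => ((gj j I a * D I a / (delta eps + D I a ^+ 2))%:C)%C
              * expi (dot xi a)).

Definition fregR j I (eps : R) (xi : R * R) : R := complex.Re (freg j I eps xi).

End inverse_problem.

(* Main.v *)
(* Pairing the equation with plane waves times sin(c |alpha| (T - t)) gives, for exact data,
   g_j = 2 D ctr f_j, where ctr f is the cosine transform of f on Omega.  As Omega and -Omega
   are disjoint, 2 ctr f is the Fourier transform of the even extension of f, so dividing by D
   recovers f_j.  The division is unstable where D is small or |alpha| is large.  D is the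
   product of two functions F(|alpha|), with F a sine transform of phi, whose n-th derivative is
   O(B^n).  Interpolating F at well-separated nodes of { |F| <= exp(-kappa r ln r) } therefore
   forces this set, inside [0, r], to have measure O(r^-p) for every p, unless F = 0.  The mass
   of (ctr f_j)^2 on it is o(1), and o(1/r) if f_j is in H^1.  The mass outside the disc of
   radius r is o(1), and O(1/r) in the H^1 case, by an integration by parts whose boundary terms
   depend on one frequency only.  With r = R_eps every data error is beaten by a power of eps. *)
Require Import Defs.
From HB Require Import structures.
From mathcomp Require Import all_boot all_order all_algebra.
From mathcomp Require Import all_classical all_reals all_analysis.
From mathcomp Require Import measurable_realfun complex ring lra.
Import Order.TTheory GRing.Theory Num.Theory.
Import numFieldNormedType.Exports.
Local Open Scope classical_set_scope.
Local Open Scope ring_scope.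
Set Implicit Arguments.
Unset Strict Implicit.
Unset Printing Implicit Defensive.

(** Why the parameters fit: with kappa = eT and r = R_eps, the level m = exp(-kappa r ln r) is
    eventually at least eps^(1/63), where 63 = 9/q. Off the set where a factor of D is below m, the
    filter factor delta_eps / (delta_eps + D^2) is of order delta_eps / m^4. This quantity and eps^2
    / delta_eps are then powers of eps with exponent above 1/2, which absorb every power of r. The
    interpolation argument has two competing constraints. With nu r nodes in [0, lam r] the
    remainder is small if nu exceeds a multiple of lam, while a measure bound r^(1-p) asks for p nu
    < kappa. So p = 3 is affordable only in a disc of radius theta r with theta small; up to radius
    r only a measure c r with c arbitrarily small is available. In the small disc boundedness of the
    transform suffices. In the annulus, plain integrability gives o(1), and H^1 decay supplies a
    weight of order r^-2 on slices of length c r, hence o(1/r). The other obstacle is that functions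
    are total and classes are only defined up to null sets: weak derivatives are compared by
    testing, and boundary pairings are replaced by measurable versions. *)

Section integral_tools.
Import HBNNSimple HBSimple.
Context d (T : measurableType d) (R : realType) (mu : {measure set T -> \bar R}).
Implicit Types (f g : T -> R) (M k : R).

Definition intg f := mu.-integrable setT (EFin \o f).

Lemma intg_meas f : intg f -> measurable_fun setT f.
Proof. by move=> /measurable_int /measurable_EFinP. Qed.

Lemma intgE f : intg f -> (\int[mu]_x (f x)%:E)%E = (\int[mu]_x f x)%:E.
Proof. by move=> fi; rewrite /Rintegral fineK// integrable_fin_num. Qed.

Lemma intgD f g : intg f -> intg g -> intg (fun x => f x + g x).
Proof. by move=> fi gi; exact: (integrableD measurableT fi gi). Qed.

Lemma intgB f g : intg f -> intg g -> intg (fun x => f x - g x).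
Proof. by move=> fi gi; exact: (integrableB measurableT fi gi). Qed.

Lemma intgZ k f : intg f -> intg (fun x => k * f x).
Proof. by move=> fi; exact: (integrableZl measurableT k fi). Qed.

Lemma intg_norm f : intg f -> intg (fun x => `|f x|).
Proof. by move=> fi; exact: (integrable_norm fi). Qed.

Lemma intg_le f g : measurable_fun setT f -> (forall x, `|f x| <= g x) ->
  intg g -> intg f.
Proof.
move=> mf fg gi; apply: le_integrable gi => //; first exact/measurable_EFinP.
move=> x _ /=; rewrite lee_fin (le_trans (fg x))// ler_norm//.
Qed.

Lemma intg_mulb M f g : intg f -> measurable_fun setT g ->
  (forall x, `|g x| <= M) -> intg (fun x => f x * g x).
Proof.
move=> fi mg gM; apply: (@intg_le _ (fun x => M * `|f x|)).
- by apply: measurable_funM => //; exact: intg_meas.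
- by move=> x; rewrite normrM mulrC ler_wpM2r.
- by apply: intgZ; exact: intg_norm.
Qed.

Lemma intg_eq f g : (forall x, f x = g x) -> intg f -> intg g.
Proof. by move=> /funext ->. Qed.

Lemma intg_sum (I : Type) (s : seq I) (F : I -> T -> R) : (forall i, intg (F i)) ->
  intg (fun x => \sum_(i <- s) F i x).
Proof.
move=> Fi; elim: s => [|i s IH].
  by apply: (@intg_eq (cst 0)) => [x|]; rewrite ?big_nil//; exact: integrable0.
apply: (@intg_eq (fun x => F i x + \sum_(j <- s) F j x)) => [x|].
  by rewrite big_cons.
exact: intgD.
Qed.

Lemma RintD f g : intg f -> intg g ->
  \int[mu]_x (f x + g x) = \int[mu]_x f x + \int[mu]_x g x.
Proof. exact: RintegralD. Qed.

Lemma RintB f g : intg f -> intg g ->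
  \int[mu]_x (f x - g x) = \int[mu]_x f x - \int[mu]_x g x.
Proof. exact: RintegralB. Qed.

Lemma RintZ k f : intg f -> \int[mu]_x (k * f x) = k * \int[mu]_x f x.
Proof. by move=> fi; rewrite RintegralZl. Qed.

Lemma RintN f : intg f -> \int[mu]_x (- f x) = - \int[mu]_x f x.
Proof.
move=> fi; rewrite -mulN1r -RintZ//; apply: eq_Rintegral => x _.
by rewrite mulN1r.
Qed.

Lemma Rint_zero : \int[mu]_x (0 : R) = 0.
Proof. by rewrite /Rintegral integral0. Qed.

Lemma Rint_sum (I : Type) (s : seq I) (F : I -> T -> R) : (forall i, intg (F i)) ->
  \int[mu]_x (\sum_(i <- s) F i x) = \sum_(i <- s) \int[mu]_x F i x.
Proof.
move=> Fi; elim: s => [|i s IH].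
  rewrite big_nil -[RHS]Rint_zero; apply: eq_Rintegral => x _; by rewrite big_nil.
rewrite big_cons -IH -RintD//; last exact: intg_sum.
by apply: eq_Rintegral => x _; rewrite big_cons.
Qed.

Lemma Rint_le f g : intg f -> intg g -> (forall x, f x <= g x) ->
  \int[mu]_x f x <= \int[mu]_x g x.
Proof. by move=> fi gi fg; apply: le_Rintegral => // x _. Qed.

Lemma Rint_ge0 f : (forall x, 0 <= f x) -> 0 <= \int[mu]_x f x.
Proof. by move=> f0; apply: Rintegral_ge0. Qed.

Lemma Rint_norm f : intg f -> `|\int[mu]_x f x| <= \int[mu]_x `|f x|.
Proof. by move=> fi; apply: le_normr_Rintegral. Qed.

Lemma Rint_normM M f g : intg f -> measurable_fun setT g ->
  (forall x, `|g x| <= M) -> `|\int[mu]_x (f x * g x)| <= M * \int[mu]_x `|f x|.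
Proof.
move=> fi mg gM; rewrite -RintZ; last exact: intg_norm.
have fg := intg_mulb fi mg gM.
apply: (le_trans (Rint_norm fg)); apply: Rint_le.
- exact: intg_norm.
- by apply: intgZ; exact: intg_norm.
- by move=> x; rewrite normrM mulrC ler_wpM2r.
Qed.

(** The quadratic t -> \int (t f - g)^2 is nonnegative; the inequality is the sign of its
    discriminant. *)
Lemma Rint_cauchy_schwarz f g :
  intg (fun x => f x ^+ 2) -> intg (fun x => g x ^+ 2) ->
  intg (fun x => f x * g x) ->
  (\int[mu]_x (f x * g x)) ^+ 2 <= \int[mu]_x f x ^+ 2 * \int[mu]_x g x ^+ 2.
Proof.
move=> ff gg fg.
set A := \int[mu]_x f x ^+ 2; set B := \int[mu]_x g x ^+ 2.
set C := \int[mu]_x (f x * g x).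
have A0 : 0 <= A by apply: Rint_ge0 => x; exact: sqr_ge0.
have H t : 0 <= t ^+ 2 * A - (2 * t) * C + B.
  have -> : t ^+ 2 * A - (2 * t) * C + B = \int[mu]_x (t * f x - g x) ^+ 2.
    rewrite /A /B /C -!RintZ// -RintB; [|exact: intgZ..].
    rewrite -RintD//; last by apply: intgB; exact: intgZ.
    by apply: eq_Rintegral => x _; ring.
  by apply: Rint_ge0 => x; exact: sqr_ge0.
have B0 : 0 <= B by apply: Rint_ge0 => x; exact: sqr_ge0.
have [A1|A1] := eqVneq A 0.
  have [->|C1] := eqVneq C 0; first by rewrite expr0n /= mulr_ge0.
  (* When A = 0 the quadratic is affine in t, and at this t it equals -1: a contradiction. *)
  have := H ((B + 1) / (2 * C)).
  rewrite A1 mulr0 sub0r.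
  have -> : 2 * ((B + 1) / (2 * C)) * C = B + 1 by field.
  lra.
have A2 : 0 < A by rewrite lt_neqAle eq_sym A1.
have := H (C / A).
have -> : (C / A) ^+ 2 * A - 2 * (C / A) * C + B = (A * B - C ^+ 2) / A by field.
by rewrite pmulr_lge0 ?invr_gt0// subr_ge0.
Qed.

Lemma Rint_dct (f_ : nat -> T -> R) f g :
  (forall n, measurable_fun setT (f_ n)) -> measurable_fun setT f ->
  (\forall x \ae mu, f_ n x @[n --> \oo] --> f x) -> intg g ->
  (forall n x, `|f_ n x| <= g x) ->
  intg f /\ \int[mu]_x f_ n x @[n --> \oo] --> \int[mu]_x f x.
Proof.
move=> mf_ mf ff gi fg.
have [] := @dominated_convergence _ T R mu setT measurableT
  (fun n => EFin \o f_ n) (EFin \o f) (EFin \o g).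
- by move=> n; exact/measurable_EFinP.
- exact/measurable_EFinP.
- by apply: filterS ff => x H _; apply/fine_cvgP; split; [exact: nearW|exact: H].
- exact: gi.
- by apply/aeW => x n _ /=; rewrite lee_fin.
move=> fi _ cv; split => //.
have fin n : intg (f_ n) by exact: (@intg_le _ g).
move: cv; rewrite (_ : (fun n => _) = (fun n => (\int[mu]_x f_ n x)%:E)).
  by rewrite [X in _ --> X](intgE fi) => /fine_cvgP[_].
by apply/funext => n; rewrite -intgE.
Qed.

Lemma Rint_dct_cvg (f_ : nat -> T -> R) f g :
  (forall n, measurable_fun setT (f_ n)) -> measurable_fun setT f ->
  (\forall x \ae mu, f_ n x @[n --> \oo] --> f x) -> intg g ->
  (forall n x, `|f_ n x| <= g x) ->
  \int[mu]_x f_ n x @[n --> \oo] --> \int[mu]_x f x.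
Proof. by move=> h1 h2 h3 h4 h5; have [] := Rint_dct h1 h2 h3 h4 h5. Qed.

(* The library's integral of a nonmeasurable function is a lower integral, which
   is also insensitive to null sets. *)
Lemma ge0_ae_le_lower_integral (f g : T -> \bar R) :
  (forall x, (0 <= f x)%E) -> (forall x, (0 <= g x)%E) ->
  (\forall x \ae mu, (f x <= g x)%E) -> (\int[mu]_x f x <= \int[mu]_x g x)%E.
Proof.
move=> f0 g0 [N [mN N0 fgN]].
rewrite (ge0_integralTE _ f0); apply: ge_ereal_sup => _ [h hf <-].
(* Cutting a simple minorant h of f to the complement of the null set N keeps its integral and puts
   it below g everywhere. *)
have mhN : measurable_fun setT (EFin \o (h \* \1_(~` N))).
  apply/measurable_EFinP; apply: measurable_funM => //.
  by apply: measurable_indic; exact: measurableC.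
rewrite -integralT_nnsfun.
rewrite (@ge0_ae_eq_integral _ _ _ mu setT _ (EFin \o (h \* \1_(~` N))))//.
- pose h' := [the {nnsfun T >-> R} of mul_nnsfun h (indic_nnsfun R (measurableC mN))].
  have -> : (\int[mu]_x (EFin \o (h \* \1_(~` N))%R) x = sintegral mu h')%E.
    by rewrite -integralT_nnsfun; apply: eq_integral.
  rewrite (ge0_integralTE _ g0); apply: ereal_sup_ubound.
  have h'E x : h' x = h x * \1_(~` N) x by [].
  exists h' => [x|//]; rewrite h'E indicE.
  case: (boolP (x \in ~` N)) => xN; rewrite ?mulr0 ?mulr1//.
  have hfx : ((h x)%:E <= f x)%E by exact: (hf : forall x, _).
  apply: le_trans hfx _; apply: contrapT => H; move: xN; rewrite inE; apply.
  by apply: fgN => /=.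
- exact/measurable_EFinP.
- by move=> x _; rewrite lee_fin.
- by move=> x _ /=; rewrite lee_fin mulr_ge0// indicE.
- exists N; split => // x /= H; apply: contrapT => xN; apply: H => _.
  by rewrite indicE mem_set ?mulr1.
Qed.

Lemma ge0_ae_eq_lower_integral (f g : T -> \bar R) :
  (forall x, (0 <= f x)%E) -> (forall x, (0 <= g x)%E) ->
  (\forall x \ae mu, f x = g x) -> (\int[mu]_x f x = \int[mu]_x g x)%E.
Proof.
move=> f0 g0 fg; apply/eqP; rewrite eq_le !ge0_ae_le_lower_integral//.
  by apply: filterS fg => x ->.
by apply: filterS fg => x ->.
Qed.

Lemma ae_eq_lower_integral (f g : T -> \bar R) :
  (\forall x \ae mu, f x = g x) -> (\int[mu]_x f x = \int[mu]_x g x)%E.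
Proof.
move=> fg; have : ae_eq mu setT f g by apply: filterS fg => x + _.
move=> /ae_eq_funeposneg[fp fn]; rewrite integralE [RHS]integralE.
congr (_ - _)%E; apply: ge0_ae_eq_lower_integral => //.
- by apply: filterS fp => x; exact.
- by apply: filterS fn => x; exact.
Qed.

Lemma Rint_ae_eq f g : (\forall x \ae mu, f x = g x) ->
  \int[mu]_x f x = \int[mu]_x g x.
Proof.
move=> fg; rewrite /Rintegral; congr fine; apply: ae_eq_lower_integral.
by apply: filterS fg => x ->.
Qed.

(** Converts integrals for the restricted measures [lebO], [lebT] and [boundary_measure] into
    integrals over a set, the form in which Tonelli and the fundamental theorem of calculus
    apply. *)
Lemma integral_mrestr (D : set T) (mD : measurable D) (f : T -> \bar R) :
  measurable_fun setT f ->
  (\int[mrestr mu mD]_x f x = \int[mu]_(x in D) f x)%E.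
Proof.
move=> mf; have mDC := measurableC mD.
have nD : mrestr mu mD (~` D) = 0%E by rewrite /mrestr setICl measure0.
rewrite -[in LHS](setUv D) (_ : (\int[_]_(x in D `|` ~` D) f x)%E
   = (\int[mrestr mu mD]_(x in D) f x)%E).
  by apply: eq_measure_integral => A mA AD; rewrite -[LHS]/(mu (A `&` D)) setIidl.
rewrite integralE [RHS]integralE; congr (_ - _)%E.
- rewrite setUv [LHS](@ge0_negligible_integral _ _ _ _ _ (~` D))//=.
  + by rewrite setTD setCK.
  + by apply: measurable_funepos.
- rewrite setUv [LHS](@ge0_negligible_integral _ _ _ _ _ (~` D))//=.
  + by rewrite setTD setCK.
  + by apply: measurable_funeneg.
Qed.

End integral_tools.

(** * Finiteness of the measures on the domain, its boundary and the time interval *)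

Section finite_measures.
Context (R : realType).

Let mT := measurableTypeR R.

Lemma leb2_Omega : @leb2 R Omega = 1%E.
Proof.
have := @product_measure1E _ _ mT mT R (@lebesgue_measure R) (@lebesgue_measure R)
   _ _ (measurable_itv `]0, 1[) (measurable_itv `]0, 1[).
have h : @lebesgue_measure R (`]0%R, 1%R[%classic : set mT) = 1%E.
  by rewrite lebesgue_measure_itv /= lte_fin ltr01 oppr0 adde0.
by rewrite [X in (X * X)%E]h mule1; apply: eq_trans.
Qed.

Lemma lebO_setT : @lebO R setT = 1%E.
Proof. by rewrite -[LHS]/(leb2 (setT `&` Omega)) setTI leb2_Omega. Qed.

Lemma lebT_fin (T : R) : (lebT T setT < +oo)%E.
Proof.
rewrite -[ltLHS]/(lebesgue_measure (setT `&` `]0, T[)) setTI.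
by rewrite lebesgue_measure_itv /=; case: ifP => _; rewrite ?ltry// -EFinB ltry.
Qed.

Lemma lebO_fin : (@lebO R setT < +oo)%E.
Proof. by rewrite lebO_setT ltry. Qed.

Lemma boundary_measure_fin : (@boundary_measure R setT < +oo)%E.
Proof.
pose S : set (mT * mT) := `[0, 1]%classic `*` `[0, 1]%classic.
rewrite -[ltLHS]/(msum line_measure 4 (setT `&` S)) setTI /msum.
have l1 : lebesgue_measure (`[0, 1]%classic : set R) = 1%E.
  by rewrite lebesgue_measure_itv /= lte_fin ltr01 oppr0 adde0.
have m1 : measurable (`[0, 1]%classic : set (measurableTypeR R)).
  exact: measurable_itv.
apply: lte_sum_pinfty => i _.
have dir (a : R) : (@dirac _ (measurableTypeR R) a R `[0%R, 1%R] < +oo)%E.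
  by rewrite diracE; case: (_ \in _); rewrite ltry.
have H1 a : ((@dirac _ (measurableTypeR R) a R \x @lebesgue_measure R)%E S < +oo)%E.
  apply: le_lt_trans (lexx _) _.
  by rewrite (product_measure1E _ _ m1 m1) [X in (_ * X)%E]l1 mule1 dir.
have H2 a : ((@lebesgue_measure R \x @dirac _ (measurableTypeR R) a R)%E S < +oo)%E.
  by rewrite (product_measure1E _ _ m1 m1) [X in (X * _)%E]l1 mul1e dir.
by case: i => -[|[|[|[|//]]]] /= _.
Qed.

End finite_measures.

Section finite_tools.
Context d (T : measurableType d) (R : realType)
  (mu : {measure set T -> \bar R}).
Hypothesis muT : (mu setT < +oo)%E.
Implicit Types (f g : T -> R) (M k : R).

Lemma intg_cst (c : R) : intg mu (cst c).
Proof.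
apply/integrableP; split; first exact/measurable_EFinP/measurable_cst.
by rewrite /= integral_cst// lte_mul_pinfty.
Qed.

Lemma intg_bounded M f : measurable_fun setT f -> (forall x, `|f x| <= M) -> intg mu f.
Proof. by move=> mf fM; apply: intg_le (intg_cst M). Qed.

Lemma intg_indic (B : set T) : measurable B -> intg mu (\1_B : T -> R).
Proof.
move=> mB; apply: (@intg_bounded 1); first exact: measurable_indic.
by move=> x; rewrite indicE normr_nat; case: (_ \in _).
Qed.

Lemma intg_sqr f : measurable_fun setT f -> intg mu (fun x => f x ^+ 2) -> intg mu f.
Proof.
move=> mf fi; apply: (@intg_le _ _ _ _ _ (fun x => 1 + f x ^+ 2)) => //.
  move=> x; have := sqr_ge0 (`|f x| - 1); have := normr_ge0 (f x).
  by rewrite -(real_normK (num_real (f x))); nra.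
by apply: intgD => //; exact: intg_cst.
Qed.
End finite_tools.

(** * Square-integrable functions *)

Section L2_tools.
Context d (T : measurableType d) (R : realType) (mu : {measure set T -> \bar R}).
Implicit Types (f g : T -> R) (M k : R).

Definition sqint f := measurable_fun setT f /\ intg mu (fun x => f x ^+ 2).

Lemma sqint_mul f g : sqint f -> sqint g -> intg mu (fun x => f x * g x).
Proof.
move=> [mf fi] [mg gi].
apply: (@intg_le _ _ _ _ _ (fun x => f x ^+ 2 + g x ^+ 2)); last exact: intgD.
  exact: measurable_funM.
move=> x; have := sqr_ge0 (`|f x| - `|g x|).
have := normr_ge0 (f x); have := normr_ge0 (g x); rewrite normrM.
by rewrite -(real_normK (num_real (f x))) -(real_normK (num_real (g x))); nra.
Qed.

Lemma sqintD f g : sqint f -> sqint g -> sqint (fun x => f x + g x).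
Proof.
move=> sf sg; have fg := sqint_mul sf sg; case: sf sg => [mf fi] [mg gi].
split; first exact: measurable_funD.
apply: (@intg_eq _ _ _ _ (fun x => f x ^+ 2 + g x ^+ 2 + 2 * (f x * g x))).
  by move=> x; ring.
by apply: intgD; [exact: intgD|exact: intgZ].
Qed.

Lemma sqintZ k f : sqint f -> sqint (fun x => k * f x).
Proof.
move=> [mf fi]; split; first exact: measurable_funM.
apply: (@intg_eq _ _ _ _ (fun x => k ^+ 2 * f x ^+ 2)); last exact: intgZ.
by move=> x; rewrite exprMn.
Qed.

Lemma sqintB f g : sqint f -> sqint g -> sqint (fun x => f x - g x).
Proof.
move=> sf sg; have := sqintD sf (sqintZ (-1) sg).
by congr sqint; apply/funext => x; rewrite mulN1r.
Qed.

Lemma sqint_le f g : measurable_fun setT f -> (forall x, `|f x| <= `|g x|) ->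
  sqint g -> sqint f.
Proof.
move=> mf fg [mg gi]; split => //; apply: intg_le gi; first exact: measurable_funX.
by move=> x; rewrite ger0_norm ?sqr_ge0// -[leLHS]real_normK ?num_real//
  -[leRHS]real_normK ?num_real// lerXn2r ?nnegrE.
Qed.

Lemma sqint_mulb M f g : sqint f -> measurable_fun setT g ->
  (forall x, `|g x| <= M) -> sqint (fun x => f x * g x).
Proof.
move=> sf mg gM; apply: (@sqint_le _ (fun x => M * f x)).
- by apply: measurable_funM => //; case: sf.
- move=> x; rewrite !normrM mulrC ler_wpM2r//; exact: le_trans (gM x) (ler_norm _).
- exact: sqintZ.
Qed.

Lemma Lnorm2_sqr f :
  ('N[mu]_(2%:E)[EFin \o f] ^+ 2 = \int[mu]_x ((f x) ^+ 2)%:E)%E.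
Proof.
have h : (2 : R) != 0 by rewrite pnatr_eq0.
transitivity (('N[mu]_(2%:E)[EFin \o f]) `^ 2)%E.
  have := Lnorm_ge0 mu 2%:E (EFin \o f).
  case: ('N[mu]_(2%:E)[EFin \o f])%E => //= [r|_].
    by rewrite lee_fin => r0; rewrite (powR_mulrn 2 r0) expr2 EFinM.
  by rewrite mulyy (negbTE h).
rewrite powR_Lnorm//; apply: eq_integral => x _ /=.
by rewrite powR_mulrn// real_normK ?num_real.
Qed.

Lemma Lfun2P f : (f \in Lfun mu 2%:E) <-> sqint f.
Proof.
split.
  move=> fL; split; last exact: Lfun2_integrable_sqr.
  by move: fL; rewrite inE => /andP[]; rewrite inE.
move=> [mf /integrableP[_ fi]]; rewrite inE; apply/andP; split; rewrite inE//=.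
rewrite /finite_norm; have := Lnorm2_sqr f.
have : (\int[mu]_x (f x ^+ 2)%:E < +oo)%E.
  apply: le_lt_trans fi; apply: le_trans (lee_abs _) _.
  by apply: le_abse_integral => //; apply/measurable_EFinP; exact: measurable_funX.
have := Lnorm_ge0 mu 2%:E (EFin \o f).
case: ('N[mu]_(2%:E)[EFin \o f])%E => //= [r|_]; first by rewrite ltry.
by rewrite mulyy => /[swap] <-.
Qed.
End L2_tools.

(** * Calculus of derivatives on the real line *)

Section derivative_tools.
Context (R : realType).
Implicit Types (f g h : R -> R) (x a b k : R).

Definition dv f x a := is_derive x (1 : R) f a.

Lemma dv_eq f x a b : dv f x a -> a = b -> dv f x b.
Proof. by move=> ? <-. Qed.

Lemma dv_id x : dv (fun y => y) x 1.
Proof. exact: is_derive_id. Qed.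

Lemma dv_cst k x : dv (fun=> k) x 0.
Proof. exact: is_derive_cst. Qed.

Lemma dvD f g x a b : dv f x a -> dv g x b -> dv (fun y => f y + g y) x (a + b).
Proof. by move=> fa gb; apply: is_deriveD. Qed.

Lemma dvN f x a : dv f x a -> dv (fun y => - f y) x (- a).
Proof. by move=> fa; apply: is_deriveN. Qed.

Lemma dvB f g x a b : dv f x a -> dv g x b -> dv (fun y => f y - g y) x (a - b).
Proof. by move=> fa gb; apply: is_deriveB. Qed.

Lemma dvM f g x a b : dv f x a -> dv g x b ->
  dv (fun y => f y * g y) x (a * g x + f x * b).
Proof.
move=> fa gb; apply: dv_eq; first exact: (is_deriveM fa gb).
by rewrite /GRing.scale /= addrC (mulrC (g x)).
Qed.

Lemma dvZ k f x a : dv f x a -> dv (fun y => k * f y) x (k * a).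
Proof. by move=> fa; apply: dv_eq (dvM (dv_cst k x) fa) _; rewrite mul0r add0r. Qed.

Lemma dv_comp h f x a b : dv h (f x) b -> dv f x a -> dv (fun y => h (f y)) x (b * a).
Proof. by move=> hb fa; apply: dv_eq (is_derive1_comp hb fa) _; rewrite mulrC. Qed.

Lemma dv_sin f x a : dv f x a -> dv (fun y => sin (f y)) x (cos (f x) * a).
Proof. by move=> fa; apply: (dv_comp (h := sin)) fa; exact: is_derive_sin. Qed.

Lemma dv_cos f x a : dv f x a -> dv (fun y => cos (f y)) x (- sin (f x) * a).
Proof. by move=> fa; apply: (dv_comp (h := cos)) fa; exact: is_derive_cos. Qed.

Lemma dv_exp f x a : dv f x a -> dv (fun y => expR (f y)) x (expR (f x) * a).
Proof. by move=> fa; apply: (dv_comp (h := expR)) fa; exact: is_derive_expR. Qed.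

Lemma dv_val f x a : dv f x a -> (f^`()%classic : R -> R) x = a.
Proof. by move=> fa; rewrite derive1E; exact: derive_val. Qed.

Lemma dv_derivable f x a : dv f x a -> derivable f x 1.
Proof. by case. Qed.

Lemma dv_cvg f x a : dv f x a -> {for x, continuous f}.
Proof. by case=> dfx _; apply/differentiable_continuous/derivable1_diffP. Qed.

Lemma dv_continuous f df : (forall x, dv f x (df x)) -> continuous f.
Proof. by move=> fa x; exact: dv_cvg. Qed.

Lemma continuous_intg_oo f (a b : R) : continuous f ->
  (@lebesgue_measure R).-integrable `[a, b] (EFin \o f).
Proof.
move=> cf; apply: continuous_compact_integrable; first exact: segment_compact.
exact: continuous_subspaceT.
Qed.

Lemma FTC2_dv f df (a b : R) : a <= b -> (forall x, dv f x (df x)) -> continuous df ->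
  (\int[@lebesgue_measure R]_(x in `[a, b]) (df x)%:E = (f b - f a)%:E)%E.
Proof.
rewrite le_eqVlt => /predU1P[->|ab] fd cd.
  by rewrite set_itv1 integral_set1 subrr.
rewrite (@continuous_FTC2 _ df f)//.
- exact: continuous_subspaceT.
- split.
  + by move=> x _; exact: dv_derivable.
  + by apply: cvg_at_right_filter; exact: dv_cvg.
  + by apply: cvg_at_left_filter; exact: dv_cvg.
- by move=> x _; exact: dv_val.
Qed.

End derivative_tools.

(** * Small values of functions with controlled derivatives *)

Section rolle_lagrange.
Context (R : realType).
Implicit Types (s : seq R) (m M d L a x : R).

(** Rolle's theorem between consecutive zeros. The clause that the new zeros exceed [x] keeps the
    list sorted when the induction prepends one more. *)
Lemma rolle_sorted (F G : R -> R) x s : (forall y : R, is_derive y (1 : R) F (G y)) ->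
  path <%R x s -> (forall y, y \in x :: s -> F y = 0) ->
  exists t, [/\ size t = size s, sorted <%R t, (forall y, y \in t -> G y = 0)
    & (forall y, y \in t -> x < y)].
Proof.
move=> dF; elim: s x => [|z s IH] x /=; first by move=> _ _; exists [::].
move=> /andP[xz pz] F0.
have [t [st tt G0 tz]] : exists t, [/\ size t = size s, sorted <%R t,
    (forall y, y \in t -> G y = 0) & (forall y, y \in t -> z < y)].
  by apply: IH => // y yz; apply: F0; rewrite inE yz orbT.
have cF : continuous F.
  by move=> y; apply/differentiable_continuous/derivable1_diffP; case: (dF y).
have [c /itvP cxz cF0] : exists2 c, c \in `]x, z[ & is_derive c 1 F 0.
  apply: Rolle => //.
  - exact: continuous_subspaceT.
  - by rewrite !F0// !inE eqxx ?orbT.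
exists (c :: t); split => /=.
- by rewrite st.
- rewrite path_min_sorted//; apply/allP => y yt.
  by rewrite (lt_trans _ (tz y yt))// cxz.
- move=> y; rewrite inE => /orP[/eqP ->|/G0//].
  by have := @derive_val _ _ _ _ _ _ _ (dF c); rewrite derive_val.
- move=> y; rewrite inE => /orP[/eqP ->|yt]; first by rewrite cxz.
  by rewrite (lt_trans xz)// tz.
Qed.

(** Rolle's theorem along the sequence of derivatives, each step losing one zero. Sorting first
    reduces to the ordered case. *)
Lemma rolle_iter (F : nat -> R -> R) n s :
  (forall k (y : R), is_derive y (1 : R) (F k) (F k.+1 y)) -> uniq s -> size s = n.+1 ->
  (forall y, y \in s -> F 0%N y = 0) -> exists c, F n c = 0.
Proof.
move=> dF us ss F0.
suff : forall n (F : nat -> R -> R) s,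
  (forall k (y : R), is_derive y (1 : R) (F k) (F k.+1 y)) -> sorted <%R s -> size s = n.+1 ->
  (forall y, y \in s -> F 0%N y = 0) -> exists c, F n c = 0.
  move/(_ n F (sort <=%R s) dF); apply.
  - by rewrite lt_sorted_uniq_le sort_uniq us sort_le_sorted.
  - by rewrite size_sort.
  - by move=> y; rewrite mem_sort => /F0.
move=> {}n {}F {dF us ss F0}s; elim: n F s => [|n IH] F [//|x s] dF /= ps [ss] F0.
  by exists x; apply: F0; rewrite inE eqxx.
have [t [st tt G0 _]] := rolle_sorted (dF 0%N) ps F0.
apply: (IH (fun k => F k.+1) t) => //.
by rewrite st.
Qed.

Lemma derivn_deg (p : {poly R}) n : (size p <= n.+1)%N ->
  p^`(n) = (p`_n *+ n`!)%:P.
Proof.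
move=> sp; apply/polyP => i; rewrite coef_derivn coefC.
case: i => [|i] /=; first by rewrite addn0 ffactnn.
by rewrite nth_default ?mul0rn// (leq_trans sp)// addnS ltnS leq_addr.
Qed.

(** Cauchy's remainder: a multiple K of the nodal polynomial is added to [q] so that the difference
    with [F 0] vanishes at [x] too. Its derivative of order [size s] then has a zero, where the
    polynomial part is the constant K (size s)!. *)
Lemma interpolation_error (F : nat -> R -> R) (q : {poly R}) s M x :
  (forall k (y : R), is_derive y (1 : R) (F k) (F k.+1 y)) ->
  (forall y, `|F (size s) y| <= M) -> uniq s -> (size q <= size s)%N ->
  (forall y, y \in s -> F 0%N y = q.[y]) ->
  `|F 0%N x - q.[x]| <= M / (size s)`!%:R * \prod_(y <- s) `|x - y|.
Proof.
move=> dF FM us sq Fq; have M0 : 0 <= M by apply: le_trans (FM 0).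
have [xs|xs] := boolP (x \in s).
  by rewrite Fq// subrr normr0 mulr_ge0 ?divr_ge0 ?ler0n// prodr_ge0.
pose w := \prod_(y <- s) ('X - y%:P).
have wE y : w.[y] = \prod_(z <- s) (y - z).
  by rewrite horner_prod; apply: eq_bigr => z _; rewrite hornerXsubC.
have wx : w.[x] != 0.
  rewrite wE prodf_seq_neq0; apply/allP => z zs /=.
  by rewrite subr_eq0; apply: contraNneq xs => ->.
pose K := (F 0%N x - q.[x]) / w.[x].
pose p := q + K *: w.
have sw : size w = (size s).+1 by rewrite size_prod_XsubC.
have sp : (size p <= (size s).+1)%N.
  rewrite (leq_trans (size_polyD _ _))// geq_max (leq_trans sq)//=.
  by rewrite (leq_trans (size_scale_leq _ _))// sw.
have dp k (y : R) : is_derive y (1 : R) (fun z => F k z - p^`(k).[z]) (F k.+1 y - p^`(k.+1).[y]).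
  have dpk : is_derive y (1 : R) (horner p^`(k)) (p^`(k.+1).[y]).
    apply: DeriveDef; first exact: derivable_horner.
    by rewrite -derive1E -derivE derivnS.
  exact: is_deriveB.
have [c] : exists c, F (size s) c - p^`(size s).[c] = 0.
  apply: (rolle_iter (s := x :: s) dp) => //=; first by rewrite xs.
  move=> y; rewrite inE /p hornerD hornerZ => /orP[/eqP ->|ys].
    by rewrite /K divfK//; ring.
  rewrite Fq// [w.[y]](_ : _ = 0) ?mulr0 ?addr0 ?subrr//.
  by rewrite wE; apply/eqP; rewrite prodf_seq_eq0; apply/hasP; exists y; rewrite ?subrr /=.
rewrite (derivn_deg sp) hornerC /p coefD [q`_(size s)]nth_default// add0r coefZ.
have -> : w`_(size s) = 1.
  have := monic_prod_XsubC s xpredT id; rewrite monicE lead_coefE.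
  by rewrite size_prod_XsubC /= => /eqP.
rewrite mulr1 => /eqP; rewrite subr_eq0 => /eqP Fc.
have KM : `|K| <= M / (size s)`!%:R.
  rewrite ler_pdivlMr ?ltr0n ?fact_gt0// -[X in _ * X](normr_nat R).
  by rewrite -normrM mulr_natr -Fc.
have -> : F 0%N x - q.[x] = K * w.[x] by rewrite /K divfK.
by rewrite normrM wE normr_prod ler_wpM2r// prodr_ge0.
Qed.

(** Kept as two products, below and above i: each half of the denominator is bounded from below by a
    factorial, and no side condition j != i appears. *)
Definition lagrange_basis n (z : nat -> R) (i : nat) : {poly R} :=
  (\prod_(0 <= j < i) ((z i - z j)^-1 *: ('X - (z j)%:P))) *
  \prod_(i.+1 <= j < n.+1) ((z i - z j)^-1 *: ('X - (z j)%:P)).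

Lemma size_prod_linear (r : seq nat) (c e : nat -> R) :
  (size (\prod_(j <- r) (c j *: ('X - (e j)%:P)) : {poly R})%R <= (size r).+1)%N.
Proof.
elim: r => [|j r IH]; first by rewrite big_nil size_poly1.
rewrite big_cons (leq_trans (size_polyMleq _ _))//=.
have : (size (c j *: ('X - (e j)%:P))%R <= 2)%N.
  by rewrite (leq_trans (size_scale_leq _ _))// size_XsubC.
by rewrite -subn1 leq_subLR add1n => h; rewrite (leq_trans (leq_add h IH)).
Qed.

Lemma prod_le_expn (I : eqType) (r : seq I) (a : I -> R) L :
  (forall y, y \in r -> 0 <= a y <= L) -> 0 <= \prod_(y <- r) a y <= L ^+ size r.
Proof.
elim: r => [|y r IH] H; first by rewrite big_nil expr0 ler01 lexx.
rewrite big_cons /= exprS; have /andP[h0 h1] := H y (mem_head _ _).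
have /andP[p0 p1] : 0 <= \prod_(y <- r) a y <= L ^+ size r.
  by apply: IH => z zr; apply: H; rewrite inE zr orbT.
by rewrite mulr_ge0//= ler_pM.
Qed.

Lemma prod_ge_fact (a : nat -> R) d k : 0 < d ->
  (forall j, (j < k)%N -> d * j.+1%:R <= a j) -> d ^+ k * k`!%:R <= \prod_(0 <= j < k) a j.
Proof.
move=> d0; elim: k => [|k IH] H; first by rewrite big_nil expr0 mul1r.
rewrite big_nat_recr//= factS exprSr natrM.
rewrite (_ : _ * _ = (d ^+ k * k`!%:R) * (d * k.+1%:R)); last by ring.
apply: ler_pM; rewrite ?mulr_ge0 ?exprn_ge0 ?ler0n ?(ltW d0)//; last exact: H.
by apply: IH => j jk; apply: H; rewrite ltnW.
Qed.

Lemma separated_dist n (z : nat -> R) d i j :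
  (forall k, (k < n)%N -> z k + d <= z k.+1) -> (i + j <= n)%N ->
  d * j%:R <= z (i + j)%N - z i.
Proof.
move=> H; elim: j => [|j IH] ij; first by rewrite addn0 subrr mulr0.
rewrite addnS in ij *; have := IH (ltnW ij); have := H _ ij.
by rewrite -natr1 mulrDr mulr1; lra.
Qed.

(* For d-separated nodes the products of distances to the i-th node are at least
   d^n i! (n-i)!, so the Lebesgue constant is at most (2L/d)^n / n!. *)
Lemma separated_prod n (z : nat -> R) d i : 0 < d ->
  (forall k, (k < n)%N -> z k + d <= z k.+1) -> (i <= n)%N ->
  d ^+ n * (i`! * (n - i)`!)%:R <=
    (\prod_(0 <= j < i) `|z i - z j|) * \prod_(i.+1 <= j < n.+1) `|z i - z j|.
Proof.
move=> d0 H ni; rewrite -[X in d ^+ X](subnKC ni) exprD natrM.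
rewrite (_ : _ * _ = (d ^+ i * i`!%:R) * (d ^+ (n - i) * (n - i)`!%:R)); last by ring.
apply: ler_pM; rewrite ?mulr_ge0 ?exprn_ge0 ?ler0n ?(ltW d0)//.
- rewrite big_nat_rev /= add0n; apply: prod_ge_fact => // j ji.
  have e : (i - j.+1 + j.+1)%N = i by rewrite subnK.
  have := @separated_dist n z d (i - j.+1)%N j.+1 H; rewrite e => /(_ ni) h.
  by rewrite (le_trans h)// ler_norm.
- rewrite -{1}[i.+1]add0n big_addn subSS; apply: prod_ge_fact => // j ji.
  have := @separated_dist n z d i j.+1 H.
  rewrite addnS addnC -addnS => h; rewrite distrC (le_trans (h _)) ?ler_norm//.
  by rewrite addnS addnC -ltn_subRL.
Qed.

(** The interpolant is small at [x] because its values at the nodes are at most m and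
    [separated_prod] controls the Lagrange basis; the second term is the remainder for n + 1
    nodes. *)
Lemma interpolation_bound (F : nat -> R -> R) n (z : nat -> R) m M d L x :
  (forall k (y : R), is_derive y (1 : R) (F k) (F k.+1 y)) ->
  (forall y, `|F n.+1 y| <= M) -> 0 < d ->
  (forall k, (k < n)%N -> z k + d <= z k.+1) ->
  (forall k, (k <= n)%N -> `|F 0%N (z k)| <= m) ->
  (forall k, (k <= n)%N -> `|x - z k| <= L) ->
  `|F 0%N x| <= m * (2 * L / d) ^+ n / n`!%:R + M * L ^+ n.+1 / n.+1`!%:R.
Proof.
move=> dF FM d0 Hz Fm xL.
have L0 : 0 <= L by apply: le_trans (xL 0%N _).
have m0 : 0 <= m by apply: le_trans (Fm 0%N _).
have zlt i j : (i < j)%N -> (j <= n)%N -> z i < z j.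
  move=> ij jn; have := @separated_dist n z d i (j - i)%N Hz.
  rewrite subnKC ?(ltnW ij)// => /(_ jn); rewrite -subr_gt0; apply: lt_le_trans.
  by rewrite mulr_gt0// ltr0n subn_gt0.
have zneq i j : (i <= n)%N -> (j <= n)%N -> i != j -> z i - z j != 0.
  move=> ni nj; rewrite neq_ltn subr_eq0 => /orP[] h.
    by rewrite lt_eqF// zlt.
  by rewrite gt_eqF// zlt.
pose s := map z (iota 0 n.+1).
have ss : size s = n.+1 by rewrite size_map size_iota.
have us : uniq s.
  rewrite map_inj_in_uniq ?iota_uniq// => i j; rewrite !mem_iota /= !add0n !ltnS.
  move=> ni nj zij; apply/eqP; apply: contraT => /(zneq _ _ ni nj).
  by rewrite zij subrr eqxx.
pose ell := lagrange_basis n z.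
have ellE i y : (ell i).[y] = (\prod_(0 <= j < i) ((z i - z j)^-1 * (y - z j))) *
    \prod_(i.+1 <= j < n.+1) ((z i - z j)^-1 * (y - z j)).
  by rewrite /ell /lagrange_basis hornerM !horner_prod; congr (_ * _);
    apply: eq_bigr => j _; rewrite hornerZ hornerXsubC.
pose q := \sum_(0 <= i < n.+1) F 0%N (z i) *: ell i.
have sq : (size q <= size s)%N.
  rewrite ss /q big_nat; elim/big_ind: _ => [|p1 p2 h1 h2|i /andP[_ ni]].
  - by rewrite size_poly0.
  - by rewrite (leq_trans (size_polyD _ _))// geq_max h1.
  - rewrite (leq_trans (size_scale_leq _ _))// /ell /lagrange_basis.
    rewrite (leq_trans (size_polyMleq _ _))//.
    have h := leq_add (size_prod_linear (index_iota 0 i) (fun j => (z i - z j)^-1) z)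
       (size_prod_linear (index_iota i.+1 n.+1) (fun j => (z i - z j)^-1) z).
    rewrite -subn1 leq_subLR add1n (leq_trans h)//.
    by rewrite !size_iota subn0 subSS addSn addnS subnKC.
have Fq y : y \in s -> F 0%N y = q.[y].
  move=> /mapP[k]; rewrite mem_iota /= add0n => kn ->.
  rewrite /q horner_sum (bigD1_seq k) ?mem_index_iota ?iota_uniq//=.
  rewrite hornerZ ellE !big1_seq ?mulr1//.
  - by rewrite addr0.
  - move=> i /andP[ik]; rewrite mem_index_iota /= => ni.
    rewrite hornerZ ellE; move: ik; rewrite neq_ltn => /orP[ik|ki].
      rewrite [X in _ * (_ * X)](bigD1_seq k) ?mem_index_iota ?iota_uniq ?ik//=.
      by rewrite subrr mulr0 mul0r !mulr0.
    rewrite [X in _ * (X * _)](bigD1_seq k) ?mem_index_iota ?iota_uniq//=.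
    by rewrite subrr mulr0 !mul0r mulr0.
  - move=> j; rewrite mem_index_iota /= => /andP[jk jn].
    by rewrite mulVf// zneq// neq_ltn jk.
  - move=> j; rewrite mem_index_iota /= => jk.
    by rewrite mulVf// zneq ?neq_ltn ?jk ?orbT// (leq_trans (ltnW jk)).
have := @interpolation_error F q s M x dF _ us sq Fq; rewrite ss => /(_ FM) E.
have P : \prod_(y <- s) `|x - y| <= L ^+ n.+1.
  rewrite -ss; apply: (andP (prod_le_expn _)).2 => y /mapP[k].
  by rewrite mem_iota /= add0n ltnS => kn ->; rewrite normr_ge0 xL.
have Q : `|q.[x]| <= m * (2 * L / d) ^+ n / n`!%:R.
  rewrite /q horner_sum (le_trans (ler_norm_sum _ _ _))//.
  apply: (@le_trans _ _ (\sum_(0 <= i < n.+1) m * (L / d) ^+ n / n`!%:R * 'C(n, i)%:R)).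
    rewrite !big_nat; apply: ler_sum => i /andP[_ ni].
    rewrite hornerZ normrM -!mulrA ler_pM//; first exact: Fm.
    have N (r : seq nat) : `|\prod_(j <- r) ((z i - z j)^-1 * (x - z j))| =
        (\prod_(j <- r) `|z i - z j|)^-1 * \prod_(j <- r) `|x - z j|.
      rewrite normr_prod -prodfV -big_split /=; apply: eq_bigr => j _.
      by rewrite normrM normfV.
    rewrite ellE normrM !N; have := separated_prod d0 Hz ni.
    have H0 (a b : nat) : (b <= n.+1)%N ->
        forall j, j \in index_iota a b -> 0 <= `|x - z j| <= L.
      move=> bn j; rewrite mem_index_iota normr_ge0 => /andP[_ jb].
      by rewrite xL// -ltnS (leq_trans jb).
    have /andP[X0 X1] := @prod_le_expn _ _ _ L (H0 0%N i (leqW ni)).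
    have /andP[Y0 Y1] := @prod_le_expn _ _ _ L (H0 i.+1 n.+1 (leqnn _)).
    have := ler_pM X0 Y0 X1 Y1.
    rewrite !size_iota subn0 subSS -exprD subnKC//.
    set X := \prod_(0 <= j < i) `|x - z j|; set Y := \prod_(_.+1 <= j < _) `|x - z j|.
    set A := \prod_(0 <= j < i) `|_|; set B := \prod_(_.+1 <= j < _) `|_|.
    move=> XY AB.
    have f0 : 0 < d ^+ n * (i`! * (n - i)`!)%:R.
      by rewrite mulr_gt0 ?exprn_gt0// ltr0n muln_gt0 !fact_gt0.
    have AB0 : 0 < A * B by apply: lt_le_trans AB.
    rewrite (_ : A^-1 * X * (B^-1 * Y) = X * Y / (A * B)); last first.
      by rewrite invfM; ring.
    apply: (@le_trans _ _ (L ^+ n / (d ^+ n * (i`! * (n - i)`!)%:R))).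
      rewrite ler_pM ?mulr_ge0 ?invr_ge0 ?(ltW AB0)//.
      by rewrite lef_pV2 ?posrE.
    (* As n! = C(n,i) i! (n-i)!, the i-th basis polynomial contributes C(n,i) (L/d)^n / n!. Summing
       over i produces the factor 2^n. *)
    rewrite expr_div_n -(@bin_fact n i ni) le_eqVlt; apply/orP; left; apply/eqP.
    rewrite !natrM; field.
    rewrite !pnatr_eq0 -!lt0n !fact_gt0 bin_gt0 -ltnS ni /=.
    by rewrite expf_neq0 ?gt_eqF.
  rewrite -mulr_sumr big_mkord -natr_sum.
  have -> : (\sum_(i < n.+1) 'C(n, i) = 2 ^ n)%N.
    by rewrite (Pascal 1 1 n); apply: eq_bigr => i _; rewrite !exp1n !muln1.
  rewrite natrX le_eqVlt; apply/orP; left; apply/eqP.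
  by rewrite !exprMn; ring.
have M0 : 0 <= M by apply: le_trans (FM 0).
have : `|F 0%N x| <= `|F 0%N x - q.[x]| + `|q.[x]|.
  by rewrite -[X in `|X| <= _](subrK q.[x]) ler_normD.
move=> /le_trans; apply; rewrite addrC lerD//; apply: (le_trans E).
by rewrite mulrAC ler_wpM2r ?invr_ge0 ?ler0n// ler_wpM2l.
Qed.

(** Induction on n; the step is (1 + 1/n)^n <= e, a consequence of 1 + x <= exp x. *)
Lemma fact_ge_expn n : (n%:R ^+ n : R) <= expR n%:R * n`!%:R.
Proof.
elim: n => [|n IH]; first by rewrite expr0 expR0 mulr1.
case: n IH => [_|n IH].
  by rewrite expr1 mulr1 (le_trans _ (expR_ge1Dx 1))// lerDl.
rewrite [leLHS]exprS factS natrM mulrCA ler_wpM2l ?ler0n//.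
rewrite -[X in expR X]natr1 expRD mulrAC (le_trans _ (ler_wpM2r (expR_ge0 1) IH))//.
rewrite -ler_pdivrMl ?exprn_gt0// mulrC -expr_div_n.
apply: (@le_trans _ _ (expR (n.+1%:R^-1) ^+ n.+1)).
  rewrite lerXn2r ?nnegrE ?divr_ge0 ?expR_ge0//.
  by rewrite -[in leLHS]natr1 mulrDl divff// (le_trans _ (expR_ge1Dx _))// mul1r.
by rewrite -expRM_natl divff.
Qed.

Let mu := @lebesgue_measure R.

(** Greedy choice: take a point within d of the infimum, discard everything less than d beyond it,
    and recurse. The discarded part lies in an interval of length at most 2d, whence the factor
    2. *)
Lemma separated_points n (S : set R) d a : measurable S -> 0 < d ->
  (forall y, S y -> a <= y) -> ((2 * n%:R * d)%:E < mu S)%E ->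
  exists z : nat -> R, (forall k, (k <= n)%N -> S (z k)) /\
    forall k, (k < n)%N -> z k + d <= z k.+1.
Proof.
move=> mS d0; elim: n S a mS => [|n IH] S a mS aS.
  rewrite mulr0 mul0r => S0.
  have [y Sy] : S !=set0.
    by apply/set0P; apply: contraTneq S0 => ->; rewrite /mu measure0 ltxx.
  by exists (fun=> y).
move=> Sn; have Sne : S !=set0.
  apply/set0P; apply: contraTneq Sn => ->.
  by rewrite /mu measure0 -leNgt lee_fin !mulr_ge0// ltW.
have Sinf : has_inf S by split => //; exists a => y /aS.
have [z0 Sz0 z0i] := inf_adherent d0 Sinf.
pose S' := S `&` `[z0 + d, +oo[.
have mS' : measurable S' by apply: measurableI => //; exact: measurable_itv.
have [z' [z'S z'd]] : exists z : nat -> R, (forall k, (k <= n)%N -> S' (z k)) /\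
    forall k, (k < n)%N -> z k + d <= z k.+1.
  apply: (IH S' a) => //; first by move=> y [/aS].
  pose J : set R := `[inf S, z0 + d[%classic.
  have SS : S `<=` J `|` S'.
    move=> y Sy; case: (ltP y (z0 + d)) => h; [left|right].
      by rewrite /J /= in_itv /= h andbT; apply: ge_inf => //; case: Sinf.
    by split => //=; rewrite in_itv /= h.
  rewrite ltNge; apply/negP => hS'; move: Sn; rewrite ltNge => /negP; apply.
  have mJ : measurable J by exact: measurable_itv.
  have h1 : (mu S <= mu (J `|` S'))%E.
    by apply: le_measure => //; rewrite inE//; apply: measurableU.
  have h2 : (mu (J `|` S') <= mu J + mu S')%E by exact: measureU2.
  apply: (le_trans h1); apply: (le_trans h2).
  rewrite (_ : (2 * n.+1%:R * d)%:E = ((2 * d)%:E + (2 * n%:R * d)%:E)%E); last first.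
    by rewrite -EFinD -natr1; congr EFin; ring.
  apply: leeD => //; rewrite /mu lebesgue_measure_itv /= lte_fin.
  by case: ifP => _; rewrite -?EFinD lee_fin ?mulr_ge0 ?(ltW d0)//; lra.
exists (fun k => if k is k'.+1 then z' k' else z0); split.
  by move=> [//|k] kn; case: (z'S k kn).
move=> [|k] kn; last exact: z'd.
by have [_] := z'S 0%N (leq0n _); rewrite /= in_itv /= andbT.
Qed.

(** By contraposition: a larger set contains n + 1 points d apart, whose images by [rho] are d/2
    apart, and interpolation at these images makes [F 0 x] smaller than it is. The map [rho] will be
    the Euclidean norm along a horizontal line, so that slices of plane sets can be measured. *)
Lemma small_values_measure (F : nat -> R -> R) (rho : R -> R) n (S : set R) m M d L x a :
  (forall k (y : R), is_derive y (1 : R) (F k) (F k.+1 y)) ->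
  (forall y, `|F n.+1 y| <= M) -> 0 < d -> measurable S ->
  (forall y, S y -> a <= y) ->
  (forall y z, S y -> S z -> y <= z -> (z - y) / 2 <= rho z - rho y) ->
  (forall y, S y -> `|F 0%N (rho y)| <= m) ->
  (forall y, S y -> `|x - rho y| <= L) ->
  m * (4 * L / d) ^+ n / n`!%:R + M * L ^+ n.+1 / n.+1`!%:R < `|F 0%N x| ->
  (mu S <= (2 * n%:R * d)%:E)%E.
Proof.
move=> dF FM d0 mS aS Srho Sm SL H; rewrite leNgt; apply/negP => nS.
have [z [zS zd]] := separated_points mS d0 aS nS.
move: H; rewrite ltNge => /negP; apply.
have -> : 4 * L / d = 2 * L / (d / 2) by field; rewrite gt_eqF.
apply: (interpolation_bound (z := rho \o z)) => //.
- by rewrite divr_gt0.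
- move=> k kn /=; have := zd k kn => zk; rewrite addrC -lerBrDr.
  apply: le_trans (Srho _ _ _ _ _).
  + by lra.
  + by apply: zS; rewrite ltnW.
  + exact: zS.
  + by apply: le_trans zk; rewrite lerDl ltW.
- by move=> k kn; apply/Sm/zS.
- by move=> k kn; apply/SL/zS.
Qed.

(* n = floor(nu R) nodes inside a set of measure c R / R^p *)
Lemma small_values_asymptotic (F : nat -> R -> R) (A B x0 kap c lam nu : R) p :
  (forall k (y : R), is_derive y (1 : R) (F k) (F k.+1 y)) ->
  (forall n y, `|F n y| <= A * B ^+ n) -> 0 <= B -> F 0%N x0 != 0 -> 0 <= x0 ->
  0 < kap -> 0 < c -> 0 < lam -> 0 < nu -> B * expR 2 * lam <= nu ->
  p%:R * nu < kap ->
  \forall r \near +oo, forall (S : set R) (rho : R -> R), measurable S ->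
    (forall y, S y -> 0 <= y) ->
    (forall y z, S y -> S z -> y <= z -> (z - y) / 2 <= rho z - rho y) ->
    (forall y, S y -> 0 <= rho y <= lam * r) ->
    (forall y, S y -> `|F 0%N (rho y)| <= expR (- (kap * r * ln r))) ->
    (mu S <= (c * r / r ^+ p)%:E)%E.
Proof.
move=> dF FAB B0 h0 x00 kap0 c0 lam0 nu0 Bnu pnu.
have A0 : 0 <= A by have := FAB 0%N 0; rewrite expr0 mulr1; exact: le_trans.
set h := `|F 0%N x0|; have hp : 0 < h by rewrite normr_gt0.
pose C := `|ln (8 * lam * expR 1 / c)|.
pose K := (nu * C + 1) / (kap - p%:R * nu).
near=> r => S rho mS S0 Srho Sr Sm.
have r1 : 1 < r by near: r; apply: nbhs_pinfty_gt; rewrite num_real.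
have r0 : 0 < r by apply: lt_trans r1.
have nur : 1 <= nu * r.
  rewrite mulrC -ler_pdivrMr//; near: r; apply: nbhs_pinfty_ge; rewrite num_real.
have rK : K <= ln r.
  rewrite -ler_expR lnK ?posrE//; near: r; apply: nbhs_pinfty_ge; rewrite num_real.
have rx0 : x0 <= lam * r.
  rewrite mulrC -ler_pdivrMr//; near: r; apply: nbhs_pinfty_ge; rewrite num_real.
have rh1 : 2 / h < r by near: r; apply: nbhs_pinfty_gt; rewrite num_real.
have rh2 : 2 * (A / nu) / h < r by near: r; apply: nbhs_pinfty_gt; rewrite num_real.
pose n := Num.truncn (nu * r).
have /andP[n1 n2] : n%:R <= nu * r < n.+1%:R by apply: truncn_itv; lra.
have n0 : (0 < n)%N by rewrite /n truncn_gt_nat.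
have n0' : (0 : R) < n%:R by rewrite ltr0n.
have rp0 : 0 < r ^+ p by rewrite exprn_gt0.
(* Chosen so that the bound 2 n d of [small_values_measure] is the announced one. *)
pose d := c * r / r ^+ p / (2 * n%:R).
have d0 : 0 < d by rewrite !divr_gt0 ?mulr_gt0.
rewrite (_ : c * r / r ^+ p = 2 * n%:R * d); last by rewrite /d; field; rewrite !gt_eqF.
apply: (@small_values_measure F rho n S (expR (- (kap * r * ln r))) (A * B ^+ n.+1) d
  (lam * r) x0 0) => //.
  move=> y Sy; have /andP[? ?] := Sr y Sy; rewrite ler_norml; lra.
rewrite -/h (_ : h = h / 2 + h / 2); last by field.
have expNlt (x : R) : 0 < x -> expR (- x) < x^-1.
  move=> xp; rewrite expRN ltf_pV2 ?posrE ?expR_gt0//.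
  by apply: lt_le_trans (expR_ge1Dx x); rewrite ltrDr.
apply: ltrD.
(* With n <= nu r and n^n / n! <= e^n, this term is at most exp(-kap r ln r + nu r (C + p ln r));
   the condition [K <= ln r] says that the exponent is at most -r. *)
- apply: (@le_lt_trans _ _ (expR (- r))); last first.
    apply: lt_trans (expNlt _ r0) _.
    by rewrite -[h / 2]invrK ltf_pV2 ?posrE// ?invr_gt0 ?divr_gt0// invf_div.
  have -> : 4 * (lam * r) / d = (8 * lam / c) * r ^+ p * n%:R.
    by rewrite /d; field; rewrite !gt_eqF.
  rewrite [(_ * n%:R) ^+ n]exprMn mulrA -[leLHS]mulrA.
  apply: (@le_trans _ _ (expR (- (kap * r * ln r)) * (8 * lam / c * r ^+ p) ^+ n * expR 1 ^+ n)).
    rewrite ler_wpM2l ?mulr_ge0 ?expR_ge0 ?exprn_ge0 ?mulr_ge0 ?invr_ge0 ?(ltW c0) ?(ltW lam0)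
      ?(ltW rp0)//.
    by rewrite ler_pdivrMr ?ltr0n ?fact_gt0// -expRM_natl mulr1 fact_ge_expn.
  rewrite -mulrA -exprMn.
  have -> : 8 * lam / c * r ^+ p * expR 1 = expR (ln (8 * lam * expR 1 / c) + p%:R * ln r).
    rewrite expRD expRM_natl !lnK ?posrE ?divr_gt0 ?mulr_gt0 ?expR_gt0//; ring.
  rewrite -expRM_natl -expRD ler_expR.
  have C0 : 0 <= C by exact: normr_ge0.
  have lr0 : 0 <= ln r by apply: ln_ge0; lra.
  have : n%:R * (ln (8 * lam * expR 1 / c) + p%:R * ln r) <= (nu * r) * (C + p%:R * ln r).
    apply: (@le_trans _ _ (n%:R * (C + p%:R * ln r))).
      by rewrite ler_wpM2l ?ler0n// lerD2r ler_norm.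
    by rewrite ler_wpM2r// addr_ge0// mulr_ge0.
  have : nu * C + 1 <= ln r * (kap - p%:R * nu) by rewrite -ler_pdivrMr ?subr_gt0.
  move=> /(ler_wpM2l (ltW r0)) H1 H2; nra.
(* Here B lam r e^2 <= nu r < n + 1, so the remainder is at most A exp(-(n + 1)). *)
- apply: (@le_lt_trans _ _ (A * expR (- (nu * r)))); last first.
    apply: (@le_lt_trans _ _ (A * (nu * r)^-1)).
      by rewrite ler_wpM2l// ltW// expNlt// mulr_gt0.
    rewrite invfM mulrA ltr_pdivrMr//.
    by move: rh2; rewrite ltr_pdivrMr// => ?; lra.
  rewrite -!mulrA ler_wpM2l// mulrA -exprMn ler_pdivrMr ?ltr0n ?fact_gt0//.
  apply: (@le_trans _ _ ((n.+1%:R * expR (- 2)) ^+ n.+1)).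
    rewrite lerXn2r ?nnegrE ?mulr_ge0 ?expR_ge0 ?(ltW lam0) ?(ltW r0)//.
    rewrite expRN ler_pdivlMr ?expR_gt0//.
    apply: le_trans (ltW n2); have -> : B * (lam * r) * expR 2 = B * expR 2 * lam * r by ring.
    by rewrite ler_wpM2r// ltW.
  rewrite exprMn; apply: le_trans (ler_wpM2r _ (fact_ge_expn _)) _.
    by rewrite exprn_ge0// expR_ge0.
  rewrite mulrAC ler_wpM2r ?ler0n// -expRM_natl -expRD ler_expR.
  lra.
Unshelve. all: by end_near. Qed.
End rolle_lagrange.

(** * The Poisson kernel and the Parseval identity on the square *)

Section poisson.
Context (R : realType).
Implicit Types s z a x : R.
Let mu := @lebesgue_measure R.

(** The Poisson kernel, normalized as the Fourier transform of exp(-s |a|); its total mass is 2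
    pi. *)
Definition pker s z : R := 2 * s / (s ^+ 2 + z ^+ 2).

Lemma pker_ge0 s z : 0 < s -> 0 <= pker s z.
Proof.
by move=> s0; rewrite divr_ge0 ?mulr_ge0 ?(ltW s0)// addr_ge0 ?sqr_ge0.
Qed.

Lemma pker_even s z : pker s (- z) = pker s z.
Proof. by rewrite /pker sqrrN. Qed.

Definition expabs s a : R := expR (- (s * `|a|)).

Lemma expabs_gt0 s a : 0 < expabs s a. Proof. exact: expR_gt0. Qed.

Lemma expabs_le1 s a : 0 < s -> expabs s a <= 1.
Proof. by move=> s0; rewrite expR_le1 oppr_le0 mulr_ge0// ltW. Qed.

Lemma expabsN s a : expabs s (- a) = expabs s a.
Proof. by rewrite /expabs normrN. Qed.

Lemma continuous_expabs s : continuous (expabs s).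
Proof.
move=> a; apply: (@continuous_comp _ _ _ (fun a => - (s * `|a|)) expR).
  by apply: continuousN; apply: continuousM; [exact: cvg_cst|exact: norm_continuous].
exact: continuous_expR.
Qed.

Lemma expR_cvg0 s : 0 < s -> expR (- (s * a)) @[a --> +oo] --> (0 : R).
Proof.
move=> s0; apply: (@cvg_comp _ _ _ (fun a => s * a) (fun x => expR (- x))).
  apply/cvgryPge => A; near=> a.
  rewrite mulrC -ler_pdivrMr//; near: a; apply: nbhs_pinfty_ge; rewrite num_real.
exact: cvgr_expR.
Unshelve. all: by end_near. Qed.

(** Adding 1 to the cosine makes the integrand nonnegative, so that an improper fundamental theorem
    of calculus gives the value before integrability is known; integrability is then read off from
    it. *)
Lemma ge0_integral_expcos s z : 0 < s ->
  (\int[mu]_a (expabs s a * (1 + cos (a * z)))%:E = (2 / s + pker s z)%:E)%E.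
Proof.
move=> s0; have sz : 0 < s ^+ 2 + z ^+ 2 by rewrite ltr_pwDl ?exprn_gt0 ?sqr_ge0.
pose f a := expabs s a * (1 + cos (a * z)).
have f0 a : 0 <= f a.
  by rewrite mulr_ge0 ?(ltW (expabs_gt0 _ _))//; have := cos_geN1 (a * z); lra.
have cf : continuous f.
  move=> a; apply: continuousM; first exact: continuous_expabs.
  apply: continuousD; first exact: cvg_cst.
  apply: (@continuous_comp _ _ _ (fun a => a * z) cos); last exact: continuous_cos.
  exact: mulrr_continuous.
rewrite ge0_symfun_integralT//; last first.
  by move=> a; rewrite /f /= expabsN mulNr cosN.
(* A primitive on a >= 0 tending to 0 at infinity; by evenness the integral is -2 F(0). *)
pose F a := expR (- (s * a)) * (- s^-1 + (z * sin (a * z) - s * cos (a * z)) / (s ^+ 2 + z ^+ 2)).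
have dF a : dv F a (expR (- (s * a)) * (1 + cos (a * z))).
  have dz : dv (fun a => a * z) a z.
    by apply: dv_eq (dvM (dv_id a) (dv_cst z a)) _; rewrite mul1r mulr0 addr0.
  have dE := dv_exp (dvN (dvZ s (dv_id a))).
  have dB := dvB (dvZ z (dv_sin dz)) (dvZ s (dv_cos dz)).
  apply: dv_eq (dvM dE (dvD (dv_cst (- s^-1) a) (dvM dB (dv_cst (s ^+ 2 + z ^+ 2)^-1 a)))) _.
  by field; rewrite !gt_eqF.
have Fl : F a @[a --> +oo] --> (0 : R).
  pose K := s^-1 + (`|z| + s) / (s ^+ 2 + z ^+ 2).
  apply/cvgr0Pnorm_le => e e0; have K0 : 0 < K.
    have h1 : 0 < s^-1 by rewrite invr_gt0.
    have h2 : 0 <= (`|z| + s) / (s ^+ 2 + z ^+ 2).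
      by apply: divr_ge0; [rewrite addr_ge0// ltW|exact: ltW].
    by rewrite /K; lra.
  have /cvgr0Pnorm_le /(_ (e / K)) := expR_cvg0 s0; rewrite divr_gt0// => /(_ isT).
  apply: filterS => a; rewrite /F normrM ler_pdivlMr// => /(le_trans _); apply.
  rewrite ler_wpM2l// (le_trans (ler_normD _ _))// lerD//.
    by rewrite normrN gtr0_norm// invr_gt0.
  rewrite normrM [`|_^-1|]gtr0_norm ?invr_gt0// ler_wpM2r ?invr_ge0 ?(ltW sz)//.
  rewrite (le_trans (ler_normB _ _))// !normrM (gtr0_norm s0) lerD//.
    by rewrite ler_piMr// sin_max.
  by rewrite ler_piMr ?(ltW s0)// cos_max.
rewrite -set_itvcy (@ge0_continuous_FTC2y _ f F 0 0)//.
- rewrite /F mulr0 oppr0 expR0 mul0r sin0 cos0 -EFinD -EFinM; congr EFin.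
  rewrite /pker; field; rewrite !gt_eqF//.
- exact: continuous_subspaceT.
- by apply: cvg_at_right_filter; exact: dv_cvg (dF 0).
- move=> a; rewrite in_itv /= andbT => a0.
  by rewrite (dv_val (dF a)) /f /expabs gtr0_norm.
Qed.

Lemma intg_expcos1 s z : 0 < s -> intg mu (fun a => expabs s a * (1 + cos (a * z))).
Proof.
move=> s0; apply/integrableP; split.
  apply/measurable_EFinP/measurable_funM.
    by apply: continuous_measurable_fun; exact: continuous_expabs.
  apply: measurable_funD => //; apply: continuous_measurable_fun => a.
  apply: (@continuous_comp _ _ _ (fun a => a * z) cos); last exact: continuous_cos.
  exact: mulrr_continuous.
rewrite (_ : (\int[mu]_x _)%E = (2 / s + pker s z)%:E) ?ltry//.
rewrite -ge0_integral_expcos//; apply: eq_integral => a _ /=.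
have c1 := cos_geN1 (a * z).
by rewrite ger0_norm// mulr_ge0 ?(ltW (expabs_gt0 _ _))//; lra.
Qed.

Lemma intg_expabs s : 0 < s -> intg mu (expabs s).
Proof.
move=> /(intg_expcos1 0) /(intgZ 2^-1); apply: intg_eq => a.
by rewrite mulr0 cos0; field.
Qed.

Lemma Rint_expcos1 s z : 0 < s ->
  \int[mu]_a (expabs s a * (1 + cos (a * z))) = 2 / s + pker s z.
Proof. by move=> s0; rewrite /Rintegral ge0_integral_expcos. Qed.

Lemma Rint_expabs s : 0 < s -> \int[mu]_a expabs s a = 2 / s.
Proof.
move=> s0; have := Rint_expcos1 0 s0; rewrite /pker expr0n /= addr0.
rewrite (_ : 2 / s + _ = 2 * (2 / s)); last by field; rewrite gt_eqF.
move/(congr1 (fun x => x / 2)); rewrite (_ : 2 * (2 / s) / 2 = 2 / s); last by field;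
  rewrite gt_eqF.
move=> <-; rewrite mulrC -RintZ; last exact: intg_expcos1.
by apply: eq_Rintegral => a _; rewrite mulr0 cos0; field.
Qed.

Lemma measurable_cosM z : measurable_fun setT (fun a : R => cos (a * z)).
Proof.
apply: continuous_measurable_fun => a.
apply: (@continuous_comp _ _ _ (fun a => a * z) cos); last exact: continuous_cos.
exact: mulrr_continuous.
Qed.

Lemma measurable_sinM z : measurable_fun setT (fun a : R => sin (a * z)).
Proof.
apply: continuous_measurable_fun => a.
apply: (@continuous_comp _ _ _ (fun a => a * z) sin); last exact: continuous_sin.
exact: mulrr_continuous.
Qed.

Lemma intg_expcos s z : 0 < s -> intg mu (fun a => expabs s a * cos (a * z)).
Proof.
move=> s0; apply: (intg_mulb (M := 1)); first exact: intg_expabs.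
  exact: measurable_cosM.
by move=> a; exact: cos_max.
Qed.

Lemma intg_expsin s z : 0 < s -> intg mu (fun a => expabs s a * sin (a * z)).
Proof.
move=> s0; apply: (intg_mulb (M := 1)); first exact: intg_expabs.
  exact: measurable_sinM.
by move=> a; exact: sin_max.
Qed.

Lemma Rint_expcos s z : 0 < s -> \int[mu]_a (expabs s a * cos (a * z)) = pker s z.
Proof.
move=> s0; have := Rint_expcos1 z s0.
under eq_Rintegral do rewrite mulrDr mulr1.
rewrite RintD; [|exact: intg_expabs|exact: intg_expcos].
by rewrite Rint_expabs// => /addrI.
Qed.

Lemma Rint_oppr (f : R -> R) : intg mu f -> \int[mu]_a f (- a) = \int[mu]_a f a.
Proof.
move=> fi; have mf := intg_meas fi; rewrite /Rintegral; congr fine.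
have mo : measurable_fun setT (-%R : measurableTypeR R -> measurableTypeR R).
  exact: oppr_measurable.
have mfo : measurable_fun setT (fun a => (f (- a))%:E).
  by apply/measurable_EFinP; exact: measurableT_comp.
transitivity (\int[pushforward mu (-%R : measurableTypeR R -> measurableTypeR R)]_y (f (- y))%:E)%E.
  by apply: eq_measure_integral => B mB _;
    first [exact: lebesgue_measureN|exact/esym/lebesgue_measureN].
rewrite integral_pushforward//; rewrite preimage_setT.
  by apply: eq_integral => x _ /=; rewrite opprK.
by apply: eq_integrable fi => // x _ /=; rewrite opprK.
Qed.

Lemma Rint_expsin s z : 0 < s -> \int[mu]_a (expabs s a * sin (a * z)) = 0.
Proof.
move=> s0; have si := intg_expsin z s0.
have := Rint_oppr si; under eq_Rintegral do rewrite expabsN mulNr sinN mulrN.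
rewrite RintN// => H; lra.
Qed.

End poisson.

Section eq_measure.
Context d (T : measurableType d) (R : realType) (m1 m2 : {measure set T -> \bar R}).
Hypothesis m12 : forall B, measurable B -> m1 B = m2 B.

Lemma Rint_eq_measure (f : T -> R) : \int[m1]_x f x = \int[m2]_x f x.
Proof.
by rewrite /Rintegral; congr fine; apply: eq_measure_integral => B mB _; exact: m12.
Qed.

Lemma intg_eq_measure (f : T -> R) : intg m1 f -> intg m2 f.
Proof.
move=> /integrableP[mf fi]; apply/integrableP; split => //.
have E : (\int[m1]_x `|(EFin \o f) x| = \int[m2]_x `|(EFin \o f) x|)%E.
  by apply: eq_measure_integral => B mB _; exact: m12.
by rewrite -E.
Qed.
End eq_measure.

Section swap.
Context d1 d2 (A : measurableType d1) (X : measurableType d2) (R : realType).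
Variables (m : {sigma_finite_measure set A -> \bar R})
  (nu : {sigma_finite_measure set X -> \bar R}).

Lemma intg_prod (g : A -> R) (f : X -> R) : intg m g -> intg nu f ->
  intg (m \x nu)%E (fun z => g z.1 * f z.2).
Proof.
move=> gi fi; have mg := intg_meas gi; have mf := intg_meas fi.
have mgf : measurable_fun setT (fun z : A * X => (g z.1 * f z.2)%:E).
  apply/measurable_EFinP; apply: measurable_funM.
    exact: measurableT_comp mg measurable_fst.
  exact: measurableT_comp mf measurable_snd.
apply/integrable12ltyP => //=.
rewrite (_ : (\int[m]_x _)%E = (\int[m]_x (`|g x| * \int[nu]_y `|f y|)%:E)%E).
  rewrite intgE ?ltry//; apply: (@intg_eq _ _ _ _ (fun x => (\int[nu]_y `|f y|) * `|g x|)).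
    by move=> x; rewrite mulrC.
  by apply: intgZ; exact: intg_norm.
apply: eq_integral => x _.
under eq_integral do rewrite normrM.
by rewrite intgE ?RintZ//; [exact: intg_norm|exact/intgZ/intg_norm].
Qed.

(** Fubini with the integrable factors separated from a bounded kernel. Integrability of both
    iterated integrands is returned with the equality, because the later manipulations of these
    integrals ask for it. *)
Lemma Rint_swap (g : A -> R) (f : X -> R) (k : A * X -> R) (M : R) :
  intg m g -> intg nu f -> measurable_fun setT k -> (forall z, `|k z| <= M) ->
  [/\ intg m (fun a => g a * \int[nu]_x (f x * k (a, x))),
      intg nu (fun x => f x * \int[m]_a (g a * k (a, x))) &
  \int[m]_a (g a * \int[nu]_x (f x * k (a, x))) =
  \int[nu]_x (f x * \int[m]_a (g a * k (a, x)))].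
Proof.
move=> gi fi mk kM.
have H : intg (m \x nu)%E (fun z => g z.1 * f z.2 * k z).
  by apply: (intg_mulb (M := M)) => //; exact: intg_prod.
have mk1 a : measurable_fun setT (fun x => k (a, x)) by exact: measurableT_comp.
have mk2 x : measurable_fun setT (fun a => k (a, x)) by exact: measurableT_comp.
have F1 a : (\int[nu]_x (g a * f x * k (a, x))%:E = (g a * \int[nu]_x (f x * k (a, x)))%:E)%E.
  have fk := intg_mulb fi (mk1 a) (fun x => kM (a, x)).
  rewrite -RintZ// -intgE; last exact: intgZ.
  by apply: eq_integral => x _; rewrite mulrA.
have F2 x : (\int[m]_a (g a * f x * k (a, x))%:E = (f x * \int[m]_a (g a * k (a, x)))%:E)%E.
  have gk := intg_mulb gi (mk2 x) (fun a => kM (a, x)).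
  rewrite -RintZ// -intgE; last exact: intgZ.
  by apply: eq_integral => a _; congr EFin; ring.
have I1 := integrable_fubini_F H.
have I2 : intg nu (fun x => f x * \int[m]_a (g a * k (a, x))).
  apply: (@intg_le _ _ _ _ _ (fun x => (M * \int[m]_a `|g a|) * `|f x|)).
  - apply/measurable_EFinP; apply: eq_measurable_fun (measurable_fubini_G H).
    by move=> x _; exact: F2.
  - by move=> x; rewrite normrM mulrC ler_wpM2r// Rint_normM.
  - by apply: intgZ; exact: intg_norm.
have E := Fubini H; split.
- by apply: eq_integrable I1 => // a _; exact: F1.
- exact: I2.
- rewrite /Rintegral; congr fine; move: E => /=.
  by under eq_integral do rewrite F1; under [X in _ = X]eq_integral do rewrite F2.
Qed.

Lemma Rint_prod (g : A -> R) (f : X -> R) : intg m g -> intg nu f ->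
  \int[(m \x nu)%E]_z (g z.1 * f z.2) = \int[m]_a g a * \int[nu]_x f x.
Proof.
move=> gi fi; have H := intg_prod gi fi.
rewrite {1}/Rintegral -(integral12_prod_meas1 H) /fubini_F /=.
under eq_integral => a _.
  rewrite intgE; last exact: intgZ.
  rewrite RintZ//. over.
rewrite -/(Rintegral m setT (fun a => g a * \int[nu]_x f x)) mulrC -RintZ//.
by apply: eq_Rintegral => a _; rewrite mulrC.
Qed.

End swap.

(** * Bessel inequality and Parseval identity for a pair of bounded kernels *)

Section bessel.
Context d1 d2 (A : measurableType d1) (X : measurableType d2) (R : realType).
Variables (m : {sigma_finite_measure set A -> \bar R})
  (nu : {finite_measure set X -> \bar R}).
Implicit Types (f h : X -> R) (k : A * X -> R).

Definition transform k f (a : A) : R := \int[nu]_x (f x * k (a, x)).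

Lemma transform_bound k f a : measurable_fun setT k -> (forall z, `|k z| <= 1) ->
  intg nu f -> `|transform k f a| <= \int[nu]_x `|f x|.
Proof.
move=> mk k1 fi; rewrite -[leRHS]mul1r; apply: Rint_normM => //.
exact: measurableT_comp.
Qed.

Lemma transform_pairing (e : A -> R) k f h : intg m e ->
  measurable_fun setT k -> (forall z, `|k z| <= 1) -> intg nu f -> intg nu h ->
  measurable_fun setT (transform k f) ->
  [/\ intg m (fun a => e a * (transform k f a * transform k h a)),
  \int[m]_a (e a * (transform k f a * transform k h a)) =
  \int[nu]_y (h y * \int[nu]_x (f x * \int[m]_a (e a * (k (a, x) * k (a, y))))) &
  intg nu (fun y => h y * \int[nu]_x (f x * \int[m]_a (e a * (k (a, x) * k (a, y)))))].
Proof.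
move=> ei mk k1 fi hi mkf.
have ekf : intg m (fun a => e a * transform k f a).
  by apply: (intg_mulb (M := \int[nu]_x `|f x|)) => // a; exact: transform_bound.
have [I1 I2 E] := Rint_swap ekf hi mk k1.
have E' y : \int[m]_a (e a * transform k f a * k (a, y)) =
    \int[nu]_x (f x * \int[m]_a (e a * (k (a, x) * k (a, y)))).
  have mky : measurable_fun setT (fun a => k (a, y)) by exact: measurableT_comp.
  have eky : intg m (fun a => e a * k (a, y)).
    by apply: (intg_mulb (M := 1)).
  have [_ _ E2] := Rint_swap eky fi mk k1.
  transitivity (\int[m]_a (e a * k (a, y) * transform k f a)).
    by apply: eq_Rintegral => a _; rewrite mulrAC.
  rewrite E2; apply: eq_Rintegral => x _; congr (_ * _).
  by apply: eq_Rintegral => a _; ring.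
split.
- by apply: intg_eq I1 => a; rewrite mulrA.
- under eq_Rintegral do rewrite mulrA.
  by rewrite E; apply: eq_Rintegral => y _; rewrite E'.
- by apply: intg_eq I2 => y; rewrite E'.
Qed.

(** The model: [c] and [s] are the cosine and sine of the product of a frequency and a point. The
    weights [e_ n] increase to 1 and make the frequency integrals converge, and [K n] is an
    approximate identity in x - y. The setting is abstract because it serves on the interval and on
    the square. *)
Variables (e_ : nat -> A -> R) (c s : A * X -> R) (K : nat -> X * X -> R)
  (Kmax : nat -> R) (M : R).
Hypothesis ei : forall n, intg m (e_ n).
Hypothesis e01 : forall n a, 0 <= e_ n a <= 1.
Hypothesis end_ : forall a n p, (n <= p)%N -> e_ n a <= e_ p a.
Hypothesis e1 : forall a, e_ n a @[n --> \oo] --> (1 : R).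
Hypotheses (mc : measurable_fun setT c) (ms : measurable_fun setT s).
Hypotheses (c1 : forall z, `|c z| <= 1) (s1 : forall z, `|s z| <= 1).
Hypothesis mK : forall n, measurable_fun setT (K n).
Hypothesis K0 : forall n z, 0 <= K n z <= Kmax n.
Hypothesis KE : forall n x y,
  \int[m]_a (e_ n a * (c (a, x) * c (a, y) + s (a, x) * s (a, y))) = K n (x, y).
Hypothesis KM1 : forall n y, \int[nu]_x K n (x, y) <= M.
Hypothesis KM2 : forall n x, \int[nu]_y K n (x, y) <= M.

Lemma transform_measurable k f : measurable_fun setT k -> (forall z, `|k z| <= 1) ->
  intg nu f -> measurable_fun setT (transform k f).
Proof.
move=> mk k1 fi; apply: (@measurable_fun_cvg _ _ _ _ (fun n a => e_ n a * transform k f a)).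
- by move=> n; have [/intg_meas] := Rint_swap (ei n) fi mk k1.
- move=> a _; rewrite -[X in _ --> X]mul1r; apply: cvgM; [exact: e1|exact: cvg_cst].
Qed.

(** The sign [sg] selects the kernel: 1 gives a function of x - y in the model, -1 a function of x +
    y. Half the sum of the two isolates the cosine transforms. *)
Lemma pairing_kernel n (sg : R) (k : X * X -> R) f h : intg nu f -> intg nu h ->
  (forall x y, \int[m]_a (e_ n a * (c (a, x) * c (a, y) + sg * (s (a, x) * s (a, y)))) = k (x, y))
    ->
  \int[m]_a (e_ n a * (transform c f a * transform c h a)) +
  sg * \int[m]_a (e_ n a * (transform s f a * transform s h a)) =
  \int[nu]_y (h y * \int[nu]_x (f x * k (x, y))).
Proof.
move=> fi hi kE.
have [_ pc pcI] := transform_pairing (ei n) mc c1 fi hi (transform_measurable mc c1 fi).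
have [_ ps psI] := transform_pairing (ei n) ms s1 fi hi (transform_measurable ms s1 fi).
rewrite pc ps -RintZ; last exact: psI.
rewrite -RintD; [|exact: pcI|by apply: intgZ; exact: psI].
apply: eq_Rintegral => y _; rewrite mulrCA -mulrDr; congr (_ * _).
have bI (l : A * X -> R) : measurable_fun setT l -> (forall z, `|l z| <= 1) ->
    intg nu (fun x => f x * \int[m]_a (e_ n a * (l (a, x) * l (a, y)))).
  move=> ml l1; have mly : measurable_fun setT (fun a => l (a, y)).
    exact: measurableT_comp.
  have ely : intg m (fun a => e_ n a * l (a, y)) by exact: (intg_mulb (M := 1)).
  have [_ + _] := Rint_swap ely fi ml l1; apply: intg_eq => x; congr (_ * _).
  by apply: eq_Rintegral => a _; ring.
have bc := bI c mc c1; have bs := bI s ms s1.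
rewrite -RintZ; last exact: bs.
rewrite -RintD; [|exact: bc|by apply: intgZ; exact: bs].
apply: eq_Rintegral => x _; rewrite mulrCA -mulrDr -kE; congr (_ * _).
have eI (l : A * X -> R) : measurable_fun setT l -> (forall z, `|l z| <= 1) ->
    intg m (fun a => e_ n a * (l (a, x) * l (a, y))).
  move=> ml l1; apply: (intg_mulb (M := 1)) => //.
    by apply: measurable_funM; exact: measurableT_comp.
  by move=> a; rewrite normrM mulr_ile1.
have ec := eI c mc c1; have es := eI s ms s1.
rewrite -RintZ; last exact: es.
rewrite -RintD; [|exact: ec|by apply: intgZ; exact: es].
by apply: eq_Rintegral => a _; ring.
Qed.

(** Schur's test: f(x) f(y) <= (f(x)^2 + f(y)^2) / 2, and both marginals of the kernel are at most
    M. *)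
Lemma schur n f : sqint nu f ->
  \int[nu]_y (f y * \int[nu]_x (f x * K n (x, y))) <= M * \int[nu]_x f x ^+ 2.
Proof.
move=> sf; have fi : intg nu f.
  by case: sf => mf; apply: intg_sqr => //; exact: fin_num_fun_lty.
have [mf qi] := sf.
have KB z : `|K n z| <= Kmax n.
  by have /andP[h1 h2] := K0 n z; rewrite ger0_norm.
have one : intg nu (cst 1) by apply: intg_cst; exact: fin_num_fun_lty.
have mK' : measurable_fun setT (fun z : X * X => K n (z.2, z.1)).
  by apply: measurableT_comp (mK n) _; apply: measurable_fun_pair.
have KB' (z : X * X) : `|K n (z.2, z.1)| <= Kmax n by exact: KB.
have [I1 _ _] := Rint_swap fi fi mK' KB'.
have [I2 I3 E] := Rint_swap one qi mK' KB'.
rewrite /= in I1 I2 I3 E.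
have Kx y : intg nu (fun x => K n (x, y)).
  have mKy : measurable_fun setT (fun x => K n (x, y)) by exact: measurableT_comp.
  by have := intg_mulb one mKy (fun x => KB (x, y)); apply: intg_eq => x; rewrite mul1r.
have Kfx h y : intg nu h -> intg nu (fun x => h x * K n (x, y)).
  move=> hi; apply: (intg_mulb hi _ (fun x => KB (x, y))).
  exact: measurableT_comp.
have I2' : intg nu (fun y => \int[nu]_x (f x ^+ 2 * K n (x, y))).
  by apply: intg_eq I2 => y; rewrite mul1r.
apply: (@le_trans _ _ (\int[nu]_y (2^-1 * \int[nu]_x (f x ^+ 2 * K n (x, y)) + (M / 2) * f y ^+
  2))).
  apply: Rint_le; [exact: I1|by apply: intgD; [exact: (intgZ _ I2')|exact: intgZ]|move=> y].
  rewrite -RintZ; last exact: Kfx.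
  apply: (@le_trans _ _ (\int[nu]_x (2^-1 * (f x ^+ 2 * K n (x, y)) + (f y ^+ 2 / 2) * K n (x,
    y)))).
    apply: Rint_le => [||x].
    - by apply: intgZ; exact: Kfx.
    - by apply: intgD; apply: intgZ => //; exact: Kfx.
    - have /andP[h1 _] := K0 n (x, y); have := sqr_ge0 (f x - f y).
      by move: h1; set k := K n (x, y); nra.
  rewrite RintD; [|apply: intgZ; exact: Kfx|exact: intgZ].
  rewrite (RintZ _ (Kfx _ y qi)) (RintZ _ (Kx y)).
  rewrite lerD2l (_ : M / 2 * f y ^+ 2 = f y ^+ 2 / 2 * M); last by ring.
  by rewrite ler_wpM2l// divr_ge0 ?sqr_ge0.
have -> : M * \int[nu]_x f x ^+ 2 = 2^-1 * (M * \int[nu]_x f x ^+ 2) + (M / 2) * \int[nu]_x f x ^+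
  2.
  by field.
rewrite RintD; [|exact: (intgZ _ I2')|exact: (intgZ _ qi)].
rewrite (RintZ _ I2') (RintZ _ qi) lerD2r ler_pM2l ?invr_gt0//.
have -> : \int[nu]_y (\int[nu]_x (f x ^+ 2 * K n (x, y))) =
   \int[nu]_x (f x ^+ 2 * \int[nu]_a (1 * K n (x, a))).
  by rewrite -E; apply: eq_Rintegral => y _; rewrite mul1r.
rewrite -(RintZ _ qi); apply: Rint_le; [exact: I3|exact: intgZ|move=> x].
rewrite mulrC ler_wpM2r ?sqr_ge0//.
by under eq_Rintegral do rewrite mul1r.
Qed.

(** [schur] bounds the weighted energy independently of n; monotone convergence removes the
    weights. *)
Lemma bessel f : sqint nu f ->
  (\int[m]_a (transform c f a ^+ 2 + transform s f a ^+ 2)%:E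
     <= (M * \int[nu]_x f x ^+ 2)%:E)%E.
Proof.
move=> sf; have fi : intg nu f.
  by case: sf => mf; apply: intg_sqr => //; exact: fin_num_fun_lty.
have mT k : measurable_fun setT k -> (forall z, `|k z| <= 1) ->
    measurable_fun setT (transform k f) by move=> mk k1; exact: transform_measurable.
pose g a := transform c f a ^+ 2 + transform s f a ^+ 2.
have g0 a : 0 <= g a by rewrite addr_ge0 ?sqr_ge0.
have mg : measurable_fun setT g.
  by apply: measurable_funD; apply: measurable_funX; exact: mT.
pose g_ n a := (e_ n a * g a)%:E.
have gl a : limn (g_^~ a) = (g a)%:E.
  apply/cvg_lim => //; apply/fine_cvgP; split; first exact: nearW.
  rewrite -[X in _ --> X]mul1r; apply: cvgM; [exact: e1|exact: cvg_cst].
have H : (\int[m]_x g_ n x)%E @[n --> \oo] --> (\int[m]_x (limn (g_^~ x)))%E.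
  apply: cvg_monotone_convergence => //.
  - move=> n; apply/measurable_EFinP; apply: measurable_funM => //; exact: intg_meas (ei n).
  - by move=> n a _; rewrite lee_fin mulr_ge0//; case/andP: (e01 n a).
  - by move=> a _ n p np; rewrite lee_fin ler_wpM2r// end_.
have -> : (\int[m]_a (g a)%:E = \int[m]_x (limn (g_^~ x)))%E.
  by apply: eq_integral => a _; rewrite gl.
apply: (cvge_le _ H); apply: nearW => n.
have P k : measurable_fun setT k -> (forall z, `|k z| <= 1) ->
    intg m (fun a => e_ n a * (transform k f a * transform k f a)).
  by move=> mk k1; have [] := transform_pairing (ei n) mk k1 fi fi (mT k mk k1).
have -> : (\int[m]_x g_ n x)%E = (\int[m]_a (e_ n a * (transform c f a * transform c f a)) +
  \int[m]_a (e_ n a * (transform s f a * transform s f a)))%:E.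
  rewrite -RintD; [|exact: P..]; rewrite -intgE; last by apply: intgD; exact: P.
  by apply: eq_integral => a _; rewrite /g_ /g; congr EFin; ring.
have KE1 x y : \int[m]_a (e_ n a * (c (a, x) * c (a, y) + 1 * (s (a, x) * s (a, y)))) = K n (x, y).
  by rewrite -KE; apply: eq_Rintegral => a _; rewrite mul1r.
by rewrite lee_fin -[X in _ + X]mul1r (pairing_kernel fi fi KE1) schur.
Qed.

Lemma sqint_transform f : sqint nu f ->
  sqint m (transform c f) /\ sqint m (transform s f).
Proof.
move=> sf; have fi : intg nu f.
  by case: sf => mf; apply: intg_sqr => //; exact: fin_num_fun_lty.
have mC := transform_measurable mc c1 fi; have mS := transform_measurable ms s1 fi.
have H : intg m (fun a => transform c f a ^+ 2 + transform s f a ^+ 2).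
  apply/integrableP; split.
    by apply/measurable_EFinP; apply: measurable_funD; exact: measurable_funX.
  apply: (@le_lt_trans _ _ (M * \int[nu]_x f x ^+ 2)%:E); last by rewrite ltry.
  apply: le_trans (bessel sf); rewrite le_eqVlt; apply/orP; left; apply/eqP.
  by apply: eq_integral => a _ /=; rewrite ger0_norm// addr_ge0 ?sqr_ge0.
split; split => //.
- apply: (intg_le _ _ H); first exact: measurable_funX.
  by move=> a; rewrite ger0_norm ?sqr_ge0// lerDl sqr_ge0.
- apply: (intg_le _ _ H); first exact: measurable_funX.
  by move=> a; rewrite ger0_norm ?sqr_ge0// lerDr sqr_ge0.
Qed.

Lemma bessel_Rint f : sqint nu f ->
  \int[m]_a transform c f a ^+ 2 + \int[m]_a transform s f a ^+ 2 <= M * \int[nu]_x f x ^+ 2.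
Proof.
move=> sf; have [[_ h1] [_ h2]] := sqint_transform sf.
rewrite -RintD; [|exact: h1|exact: h2].
by have := bessel sf; rewrite intgE; [rewrite lee_fin|exact: intgD].
Qed.

Lemma bessel_cos f : sqint nu f -> \int[m]_a transform c f a ^+ 2 <= M * \int[nu]_x f x ^+ 2.
Proof.
by move=> /bessel_Rint; apply: le_trans; rewrite lerDl Rint_ge0// => a; exact: sqr_ge0.
Qed.

Lemma transformB k f h a : measurable_fun setT k -> (forall z, `|k z| <= 1) ->
  intg nu f -> intg nu h ->
  transform k (fun x => f x - h x) a = transform k f a - transform k h a.
Proof.
move=> mk k1 fi hi; rewrite /transform.
have mka : measurable_fun setT (fun x => k (a, x)) by exact: measurableT_comp.
have H g : intg nu g -> intg nu (fun x => g x * k (a, x)).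
  by move=> gi; exact: (intg_mulb (M := 1)).
rewrite -RintB; [|exact: H|exact: H].
by apply: eq_Rintegral => x _; rewrite mulrBl.
Qed.

Lemma transformD k f h a : measurable_fun setT k -> (forall z, `|k z| <= 1) ->
  intg nu f -> intg nu h ->
  transform k (fun x => f x + h x) a = transform k f a + transform k h a.
Proof.
move=> mk k1 fi hi; rewrite /transform.
have mka : measurable_fun setT (fun x => k (a, x)) by exact: measurableT_comp.
have H g : intg nu g -> intg nu (fun x => g x * k (a, x)).
  by move=> gi; exact: (intg_mulb (M := 1)).
rewrite -RintD; [|exact: H|exact: H].
by apply: eq_Rintegral => x _; rewrite mulrDl.
Qed.

Lemma transformZ k r f a : measurable_fun setT k -> (forall z, `|k z| <= 1) ->
  intg nu f -> transform k (fun x => r * f x) a = r * transform k f a.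
Proof.
move=> mk k1 fi; rewrite /transform.
have mka : measurable_fun setT (fun x => k (a, x)) by exact: measurableT_comp.
rewrite -RintZ; last exact: (intg_mulb (M := 1)).
by apply: eq_Rintegral => x _; rewrite mulrA.
Qed.

(** [K'] comes from c c - s s and is a kernel in x + y in the model. It concentrates on y = -x, away
    from the domain, so its limit is 0: here enters the disjointness of the domain from its
    reflection. Limits are only asked on a generating family stable under intersection, and on the
    whole space. *)
Variables (K' : nat -> X * X -> R) (Kinf : R) (G : set (set X)).
Hypothesis KE' : forall n x y,
  \int[m]_a (e_ n a * (c (a, x) * c (a, y) + (-1) * (s (a, x) * s (a, y)))) = K' n (x, y).
Hypothesis mK' : forall n, measurable_fun setT (K' n).
Hypothesis K0' : forall n z, 0 <= K' n z <= Kmax n.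
Hypothesis KM1' : forall n y, \int[nu]_x K' n (x, y) <= M.
Hypothesis mG : @measurable _ X = <<s G >>.
Hypothesis GI : setI_closed G.
Hypothesis limK : forall B, G B \/ B = setT -> \forall y \ae nu,
  \int[nu]_x (\1_B x * K n (x, y)) @[n --> \oo] --> Kinf * \1_B y.
Hypothesis limK' : forall B, G B \/ B = setT -> \forall y \ae nu,
  \int[nu]_x (\1_B x * K' n (x, y)) @[n --> \oo] --> (0 : R).

(** One argument is frozen so that the class of admissible h can grow: generating sets, measurable
    sets, simple functions, nonnegative functions, all square-integrable functions. *)
Definition parseval_for h := forall f, sqint nu f ->
  \int[m]_a (transform c f a * transform c h a) = Kinf / 2 * \int[nu]_x (f x * h x).

(** Dominated convergence with majorant M |f|, since the marginal bound is uniform in n. *)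
Lemma kernel_limit (k : nat -> X * X -> R) (B : set X) (l : X -> R) f :
  measurable B -> (forall n, measurable_fun setT (k n)) ->
  (forall n z, 0 <= k n z <= Kmax n) ->
  (forall n y, \int[nu]_x k n (x, y) <= M) -> measurable_fun setT l ->
  (\forall y \ae nu, \int[nu]_x (\1_B x * k n (x, y)) @[n --> \oo] --> l y) ->
  intg nu f ->
  \int[nu]_y (f y * \int[nu]_x (\1_B x * k n (x, y))) @[n --> \oo] -->
  \int[nu]_y (f y * l y).
Proof.
move=> mB mk k0 kM ml kl fi.
have one : intg nu (cst 1) by apply: intg_cst; exact: fin_num_fun_lty.
have iB : intg nu (\1_B : X -> R).
  by apply: intg_indic => //; exact: fin_num_fun_lty.
have kb n z : `|k n z| <= Kmax n by have /andP[h1 h2] := k0 n z; rewrite ger0_norm.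
have mk' n : measurable_fun setT (fun z : X * X => k n (z.2, z.1)).
  by apply: measurableT_comp (mk n) _; apply: measurable_fun_pair.
have kb' n (z : X * X) : `|k n (z.2, z.1)| <= Kmax n by exact: kb.
pose J n y := \int[nu]_x (\1_B x * k n (x, y)).
have mJ n : measurable_fun setT (J n).
  have [/intg_meas + _ _] := Rint_swap one iB (mk' n) (kb' n).
  by apply: eq_measurable_fun => y _ /=; rewrite mul1r.
have mky n y : measurable_fun setT (fun x => k n (x, y)) by exact: measurableT_comp.
have ky n y : intg nu (fun x => k n (x, y)).
  by have := intg_mulb one (mky n y) (fun x => kb n (x, y)); apply: intg_eq => x; rewrite mul1r.
have Jb n y : `|J n y| <= M.
  rewrite ger0_norm; last first.
    by apply: Rint_ge0 => x; rewrite mulr_ge0//; case/andP: (k0 n (x, y)).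
  apply: le_trans (kM n y); apply: Rint_le.
  - exact: (intg_mulb iB (mky n y) (fun x => kb n (x, y))).
  - exact: ky.
  - move=> x; have /andP[h1 _] := k0 n (x, y); rewrite indicE.
    by case: (_ \in _); rewrite ?mul1r ?mul0r.
apply: (@Rint_dct_cvg _ _ _ nu (fun n y => f y * J n y) (fun y => f y * l y)
  (fun y => M * `|f y|)).
- by move=> n; apply: measurable_funM; [exact: intg_meas fi|exact: mJ].
- by apply: measurable_funM => //; exact: intg_meas fi.
- by apply: filterS kl => y H; apply: cvgM => //; exact: cvg_cst.
- by apply: intgZ; exact: intg_norm.
- by move=> n y; rewrite normrM mulrC ler_wpM2r.
Qed.

(** Half the sum of the pairings for [K] and [K'] passes to the limit on both sides: the weights
    tend to 1 on the frequency side, the kernels to [Kinf] times the identity and to 0 on the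
    other. *)
Lemma parseval_base B : G B \/ B = setT -> parseval_for \1_B.
Proof.
move=> GB f sf; have fi : intg nu f.
  by case: sf => mf; apply: intg_sqr => //; exact: fin_num_fun_lty.
have mB : measurable B.
  by case: GB => [?|->//]; rewrite mG; exact: sub_sigma_algebra.
have iB : intg nu (\1_B : X -> R).
  by apply: intg_indic => //; exact: fin_num_fun_lty.
have sB : sqint nu (\1_B : X -> R).
  split; first exact: measurable_indic.
  by apply: intg_eq iB => x; rewrite indicE; case: (_ \in _); rewrite ?expr1n ?expr0n.
have [sC _] := sqint_transform sf; have [sCB _] := sqint_transform sB.
have CC := sqint_mul sC sCB.
have KE1 n x y : \int[m]_a (e_ n a * (c (a, x) * c (a, y) + 1 * (s (a, x) * s (a, y)))) = K n (x,
  y).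
  by rewrite -KE; apply: eq_Rintegral => a _; rewrite mul1r.
pose E n := \int[m]_a (e_ n a * (transform c \1_B a * transform c f a)).
have E1 n := pairing_kernel iB fi (KE1 n).
have E2 n := pairing_kernel iB fi (KE' n).
have L1 := kernel_limit mB mK K0 KM1 _ (limK GB) fi.
have L2 := kernel_limit mB mK' K0' KM1' (measurable_cst (0 : R)) (limK' GB) fi.
have {}L1 : \int[nu]_y (f y * \int[nu]_x (\1_B x * K n (x, y))) @[n --> \oo] -->
    \int[nu]_y (f y * (Kinf * \1_B y)).
  by apply: L1; apply: measurable_funM => //; exact: measurable_indic.
have L : E n @[n --> \oo] --> Kinf / 2 * \int[nu]_x (f x * \1_B x).
  have -> : Kinf / 2 * \int[nu]_x (f x * \1_B x) = 2^-1 *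
     (\int[nu]_y (f y * (Kinf * \1_B y)) + \int[nu]_y (f y * cst 0 y)).
    rewrite [X in _ + X](_ : _ = 0); last first.
      by rewrite -[RHS](Rint_zero nu); apply: eq_Rintegral => y _; rewrite mulr0.
    rewrite addr0 (_ : Kinf / 2 = 2^-1 * Kinf); last by rewrite mulrC.
    rewrite -mulrA -RintZ; last first.
      by apply: (intg_mulb (M := 1)) => // x; rewrite indicE normr_nat; case: (_ \in _).
    by congr (_ * _); apply: eq_Rintegral => y _; ring.
  rewrite (_ : E = fun n => 2^-1 *
     (\int[nu]_y (f y * \int[nu]_x (\1_B x * K n (x, y))) +
      \int[nu]_y (f y * \int[nu]_x (\1_B x * K' n (x, y))))); last first.
    apply/funext => n; rewrite -E1 -E2 /E; set u := Rintegral _ _ _.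
    by field.
  by apply: cvgM; [exact: cvg_cst|exact: cvgD].
have L' : E n @[n --> \oo] --> \int[m]_a (transform c f a * transform c \1_B a).
  apply: (@Rint_dct_cvg _ _ _ m (fun n a => e_ n a * (transform c \1_B a * transform c f a))
   (fun a => transform c f a * transform c \1_B a) (fun a => `|transform c f a * transform c \1_B
     a|)).
  - move=> n; apply: measurable_funM; first exact: intg_meas (ei n).
    by apply: measurable_funM; [case: sCB|case: sC].
  - exact: intg_meas CC.
  - apply/aeW => a; rewrite [X in _ --> X]mulrC -[X in _ --> X]mul1r.
    by apply: cvgM; [exact: e1|exact: cvg_cst].
  - exact: intg_norm.
  - move=> n a; have /andP[h0 h1] := e01 n a.
    by rewrite normrM (ger0_norm h0) [X in _ * `|X|]mulrC ler_piMl.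
exact: cvg_unique L' L.
Qed.

Let nuT : (nu setT < +oo)%E. Proof. exact: fin_num_fun_lty. Qed.

Let sqint_intg f : sqint nu f -> intg nu f.
Proof. by case=> mf; exact: intg_sqr. Qed.

Let sqint_indic B : measurable B -> sqint nu (\1_B : X -> R).
Proof.
move=> mB; split; first exact: measurable_indic.
apply: intg_eq (intg_indic nuT mB) => x.
by rewrite indicE; case: (_ \in _); rewrite ?expr1n ?expr0n.
Qed.

Lemma parseval_lin r f h : sqint nu f -> sqint nu h ->
  parseval_for f -> parseval_for h -> parseval_for (fun x => f x + r * h x).
Proof.
move=> sf sh pf ph g sg.
have fi := sqint_intg sf; have hi := sqint_intg sh.
have [sCf _] := sqint_transform sf; have [sCh _] := sqint_transform sh.
have [sCg _] := sqint_transform sg.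
have I1 := sqint_mul sCg sCf; have I2 := sqint_mul sCg sCh.
have J1 := sqint_mul sg sf; have J2 := sqint_mul sg sh.
transitivity (\int[m]_a (transform c g a * transform c f a + r * (transform c g a * transform c h
  a))).
  apply: eq_Rintegral => a _; rewrite transformD//; last exact: intgZ.
  by rewrite transformZ// mulrDr; ring.
rewrite RintD; [|exact: I1|exact: (intgZ _ I2)].
rewrite (RintZ _ I2) pf// ph// mulrCA -mulrDr; congr (_ * _).
rewrite -(RintZ _ J2) -RintD; [|exact: J1|exact: (intgZ _ J2)].
by apply: eq_Rintegral => x _; ring.
Qed.

(** The integrals over the domain converge by dominated convergence. On the frequency side,
    Cauchy-Schwarz and [bessel_cos] turn the L^2 convergence of [h_ i] into convergence of the
    pairings. *)
Lemma parseval_cvg (h_ : nat -> X -> R) h (g : X -> R) :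
  (forall i, parseval_for (h_ i)) ->
  (forall i, measurable_fun setT (h_ i)) -> measurable_fun setT h ->
  (forall x, h_ i x @[i --> \oo] --> h x) -> (forall i x, `|h_ i x| <= g x) ->
  sqint nu g -> parseval_for h.
Proof.
move=> ph mh_ mh hh hg sg f sf; have gi := sqint_intg sg; have [mg g2] := sg.
have g0 x : 0 <= g x by apply: le_trans (hg 0%N x).
have hlg x : `|h x| <= g x.
  have nh : `|h_ i x| @[i --> \oo] --> `|h x| by apply: cvg_norm; exact: hh.
  rewrite -(cvg_lim _ nh)//; apply: limr_le.
    exact: cvgP nh.
  by apply: nearW => i; exact: hg.
have shk i : sqint nu (h_ i).
  by apply: (sqint_le _ _ sg) => // x; rewrite (ger0_norm (g0 x)).
have sh : sqint nu h.
  by apply: (sqint_le _ _ sg) => // x; rewrite (ger0_norm (g0 x)).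
have [sCf _] := sqint_transform sf.
have sd i : sqint nu (fun x => h_ i x - h x) by exact: sqintB.
have L1 : \int[nu]_x (f x * h_ i x) @[i --> \oo] --> \int[nu]_x (f x * h x).
  apply: (@Rint_dct_cvg _ _ _ nu (fun i x => f x * h_ i x) _ (fun x => `|f x * g x|)).
  - by move=> i; apply: measurable_funM => //; case: sf.
  - by apply: measurable_funM => //; case: sf.
  - by apply/aeW => x; apply: cvgM; [exact: cvg_cst|exact: hh].
  - by apply: intg_norm; exact: sqint_mul.
  - by move=> i x; rewrite !normrM ler_wpM2l// (ger0_norm (g0 x)).
have L2 : \int[nu]_x (h_ i x - h x) ^+ 2 @[i --> \oo] --> (0 : R).
  rewrite -[X in _ --> X](Rint_zero nu).
  apply: (@Rint_dct_cvg _ _ _ nu (fun i x => (h_ i x - h x) ^+ 2) _ (fun x => 4 * g x ^+ 2)).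
  - by move=> i; apply: measurable_funX; exact: measurable_funB.
  - exact: measurable_cst.
  - apply/aeW => x; have d0 : h_ i x - h x @[i --> \oo] --> (0 : R).
      by rewrite -(subrr (h x)); apply: cvgB; [exact: hh|exact: cvg_cst].
    have := cvgM d0 d0; rewrite mulr0 => dd; under eq_fun do rewrite expr2.
    exact: dd.
  - exact: intgZ.
  - move=> i x; rewrite ger0_norm ?sqr_ge0//.
    have /ler_normlP[a1 a2] := hg i x; have /ler_normlP[b1 b2] := hlg x.
    have := g0 x; nra.
pose I i := \int[m]_a (transform c f a * transform c (h_ i) a).
have L3 : I i - \int[m]_a (transform c f a * transform c h a) @[i --> \oo] --> (0 : R).
  set B := \int[m]_a transform c f a ^+ 2.
  have B0 : 0 <= B by apply: Rint_ge0 => a; exact: sqr_ge0.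
  have E i : I i - \int[m]_a (transform c f a * transform c h a) =
      \int[m]_a (transform c f a * transform c (fun x => h_ i x - h x) a).
    have [sCi _] := sqint_transform (shk i); have [sCh _] := sqint_transform sh.
    rewrite -RintB; [|exact: sqint_mul|exact: sqint_mul].
    apply: eq_Rintegral => a _; rewrite transformB//; last 2 first.
      exact: sqint_intg. exact: sqint_intg.
    by rewrite mulrBr.
  have Q i : (I i - \int[m]_a (transform c f a * transform c h a)) ^+ 2 <=
      B * (M * \int[nu]_x (h_ i x - h x) ^+ 2).
    have [sCd _] := sqint_transform (sd i); rewrite E.
    apply: le_trans (Rint_cauchy_schwarz _ _ _) _.
    - by case: sCf.
    - by case: sCd.
    - exact: sqint_mul.
    - by rewrite ler_wpM2l// bessel_cos.
  have Q0 : B * (M * \int[nu]_x (h_ i x - h x) ^+ 2) @[i --> \oo] --> (0 : R).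
    rewrite -[X in _ --> X](mulr0 B) -[X in _ --> B * X](mulr0 M).
    by apply: cvgM; [exact: cvg_cst|apply: cvgM => //; exact: cvg_cst].
  apply/cvgr0Pnorm_lt => e e0.
  have /cvgr0Pnorm_lt /(_ (e ^+ 2)) := Q0; rewrite exprn_gt0// => /(_ isT).
  apply: filterS => i; move/(le_lt_trans (ler_norm _)) => /(le_lt_trans (Q i)).
  by rewrite -[ltLHS]real_normK ?num_real// ltr_pXn2r// nnegrE ltW.
have L4 : I i @[i --> \oo] --> Kinf / 2 * \int[nu]_x (f x * h x).
  rewrite (_ : I = fun i => Kinf / 2 * \int[nu]_x (f x * h_ i x)); last first.
    by apply/funext => i; rewrite /I ph.
  by apply: cvgM; [exact: cvg_cst|exact: L1].
have L5 : I i - (I i - \int[m]_a (transform c f a * transform c h a)) @[i --> \oo] -->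
    Kinf / 2 * \int[nu]_x (f x * h x) - 0 by apply: cvgB.
move: L5; under eq_fun do rewrite subKr; rewrite subr0.
by move/cvg_lim => <- //; rewrite lim_cst.
Qed.

(** Dynkin induction from the generating family; a countable disjoint union is reached through
    finite unions, dominated by the constant 1. *)
Lemma parseval_measurable B : measurable B -> parseval_for \1_B.
Proof.
move=> mB; have : <<s G >> B by rewrite -mG.
apply: (dynkin_induction mG GI (P := fun B => parseval_for \1_B)).
- by apply: parseval_base; right.
- by move=> D GD; apply: parseval_base; left.
- move=> D mD pD.
  have -> : (\1_(~` D) : X -> R) = fun x => \1_setT x + (-1) * \1_D x.
    apply/funext => x; rewrite !indicE in_setT in_setC.
    by case: (x \in D); rewrite /=; ring.
  apply: parseval_lin => //; first exact: sqint_indic measurableT.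
    exact: sqint_indic.
  by apply: parseval_base; right.
move=> F mF tF pF.
have pS n : parseval_for \1_(\big[setU/set0]_(i < n) F i).
  elim: n => [|n IH].
    (* The zero function is written 1 - 1, so that linearity and the whole space cover this case. *)
    have -> : (\1_(\big[setU/set0]_(i < 0) F i) : X -> R) =
        fun x => \1_setT x + (-1) * \1_setT x.
      by rewrite big_ord0; apply/funext => x; rewrite !indicE in_setT in_set0 /=; ring.
    by apply: parseval_lin => //; (try exact: sqint_indic); apply: parseval_base; right.
  have -> : (\1_(\big[setU/set0]_(i < n.+1) F i) : X -> R) =
      fun x => \1_(\big[setU/set0]_(i < n) F i) x + 1 * \1_(F n) x.
    apply/funext => x; rewrite big_ord_recr /= !indicE in_setU mul1r.
    case: (boolP (x \in F n)) => xF; rewrite ?orbF ?orbT ?addr0//.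
    rewrite [x \in \big[_/_]_(i < n) _](_ : _ = false) ?add0r//.
    apply/negbTE/negP; rewrite inE -bigcup_mkord => -[i /= ni Fix].
    have := tF i n I I; rewrite inE in xF => /(_ (ex_intro _ x (conj Fix xF))) => E.
    by rewrite E ltnn in ni.
  apply: parseval_lin => //; apply: sqint_indic => //.
  exact: bigsetU_measurable.
apply: (parseval_cvg (h_ := fun n => \1_(\big[setU/set0]_(i < n) F i)) (g := cst 1)) => //.
- move=> n; apply: measurable_indic; exact: bigsetU_measurable.
- by apply: measurable_indic; exact: bigcup_measurable.
- move=> x; apply: cvg_near_cst; have [[k _ Fkx]|nF] := pselect ((\bigcup_k F k) x).
    near=> n; rewrite !indicE !mem_set//; first by exists k.
    rewrite -bigcup_mkord; exists k => //=; near: n; exact: nbhs_infty_gt.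
  apply: nearW => n; rewrite !indicE !memNset//.
  by rewrite -bigcup_mkord => -[k _ Fkx]; apply: nF; exists k.
- by move=> n x; rewrite indicE normr_nat; case: (_ \in _).
- by have := sqint_indic measurableT; rewrite indicT.
Unshelve. all: by end_near. Qed.

Import HBNNSimple HBSimple.

Lemma parseval_nnsfun (h : {nnsfun X >-> R}) : parseval_for h.
Proof.
have [r hr] : exists r : seq R, (h : X -> R) =
    fun x => \sum_(y <- r) (y * \1_(h @^-1` [set y]) x).
  exists (finmap.enum_fset (fset_set (range h))); apply/funext => x.
  by rewrite {1}fimfunE fsbig_finite.
rewrite hr; elim: r {hr} => [|y s0 IH].
  have -> : (fun x => \sum_(y <- [::]) (y * \1_(h @^-1` [set y]) x)) =
      fun x => \1_setT x + (-1) * \1_setT x.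
    by apply/funext => x; rewrite big_nil indicE in_setT; ring.
  by apply: parseval_lin; (try exact: sqint_indic); apply: parseval_base; right.
have -> : (fun x => \sum_(z <- y :: s0) (z * \1_(h @^-1` [set z]) x)) =
    fun x => \sum_(z <- s0) (z * \1_(h @^-1` [set z]) x) + y * \1_(h @^-1` [set y]) x.
  by apply/funext => x; rewrite big_cons addrC.
apply: parseval_lin => //; last exact: parseval_measurable.
  elim: s0 {IH} => [|z s0 IH].
    by apply: sqint_le (sqint_indic measurableT) => // [|x]; [
      under eq_fun do rewrite big_nil; exact: measurable_cst|rewrite big_nil normr0].
  under eq_fun do rewrite big_cons.
  by apply: sqintD => //; apply: sqintZ; exact: sqint_indic.
exact: sqint_indic.
Qed.

Lemma parseval_ge0 h : sqint nu h -> (forall x, 0 <= h x) -> parseval_for h.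
Proof.
move=> sh h0; have mh : measurable_fun setT (EFin \o h).
  by apply/measurable_EFinP; case: sh.
pose g := nnsfun_approx measurableT mh.
have gh x : g n x @[n --> \oo] --> h x.
  have h0' y : setT y -> (0 <= (EFin \o h) y)%E by rewrite lee_fin.
  by have /fine_cvgP[] := cvg_nnsfun_approx measurableT mh h0' (I : setT x).
have nd x : {homo (fun n => g n x) : n p / (n <= p)%N >-> n <= p}.
  by move=> n p np; have /lefP := nd_nnsfun_approx measurableT mh np; apply.
apply: (parseval_cvg (h_ := fun n => g n) (g := h)) => //.
- by move=> n; exact: parseval_nnsfun.
- by case: sh.
move=> n x; rewrite ger0_norm//.
have cg : cvgn (fun n => g n x) by apply/cvg_ex; exists (h x); exact: gh.
by have := nondecreasing_cvgn_le (@nd x) cg n; rewrite (cvg_lim _ (gh x)).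
Qed.

Lemma parseval f h : sqint nu f -> sqint nu h ->
  \int[m]_a (transform c f a * transform c h a) = Kinf / 2 * \int[nu]_x (f x * h x).
Proof.
move=> sf sh; suff: parseval_for h by exact.
have -> : h = fun x => Num.max (h x) 0 + (-1) * Num.max (- h x) 0.
  by apply/funext => x; rewrite /Num.max /Order.max; do 2 case: ifP; move/negbT || move=> ?; lra.
have mh : measurable_fun setT h by case: sh.
have s1' : sqint nu (fun x => Num.max (h x) 0).
  apply: sqint_le sh => [|x]; first exact: measurable_maxr.
  by rewrite /Num.max /Order.max; case: ifP => _; rewrite ?normr0.
have s2' : sqint nu (fun x => Num.max (- h x) 0).
  apply: sqint_le sh => [|x]; first by apply: measurable_maxr => //; exact: measurable_funN.
  by rewrite /Num.max /Order.max; case: ifP => _; rewrite ?normr0 ?normrN.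
by apply: parseval_lin => //; apply: parseval_ge0 => // x; rewrite le_max lexx orbT.
Qed.

End bessel.

(** * Cosine transforms on the unit interval and on the square *)

Section interval_measure.
Context (R : realType).

Let mT := measurableTypeR R.

Lemma fin_num_of_lt d (T : measurableType d) (mu : {measure set T -> \bar R}) :
  (mu setT < +oo)%E -> fin_num_fun mu.
Proof.
move=> h A mA; rewrite ge0_fin_numE//; apply: le_lt_trans h.
by apply: le_measure => //; rewrite inE.
Qed.

(** The same measure packed with its finiteness, which the abstract section asks of the measure on
    the domain; likewise [unitI]. *)
Definition lebOf : {finite_measure set (mT * mT)%type -> \bar R} :=
  HB.pack (Measure.sort (@lebO R))
    (Measure_isFinite.Build _ _ _ (Measure.sort (@lebO R)) (fin_num_of_lt (@lebO_fin R))).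

Definition unitI : {finite_measure set mT -> \bar R} :=
  HB.pack (Measure.sort (@lebT R 1))
    (Measure_isFinite.Build _ _ _ (Measure.sort (@lebT R 1)) (fin_num_of_lt (@lebT_fin R 1))).

Definition lebesgue : {sigma_finite_measure set mT -> \bar R} := @lebesgue_measure R.

Lemma leb2E : @leb2 R = (lebesgue \x lebesgue)%E. Proof. by []. Qed.

Lemma lebOE (B : set (mT * mT)) : measurable B -> @lebO R B = (unitI \x unitI)%E B.
Proof.
move=> mB; apply/esym/product_measure_unique => // A1 A2 mA1 mA2.
have mi : measurable (`]0, 1[%classic : set mT) by exact: measurable_itv.
rewrite -[LHS]/((lebesgue \x lebesgue)%E ((A1 `*` A2) `&` Omega)).
have -> : (A1 `*` A2) `&` Omega = (A1 `&` `]0, 1[) `*` (A2 `&` `]0, 1[).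
  apply/seteqP; split => -[x1 x2] /=; rewrite /Omega /=.
    by move=> [[? ?] [? ?]].
  by move=> [[? ?] [? ?]].
by apply: eq_trans (product_measure1E _ _ _ _) _ => //; exact: measurableI.
Qed.

Lemma dotE (a x : R * R) : dot a x = a.1 * x.1 + a.2 * x.2.
Proof. by rewrite /dot big_ord_recl big_ord1 /crd. Qed.

Lemma continuous_pker (s y : R) : 0 < s -> continuous (fun x : R => pker s (x - y)).
Proof.
move=> s0 x; rewrite /pker; apply: cvgM; first exact: cvg_cst.
apply: cvgV.
  by rewrite gt_eqF// ltr_pwDl ?exprn_gt0 ?sqr_ge0.
apply: cvgD; first exact: cvg_cst.
apply: (@continuous_comp _ _ _ (fun x : R => x - y) (fun z => z ^+ 2)).
  by apply: cvgB; [exact: cvg_id|exact: cvg_cst].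
exact: exprn_continuous.
Qed.

Lemma measurable_pker (s y : R) : 0 < s -> measurable_fun setT (fun x : R => pker s (x - y)).
Proof. by move=> s0; apply: continuous_measurable_fun; exact: continuous_pker. Qed.

Lemma pker_intervalE (s a b y : R) : 0 < s -> a <= b ->
  (\int[lebesgue]_(x in `[a, b]) (pker s (x - y))%:E =
   (2 * (atan ((b - y) / s) - atan ((a - y) / s)))%:E)%E.
Proof.
move=> s0 ab.
have := @FTC2_dv R (fun x => 2 * atan ((x - y) / s)) (fun x => pker s (x - y)) a b ab.
rewrite -mulrBr; apply.
  move=> x.
  have dx : dv (fun x => (x - y) / s) x s^-1.
    by apply: dv_eq (dvM (dvB (dv_id x) (dv_cst y x)) (dv_cst s^-1 x)) _; ring.
  apply: dv_eq (dvZ 2 (dv_comp (is_derive1_atan _) dx)) _.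
  have h1 : s ^+ 2 + (x - y) ^+ 2 != 0 by rewrite gt_eqF// ltr_pwDl ?exprn_gt0 ?sqr_ge0.
  have s1 : s != 0 by rewrite gt_eqF.
  have h2 : 1 + ((x - y) / s) ^+ 2 != 0 by rewrite gt_eqF// ltr_pwDl ?sqr_ge0.
  rewrite /pker (_ : 1 + ((x - y) / s) ^+ 2 = (s ^+ 2 + (x - y) ^+ 2) / s ^+ 2); last by field.
  by field; rewrite s1 h1.
exact: continuous_pker.
Qed.

(** The indicator and the restriction to the unit interval clip the interval to one between max a 0
    and min b 1, where the primitive is an arctangent; the test covers the case where nothing is
    left. *)
Lemma pker_mass (s a b y : R) : 0 < s ->
  \int[unitI]_x (\1_(`]a, b]%classic : set mT) x * pker s (x - y)) =
  if Num.max a 0 <= Num.min b 1 then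
    2 * (atan ((Num.min b 1 - y) / s) - atan ((Num.max a 0 - y) / s)) else 0.
Proof.
move=> s0; set a' := Num.max a 0; set b' := Num.min b 1.
pose I1 : set mT := `]a, b]%classic; pose I0 : set mT := `]0, 1[%classic.
have mI : measurable I1 by exact: measurable_itv.
have mU : measurable I0 by exact: measurable_itv.
have mp := measurable_pker y s0.
have mf : measurable_fun setT (fun x : mT => (\1_I1 x * pker s (x - y))%:E).
  by apply/measurable_EFinP; apply: measurable_funM => //; exact: measurable_indic.
rewrite /Rintegral (integral_mrestr _ mU mf) -/lebesgue.
have -> : (\int[lebesgue]_(x in I0) (\1_I1 x * pker s (x - y))%:E =
  \int[lebesgue]_(x in (I0 `&` I1)) (pker s (x - y))%:E)%E.
  rewrite [RHS]integral_mkcondr; apply: eq_integral => x _.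
  rewrite patchE indicE; case: ifP => xI; first by rewrite mul1r.
  by rewrite mul0r.
case: ifPn => [ab|]; last first.
  rewrite -ltNge => ba; rewrite (_ : I0 `&` I1 = set0) ?integral_set0//.
  rewrite -subset0 => x []; rewrite /I0 /I1 /= !in_itv /= => /andP[x0 x1] /andP[ax xb].
  have : a' < b'.
    by rewrite (@lt_le_trans _ _ x)// ?gt_max ?ax//; rewrite le_min xb ltW.
  by move/(lt_trans ba); rewrite ltxx.
have E := pker_intervalE y s0 ab; rewrite -[RHS]/(fine _%:E) -E; congr fine.
have mO : measurable (`]a', b'[%classic : set mT) by exact: measurable_itv.
have mC : measurable (`[a', b']%classic : set mT) by exact: measurable_itv.
have mEp D : measurable_fun D (fun x : mT => (pker s (x - y))%:E).
  by apply/measurable_EFinP; apply: measurable_funTS.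
have p0 (x : R) : (0 <= (pker s (x - y))%:E)%E by rewrite lee_fin pker_ge0.
apply/eqP; rewrite eq_le; apply/andP; split.
  apply: ge0_subset_integral => //; first exact: measurableI.
  move=> x []; rewrite /I0 /I1 /= !in_itv /= => /andP[x0 x1] /andP[ax xb].
  by rewrite ge_max le_min (ltW ax) (ltW x0) xb ltW.
rewrite [leLHS](_ : _ = (\int[lebesgue]_(x in `]a', b'[) (pker s (x - y))%:E)%E); last first.
  exact: (@integral_itv_bndoo R a' b' (fun x => (pker s (x - y))%:E) true false (mEp _)).
apply: ge0_subset_integral => //; first exact: measurableI.
move=> x; rewrite /I0 /I1 /= !in_itv /= gt_max lt_min => /andP[/andP[ax x0] /andP[xb x1]].
by rewrite x0 x1 ax ltW.
Qed.

Lemma pker_mass_le (s y : R) : 0 < s -> \int[unitI]_x pker s (x - y) <= 2 * pi.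
Proof.
move=> s0; have := pker_mass (-1) 1 y s0.
have -> : \int[unitI]_x (\1_(`](-1), 1]%classic : set mT) x * pker s (x - y)) =
    \int[unitI]_x pker s (x - y).
  have mU : measurable (`]0, 1[%classic : set mT) by exact: measurable_itv.
  have mI : measurable (`](-1), 1]%classic : set mT) by exact: measurable_itv.
  have mp := measurable_pker y s0.
  have mf : measurable_fun setT (fun x : mT => (\1_(`](-1), 1]%classic : set mT) x * pker s (x -
    y))%:E).
    by apply/measurable_EFinP; apply: measurable_funM => //; exact: measurable_indic.
  rewrite /Rintegral (integral_mrestr _ mU mf) integral_mrestr//; last exact/measurable_EFinP.
  congr fine; apply: eq_integral => x; rewrite inE /= in_itv /= => /andP[x0 x1].
  rewrite indicE mem_set ?mul1r//= in_itv /= (ltW x1) andbT.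
  by rewrite (lt_trans _ x0)// ltrN10.
move=> ->; case: ifP => _; last by rewrite mulr_ge0// pi_ge0.
rewrite ler_pM2l//.
have := atan_ltpi2 ((Num.min 1 1 - y) / s).
have := atan_gtNpi2 ((Num.max (-1) 0 - y) / s); lra.
Qed.

Lemma cvg_atan_scaled (z : R) : atan (z / n.+1%:R^-1) @[n --> \oo] -->
  (if 0 < z then pi / 2 else if z < 0 then - (pi / 2) else 0).
Proof.
have P (x : R) : 0 < x -> atan (x / n.+1%:R^-1) @[n --> \oo] --> pi / 2.
  move=> x0; apply: (@cvg_comp _ _ _ (fun n => x / n.+1%:R^-1) atan _ +oo); last exact: cvgy_atan.
  apply/cvgryPge => A; near=> n.
  rewrite invrK mulrC -ler_pdivrMr// (le_trans (ler_norm _))//.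
  apply: ltW; apply: (lt_le_trans (Num.Theory.truncnS_gt _)).
  rewrite ler_nat ltnS; near: n; exact: nbhs_infty_ge.
case: ltgtP => z0.
- exact: P.
- rewrite (_ : (fun _ => _) = fun n => - atan ((- z) / n.+1%:R^-1)); last first.
    by apply/funext => n; rewrite mulNr atanN opprK.
  by apply: cvgN; apply: P; rewrite oppr_gt0.
- by rewrite -z0; under eq_fun do rewrite mul0r atan0; exact: cvg_cst.
Unshelve. all: by end_near. Qed.

(** The scaled arctangents tend to pi / 2 times the signs of their arguments, so the mass tends to 2
    pi inside and to 0 outside. The clipped endpoints are excluded because only half of the mass is
    seen from there. *)
Lemma pker_mass_cvg (a b y : R) : y != Num.max a 0 -> y != Num.min b 1 -> 0 < y < 1 ->
  \int[unitI]_x (\1_(`]a, b]%classic : set mT) x * pker n.+1%:R^-1 (x - y)) @[n --> \oo] -->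
  2 * pi * \1_(`]a, b]%classic : set mT) y.
Proof.
move=> ya yb /andP[y0 y1]; under eq_fun do rewrite pker_mass ?invr_gt0//.
have [ab|ba] := leP (Num.max a 0) (Num.min b 1); last first.
  rewrite indicE memNset ?mulr0; first exact: cvg_cst.
  rewrite /= in_itv /= => /andP[ay yb'].
  move: ba; rewrite ltNge => /negP; apply.
  by apply: (@le_trans _ _ y); [rewrite ge_max (ltW ay) (ltW y0)|rewrite le_min yb' (ltW y1)].
pose hs (z : R) := if 0 < z then pi / 2 else if z < 0 then - (pi / 2) else 0 : R.
have L : 2 * (atan ((Num.min b 1 - y) / n.+1%:R^-1) - atan ((Num.max a 0 - y) / n.+1%:R^-1))
    @[n --> \oo] --> 2 * (hs (Num.min b 1 - y) - hs (Num.max a 0 - y)).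
  by apply: cvgM; [exact: cvg_cst|apply: cvgB; exact: cvg_atan_scaled].
rewrite (_ : 2 * pi * _ = 2 * (hs (Num.min b 1 - y) - hs (Num.max a 0 - y))); first exact: L.
rewrite /hs !subr_gt0 !subr_lt0 indicE.
have -> : (y \in (`]a, b]%classic : set mT)) = (a < y <= b).
  by apply/idP/idP; rewrite inE /= in_itv.
have -> : (a < y <= b) = (Num.max a 0 < y) && (y < Num.min b 1).
  rewrite gt_max y0 andbT lt_min y1 andbT; congr andb.
  rewrite le_eqVlt; case: eqP => //= yb'; apply/esym/idP/negP.
  by move: yb; rewrite -yb' eq_sym minEle (ltW y1) eqxx.
case: ltgtP ya => // ya _; case: ltgtP yb => // yb _ /=; rewrite ?mulr0 ?mulr1; try by field.
by move: (lt_le_trans (lt_trans yb ya) ab); rewrite ltxx.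
Qed.

(** The kernel is now centred at -y, outside the unit interval, and both arctangents tend to pi /
    2. *)
Lemma pker_mass_cvg0 (a b y : R) : 0 < y < 1 ->
  \int[unitI]_x (\1_(`]a, b]%classic : set mT) x * pker n.+1%:R^-1 (x + y)) @[n --> \oo] --> (0 :
    R).
Proof.
move=> /andP[y0 y1].
have E n : \int[unitI]_x (\1_(`]a, b]%classic : set mT) x * pker n.+1%:R^-1 (x + y)) =
  if Num.max a 0 <= Num.min b 1 then
    2 * (atan ((Num.min b 1 + y) / n.+1%:R^-1) - atan ((Num.max a 0 + y) / n.+1%:R^-1)) else 0.
  by rewrite -[y]opprK -pker_mass// invr_gt0.
under eq_fun do rewrite E.
have [ab|ba] := leP (Num.max a 0) (Num.min b 1); last exact: cvg_cst.
have L := cvgM (cvg_cst (2 : R)) (cvgB (@cvg_atan_scaled (Num.min b 1 + y)) (@cvg_atan_scaled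
  (Num.max a 0 + y))).
have h1 : 0 < Num.max a 0 + y by rewrite ltr_pwDr// le_max lexx orbT.
have h2 : 0 < Num.min b 1 + y by rewrite (lt_le_trans h1)// lerD2r.
by move: L; rewrite h1 h2 subrr mulr0; exact.
Qed.

Lemma continuous_dot (x : R * R) : continuous (fun a : R * R => dot a x).
Proof.
move=> a; rewrite (_ : (fun a => dot a x) = fun a => a.1 * x.1 + a.2 * x.2); last first.
  by apply/funext => b; rewrite dotE.
by apply: cvgD; apply: cvgM; (try exact: cvg_cst); [exact: cvg_fst|exact: cvg_snd].
Qed.

Let P2 := (mT * mT)%type.

Lemma measurable_dot2 : measurable_fun setT (fun z : P2 * P2 => dot z.1 z.2).
Proof.
rewrite (_ : (fun z => _) = fun z : P2 * P2 => z.1.1 * z.2.1 + z.1.2 * z.2.2); last first.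
  by apply/funext => z; rewrite dotE.
have m1 := @measurable_fst _ _ P2 P2; have m2 := @measurable_snd _ _ P2 P2.
have n1 := @measurable_fst _ _ mT mT; have n2 := @measurable_snd _ _ mT mT.
apply: measurable_funD; apply: measurable_funM.
- exact: measurableT_comp n1 m1.
- exact: measurableT_comp n1 m2.
- exact: measurableT_comp n2 m1.
- exact: measurableT_comp n2 m2.
Qed.

Definition cosk (z : P2 * P2) : R := cos (dot z.1 z.2).
Definition sink (z : P2 * P2) : R := sin (dot z.1 z.2).

Lemma measurable_cosk : measurable_fun setT cosk.
Proof.
by apply: measurableT_comp measurable_dot2; apply: continuous_measurable_fun;
  exact: continuous_cos.
Qed.

Lemma measurable_sink : measurable_fun setT sink.
Proof.
by apply: measurableT_comp measurable_dot2; apply: continuous_measurable_fun;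
  exact: continuous_sin.
Qed.

Definition expabs2 (s : R) (a : P2) : R := expabs s a.1 * expabs s a.2.

Lemma intg_expabs2 s : 0 < s -> intg (lebesgue \x lebesgue)%E (expabs2 s).
Proof. by move=> s0; apply: intg_prod; exact: intg_expabs. Qed.

(** In the expansion of the cosine of the sum the product of sines integrates to 0 by oddness, so
    the kernel of the plane is a product of kernels of the line. *)
Lemma Rint_expabs2_cos s (z : R * R) : 0 < s ->
  \int[(lebesgue \x lebesgue)%E]_a (expabs2 s a * cos (dot a z)) = pker s z.1 * pker s z.2.
Proof.
move=> s0.
have Ic := fun t => @intg_expcos R s t s0; have Is := fun t => @intg_expsin R s t s0.
transitivity (\int[(lebesgue \x lebesgue)%E]_a
   ((expabs s a.1 * cos (a.1 * z.1)) * (expabs s a.2 * cos (a.2 * z.2)) -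
    (expabs s a.1 * sin (a.1 * z.1)) * (expabs s a.2 * sin (a.2 * z.2)))).
  by apply: eq_Rintegral => a _; rewrite dotE cosD /expabs2; ring.
rewrite RintB; [|exact: intg_prod (Ic _) (Ic _)|exact: intg_prod (Is _) (Is _)].
rewrite (Rint_prod (Ic z.1) (Ic z.2)) (Rint_prod (Is z.1) (Is z.2)).
rewrite [X in X * _ - _](Rint_expcos _ s0) [X in _ * X - _](Rint_expcos _ s0).
by rewrite [X in _ - X * _](Rint_expsin _ s0) mul0r subr0.
Qed.

Lemma pker_le s z : 0 < s -> pker s z <= 2 / s :> R.
Proof.
move=> s0; rewrite /pker ler_pdivrMr; last by rewrite ltr_pwDl ?exprn_gt0 ?sqr_ge0.
rewrite mulrAC ler_pdivlMr// -mulrA -expr2 ler_pM2l//.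
by rewrite lerDl sqr_ge0.
Qed.

Let sn (n : nat) : R := n.+1%:R^-1.
Let sn0 n : 0 < sn n. Proof. by rewrite invr_gt0. Qed.

Let K n (z : P2 * P2) : R := pker (sn n) (z.1.1 - z.2.1) * pker (sn n) (z.1.2 - z.2.2).
Let K' n (z : P2 * P2) : R := pker (sn n) (z.1.1 + z.2.1) * pker (sn n) (z.1.2 + z.2.2).

Let measurable_pker1 n : measurable_fun setT (pker (sn n) : mT -> R).
Proof.
have := measurable_pker 0 (sn0 n); apply: eq_measurable_fun => x _.
by rewrite subr0.
Qed.

Let mK n : measurable_fun setT (K n).
Proof.
have m1 := @measurable_fst _ _ P2 P2; have m2 := @measurable_snd _ _ P2 P2.
have n1 := @measurable_fst _ _ mT mT; have n2 := @measurable_snd _ _ mT mT.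
apply: measurable_funM; apply: measurableT_comp (measurable_pker1 n) _;
  apply: measurable_funB.
- exact: measurableT_comp n1 m1.
- exact: measurableT_comp n1 m2.
- exact: measurableT_comp n2 m1.
- exact: measurableT_comp n2 m2.
Qed.

Let mK' n : measurable_fun setT (K' n).
Proof.
have m1 := @measurable_fst _ _ P2 P2; have m2 := @measurable_snd _ _ P2 P2.
have n1 := @measurable_fst _ _ mT mT; have n2 := @measurable_snd _ _ mT mT.
apply: measurable_funM; apply: measurableT_comp (measurable_pker1 n) _;
  apply: measurable_funD.
- exact: measurableT_comp n1 m1.
- exact: measurableT_comp n1 m2.
- exact: measurableT_comp n2 m1.
- exact: measurableT_comp n2 m2.
Qed.

Lemma intg_unitI_pker s (B : set mT) y : 0 < s -> measurable B ->
  intg unitI (fun x => \1_B x * pker s (x - y)).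
Proof.
move=> s0 mB; have iB := intg_indic (@lebT_fin R 1) mB.
have [b Hb] : exists b, forall x : mT, `|pker s (x - y)| <= b.
  by exists (2 / s) => x; rewrite ger0_norm ?pker_ge0// pker_le.
by apply: (intg_mulb iB _ Hb); exact: measurable_pker.
Qed.

Lemma Rint_lebO_prod (f g : mT -> R) : intg unitI f -> intg unitI g ->
  \int[lebOf]_x (f x.1 * g x.2) = \int[unitI]_x f x * \int[unitI]_x g x.
Proof. by move=> fi gi; rewrite (Rint_eq_measure lebOE) (Rint_prod fi gi). Qed.

Lemma Rint_K n (B1 B2 : set mT) (y : P2) : measurable B1 -> measurable B2 ->
  \int[lebOf]_x (\1_(B1 `*` B2) x * K n (x, y)) =
  \int[unitI]_x (\1_B1 x * pker (sn n) (x - y.1)) *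
  \int[unitI]_x (\1_B2 x * pker (sn n) (x - y.2)).
Proof.
move=> m1 m2; rewrite -Rint_lebO_prod; [|exact: intg_unitI_pker|exact: intg_unitI_pker].
apply: eq_Rintegral => x _; rewrite /K /= !indicE in_setX.
by case: (_ \in B1); case: (_ \in B2); rewrite /= ?mul0r ?mul1r ?mulr0.
Qed.

Lemma Rint_K' n (B1 B2 : set mT) (y : P2) : measurable B1 -> measurable B2 ->
  \int[lebOf]_x (\1_(B1 `*` B2) x * K' n (x, y)) =
  \int[unitI]_x (\1_B1 x * pker (sn n) (x + y.1)) *
  \int[unitI]_x (\1_B2 x * pker (sn n) (x + y.2)).
Proof.
move=> m1 m2; rewrite -[y.1]opprK -[y.2]opprK.
rewrite -Rint_lebO_prod; [|exact: intg_unitI_pker|exact: intg_unitI_pker].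
apply: eq_Rintegral => x _; rewrite /K' /= !indicE in_setX !opprK.
by case: (_ \in B1); case: (_ \in B2); rewrite /= ?mul0r ?mul1r ?mulr0.
Qed.

Section ae_tools.
Context d (T : measurableType d) (m : {measure set T -> \bar R}).

Lemma aeS (P Q : T -> Prop) : (forall x, P x -> Q x) ->
  (\forall x \ae m, P x) -> \forall x \ae m, Q x.
Proof. by move=> PQ; apply: filterS. Qed.

Lemma aeI (P Q : T -> Prop) : (\forall x \ae m, P x) -> (\forall x \ae m, Q x) ->
  \forall x \ae m, P x /\ Q x.
Proof. by move=> aP aQ; apply: filterI. Qed.

Variables (D : set T) (mD : measurable D).

Lemma ae_mrestr_in : \forall x \ae mrestr m mD, D x.
Proof.
exists (~` D); split => //; first exact: measurableC.
by rewrite /mrestr /= setICl measure0.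
Qed.

Lemma ae_mrestr (P : T -> Prop) : (\forall x \ae m, P x) -> \forall x \ae mrestr m mD, P x.
Proof.
move=> [B [mB B0 PB]]; exists B; split => //.
apply/eqP; rewrite eq_le measure_ge0 andbT -B0.
by apply: le_measure; rewrite ?inE//; exact: measurableI.
Qed.

End ae_tools.

Lemma aeT_in (T : R) : \forall t \ae lebT T, 0 < t < T.
Proof.
apply: aeS (ae_mrestr_in (@lebesgue_measure R) (measurable_interval T)) => t.
by rewrite /= in_itv.
Qed.

Lemma aeO_in : \forall x \ae @lebO R, Omega x.
Proof. exact: ae_mrestr_in. Qed.

Lemma aeO_fst (c : R) : \forall x \ae @lebO R, x.1 != c.
Proof.
have m1 : measurable ([set c] : set mT) by exact: measurable_set1.
apply: ae_mrestr; exists ([set c] `*` setT); split.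
- exact: measurableX.
- rewrite leb2E [LHS](_ : _ = (lebesgue [set c] * lebesgue setT)%E); last exact: product_measure1E.
  by rewrite [X in (X * _)%E]lebesgue_measure_set1 mul0e.
- by move=> -[x1 x2] /= /negP; rewrite negbK => /eqP ->.
Qed.

Lemma aeO_snd (c : R) : \forall x \ae @lebO R, x.2 != c.
Proof.
have m1 : measurable ([set c] : set mT) by exact: measurable_set1.
apply: ae_mrestr; exists (setT `*` [set c]); split.
- exact: measurableX.
- rewrite leb2E [LHS](_ : _ = (lebesgue setT * lebesgue [set c])%E); last exact: product_measure1E.
  by rewrite [X in (_ * X)%E]lebesgue_measure_set1 mule0.
- by move=> -[x1 x2] /= /negP; rewrite negbK => /eqP ->.
Qed.

(** The whole line is added to the half-open intervals so that strips are rectangles; this makes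
    both projections measurable for the generated sigma-algebra. *)
Let ocT : set (set mT) := [set B | ocitv B \/ B = setT].

Let ocT_measurable B : ocT B -> measurable B.
Proof. by case=> [oB|->//]; exact: sub_sigma_algebra. Qed.

Let rectangles : set (set P2) := [set A `*` B | A in ocT & B in ocT].

Let rectangles_gen : @measurable _ P2 = <<s rectangles >>.
Proof.
pose P2' := g_sigma_algebraType rectangles.
have mf : measurable_fun setT (fst : P2' -> mT).
  apply: (@measurability _ _ P2' mT setT fst (@ocitv R)) => // _ [B oB <-].
  rewrite setTI; apply: sub_sigma_algebra; exists B; first by left.
  by exists setT; [right|apply/seteqP; split => -[x1 x2] /=; [case|]].
have ms : measurable_fun setT (snd : P2' -> mT).
  apply: (@measurability _ _ P2' mT setT snd (@ocitv R)) => // _ [B oB <-].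
  rewrite setTI; apply: sub_sigma_algebra; exists setT; first by right.
  by exists B; [left|apply/seteqP; split => -[x1 x2] /=; [case|]].
rewrite measurable_prod_measurableType; apply/seteqP; split.
  apply: smallest_sub; first exact: smallest_sigma_algebra.
  move=> _ [A mA [B mB <-]].
  have -> : A `*` B = (setT `&` fst @^-1` A) `&` (setT `&` snd @^-1` B) by rewrite !setTI.
  apply: (@measurableI _ P2'); [exact: mf|exact: ms].
apply: smallest_sub; first exact: smallest_sigma_algebra.
move=> _ [A oA [B oB <-]]; apply: sub_sigma_algebra.
by exists A; [exact: ocT_measurable|exists B => //; exact: ocT_measurable].
Qed.

Let rectanglesI : setI_closed rectangles.
Proof.
have oI A B : ocT A -> ocT B -> ocT (A `&` B).
  move=> [oA|->] [oB|->]; rewrite ?setIT ?setTI; [|by left..|by right].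
  by left; exact: ocitvI.
move=> _ _ [A oA [B oB <-]] [A' oA' [B' oB' <-]].
exists (A `&` A'); first exact: oI.
exists (B `&` B'); first exact: oI.
by rewrite setXI.
Qed.

Let ocT_unitI B : ocT B -> exists a b : R, forall x : mT, 0 < x < 1 ->
  (x \in B) = (x \in (`]a, b]%classic : set mT)).
Proof.
move=> [[[a b] _ <-]|->]; first by exists a, b.
exists 0, 1 => x /andP[x0 x1]; rewrite in_setT; apply/esym.
by rewrite mem_set//= in_itv /= x0 ltW.
Qed.

Lemma cvg_to_eq (u : nat -> R) (l l' : R) : u n @[n --> \oo] --> l -> l = l' ->
  u n @[n --> \oo] --> l'.
Proof. by move=> ul <-. Qed.

Let pker_mass_ocT_cvg B : ocT B -> exists Z : seq R, forall y : R, 0 < y < 1 -> y \notin Z ->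
  \int[unitI]_x (\1_B x * pker (sn n) (x - y)) @[n --> \oo] --> 2 * pi * \1_B y /\
  \int[unitI]_x (\1_B x * pker (sn n) (x + y)) @[n --> \oo] --> (0 : R).
Proof.
move=> oB; have [a [b H]] := ocT_unitI oB.
exists [:: Num.max a 0; Num.min b 1] => y y01; rewrite !inE => /norP[ya yb].
have E g : \int[unitI]_x (\1_B x * g x) = \int[unitI]_x (\1_(`]a, b]%classic : set mT) x * g x).
  by apply: Rint_ae_eq; apply: aeS (aeT_in 1) => x x01; rewrite !indicE H.
split; under eq_fun do rewrite E.
- rewrite indicE H// -indicE; exact: pker_mass_cvg.
- exact: pker_mass_cvg0.
Qed.

Lemma aeO_notin (Z : seq R) : \forall y \ae @lebO R, (y.1 \notin Z) /\ (y.2 \notin Z).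
Proof.
elim: Z => [|z Z IH]; first exact: aeW.
have := aeI (aeI (aeO_fst z) (aeO_snd z)) IH; apply: aeS => y [[h1 h2] [h3 h4]].
by rewrite !inE !negb_or h1 h2 h3 h4.
Qed.

(** A product of one-dimensional limits, valid off finitely many lines parallel to the axes, which
    are null. *)
Let limK2 B : rectangles B \/ B = setT -> \forall y \ae lebOf,
  \int[lebOf]_x (\1_B x * K n (x, y)) @[n --> \oo] --> (2 * pi) ^+ 2 * \1_B y /\
  \int[lebOf]_x (\1_B x * K' n (x, y)) @[n --> \oo] --> (0 : R).
Proof.
move=> RB; have {RB} [A oA [B' oB' <-{B}]] : rectangles B.
  by case: RB => // ->; exists setT; [right|exists setT; [right|exact: setXTT]].
have [Z1 H1] := pker_mass_ocT_cvg oA; have [Z2 H2] := pker_mass_ocT_cvg oB'.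
have := aeI aeO_in (aeO_notin (Z1 ++ Z2)); apply: aeS => y [[y1 y2] []].
rewrite /= !in_itv /= in y1 y2; rewrite !mem_cat !negb_or => /andP[h1 _] /andP[_ h2].
have [a1 a2] := H1 _ y1 h1; have [b1 b2] := H2 _ y2 h2.
have mA := ocT_measurable oA; have mB := ocT_measurable oB'; split.
- under eq_fun do rewrite Rint_K//.
  have -> : (2 * pi) ^+ 2 * \1_(A `*` B') y = (2 * pi * \1_A y.1) * (2 * pi * \1_B' y.2) :> R.
    rewrite !indicE in_setX /=.
    by case: (_ \in A); case: (_ \in B'); rewrite /= ?mulr0 ?mulr1 ?mul0r// expr2.
  by apply: cvgM.
- under eq_fun do rewrite Rint_K'//.
  by apply: cvg_to_eq (mulr0 0); apply: cvgM.
Qed.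

Let expabs01 s a : 0 < s -> 0 <= expabs s (a : R) <= 1.
Proof. by move=> s0; rewrite ltW ?expabs_gt0//= expabs_le1. Qed.

Let expabs_homo (a : R) n p : (n <= p)%N -> expabs (sn n) a <= expabs (sn p) a.
Proof.
move=> np; rewrite ler_expR lerN2 ler_wpM2r// lef_pV2 ?posrE//.
by rewrite ler_nat ltnS.
Qed.

Let expabs_cvg1 (a : R) : expabs (sn n) a @[n --> \oo] --> (1 : R).
Proof.
rewrite -expR0; apply: (@cvg_comp _ _ _ (fun n => - (sn n * `|a|)) expR);
  last exact: continuous_expR.
apply: (@cvg_to_eq _ (- (0 * `|a|))); last by rewrite mul0r oppr0.
by apply: cvgN; apply: cvgM; [exact: cvg_harmonic|exact: cvg_cst].
Qed.

Let le_unitM (x y : R) : 0 <= x <= 1 -> 0 <= y <= 1 -> 0 <= x * y <= 1.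
Proof. by move=> /andP[? ?] /andP[? ?]; rewrite mulr_ge0// mulr_ile1. Qed.

Let pker_bound n (z : R) : 0 <= pker (sn n) z <= 2 / sn n.
Proof. by rewrite pker_ge0 ?pker_le. Qed.

Let pkerM_bound n (z w : R) : 0 <= pker (sn n) z * pker (sn n) w <= (2 / sn n) ^+ 2.
Proof.
have /andP[h1 h2] := pker_bound n z; have /andP[h3 h4] := pker_bound n w.
by rewrite mulr_ge0// expr2 ler_pM.
Qed.

Let pker_mass_leD s y : 0 < s -> \int[unitI]_x pker s (x + y) <= 2 * pi.
Proof. by move=> s0; have := pker_mass_le (- y) s0; under eq_Rintegral do rewrite opprK. Qed.

Let intg_pker s y : 0 < s -> intg unitI (fun x => pker s (x - y)).
Proof.
move=> s0; have := intg_unitI_pker y s0 (@measurableT _ mT).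
by apply: intg_eq => x; rewrite indicT mul1r.
Qed.

Let massM (g h : R -> R) : intg unitI g -> intg unitI h -> (forall x, 0 <= g x) ->
  (forall x, 0 <= h x) -> \int[unitI]_x g x <= 2 * pi -> \int[unitI]_x h x <= 2 * pi ->
  \int[lebOf]_x (g x.1 * h x.2) <= (2 * pi) ^+ 2.
Proof.
move=> gi hi g0 h0 gM hM; rewrite (Rint_lebO_prod gi hi) expr2 ler_pM ?Rint_ge0//.
Qed.

Lemma measurable_cos1 : measurable_fun setT (fun z : mT * mT => cos (z.1 * z.2) : R).
Proof.
apply: measurableT_comp; first by apply: continuous_measurable_fun; exact: continuous_cos.
exact: measurable_funM.
Qed.

Lemma measurable_sin1 : measurable_fun setT (fun z : mT * mT => sin (z.1 * z.2) : R).
Proof.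
apply: measurableT_comp; first by apply: continuous_measurable_fun; exact: continuous_sin.
exact: measurable_funM.
Qed.

Let KE1 n (x y : R) : \int[lebesgue]_a (expabs (sn n) a *
  (cos (a * x) * cos (a * y) + sin (a * x) * sin (a * y))) = pker (sn n) (x - y).
Proof.
rewrite -Rint_expcos//; apply: eq_Rintegral => a _; rewrite mulrBr cosB//.
Qed.

Let mK1 n : measurable_fun setT (fun z : mT * mT => pker (sn n) (z.1 - z.2)).
Proof.
apply: measurableT_comp (measurable_pker1 n) _; exact: measurable_funB.
Qed.

Let mass1 n y : \int[unitI]_x pker (sn n) (x - y) <= 2 * pi.
Proof. exact: pker_mass_le. Qed.

Let mass1' n x : \int[unitI]_y pker (sn n) (x - y) <= 2 * pi.
Proof.
rewrite (_ : (\int[_]__ _) = \int[unitI]_y pker (sn n) (y - x)) ?pker_mass_le//.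
by apply: eq_Rintegral => y _; rewrite -pker_even opprB.
Qed.

Definition cos_unit g (b : R) : R := \int[lebT 1]_x (g x * cos (b * x)).
Definition sin_unit g (b : R) : R := \int[lebT 1]_x (g x * sin (b * x)).

Let bessel_unit_ g : sqint unitI g ->
  [/\ sqint lebesgue (cos_unit g), sqint lebesgue (sin_unit g) &
   \int[lebesgue]_b cos_unit g b ^+ 2 + \int[lebesgue]_b sin_unit g b ^+ 2 <=
   2 * pi * \int[unitI]_x g x ^+ 2].
Proof.
move=> sg.
have ei n : intg lebesgue (expabs (sn n)) by exact: intg_expabs.
have e01 n a := @expabs01 (sn n) a (sn0 n).
have c1 z : `|cos (z.1 * z.2)| <= 1 :> R by exact: cos_max.
have s1 z : `|sin (z.1 * z.2)| <= 1 :> R by exact: sin_max.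
have K0 n (z : mT * mT) := pker_bound n (z.1 - z.2).
have [h1 h2] := sqint_transform ei e01 expabs_homo expabs_cvg1 measurable_cos1 measurable_sin1
  c1 s1 mK1 K0 KE1 mass1 mass1' sg.
have h3 := bessel_Rint ei e01 expabs_homo expabs_cvg1 measurable_cos1 measurable_sin1
  c1 s1 mK1 K0 KE1 mass1 mass1' sg.
by split.
Qed.

Lemma bessel_unit g : sqint (lebT 1) g ->
  [/\ sqint (@lebesgue_measure R) (cos_unit g), sqint (@lebesgue_measure R) (sin_unit g) &
   \int[@lebesgue_measure R]_b cos_unit g b ^+ 2 + \int[@lebesgue_measure R]_b sin_unit g b ^+ 2 <=
   2 * pi * \int[lebT 1]_x g x ^+ 2].
Proof. exact: bessel_unit_. Qed.

Section sigma_finite_product.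
Context d1 d2 (T1 : measurableType d1) (T2 : measurableType d2)
  (m1 : {sigma_finite_measure set T1 -> \bar R}) (m2 : {sigma_finite_measure set T2 -> \bar R}).

Lemma sigma_finite_product : sigma_finite setT (m1 \x m2)%E.
Proof.
have /sigma_finiteP[F [TF ndF Foo]] := sigma_finiteT m1.
have /sigma_finiteP[G [TG ndG Goo]] := sigma_finiteT m2.
exists (fun n => F n `*` G n).
  rewrite -setXTT TF TG; apply/seteqP; split => -[x y] /=.
    move=> [[n _ Fnx] [k _ Gky]]; exists (maxn n k) => //; split.
    - by move: x Fnx; exact/subsetPset/ndF/leq_maxl.
    - by move: y Gky; exact/subsetPset/ndG/leq_maxr.
  by move=> [n _ [Fx Gy]]; split; exists n.
move=> k; have [h1 h2] := Foo k; have [h3 h4] := Goo k.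
split; first exact: measurableX.
by rewrite product_measure1E// lte_mul_pinfty// ge0_fin_numE.
Qed.

Definition sigma_finite_prod : {sigma_finite_measure set (T1 * T2)%type -> \bar R} :=
  HB.pack (product_measure1 m1 m2) (Measure_isSigmaFinite.Build _ _ _ _ sigma_finite_product).
End sigma_finite_product.

(** Lebesgue measure of the plane, packed with sigma-finiteness so that it can be the frequency
    measure [m] of the abstract section. *)
Definition lebesgue2 := sigma_finite_prod lebesgue lebesgue.

(** For f extended by zero outside Omega, [ctr] is the real part of the Fourier transform and [str]
    is minus its imaginary part. *)
Definition ctr f (a : R * R) : R := \int[lebO]_x (f x * cos (dot a x)).
Definition str f (a : R * R) : R := \int[lebO]_x (f x * sin (dot a x)).

Let KE2 n (x y : P2) : \int[lebesgue2]_a (expabs2 (sn n) a *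
  (cosk (a, x) * cosk (a, y) + sink (a, x) * sink (a, y))) = K n (x, y).
Proof.
rewrite /K /= -(Rint_expabs2_cos (x.1 - y.1, x.2 - y.2))//.
apply: eq_Rintegral => a _; rewrite /cosk /sink /= -cosB; congr (_ * cos _).
by rewrite !dotE /=; ring.
Qed.

Let KE2' n (x y : P2) : \int[lebesgue2]_a (expabs2 (sn n) a *
  (cosk (a, x) * cosk (a, y) + (-1) * (sink (a, x) * sink (a, y)))) = K' n (x, y).
Proof.
rewrite /K' /= -(Rint_expabs2_cos (x.1 + y.1, x.2 + y.2))//.
apply: eq_Rintegral => a _; rewrite /cosk /sink /= mulN1r -cosD; congr (_ * cos _).
by rewrite !dotE /=; ring.
Qed.

Let mass2 n (y : P2) : \int[lebOf]_x K n (x, y) <= (2 * pi) ^+ 2.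
Proof.
apply: (massM (g := fun x => pker (sn n) (x - y.1)) (h := fun x => pker (sn n) (x - y.2)));
  by [exact: intg_pker|move=> x; exact: pker_ge0|exact: pker_mass_le].
Qed.

Let mass2s n (x : P2) : \int[lebOf]_y K n (x, y) <= (2 * pi) ^+ 2.
Proof.
rewrite (_ : (\int[_]__ _) = \int[lebOf]_y K n (y, x)) ?mass2//.
apply: eq_Rintegral => y _; rewrite /K /= -(pker_even _ (x.1 - y.1)) -(pker_even _ (x.2 - y.2)).
by rewrite !opprB.
Qed.

Let mass2' n (y : P2) : \int[lebOf]_x K' n (x, y) <= (2 * pi) ^+ 2.
Proof.
have ip c : intg unitI (fun x => pker (sn n) (x + c)).
  by have := intg_pker (- c) (sn0 n); apply: intg_eq => x; rewrite opprK.
apply: (massM (g := fun x => pker (sn n) (x + y.1)) (h := fun x => pker (sn n) (x + y.2)));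
  by [exact: ip|move=> x; exact: pker_ge0|exact: pker_mass_leD].
Qed.

Let parseval_ f h : sqint lebOf f -> sqint lebOf h ->
  [/\ sqint lebesgue2 (ctr f), sqint lebesgue2 (str f) &
   \int[lebesgue2]_a (ctr f a * ctr h a) =
   (2 * pi) ^+ 2 / 2 * \int[lebOf]_x (f x * h x)].
Proof.
move=> sf sh.
have ei n : intg lebesgue2 (expabs2 (sn n)) by exact: intg_expabs2.
have e01 n a : 0 <= expabs2 (sn n) a <= 1.
  by apply: le_unitM; exact: expabs01.
have eh a n p : (n <= p)%N -> expabs2 (sn n) a <= expabs2 (sn p) a.
  by move=> np; rewrite ler_pM ?expabs_homo// ltW// expabs_gt0.
have e1 a : expabs2 (sn n) a @[n --> \oo] --> (1 : R).
  by rewrite -[X in _ --> X](mulr1 (1 : R)); apply: cvgM.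
have c1 z : `|cosk z| <= 1 by exact: cos_max.
have s1 z : `|sink z| <= 1 by exact: sin_max.
have K0 n (z : P2 * P2) : 0 <= K n z <= (2 / sn n) ^+ 2 by exact: pkerM_bound.
have K0' n (z : P2 * P2) : 0 <= K' n z <= (2 / sn n) ^+ 2 by exact: pkerM_bound.
have [h1 h2] := sqint_transform ei e01 eh e1 measurable_cosk measurable_sink
  c1 s1 mK K0 KE2 mass2 mass2s sf.
have L B RB := aeS (fun y => @proj1 _ _) (@limK2 B RB).
have L' B RB := aeS (fun y => @proj2 _ _) (@limK2 B RB).
split => //.
exact: (parseval ei e01 eh e1 measurable_cosk measurable_sink
  c1 s1 mK K0 KE2 mass2 mass2s KE2' mK' K0' mass2' rectangles_gen rectanglesI L L' sf sh).
Qed.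

Lemma sqint_ctr f : sqint lebO f -> sqint leb2 (ctr f).
Proof. by move=> sf; have [] := parseval_ sf sf. Qed.

Lemma sqint_str f : sqint lebO f -> sqint leb2 (str f).
Proof. by move=> sf; have [] := parseval_ sf sf. Qed.

(** The constant is half of the (2 pi)^2 of Plancherel: f and its reflection have disjoint supports,
    so cosines and sines carry the same energy. *)
Lemma parseval_square f h : sqint lebO f -> sqint lebO h ->
  \int[leb2]_a (ctr f a * ctr h a) = 2 * pi ^+ 2 * \int[lebO]_x (f x * h x).
Proof.
by move=> sf sh; have [_ _ ->] := parseval_ sf sh; congr (_ * _); field.
Qed.

Lemma ctr_square f : sqint lebO f ->
  \int[leb2]_a ctr f a ^+ 2 = 2 * pi ^+ 2 * \int[lebO]_x f x ^+ 2.
Proof.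
move=> sf; have := parseval_square sf sf.
by under eq_Rintegral do rewrite -expr2; under [in RHS]eq_Rintegral do rewrite -expr2.
Qed.

Lemma measurable_ctr f : intg lebO f -> measurable_fun setT (ctr f).
Proof.
move=> fi; have ei n : intg lebesgue2 (expabs2 (sn n)) by exact: intg_expabs2.
have e1 a : expabs2 (sn n) a @[n --> \oo] --> (1 : R).
  by rewrite -[X in _ --> X](mulr1 (1 : R)); apply: cvgM.
have c1 z : `|cosk z| <= 1 by exact: cos_max.
exact: (transform_measurable (nu := lebOf) ei e1 measurable_cosk c1 fi).
Qed.

Definition icos (G : R * R -> R) (x : R * R) : R := \int[leb2]_a (G a * cos (dot a x)).

Let inversion_cst (p J : R) : p != 0 -> J = (4 * p ^+ 2)^-1 * (2 * (2 * p ^+ 2 * J)).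
Proof. by move=> p0; field. Qed.

Let inversion_cst2 (p A N : R) : p != 0 ->
  (4 * p ^+ 2)^-1 ^+ 2 * (A * (2 * p ^+ 2 * N)) = (8 * p ^+ 2)^-1 * A * N.
Proof. by move=> p0; field. Qed.

Let inversion_fin (A N : R) : 0 <= N -> 0 <= A ->
  N ^+ 2 <= (4 * pi ^+ 2)^-1 ^+ 2 * (A * (2 * pi ^+ 2 * N)) -> N <= (8 * pi ^+ 2)^-1 * A.
Proof.
move=> N0 A0; rewrite (inversion_cst2 _ _ (lt0r_neq0 (pi_gt0 R))) => CS.
have [->|N1] := eqVneq N 0.
  by apply: mulr_ge0 => //; rewrite invr_ge0; apply: mulr_ge0 => //; exact: sqr_ge0.
by rewrite -(@ler_pM2r _ N) ?lt_def ?N1// -expr2.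
Qed.

Let inversion_cs (k p A B J N : R) : N = k * J -> J ^+ 2 <= A * B -> B = p * N ->
  N ^+ 2 <= k ^+ 2 * (A * (p * N)).
Proof. by move=> NJ + <-; rewrite {1}NJ exprMn; apply: ler_wpM2l; exact: sqr_ge0. Qed.

(* The inversion formula, in the only form used: testing u - f against itself turns the
   L^2 distance into a distance of transforms. *)
Lemma icos_error (G : P2 -> R) f : intg leb2 G -> sqint leb2 G -> sqint lebO f ->
  sqint lebO (icos G) /\
  \int[lebO]_x ((4 * pi ^+ 2)^-1 * icos G x - f x) ^+ 2 <=
  (8 * pi ^+ 2)^-1 * \int[leb2]_a (G a - 2 * ctr f a) ^+ 2.
Proof.
move=> iG sG sf.
have c1 z : `|cosk z| <= 1 by exact: cos_max.
have one : intg lebOf (cst 1) by apply: intg_cst; exact: lebO_fin.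
have iG2 : intg lebesgue2 G by [].
have mc x : measurable_fun setT (fun a => cosk (a, x)).
  exact: measurableT_comp measurable_cosk (measurable_pair2 x).
have mu : measurable_fun setT (icos G).
  have [_ /intg_meas + _] := Rint_swap iG2 one measurable_cosk c1.
  by apply: eq_measurable_fun => x _; rewrite mul1r.
have ub x : `|icos G x| <= \int[leb2]_a `|G a|.
  rewrite -[leRHS]mul1r; exact: (Rint_normM iG (mc x) (fun a => c1 (a, x))).
have su : sqint lebO (icos G).
  split; first exact: mu.
  apply: (intg_le (g := cst ((\int[leb2]_a `|G a|) ^+ 2))).
  - by apply: measurable_funX; exact: mu.
  - by move=> x; rewrite normrX lerXn2r ?nnegrE//; exact: Rint_ge0.
  - exact: intg_cst (@lebO_fin R) _.
split => //.
set K0 := (4 * pi ^+ 2)^-1; set h := fun x => K0 * icos G x - f x.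
have sh : sqint lebO h by exact: (sqintB (sqintZ K0 su) sf).
have ih : intg lebOf h.
  by case: (sh) => mh; apply: intg_sqr => //; exact: lebO_fin.
have [_ _ E] := Rint_swap iG2 ih measurable_cosk c1.
have sC := sqint_ctr sh; have sCf := sqint_ctr sf.
have sd : sqint leb2 (fun a => G a - 2 * ctr f a) by exact: (sqintB sG (sqintZ 2 sCf)).
set N := \int[lebO]_x h x ^+ 2; set A := \int[leb2]_a _ ^+ 2.
have pi0 : 0 < pi ^+ 2 :> R by rewrite exprn_gt0 ?pi_gt0.
have E1 : \int[lebO]_x (h x * icos G x) = \int[leb2]_a (G a * ctr h a) by exact: esym E.
have E2 : \int[lebO]_x (f x * h x) = K0 * (2 * \int[leb2]_a (ctr f a * ctr h a)).
  rewrite (parseval_square sf sh) /K0; move: (\int[lebO]_x (f x * h x)) => J.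
  exact: inversion_cst (lt0r_neq0 (pi_gt0 R)).
have I1 := sqint_mul sh su; have I2 := sqint_mul sf sh.
have I3 := sqint_mul sG sC; have I4 := sqint_mul sCf sC.
(* The error tested against itself becomes a pairing of transforms. Cauchy-Schwarz and [ctr_square]
   then bound N^2 by a multiple of A N, and one factor N cancels. *)
have EN : N = K0 * \int[leb2]_a ((G a - 2 * ctr f a) * ctr h a).
  have -> : N = K0 * \int[lebO]_x (h x * icos G x) - \int[lebO]_x (f x * h x).
    rewrite -(RintZ K0 I1) -(RintB (intgZ K0 I1) I2).
    by apply: eq_Rintegral => x _; rewrite /h; ring.
  apply: etrans (congr2 (fun x y => K0 * x - y) E1 E2) _; rewrite -mulrBr; congr (_ * _).
  have F := RintB I3 (intgZ 2 I4); have F' := RintZ 2 I4.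
  apply: etrans (congr1 (fun y => _ - y) (esym F')) _; apply: etrans (esym F) _.
  by apply: eq_Rintegral => a _; rewrite mulrBl mulrA.
have N0 : 0 <= N by apply: Rint_ge0 => x; exact: sqr_ge0.
have A0 : 0 <= A by apply: Rint_ge0 => x; exact: sqr_ge0.
have CS : N ^+ 2 <= K0 ^+ 2 * (A * (2 * pi ^+ 2 * N)).
  have H := Rint_cauchy_schwarz (proj2 sd) (proj2 sC) (sqint_mul sd sC).
  exact: inversion_cs EN H (ctr_square sh).
exact: inversion_fin N0 A0 CS.
Qed.

End interval_measure.

(** * Test functions and traces on the square *)

Section smooth_functions.
Context (R : realType).
Implicit Types (f g a b : R -> R) (p : {poly R}) (x y : R).

(** The functions p(1/y) exp(-1/y), extended by 0, are stable under differentiation: p becomes X^2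
    (p - p'). Smoothness of the bump is then a matter of polynomials. *)
Definition flat p y : R := if 0 < y then p.[y^-1] * expR (- y^-1) else 0.

Lemma expR_monomial_le n (z : R) : 0 <= z -> z ^+ n * expR (- z) <= n`!%:R.
Proof.
move=> z0; rewrite expRN ler_pdivrMr ?expR_gt0// mulrC -ler_pdivrMr ?ltr0n ?fact_gt0//.
case: n => [|n]; first by rewrite expr0 invr1 mulr1 -expR0 ler_expR.
by apply: le_trans (expR_ge1Dxn n z0); rewrite lerDr.
Qed.

Lemma flat_bound p n : exists2 C, 0 <= C & forall y, 0 < y -> `|flat p y| <= C * y ^+ n.
Proof.
pose C := \sum_(i < size p) `|p`_i| * (i + n)`!%:R.
exists C; first by apply: sumr_ge0 => i _; rewrite mulr_ge0.
move=> y y0; rewrite /flat y0 -ler_pdivrMr ?exprn_gt0//.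
rewrite -exprVn -[X in _ * X]ger0_norm ?exprn_ge0 ?invr_ge0 ?(ltW y0)//.
set z := y^-1; have z0 : 0 <= z by rewrite invr_ge0 ltW.
rewrite -normrM horner_coef mulr_suml mulr_suml.
apply: le_trans (ler_norm_sum _ _ _) _; apply: ler_sum => i _.
rewrite -!mulrA normrM ler_wpM2l// ger0_norm; last first.
  by rewrite !mulr_ge0 ?exprn_ge0 ?expR_ge0.
by rewrite [expR _ * _]mulrC mulrA -exprD expR_monomial_le.
Qed.

Lemma flat_le0 p y : y <= 0 -> flat p y = 0.
Proof. by move=> y0; rewrite /flat ltNge y0. Qed.

Lemma dv_locally f g y d (U : set R) : open U -> U y -> (forall z, U z -> f z = g z) ->
  dv f y d -> dv g y d.
Proof.
move=> oU Uy fg; have E : \near y, f y = g y.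
  by apply: filterS (open_nbhs_nbhs (conj oU Uy)) => z /fg.
by move=> fd; apply: near_eq_is_derive fd; rewrite ?oner_neq0.
Qed.

Lemma dv_poly p y : dv (fun z => p.[z]) y p^`().[y].
Proof. exact: is_derive_poly. Qed.

Lemma dv_inv y : y != 0 -> dv (fun z => z^-1) y (- y ^- 2).
Proof.
move=> y0; apply: dv_eq (is_deriveV (f := id) (x := y) (v := 1) (t := 1) y0 _) _.
by rewrite /GRing.scale /= mulr1.
Qed.

Lemma dv_flat p y : dv (flat p) y (flat ('X^2 * (p - p^`())) y).
Proof.
have [y0|y0|y0] := ltgtP 0 y.
- apply: (@dv_locally (fun z => p.[z^-1] * expR (- z^-1)) _ _ _ [set z | 0 < z]) => //.
  + by move=> z z0; rewrite /flat z0.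
  + have yn : y != 0 by rewrite gt_eqF.
    have d1 := dv_comp (dv_poly p y^-1) (dv_inv yn).
    apply: dv_eq (dvM d1 (dv_exp (dvN (dv_inv yn)))) _.
    rewrite /flat y0 !hornerE [LHS]/=; move: (expR _) p.[_] p^`().[_] => E A B.
    by rewrite -exprVn; rewrite -[_ (_ A E) _]/(A * E * - - y^-1 ^+ 2); ring.
- apply: (@dv_locally (cst 0) _ _ _ [set z | z < 0]) => //.
  + by move=> z z0; rewrite flat_le0// ltW.
  + by apply: dv_eq (dv_cst 0 y) _; rewrite flat_le0// ltW.
(* At 0, the quadratic case of [flat_bound] makes the difference quotient O(h). *)
- rewrite -y0 flat_le0//; have [C C0 HC] := flat_bound p 2.
  have L : h^-1 *: ((flat p \o shift 0) (h *: (1 : R)) - flat p 0) @[h --> (0 : R)^'] --> (0 : R).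
    apply/cvgr0Pnorm_le => e e0; near=> h.
    have h0 : h != 0 by near: h; exact: nbhs_dnbhs_neq.
    rewrite /= addr0 /GRing.scale /= mulr1 (flat_le0 _ (lexx 0)) subr0.
    have [h1|h1] := ltP 0 h; last by rewrite flat_le0// mulr0 normr0 ltW.
    rewrite normrM normfV (gtr0_norm h1) mulrC ler_pdivrMr//.
    apply: le_trans (HC _ h1) _; rewrite expr2 mulrA ler_pM2r//.
    rewrite -[leRHS]mulr1 -(mulfV (x := C + 1)) ?gt_eqF ?ltr_wpDl//.
    rewrite mulrCA; apply: ler_pM; rewrite ?(ltW h1)//; first by rewrite lerDl.
    have : `|h| < e / (C + 1) by near: h; apply: dnbhs0_lt; rewrite divr_gt0// ltr_wpDl.
    by rewrite gtr0_norm// => /ltW; rewrite mulrC.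
  apply: DeriveDef; first by apply: cvgP L.
  exact: cvg_lim L.
Unshelve. all: by end_near. Qed.

(** A syntactic class stable under differentiation. Iterated partial derivatives of a product a(x_1)
    b(x_2) of members are again such products, whence [smooth] by induction. *)
Inductive smooth1 : (R -> R) -> Prop :=
| smooth1_flat p : smooth1 (flat p)
| smooth1_cos k : smooth1 (fun y => cos (k * y))
| smooth1_sin k : smooth1 (fun y => sin (k * y))
| smooth1_cst c : smooth1 (fun=> c)
| smooth1_id : smooth1 (fun y => y)
| smooth1_add f g : smooth1 f -> smooth1 g -> smooth1 (fun y => f y + g y)
| smooth1_mul f g : smooth1 f -> smooth1 g -> smooth1 (fun y => f y * g y)
| smooth1_affine f m c : smooth1 f -> smooth1 (fun y => f (m * y + c)).

Lemma smooth1_deriv f : smooth1 f -> exists2 g, smooth1 g & forall y, dv f y (g y).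
Proof.
have dk (k y : R) : dv (fun y => k * y) y k.
  by apply: dv_eq (dvZ k (dv_id y)) _; rewrite mulr1.
elim=> {f}.
- by move=> p; exists (flat ('X^2 * (p - p^`()))); [exact: smooth1_flat|exact: dv_flat].
- move=> k; exists (fun y => (- k) * sin (k * y)).
    by apply: smooth1_mul; [exact: smooth1_cst|exact: smooth1_sin].
  by move=> y; apply: dv_eq (dv_cos (dk k y)) _; ring.
- move=> k; exists (fun y => k * cos (k * y)).
    by apply: smooth1_mul; [exact: smooth1_cst|exact: smooth1_cos].
  by move=> y; apply: dv_eq (dv_sin (dk k y)) _; ring.
- by move=> c; exists (fun=> 0); [exact: smooth1_cst|exact: dv_cst].
- by exists (fun=> 1); [exact: smooth1_cst|exact: dv_id].
- move=> f g _ [f' sf' df] _ [g' sg' dg]; exists (fun y => f' y + g' y).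
    exact: smooth1_add.
  by move=> y; exact: dvD.
- move=> f g sf [f' sf' df] sg [g' sg' dg]; exists (fun y => f' y * g y + f y * g' y).
    by apply: smooth1_add; exact: smooth1_mul.
  by move=> y; exact: dvM.
- move=> f m c sf [f' sf' df]; exists (fun y => f' (m * y + c) * m).
    by apply: smooth1_mul; [exact: smooth1_affine|exact: smooth1_cst].
  move=> y; apply: dv_comp; first exact: df.
  by apply: dv_eq (dvD (dk m y) (dv_cst c y)) _; rewrite addr0.
Qed.

Lemma smooth1_continuous f : smooth1 f -> continuous f.
Proof. by move=> /smooth1_deriv[g _ fg] y; exact: dv_cvg (fg y). Qed.

Definition ebump : R -> R := flat 1.
Definition dbump : R -> R := flat 'X^2.

Lemma dv_bump y : dv ebump y (dbump y).
Proof. by apply: dv_eq (dv_flat 1 y) _; rewrite /dbump derivC subr0 mulr1. Qed.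

Lemma bump_ge0 y : 0 <= ebump y.
Proof. by rewrite /ebump /flat; case: ifP => // _; rewrite hornerC mul1r expR_ge0. Qed.

Lemma bump_le1 y : ebump y <= 1.
Proof.
rewrite /ebump /flat; case: ifP => // y0; rewrite hornerC mul1r expR_le1 oppr_le0.
by rewrite invr_ge0 ltW.
Qed.

Lemma bumpE y : 0 < y -> ebump y = expR (- y^-1).
Proof. by move=> y0; rewrite /ebump /flat y0 hornerC mul1r. Qed.

Lemma dbumpE y : 0 < y -> dbump y = y^-1 ^+ 2 * expR (- y^-1).
Proof. by move=> y0; rewrite /dbump /flat y0 hornerXn. Qed.

Lemma dbump_ge0 y : 0 <= dbump y.
Proof.
by rewrite /dbump /flat; case: ifP => // _; rewrite hornerXn mulr_ge0 ?sqr_ge0 ?expR_ge0.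
Qed.

(** With z = 1/y the left-hand side is (z + z^2) exp(-z), and z^n exp(-z) <= n! gives 1 + 2. *)
Lemma dbump_weight_le y : (y + 1) * dbump y <= 3.
Proof.
have [y0|y0] := leP y 0; first by rewrite /dbump flat_le0// mulr0.
rewrite dbumpE// mulrA; set z := y^-1; have z0 : 0 <= z by rewrite invr_ge0 ltW.
have -> : (y + 1) * z ^+ 2 = z + z ^+ 2.
  by rewrite /z mulrDl mul1r expr2 mulrA mulfV ?mul1r// gt_eqF.
have := expR_monomial_le 1 z0; have := expR_monomial_le 2 z0.
rewrite /= mulrDl expr1 !factS fact0 => h1 h2; apply: le_trans (lerD h2 h1) _; lra.
Qed.

(* Its slope is of order m near the endpoints, which functions vanishing there compensate. *)
Definition cutoff (m : nat) y := ebump (m%:R * y - 1) * ebump (m%:R * (1 - y) - 1).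
Definition dcutoff (m : nat) y :=
  m%:R * dbump (m%:R * y - 1) * ebump (m%:R * (1 - y) - 1)
  - m%:R * ebump (m%:R * y - 1) * dbump (m%:R * (1 - y) - 1).

Lemma smooth1_cutoff m : smooth1 (cutoff m).
Proof.
apply: smooth1_mul.
  by apply: (@smooth1_affine (flat 1) m%:R (-1)); exact: smooth1_flat.
have -> : (fun y => ebump (m%:R * (1 - y) - 1)) = (fun y => ebump (- m%:R * y + (m%:R - 1))).
  by apply/funext => y; congr ebump; ring.
by apply: smooth1_affine; exact: smooth1_flat.
Qed.

Lemma dv_cutoff m y : dv (cutoff m) y (dcutoff m y).
Proof.
have d1 : dv (fun y => m%:R * y - 1) y m%:R.
  by apply: dv_eq (dvB (dvZ m%:R (dv_id y)) (dv_cst 1 y)) _; rewrite mulr1 subr0.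
have d2 : dv (fun y => m%:R * (1 - y) - 1) y (- m%:R).
  apply: dv_eq (dvB (dvZ m%:R (dvB (dv_cst 1 y) (dv_id y))) (dv_cst 1 y)) _; ring.
apply: dv_eq (dvM (dv_comp (dv_bump _) d1) (dv_comp (dv_bump _) d2)) _.
by rewrite /dcutoff; ring.
Qed.

Lemma cutoff_ge0_le1 m y : 0 <= cutoff m y <= 1.
Proof. by rewrite mulr_ge0 ?bump_ge0//= mulr_ile1 ?bump_ge0 ?bump_le1. Qed.

Lemma cutoff_norm m y : `|cutoff m y| <= 1.
Proof. by have /andP[h1 h2] := cutoff_ge0_le1 m y; rewrite ger0_norm. Qed.

Lemma cutoff_out m y : (0 < m)%N -> cutoff m y != 0 -> m%:R^-1 <= y <= 1 - m%:R^-1.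
Proof.
move=> m0; have mR : 0 < m%:R :> R by rewrite ltr0n.
apply: contraR; rewrite negb_and -!ltNge => /orP[h|h]; rewrite /cutoff /ebump.
  by rewrite flat_le0 ?mul0r// subr_le0 mulrC -ler_pdivlMr// mul1r ltW.
by rewrite [X in _ * X]flat_le0 ?mulr0// subr_le0 mulrC -ler_pdivlMr// mul1r lerBlDl -lerBlDr ltW.
Qed.

Let cvg_inv_affine (c : R) : 0 < c -> (n.+1%:R * c - 1)^-1 @[n --> \oo] --> (0 : R).
Proof.
move=> c0; apply/cvgr0Pnorm_le => e e0; near=> n.
have h : e^-1 + 1 <= n.+1%:R * c.
  rewrite -ler_pdivrMr// (le_trans (ler_norm _))//; apply: ltW.
  apply: (lt_le_trans (Num.Theory.truncnS_gt _)).
  by rewrite ler_nat ltnS; near: n; exact: nbhs_infty_ge.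
have e1 : 0 < e^-1 by rewrite invr_gt0.
have p : 0 < n.+1%:R * c - 1 by lra.
rewrite normfV (gtr0_norm p) -[leRHS]invrK lef_pV2 ?posrE//; lra.
Unshelve. all: by end_near. Qed.

Lemma affine_gt0 (c : R) : 0 < c -> \forall n \near \oo, 0 < n.+1%:R * c - 1.
Proof.
move=> c0; near=> n; rewrite subr_gt0 -ltr_pdivrMr// (le_lt_trans (ler_norm _))//.
apply: (lt_le_trans (Num.Theory.truncnS_gt _)).
by rewrite ler_nat ltnS; near: n; exact: nbhs_infty_ge.
Unshelve. all: by end_near. Qed.

Lemma bump_cvg1 (c : R) : 0 < c -> ebump (n.+1%:R * c - 1) @[n --> \oo] --> (1 : R).
Proof.
move=> c0; have L : expR (- (n.+1%:R * c - 1)^-1) @[n --> \oo] --> (1 : R).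
  have z0 : - (n.+1%:R * c - 1)^-1 @[n --> \oo] --> (0 : R).
    by apply: cvg_to_eq (oppr0 _); apply: cvgN; exact: cvg_inv_affine.
  apply: (@cvg_to_eq _ _ (expR 0)); last exact: expR0.
  by apply: (@continuous_cvg _ _ _ _ _ _ expR) => //; exact: continuous_expR.
apply: cvg_trans L; apply: near_eq_cvg; near=> n.
by apply/esym/bumpE; near: n; exact: affine_gt0.
Unshelve. all: by end_near. Qed.

Lemma cutoff_cvg1 y : 0 < y < 1 -> cutoff n.+1 y @[n --> \oo] --> (1 : R).
Proof.
move=> /andP[y0 y1]; apply: cvg_to_eq (mulr1 1).
by apply: cvgM; apply: bump_cvg1; rewrite ?subr_gt0.
Qed.

Let dbump_cvg0 (c : R) : 0 < c -> n.+1%:R * dbump (n.+1%:R * c - 1) @[n --> \oo] --> (0 : R).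
Proof.
move=> c0; pose z n : R := (n.+1%:R * c - 1)^-1.
have z0 := cvg_inv_affine c0.
have L : c^-1 * (z n + z n ^+ 2) @[n --> \oo] --> (0 : R).
  apply: cvg_to_eq (_ : c^-1 * (0 + 0 * 0) = 0); last by rewrite mulr0 addr0 mulr0.
  apply: cvgM; first exact: cvg_cst.
  by apply: cvgD => //; apply: cvgM.
apply: (squeeze_cvgr _ (cvg_cst 0) L); near=> n; apply/andP; split.
  by rewrite mulr_ge0// dbump_ge0.
have p : 0 < n.+1%:R * c - 1 by near: n; exact: affine_gt0.
rewrite ler_pdivlMl// mulrA [c * _]mulrC.
rewrite dbumpE// mulrA -/(z n).
have -> : n.+1%:R * c * z n ^+ 2 = z n + z n ^+ 2.
  rewrite -[n.+1%:R * c](subrK 1) mulrDl mul1r expr2 mulrA /z mulfV ?mul1r//.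
  by rewrite gt_eqF.
rewrite -[leRHS]mulr1 ler_wpM2l//.
  by rewrite addr_ge0 ?sqr_ge0// invr_ge0 ltW.
by rewrite expR_le1 oppr_le0 invr_ge0 ltW.
Unshelve. all: by end_near. Qed.

Lemma dcutoff_cvg0 y : 0 < y < 1 -> dcutoff n.+1 y @[n --> \oo] --> (0 : R).
Proof.
move=> /andP[y0 y1]; apply: cvg_to_eq (_ : 0 * 1 - 1 * 0 = 0); last by rewrite mulr0 mul0r subrr.
have y1' : 0 < 1 - y by rewrite subr_gt0.
have -> : (fun n => dcutoff n.+1 y) = fun n : nat =>
    (n.+1%:R * dbump (n.+1%:R * y - 1)) * ebump (n.+1%:R * (1 - y) - 1)
    - ebump (n.+1%:R * y - 1) * (n.+1%:R * dbump (n.+1%:R * (1 - y) - 1)).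
  by apply/funext => n; rewrite /dcutoff; ring.
apply: cvgB; apply: cvgM; by [exact: dbump_cvg0|exact: bump_cvg1].
Qed.

(** Near an endpoint at distance z the slope is at most m dbump(m z - 1); times C z this is at most
    3 C by [dbump_weight_le]. There are two endpoints. *)
Lemma dcutoff_weight m (C r : R) y : 0 < y < 1 -> 0 <= C ->
  `|r| <= C * y -> `|r| <= C * (1 - y) -> `|dcutoff m y * r| <= 6 * C.
Proof.
move=> /andP[y0 y1] C0 r1 r2; rewrite normrM.
have K z : 0 < z -> m%:R * dbump (m%:R * z - 1) * z <= 3.
  move=> z0; rewrite mulrAC; have := dbump_weight_le (m%:R * z - 1).
  by rewrite subrK.
have b z : 0 <= ebump z <= 1 by rewrite bump_ge0 bump_le1.
have P (d e : R) : 0 <= d -> 0 <= e <= 1 -> d * `|r| <= 3 * C -> `|d * e| * `|r| <= 3 * C.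
  move=> d0 /andP[e0 e1]; apply: le_trans; rewrite ger0_norm ?mulr_ge0//.
  by rewrite ler_wpM2r// ler_piMr.
have h1 : `|m%:R * dbump (m%:R * y - 1) * ebump (m%:R * (1 - y) - 1)| * `|r| <= 3 * C.
  have d0 : 0 <= m%:R * dbump (m%:R * y - 1) by rewrite mulr_ge0 ?dbump_ge0.
  apply: P => //; apply: le_trans (ler_wpM2l d0 r1) _; rewrite mulrCA mulrC.
  by apply: ler_wpM2r => //; exact: K.
have h2 : `|m%:R * ebump (m%:R * y - 1) * dbump (m%:R * (1 - y) - 1)| * `|r| <= 3 * C.
  have d0 : 0 <= m%:R * dbump (m%:R * (1 - y) - 1) by rewrite mulr_ge0 ?dbump_ge0.
  rewrite mulrAC; apply: P => //; apply: le_trans (ler_wpM2l d0 r2) _; rewrite mulrCA mulrC.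
  by apply: ler_wpM2r => //; apply: K; rewrite subr_gt0.
rewrite /dcutoff; apply: le_trans (ler_wpM2r (normr_ge0 r) (ler_normB _ _)) _.
rewrite mulrDl; lra.
Qed.

End smooth_functions.

(** * Partial derivatives and separable test functions *)

Section plane_calculus.
Context (R : realType).
Implicit Types (w v : R * R -> R) (a b : R -> R) (x : R * R) (k : 'I_2).

Lemma ord2P (P : 'I_2 -> Prop) : P 0 -> P 1 -> forall k, P k.
Proof.
move=> P0 P1 [[|[|//]] k2].
  by have -> : Ordinal k2 = 0 by exact: val_inj.
by have -> : Ordinal k2 = 1 by exact: val_inj.
Qed.

Lemma is_derive_fst w x d : dv (fun y => w (y, x.2)) x.1 d ->
  is_derive x (basis_vec 0) w d.
Proof.
move=> [h1 h2].
have E : (fun h : R => h^-1 *: ((w \o shift x) (h *: basis_vec 0) - w x)) =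
   fun h => h^-1 *: (((fun y => w (y, x.2)) \o shift x.1) (h *: (1 : R)) - w (x.1, x.2)).
  apply/funext => h /=; case: x h1 h2 => x1 x2 /= _ _; congr (_ *: (w _ - _)).
  by rewrite /basis_vec /=; congr pair; rewrite /= /GRing.scale /= ?mulr0 ?add0r.
by apply: DeriveDef; [rewrite /derivable E|rewrite /derive E].
Qed.

Lemma is_derive_snd w x d : dv (fun y => w (x.1, y)) x.2 d ->
  is_derive x (basis_vec 1) w d.
Proof.
move=> [h1 h2].
have E : (fun h : R => h^-1 *: ((w \o shift x) (h *: basis_vec 1) - w x)) =
   fun h => h^-1 *: (((fun y => w (x.1, y)) \o shift x.2) (h *: (1 : R)) - w (x.1, x.2)).
  apply/funext => h /=; case: x h1 h2 => x1 x2 /= _ _; congr (_ *: (w _ - _)).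
  by rewrite /basis_vec /=; congr pair; rewrite /= /GRing.scale /= ?mulr0 ?add0r.
by apply: DeriveDef; [rewrite /derivable E|rewrite /derive E].
Qed.

Lemma dv_fst w x d : is_derive x (basis_vec 0) w d -> dv (fun y => w (y, x.2)) x.1 d.
Proof.
move=> [h1 h2].
have E : (fun h : R => h^-1 *: ((w \o shift x) (h *: basis_vec 0) - w x)) =
   fun h => h^-1 *: (((fun y => w (y, x.2)) \o shift x.1) (h *: (1 : R)) - w (x.1, x.2)).
  apply/funext => h /=; case: x h1 h2 => x1 x2 /= _ _; congr (_ *: (w _ - _)).
  by rewrite /basis_vec /=; congr pair; rewrite /= /GRing.scale /= ?mulr0 ?add0r.
by apply: DeriveDef; [rewrite /derivable -E|rewrite /derive -E].
Qed.

Lemma dv_snd w x d : is_derive x (basis_vec 1) w d -> dv (fun y => w (x.1, y)) x.2 d.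
Proof.
move=> [h1 h2].
have E : (fun h : R => h^-1 *: ((w \o shift x) (h *: basis_vec 1) - w x)) =
   fun h => h^-1 *: (((fun y => w (x.1, y)) \o shift x.2) (h *: (1 : R)) - w (x.1, x.2)).
  apply/funext => h /=; case: x h1 h2 => x1 x2 /= _ _; congr (_ *: (w _ - _)).
  by rewrite /basis_vec /=; congr pair; rewrite /= /GRing.scale /= ?mulr0 ?add0r.
by apply: DeriveDef; [rewrite /derivable -E|rewrite /derive -E].
Qed.

(** Separable functions suffice for testing: plane waves are combinations of two of them, and their
    partial derivatives reduce to derivatives on the line. *)
Definition tens a b x := a x.1 * b x.2.

Lemma pderiv_tens0 a a' b x : (forall y, dv a y (a' y)) ->
  is_derive x (basis_vec 0) (tens a b) (tens a' b x).
Proof.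
move=> da; apply: is_derive_fst; rewrite /tens /=.
by apply: dv_eq (dvM (da x.1) (dv_cst (b x.2) x.1)) _; rewrite mulr0 addr0.
Qed.

Lemma pderiv_tens1 a b b' x : (forall y, dv b y (b' y)) ->
  is_derive x (basis_vec 1) (tens a b) (tens a b' x).
Proof.
by move=> db; apply: is_derive_snd; rewrite /tens /=; apply: dvZ.
Qed.

Lemma continuous_tens a b : continuous a -> continuous b -> continuous (tens a b).
Proof.
move=> ca cb x; apply: cvgM.
  by apply: (@continuous_comp _ _ _ fst a); [exact: cvg_fst|exact: ca].
by apply: (@continuous_comp _ _ _ snd b); [exact: cvg_snd|exact: cb].
Qed.

Lemma smooth_tens a b : smooth1 a -> smooth1 b -> smooth (tens a b).
Proof.
move=> sa sb s.
have [a' [b' [sa' sb' ->]]] : exists a' b', [/\ smooth1 a', smooth1 b' &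
    foldr pderiv (tens a b) s = tens a' b'].
  elim: s => [|k s [a' [b' [sa' sb' IH]]]]; first by exists a, b.
  have [da sda Ha] := smooth1_deriv sa'; have [db sdb Hb] := smooth1_deriv sb'.
  rewrite /= IH; elim/ord2P: k.
  - exists da, b'; split => //; apply/funext => x; rewrite /pderiv.
    by have [] := pderiv_tens0 b' x Ha.
  - exists a', db; split => //; apply/funext => x; rewrite /pderiv.
    by have [] := pderiv_tens1 a' x Hb.
have [da sda Ha] := smooth1_deriv sa'; have [db sdb Hb] := smooth1_deriv sb'.
split; first by apply: continuous_tens; exact: smooth1_continuous.
move=> + x; apply: ord2P.
  by have [] := pderiv_tens0 b' x Ha.
by have [] := pderiv_tens1 a' x Hb.
Qed.

Definition test1 a := smooth1 a /\
  exists2 d : R, 0 < d & forall y, ~~ (d <= y <= 1 - d) -> a y = 0.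

Lemma test1_deriv a a' : test1 a -> smooth1 a' -> (forall y, dv a y (a' y)) -> test1 a'.
Proof.
move=> [sa [d d0 a0]] sa' aa'; split => //; exists (d / 2); first by rewrite divr_gt0.
move=> y; rewrite negb_and -!ltNge => H.
have [y1|y1] : y < d \/ 1 - d < y by case/orP: H => H; [left|right]; lra.
- have U0 z : z < d -> a z = cst 0 z by move=> zd; rewrite a0// negb_and -!ltNge zd.
  have h := dv_locally (@open_lt R d) y1 U0 (aa' y).
  by rewrite -(dv_val h); exact: dv_val (dv_cst 0 y).
- have U0 z : 1 - d < z -> a z = cst 0 z.
    by move=> zd; rewrite a0// negb_and -!ltNge zd orbT.
  have h := dv_locally (@open_gt R (1 - d)) y1 U0 (aa' y).
  by rewrite -(dv_val h); exact: dv_val (dv_cst 0 y).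
Qed.

Lemma test1_cutoff m a : smooth1 a -> test1 (fun y => cutoff m.+1 y * a y).
Proof.
move=> sa; split; first by apply: smooth1_mul => //; exact: smooth1_cutoff.
exists m.+1%:R^-1; first by rewrite invr_gt0.
move=> y; apply: contraNeq; rewrite mulf_eq0 negb_or => /andP[+ _].
exact: cutoff_out.
Qed.

Lemma test_function_tens a b : test1 a -> test1 b -> test_function (tens a b).
Proof.
move=> [sa [d d0 a0]] [sb [e e0 b0]].
pose K : set (R * R) := `[d, 1 - d]%classic `*` `[e, 1 - e]%classic.
have cK : compact K by apply: compact_setX; exact: segment_compact.
have clK : closed K by apply: compact_closed.
have sK : [set x | tens a b x != 0] `<=` K.
  move=> [x y]; rewrite /tens /= mulf_eq0 negb_or => /andP[ax bx]; split; rewrite /= in_itv /=.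
    by apply: contraNT ax => /a0 ->.
  by apply: contraNT bx => /b0 ->.
have cl : closure [set x | tens a b x != 0] `<=` K.
  by rewrite (closure_id K).1//; exact: closure_subset.
split; first exact: smooth_tens.
- by apply: subclosed_compact cl => //; exact: closed_closure.
- apply: (subset_trans cl) => -[x y] [] /=; rewrite !in_itv /= => /andP[h1 h2] /andP[h3 h4].
  by split; rewrite /= in_itv /=; lra.
Qed.

End plane_calculus.

Section measure_invariance.
Context d (T : measurableType d) (R : realType) (M : {measure set T -> \bar R}) (rho : T -> T).
Hypothesis mrho : measurable_fun setT rho.

Lemma Rint_invariant (f : T -> R) :
  (forall B, measurable B -> M (rho @^-1` B) = M B) -> intg M f ->
  intg M (f \o rho) /\ \int[M]_x f (rho x) = \int[M]_x f x.
Proof.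
move=> inv fi; have mf : measurable_fun setT f := intg_meas fi.
have fs : intg M (f \o rho).
  apply/integrableP; split; first by apply/measurable_EFinP; exact: measurableT_comp.
  have /integrableP[_] := fi; apply: le_lt_trans.
  rewrite le_eqVlt; apply/orP; left; apply/eqP.
  transitivity (\int[pushforward M rho]_x `|(f x)%:E|)%E.
    rewrite [RHS]ge0_integral_pushforward ?preimage_setT//.
    by do 2 apply: measurableT_comp => //.
  by apply: eq_measure_integral => B mB _; exact: inv.
split => //; rewrite /Rintegral; congr fine.
transitivity (\int[pushforward M rho]_x (f x)%:E)%E.
  by rewrite [RHS]integral_pushforward ?preimage_setT//; exact/measurable_EFinP.
by apply: eq_measure_integral => B mB _; exact: inv.
Qed.

End measure_invariance.

(** * Measurability, Fubini and the divergence formula on the square and its boundary *)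

Section square_integrals.
Context (R : realType).
Let mT := measurableTypeR R.
Let P2 := (mT * mT)%type.
Local Notation unitI := (unitI R).
Local Notation lebOf := (lebOf R).
Implicit Types (w v f g : R * R -> R) (a b : R -> R) (x : R * R) (k : 'I_2).

Lemma intg_ae_le d (T : measurableType d) (m : {measure set T -> \bar R}) (f g : T -> R) :
  measurable_fun setT f -> (\forall x \ae m, `|f x| <= g x) -> intg m g -> intg m f.
Proof.
move=> mf fg gi; apply/integrableP; split; first exact/measurable_EFinP.
have /integrableP[_] := intg_norm gi; apply: le_lt_trans.
apply: ae_ge0_le_integral => //.
- by apply/measurable_EFinP; exact: measurableT_comp mf.
- by apply/measurable_EFinP; do 2 (apply: measurableT_comp; [exact: normr_measurable|]);
  exact: intg_meas gi.
- by apply: aeS fg => x h _; rewrite /= normr_id lee_fin (le_trans h)// ler_norm.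
Qed.

(** An open set is the union of the boxes with rational centre and half-width that it contains;
    measurability of continuous functions of two variables rests on this. *)
Lemma open_measurable2 (U : set (R * R)) : open U -> measurable (U : set P2).
Proof.
move=> oU; pose box (q : rat * rat * rat) : set P2 :=
  `]ratr q.1.1 - ratr q.2, ratr q.1.1 + ratr q.2[%classic `*`
  `]ratr q.1.2 - ratr q.2, ratr q.1.2 + ratr q.2[%classic.
have -> : U = \bigcup_(q in [set q | box q `<=` U]) box q.
  apply/seteqP; split => [x Ux|x [q /= qU /qU//]].
  have [e /= e0 eU] : exists2 e : R, 0 < e & ball x e `<=` U.
    by have /nbhs_ballP := open_nbhs_nbhs (conj oU Ux).
  have e2 : 0 < e / 2 by rewrite divr_gt0.
  have [r /itvP rI] : exists r : rat, ratr r \in `]0, (e / 2)[ by exact: rat_in_itvoo.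
  have r0 : 0 < ratr r :> R by rewrite rI.
  have Hq (y : R) : exists q : rat, `|y - ratr q| < ratr r.
    have [q /itvP qI] : exists q : rat, ratr q \in `]y - ratr r, y + ratr r[.
      by apply: rat_in_itvoo; rewrite ltrBlDr -addrA ltrDl addr_gt0.
    have h1 : y - ratr r < ratr q by rewrite qI.
    have h2 : ratr q < y + ratr r by rewrite qI.
    by exists q; rewrite ltr_norml; lra.
  have [q1 h1] := Hq x.1; have [q2 h2] := Hq x.2.
  exists (q1, q2, r); last first.
    by split; rewrite /= in_itv /= -ltr_distl.
  move=> y [] /=; rewrite !in_itv /= -!ltr_distl => y1 y2; apply: eU; split => /=.
  - rewrite /ball /= (_ : x.1 - y.1 = (x.1 - ratr q1) - (y.1 - ratr q1)); last by ring.
    have re : ratr r < e / 2 by rewrite rI.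
    clear rI; have := ler_normB (x.1 - ratr q1) (y.1 - ratr q1); lra.
  - rewrite /ball /= (_ : x.2 - y.2 = (x.2 - ratr q2) - (y.2 - ratr q2)); last by ring.
    have re : ratr r < e / 2 by rewrite rI.
    clear rI; have := ler_normB (x.2 - ratr q2) (y.2 - ratr q2); lra.
rewrite bigcup_mkcond; apply: countable_bigcupT_measurable.
  exact: countableP.
move=> q; case: ifP => _ //; by apply: measurableX; exact: measurable_itv.
Qed.

Lemma continuous_measurable2 f : continuous f -> measurable_fun (setT : set P2) f.
Proof.
move=> /continuousP cf; apply: (measurability _ (RGenOpens.measurableE R)).
move=> _ [_ [a [b ->] <-]]; rewrite setTI; apply: open_measurable2; apply: cf.
exact: interval_open.
Qed.

Lemma continuous_bounded_square f : continuous f ->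
  exists2 M, 0 <= M & forall x, 0 <= x.1 <= 1 -> 0 <= x.2 <= 1 -> `|f x| <= M.
Proof.
move=> cf; pose K : set (R * R) := `[0, 1]%classic `*` `[0, 1]%classic.
have cK : compact K by apply: compact_setX; exact: segment_compact.
have : compact (f @` K) by apply: continuous_compact => //; exact: continuous_subspaceT.
move=> /compact_bounded[M [_ HM]]; exists (`|M| + 1); first by rewrite addr_ge0.
move=> x x1 x2; apply: (HM (`|M| + 1)).
  by rewrite (le_lt_trans (ler_norm M))// ltrDl.
by exists x => //; split; rewrite /= in_itv.
Qed.

Lemma OmegaP x : Omega x -> 0 < x.1 < 1 /\ 0 < x.2 < 1.
Proof. by case; rewrite /= !in_itv. Qed.

Lemma ae_bounded_O f : continuous f -> exists2 M, 0 <= M & \forall x \ae @lebO R, `|f x| <= M.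
Proof.
move=> /continuous_bounded_square[M M0 HM]; exists M => //; apply: aeS (aeO_in R) => x.
by case/OmegaP => /andP[h1 h2] /andP[h3 h4]; apply: HM; rewrite !ltW.
Qed.

Lemma sqint_mul_ae (m : {measure set P2 -> \bar R}) (M : R) f g : sqint m f ->
  measurable_fun setT g -> (\forall x \ae m, `|g x| <= M) -> sqint m (fun x => f x * g x).
Proof.
move=> [mf fi] mg gM; split; first exact: measurable_funM.
have H := @intg_ae_le _ _ m (fun x => (f x * g x) ^+ 2) (fun x => M ^+ 2 * f x ^+ 2).
apply: H.
- by apply: measurable_funX; exact: measurable_funM.
- apply: aeS gM => x h; rewrite normrX normrM exprMn mulrC real_normK ?num_real//.
  apply: le_trans (_ : _ <= `|g x| ^+ 2 * f x ^+ 2) _.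
    by rewrite !real_normK ?num_real.
  by rewrite ler_wpM2r ?sqr_ge0// lerXn2r ?nnegrE// (le_trans _ h).
- exact: intgZ.
Qed.

Lemma sqint_continuous f : continuous f -> sqint lebO f.
Proof.
move=> cf; have [M M0 HM] := ae_bounded_O cf.
have one : sqint lebO (cst 1 : R * R -> R).
  split; first exact: measurable_cst.
  by apply: intg_eq (intg_cst (@lebO_fin R) 1) => x; rewrite expr1n.
have := sqint_mul_ae one (continuous_measurable2 cf) HM.
by congr sqint; apply/funext => x; rewrite mul1r.
Qed.

Lemma sqintO_intg f : sqint lebO f -> intg lebO f.
Proof. by case=> mf; apply: intg_sqr => //; exact: lebO_fin. Qed.

Lemma sqint_mul_continuous f g : sqint lebO f -> continuous g -> sqint lebO (fun x => f x * g x).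
Proof.
move=> sf cg; have [M M0 HM] := ae_bounded_O cg.
exact: sqint_mul_ae sf (continuous_measurable2 cg) HM.
Qed.

Lemma intg_mul_continuous f g : sqint lebO f -> continuous g -> intg lebO (fun x => f x * g x).
Proof. by move=> sf cg; apply: sqintO_intg; exact: sqint_mul_continuous. Qed.

Lemma intg_lebOE f : intg lebO f -> intg (unitI \x unitI)%E f.
Proof. by apply: intg_eq_measure; exact: lebOE. Qed.

Definition swap2 (x : R * R) : R * R := (x.2, x.1).

Lemma measurable_swap2 : measurable_fun setT (swap2 : P2 -> P2).
Proof. exact: measurable_fun_pair. Qed.

Let product_swap2 (m : {sigma_finite_measure set mT -> \bar R}) (B : set P2) : measurable B ->
  (m \x m)%E ((swap2 : P2 -> P2) @^-1` B) = (m \x m)%E B.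
Proof.
move=> mB.
have H := @product_measure_unique _ _ _ _ R m m (pushforward (m \x m)%E (swap2 : P2 -> P2)).
apply/esym; apply: H => // [|? A1 A2 m1 m2]; first exact: measurable_swap2.
rewrite [LHS](_ : _ = (m \x m)%E (A2 `*` A1)); last first.
  congr (product_measure1 _ _).
  by apply/seteqP; split => -[x y] /= [].
by rewrite muleC; exact: product_measure1E.
Qed.

Lemma swap2O f : intg lebO f ->
  intg lebO (f \o swap2) /\ \int[lebO]_x f (swap2 x) = \int[lebO]_x f x.
Proof.
apply: (Rint_invariant measurable_swap2) => B mB; rewrite !lebOE//; first exact: product_swap2.
by rewrite -[X in measurable X]setTI; exact: measurable_swap2.
Qed.

Lemma swap2_leb2 f : intg leb2 f ->
  intg leb2 (f \o swap2) /\ \int[leb2]_x f (swap2 x) = \int[leb2]_x f x.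
Proof. by apply: (Rint_invariant measurable_swap2) => B mB;
  exact: (@product_swap2 (@lebesgue R)). Qed.

Definition slice2 f (x : R) : R := \int[unitI]_y f (x, y).
Definition slice1 f (y : R) : R := \int[unitI]_x f (x, y).

(** The real-valued slice integral agrees with the extended-real one of Fubini only where the latter
    is finite, that is almost everywhere. *)
Lemma intg_slice2 f : intg lebO f ->
  intg unitI (slice2 f) /\ \int[lebO]_x f x = \int[unitI]_y slice2 f y.
Proof.
move=> fi; have H := intg_lebOE fi.
pose G := fubini_F unitI (EFin \o f).
have iG : unitI.-integrable setT G := integrable_fubini_F H.
have mG : measurable_fun setT G := measurable_int _ iG.
have ms : measurable_fun setT (slice2 f).
  by apply: measurableT_comp mG; exact: fine_measurable.
have aG : \forall y \ae unitI, (slice2 f y)%:E = G y.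
  have := integrable_ae measurableT iG; apply: aeS => y /(_ Logic.I) yf.
  by rewrite -[RHS]fineK.
split.
  apply/integrableP; split; first exact/measurable_EFinP.
  have /integrableP[_] := iG; apply: le_lt_trans.
  rewrite le_eqVlt; apply/orP; left; apply/eqP; apply: ae_eq_lower_integral.
  by apply: aeS aG => y <-.
rewrite (Rint_eq_measure (@lebOE R)) /Rintegral -(integral12_prod_meas1 H); congr fine.
by apply: ae_eq_lower_integral; apply: aeS aG => y /esym.
Qed.

Lemma intg_slice1 f : intg lebO f ->
  intg unitI (slice1 f) /\ \int[lebO]_x f x = \int[unitI]_y slice1 f y.
Proof. by move=> /swap2O[/intg_slice2[h1 h2] h3]; split => //; rewrite -h3. Qed.

Lemma Rint_unitI (g : R -> R) : measurable_fun setT g ->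
  \int[unitI]_x g x = \int[lebesgue_measure]_(x in `[0, 1]) g x.
Proof.
move=> mg; have mg' : measurable_fun setT (EFin \o g) by exact/measurable_EFinP.
rewrite /Rintegral; congr fine; rewrite (integral_mrestr _ (measurable_interval 1) mg').
by apply/esym; apply: (@integral_itv_bndoo R 0 1 (EFin \o g) true false); exact: measurable_funTS.
Qed.

Lemma Rint_unit_FTC (g dg : R -> R) : (forall y, dv g y (dg y)) -> continuous dg ->
  \int[unitI]_x dg x = g 1 - g 0.
Proof.
move=> gd cd; rewrite Rint_unitI; last exact: continuous_measurable_fun.
by rewrite /Rintegral (FTC2_dv ler01 gd cd).
Qed.

Let continuous_fst_section f (y : R) : continuous f -> continuous (fun x : R => f (x, y)).
Proof.
move=> cf x; apply: (@continuous_comp _ _ _ (fun x : R => (x, y)) f); last exact: cf.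
by apply: (@cvg_pair _ _ _ (nbhs x) (nbhs x) (nbhs y)); [exact: cvg_id|exact: cvg_cst].
Qed.

Let continuous_snd_section f (x : R) : continuous f -> continuous (fun y => f (x, y)).
Proof.
move=> cf y; apply: (@continuous_comp _ _ _ (fun y => (x, y)) f); last exact: cf.
by apply: (@cvg_pair _ _ _ (nbhs y) (nbhs x) (nbhs y)); [exact: cvg_cst|exact: cvg_id].
Qed.

Lemma div_fst w dw : continuous dw -> (forall x, is_derive x (basis_vec 0) w (dw x)) ->
  \int[lebO]_x dw x = \int[unitI]_y (w (1, y) - w (0, y)).
Proof.
move=> cd wd; have [_ ->] := intg_slice1 (sqintO_intg (sqint_continuous cd)).
apply: eq_Rintegral => y _; rewrite /slice1.
apply: (Rint_unit_FTC (g := fun x : R => w (x, y))); last exact: continuous_fst_section.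
by move=> x; exact: dv_fst (wd (x, y)).
Qed.

Lemma div_snd w dw : continuous dw -> (forall x, is_derive x (basis_vec 1) w (dw x)) ->
  \int[lebO]_x dw x = \int[unitI]_y (w (y, 1) - w (y, 0)).
Proof.
move=> cd wd; have [_ ->] := intg_slice2 (sqintO_intg (sqint_continuous cd)).
apply: eq_Rintegral => x _; rewrite /slice2.
apply: (Rint_unit_FTC (g := fun y : R => w (x, y))); last exact: continuous_snd_section.
by move=> y; exact: dv_snd (wd (x, y)).
Qed.

End square_integrals.

Section boundary.
Context (R : realType).
Let mT := measurableTypeR R.
Let P2 := (mT * mT)%type.
Local Notation unitI := (unitI R).
Implicit Types (w v f g : R * R -> R) (a b : R -> R) (x : R * R).

Let S : set P2 := `[0, 1]%classic `*` `[0, 1]%classic.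

Let ge0_unitI (F : mT -> \bar R) : measurable_fun setT F ->
  (\int[lebesgue_measure]_(y in `[0%R, 1%R]) F y = \int[unitI]_y F y)%E.
Proof.
move=> mF; rewrite (integral_mrestr _ (measurable_interval 1) mF).
by apply: (@integral_itv_bndoo R 0 1 F true false); exact: measurable_funTS.
Qed.

Let ge0_integral_left (c : R) (F : P2 -> \bar R) : 0 <= c <= 1 ->
  (forall x, (0 <= F x)%E) -> measurable_fun setT F ->
  (\int[(@dirac _ mT c R \x @lebesgue_measure R)%E]_(x in S) F x =
   \int[unitI]_y F (c, y))%E.
Proof.
move=> c01 F0 mF; have mS : measurable S by exact: measurable_square.
have mc : measurable_fun setT (fun y : mT => F (c, y)) by exact: measurableT_comp mF
  (pair1_measurable c).
have mFS : measurable_fun setT (F \_ S) by apply/(measurable_restrictT _ mS);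
  exact: measurable_funTS.
have FS0 x : (0 <= (F \_ S) x)%E by rewrite patchE; case: ifP.
rewrite integral_mkcond fubini_tonelli1//.
rewrite integral_dirac//; last exact: measurable_fun_fubini_tonelli_F.
rewrite diracE in_setT mul1e /fubini_F.
rewrite -ge0_unitI// [RHS]integral_mkcond; apply: eq_integral => y _.
by rewrite !patchE in_setX /= (mem_set (_ : `[0, 1]%classic c)).
Qed.

Let ge0_integral_bottom (c : R) (F : P2 -> \bar R) : 0 <= c <= 1 ->
  (forall x, (0 <= F x)%E) -> measurable_fun setT F ->
  (\int[(@lebesgue_measure R \x @dirac _ mT c R)%E]_(x in S) F x =
   \int[unitI]_y F (y, c))%E.
Proof.
move=> c01 F0 mF; have mS : measurable S by exact: measurable_square.
have mc : measurable_fun setT (fun y : mT => F (y, c)) by exact: measurableT_comp mF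
  (pair2_measurable c).
have mFS : measurable_fun setT (F \_ S) by apply/(measurable_restrictT _ mS);
  exact: measurable_funTS.
have FS0 x : (0 <= (F \_ S) x)%E by rewrite patchE; case: ifP.
rewrite integral_mkcond fubini_tonelli2//.
rewrite integral_dirac//; last exact: measurable_fun_fubini_tonelli_G.
rewrite diracE in_setT mul1e /fubini_G.
rewrite -ge0_unitI// [RHS]integral_mkcond; apply: eq_integral => y _.
by rewrite !patchE in_setX /= (mem_set (_ : `[0, 1]%classic c)) ?andbT.
Qed.

(** Arc length is a sum of four products of Lebesgue measure with a Dirac mass, and Tonelli
    evaluates each on its side. Open and closed sides give the same integrals, so corners do not
    matter. *)
Lemma ge0_integral_boundary (F : P2 -> \bar R) :
  (forall x, (0 <= F x)%E) -> measurable_fun setT F ->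
  (\int[@boundary_measure R]_x F x = \int[unitI]_y F (0%R, y) + \int[unitI]_y F (1%R, y) +
    \int[unitI]_y F (y, 0%R) + \int[unitI]_y F (y, 1%R))%E.
Proof.
move=> F0 mF; have mS : measurable S by exact: measurable_square.
rewrite (integral_mrestr _ (@measurable_square R) mF).
rewrite ge0_integral_measure_sum//; last exact: measurable_funTS.
rewrite !big_ord_recl big_ord0 adde0 /= -!ge0_integral_left ?lexx ?ler01//.
by rewrite -!ge0_integral_bottom ?lexx ?ler01// !addeA.
Qed.

Lemma Rint_boundary f : measurable_fun (setT : set P2) f ->
  [/\ intg unitI (fun y => f (0, y)), intg unitI (fun y => f (1, y)),
      intg unitI (fun y => f (y, 0)) & intg unitI (fun y => f (y, 1))] ->
  \int[boundary_measure]_x f x = \int[unitI]_y f (0, y) + \int[unitI]_y f (1, y) +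
    \int[unitI]_y f (y, 0) + \int[unitI]_y f (y, 1).
Proof.
move=> mf [i1 i2 i3 i4].
have mF : measurable_fun setT (EFin \o f) by exact/measurable_EFinP.
have mp := measurable_funepos mF; have mn := measurable_funeneg mF.
rewrite /Rintegral integralE ge0_integral_boundary// (@ge0_integral_boundary ((EFin \o f)^\-)%E)//.
have D (h : R -> R * R) : intg unitI (fun y => f (h y)) -> exists p n : R,
  [/\ (\int[unitI]_y ((EFin \o f)^\+)%E (h y) = p%:E)%E, (\int[unitI]_y ((EFin \o f)^\-)%E (h y) =
    n%:E)%E &
      \int[unitI]_y f (h y) = p - n].
  move=> ih; have pf := integrable_funepos measurableT ih;
    have nf := integrable_funeneg measurableT ih.
  have ep : (\int[unitI]_y ((EFin \o f)^\+)%E (h y) =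
    \int[unitI]_y ((EFin \o (fun y => f (h y)))^\+)%E y)%E.
    by apply: eq_integral => y _; rewrite !funeposE.
  have en : (\int[unitI]_y ((EFin \o f)^\-)%E (h y) =
    \int[unitI]_y ((EFin \o (fun y => f (h y)))^\-)%E y)%E.
    by apply: eq_integral => y _; rewrite !funenegE.
  have fp := integrable_fin_num measurableT pf; have fn := integrable_fin_num measurableT nf.
  exists (fine (\int[unitI]_y ((EFin \o (fun y => f (h y)))^\+)%E y)%E),
    (fine (\int[unitI]_y ((EFin \o (fun y => f (h y)))^\-)%E y)%E).
  rewrite ep en !fineK//; split => //; rewrite /Rintegral integralE.
  by rewrite fineB.
have [p1 [n1 [-> -> E1]]] := D _ i1; have [p2 [n2 [-> -> E2]]] := D _ i2.
have [p3 [n3 [-> -> E3]]] := D _ i3; have [p4 [n4 [-> -> E4]]] := D _ i4.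
rewrite -![fine (integral _ _ _)]/(Rintegral _ _ _) E1 E2 E3 E4 /=; ring.
Qed.

End boundary.

(** * Weak derivatives tested on separable functions *)

Section weak_derivatives.
Context (R : realType).
Let mT := measurableTypeR R.
Let P2 := (mT * mT)%type.
Local Notation unitI := (unitI R).
Implicit Types (w v f g h : R * R -> R) (a b : R -> R) (x : R * R) (k : 'I_2).

Definition tens_deriv k a da b db : R * R -> R := if k == 0 then tens da b else tens a db.

Lemma is_derive_tens k a da b db x : (forall y, dv a y (da y)) -> (forall y, dv b y (db y)) ->
  is_derive x (basis_vec k) (tens a b) (tens_deriv k a da b db x).
Proof.
move=> Ha Hb; elim/ord2P: k; rewrite /tens_deriv /=.
  exact: pderiv_tens0. exact: pderiv_tens1.
Qed.

Lemma L2P w : L2 w <-> sqint lebO w.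
Proof. exact: Lfun2P. Qed.

Lemma is_wderiv_tens k w v a da b db : is_wderiv k w v -> test1 a -> test1 b ->
  (forall y, dv a y (da y)) -> (forall y, dv b y (db y)) ->
  \int[lebO]_x (w x * tens_deriv k a da b db x) = - \int[lebO]_x (v x * tens a b x).
Proof.
move=> [_ _ H] ta tb Ha Hb; rewrite -H; last exact: test_function_tens.
apply: eq_Rintegral => x _; congr (_ * _); rewrite /pderiv.
by have [_ ->] := is_derive_tens k x Ha Hb.
Qed.

Lemma smooth1_tens_continuous a b : smooth1 a -> smooth1 b -> continuous (tens a b).
Proof. by move=> sa sb; apply: continuous_tens; exact: smooth1_continuous. Qed.

Lemma norm_mul_cut (c d u p q : R) : `|c| <= 1 -> `|d| <= 1 ->
  `|u * (c * p * (d * q))| <= `|u * (p * q)|.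
Proof.
move=> c1 d1; have -> : u * (c * p * (d * q)) = (c * d) * (u * (p * q)) by ring.
by rewrite normrM ler_piMl// normrM mulr_ile1.
Qed.

(** Cutoffs make both factors admissible, and dominated convergence removes them. No derivative
    falls on a cutoff, so no behaviour at the boundary is asked. *)
Lemma test_uniq v : sqint lebO v ->
  (forall a b, test1 a -> test1 b -> \int[lebO]_x (v x * tens a b x) = 0) ->
  forall a b, smooth1 a -> smooth1 b -> \int[lebO]_x (v x * tens a b x) = 0.
Proof.
move=> sv H a b sa sb.
pose F n x := v x * tens (fun y => cutoff n.+1 y * a y) (fun y => cutoff n.+1 y * b y) x.
have cab := smooth1_tens_continuous sa sb.
have L : \int[lebO]_x F n x @[n --> \oo] --> \int[lebO]_x (v x * tens a b x).
  apply: (@Rint_dct_cvg _ _ _ lebO F (fun x => v x * tens a b x) (fun x => `|v x * tens a b x|)).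
  - move=> n; apply: intg_meas; apply: intg_mul_continuous => //.
    by apply: smooth1_tens_continuous; apply: smooth1_mul => //; exact: smooth1_cutoff.
  - by apply: intg_meas; exact: intg_mul_continuous.
  - apply: aeS (aeO_in R) => x /OmegaP[x1 x2]; rewrite /F /tens.
    apply: cvgM; first exact: cvg_cst.
    apply: cvgM; (apply: cvg_to_eq (mul1r _); apply: cvgM; [exact: cutoff_cvg1|exact: cvg_cst]).
  - by apply: intg_norm; exact: intg_mul_continuous.
  - by move=> n x; apply: norm_mul_cut; exact: cutoff_norm.
have E : (fun n => \int[lebO]_x F n x) = cst 0.
  by apply/funext => n; apply: H; exact: test1_cutoff.
by move: L; rewrite E => /cvg_lim <- //; rewrite lim_cst.
Qed.

Lemma smooth_continuous w : smooth w -> continuous w.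
Proof. by move=> /(_ [::])[]. Qed.

Lemma smooth_pderiv_continuous k w : smooth w -> continuous (pderiv k w).
Proof. by move=> /(_ [:: k])[]. Qed.

Lemma smooth_is_derive k w x : smooth w -> is_derive x (basis_vec k) w (pderiv k w x).
Proof. by move=> /(_ [::])[_ H]; apply: DeriveDef => //; exact: H. Qed.

Lemma Rint_by_parts k w dw v dv' :
  continuous w -> continuous dw -> continuous v -> continuous dv' ->
  (forall x, is_derive x (basis_vec k) w (dw x)) ->
  (forall x, is_derive x (basis_vec k) v (dv' x)) ->
  \int[lebO]_x (dw x * v x) + \int[lebO]_x (w x * dv' x) =
  if k == 0 then \int[unitI]_y (w (1, y) * v (1, y) - w (0, y) * v (0, y))
  else \int[unitI]_y (w (y, 1) * v (y, 1) - w (y, 0) * v (y, 0)).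
Proof.
move=> cw cdw cv cdv wd vd.
have c1 : continuous (fun x => dw x * v x) by move=> x; apply: cvgM; [exact: cdw|exact: cv].
have c2 : continuous (fun x => w x * dv' x) by move=> x; apply: cvgM; [exact: cw|exact: cdv].
rewrite -RintD; [|exact: sqintO_intg (sqint_continuous c1)|exact: sqintO_intg (sqint_continuous
  c2)].
have c3 : continuous (fun x => dw x * v x + w x * dv' x).
  by move=> x; apply: cvgD; [exact: c1|exact: c2].
have d3 x : is_derive x (basis_vec k) (fun x => w x * v x) (dw x * v x + w x * dv' x).
  have H := is_deriveM (wd x) (vd x).
  apply: (is_derive_eq (is_deriveM (wd x) (vd x))).
  by rewrite /GRing.scale /= addrC [dw x * _]mulrC.
elim/ord2P: k wd vd d3 => wd vd d3 /=.
  exact: (div_fst c3 d3).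
exact: (div_snd c3 d3).
Qed.

Lemma test_function_boundary w x : test_function w -> ~ Omega x -> w x = 0.
Proof.
move=> [_ _ H] nx; apply/eqP/negPn/negP => wx.
by apply: nx; apply: H; apply: subset_closure.
Qed.

Lemma is_wderiv_smooth k w : smooth w -> is_wderiv k w (pderiv k w).
Proof.
move=> sw; have cw := smooth_continuous sw; have cdw := smooth_pderiv_continuous (k := k) sw.
split; [exact/L2P/sqint_continuous|exact/L2P/sqint_continuous|move=> h th].
have [sh _ _] := th; have ch := smooth_continuous sh;
  have cdh := smooth_pderiv_continuous (k := k) sh.
have h0 x : ~ Omega x -> h x = 0 by exact: test_function_boundary.
have := Rint_by_parts cw cdw ch cdh (fun x => smooth_is_derive k x sw) (fun x => smooth_is_derive k
  x sh).
have z1 y : h (1, y) = 0 by apply: h0 => /OmegaP[/andP[_]]; rewrite /= ltxx.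
have z0 y : h (0, y) = 0 by apply: h0 => /OmegaP[/andP[]]; rewrite /= ltxx.
have y1 y : h (y, 1) = 0 by apply: h0 => /OmegaP[_ /andP[_]]; rewrite /= ltxx.
have y0 y : h (y, 0) = 0 by apply: h0 => /OmegaP[_ /andP[]]; rewrite /= ltxx.
under [X in if _ then X else _]eq_Rintegral do rewrite z1 z0 !mulr0 subr0.
under [X in if _ then _ else X]eq_Rintegral do rewrite y1 y0 !mulr0 subr0.
by rewrite !Rint_zero if_same => /eqP; rewrite addr_eq0 => /eqP ->; rewrite opprK.
Qed.

Lemma wderivP k w : H1 w -> is_wderiv k w (wderiv k w).
Proof. by move=> [_ /(_ k)[v vw]]; rewrite /wderiv; apply: (@getPex _ [set v | is_wderiv k w v]);
  exists v. Qed.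

Lemma test_function_continuous h : test_function h -> continuous h.
Proof. by case=> /smooth_continuous. Qed.

Lemma test_function_pderiv_continuous k h : test_function h -> continuous (pderiv k h).
Proof. by case=> sh _ _; exact: smooth_pderiv_continuous. Qed.

Lemma is_wderivD k (r : R) w v w' v' : is_wderiv k w v -> is_wderiv k w' v' ->
  is_wderiv k (fun x => w x + r * w' x) (fun x => v x + r * v' x).
Proof.
move=> [/L2P sw /L2P sv H] [/L2P sw' /L2P sv' H']; split.
- by apply/L2P; apply: sqintD => //; exact: sqintZ.
- by apply/L2P; apply: sqintD => //; exact: sqintZ.
move=> h th; have ch := test_function_continuous th;
  have cdh := test_function_pderiv_continuous (k := k) th.
have lin f f' g : sqint lebO f -> sqint lebO f' -> continuous g ->
    \int[lebO]_x ((f x + r * f' x) * g x) = \int[lebO]_x (f x * g x) + r * \int[lebO]_x (f' x * g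
      x).
  move=> sf sf' cg; have i1 := intg_mul_continuous sf cg; have i2 := intg_mul_continuous sf' cg.
  rewrite -(RintZ _ i2) -(RintD i1 (intgZ r i2)).
  by apply: eq_Rintegral => x _; ring.
by rewrite !lin// H// H'//; ring.
Qed.

End weak_derivatives.

(** * Traces and integration by parts in H^1 *)

Section traces.
Context (R : realType).
Let mT := measurableTypeR R.
Let P2 := (mT * mT)%type.
Local Notation unitI := (unitI R).
Implicit Types (w v f g h : R * R -> R) (a b : R -> R) (x : R * R) (k : 'I_2).

Lemma Lnorm2E d (T : measurableType d) (m : {measure set T -> \bar R}) (v : T -> R) :
  sqint m v -> ('N[m]_(2%:E)[EFin \o v] = (Num.sqrt (\int[m]_x v x ^+ 2))%:E)%E.
Proof.
move=> [mv vi]; have := Lnorm2_sqr m v; rewrite (intgE vi).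
have := Lnorm_ge0 m 2%:E (EFin \o v).
case: ('N[m]_(2%:E)[EFin \o v])%E => [r|//|//] /=.
rewrite lee_fin => r0 [<-].
by rewrite -expr2 sqrtr_sqr ger0_norm.
Qed.

Lemma Rint_le_Lnorm2 d (T : measurableType d) (m : {measure set T -> \bar R}) (v h : T -> R) :
  sqint m v -> sqint m h ->
  (`|\int[m]_x (v x * h x)|%:E <= 'N[m]_(2%:E)[EFin \o v] * (Num.sqrt (\int[m]_x h x ^+ 2))%:E)%E.
Proof.
move=> sv sh; rewrite Lnorm2E// -EFinM lee_fin -sqrtrM; last by apply: Rint_ge0 => x;
  exact: sqr_ge0.
rewrite -[leLHS]sqrtr_sqr; apply: ler_wsqrtr.
exact: Rint_cauchy_schwarz (proj2 sv) (proj2 sh) (sqint_mul sv sh).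
Qed.

Lemma cvg0_ereal (e : nat -> \bar R) (u : nat -> R) (C : R) : e n @[n --> \oo] --> 0%E ->
  (forall n, (`|u n|%:E <= e n * C%:E)%E) -> u n @[n --> \oo] --> (0 : R).
Proof.
move=> /fine_cvgP[ef ec] H; apply/norm_cvg0P.
have L : fine (e n) * C @[n --> \oo] --> (0 : R).
  by apply: cvg_to_eq (mul0r C); apply: cvgM => //; exact: cvg_cst.
apply: (squeeze_cvgr _ (cvg_cst 0) L); near=> n; rewrite normr_ge0 /=.
have en : e n \is a fin_num by near: n.
by rewrite -lee_fin EFinM fineK.
Unshelve. all: by end_near. Qed.

Lemma sqr_poweR_half (x : \bar R) : (0 <= x)%E -> ((x ^+ 2) `^ 2^-1 = x)%E.
Proof.
move=> x0; rewrite poweR12_sqrt; last exact: expe_ge0.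
case: x x0 => [r||//]; last by [].
by rewrite lee_fin => r0 /=; rewrite -expr2 sqrtr_sqr ger0_norm.
Qed.

Lemma normL2_ge0 v : (0 <= normL2 v)%E. Proof. exact: Lnorm_ge0. Qed.

Let sqr_ge0e (x : \bar R) : (0 <= x)%E -> (0 <= x ^+ 2)%E.
Proof. by move=> x0; exact: expe_ge0. Qed.

Lemma normL2_le_normH1 w : (normL2 w <= normH1 w)%E.
Proof.
rewrite -[leLHS]sqr_poweR_half ?normL2_ge0// /normH1; apply: gt0_ler_poweR => //.
- by rewrite in_itv /= leey andbT sqr_ge0e ?normL2_ge0.
- rewrite in_itv /= leey andbT adde_ge0 ?sqr_ge0e ?normL2_ge0//.
  by apply: sume_ge0 => k _; rewrite sqr_ge0e ?normL2_ge0.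
by rewrite leeDl//; apply: sume_ge0 => k _; rewrite sqr_ge0e ?normL2_ge0.
Qed.

Lemma normL2_wderiv_le_normH1 k w : (normL2 (wderiv k w) <= normH1 w)%E.
Proof.
rewrite -[leLHS]sqr_poweR_half ?normL2_ge0// /normH1; apply: gt0_ler_poweR => //.
- by rewrite in_itv /= leey andbT sqr_ge0e ?normL2_ge0.
- rewrite in_itv /= leey andbT adde_ge0 ?sqr_ge0e ?normL2_ge0//.
  by apply: sume_ge0 => i _; rewrite sqr_ge0e ?normL2_ge0.
rewrite /sqnormH1 (bigD1 k)//= addeCA leeDl// adde_ge0 ?sqr_ge0e ?normL2_ge0//.
by apply: sume_ge0 => i _; rewrite sqr_ge0e ?normL2_ge0.
Qed.

Lemma ae_boundary_square : \forall x \ae @boundary_measure R, 0 <= x.1 <= 1 /\ 0 <= x.2 <= 1.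
Proof.
apply: aeS (ae_mrestr_in _ (@measurable_square R)) => x [] /=.
by rewrite !in_itv.
Qed.

Lemma sqint_boundary_continuous f : continuous f -> sqint boundary_measure f.
Proof.
move=> cf; have [M M0 HM] := continuous_bounded_square cf.
have one : sqint boundary_measure (cst 1 : R * R -> R).
  split; first exact: measurable_cst.
  by apply: intg_eq (intg_cst (@boundary_measure_fin R) 1) => x; rewrite expr1n.
have B : \forall x \ae @boundary_measure R, `|f x| <= M.
  by apply: aeS ae_boundary_square => x [h1 h2]; exact: HM.
have := sqint_mul_ae one (continuous_measurable2 cf) B.
by congr sqint; apply/funext => x; rewrite mul1r.
Qed.

Lemma measurable_unit_normal k : measurable_fun (setT : set P2) (unit_normal k).
Proof.
have E (c : R) : measurable_fun (setT : set P2) (fun x : P2 => (crd k x == c)%:R : R).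
  have -> : (fun x : P2 => (crd k x == c)%:R : R) = \1_[set x : P2 | crd k x = c].
    apply/funext => x; rewrite indicE; congr (nat_of_bool _)%:R; apply/eqP/idP.
      by move=> h; rewrite inE.
    by rewrite inE.
  apply: measurable_indic.
  have mc : measurable_fun (setT : set P2) (crd k : P2 -> mT).
    by elim/ord2P: k; rewrite /crd /=; [exact: measurable_fst|exact: measurable_snd].
  have := mc measurableT [set c] (measurable_set1 c); rewrite setTI.
  by congr measurable.
by apply: measurable_funB; exact: E.
Qed.

Lemma unit_normal_le1 k x : `|unit_normal k x| <= 1.
Proof.
by rewrite /unit_normal; case: eqP => [->|_]; case: eqP => [|_];
  rewrite ?subrr ?normr0 ?subr0 ?normr1 ?sub0r ?normrN ?normr1.
Qed.

Lemma intg_unitI_continuous (f : R -> R) : continuous f -> intg unitI f.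
Proof.
move=> cf; have [M M0 HM] : exists2 M, 0 <= M & forall y, 0 <= y <= 1 -> `|f y| <= M.
  have cf2 : continuous (fun x : R * R => f x.1).
    by move=> x; apply: (@continuous_comp _ _ _ fst f); [exact: cvg_fst|exact: cf].
  have [M M0 HM] := continuous_bounded_square cf2; exists M => // y y01.
  by have := HM (y, 0) y01; apply; rewrite /= lexx ler01.
apply: (@intg_ae_le _ _ _ _ _ (cst M)); first exact: continuous_measurable_fun.
  by apply: aeS (aeT_in 1) => y /andP[h1 h2]; apply: HM; rewrite !ltW.
by apply: intg_cst; exact: lebT_fin.
Qed.

(** On each side only one component of the normal is nonzero off the corners, which are null for arc
    length. *)
Let Rint_unit_normal f k : continuous f ->
  \int[boundary_measure]_x (f x * unit_normal k x) =
  if k == 0 then \int[unitI]_y (f (1, y) - f (0, y))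
  else \int[unitI]_y (f (y, 1) - f (y, 0)).
Proof.
move=> cf.
have mf : measurable_fun (setT : set P2) (fun x => f x * unit_normal k x).
  by apply: measurable_funM; [exact: continuous_measurable2|exact: measurable_unit_normal].
have c1 (c : R) : continuous (fun y : R => f (c, y)).
  move=> y; apply: (@continuous_comp _ _ _ (fun y : R => (c, y)) f); last exact: cf.
  by apply: (@cvg_pair _ _ _ (nbhs y) (nbhs c) (nbhs y)); [exact: cvg_cst|exact: cvg_id].
have c2 (c : R) : continuous (fun y : R => f (y, c)).
  move=> y; apply: (@continuous_comp _ _ _ (fun y : R => (y, c)) f); last exact: cf.
  by apply: (@cvg_pair _ _ _ (nbhs y) (nbhs y) (nbhs c)); [exact: cvg_id|exact: cvg_cst].
have i1 c : intg unitI (fun y => f (c, y)) by exact: intg_unitI_continuous.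
have i2 c : intg unitI (fun y => f (y, c)) by exact: intg_unitI_continuous.
have z y : 0 < y < 1 -> (y == 1 :> R)%:R - (y == 0 :> R)%:R = 0 :> R.
  by move=> /andP[y0 y1]; rewrite lt_eqF// gt_eqF// subrr.
have m1 c : measurable_fun setT (fun y : mT => f (c, y) * unit_normal k (c, y)).
  exact: measurableT_comp mf (pair1_measurable c).
have m2 c : measurable_fun setT (fun y : mT => f (y, c) * unit_normal k (y, c)).
  exact: measurableT_comp mf (pair2_measurable c).
have j1 c : intg unitI (fun y => f (c, y) * unit_normal k (c, y)).
  apply: (intg_mulb (M := 1) (i1 c)); last by move=> y; exact: unit_normal_le1.
  exact: measurableT_comp (measurable_unit_normal k) (pair1_measurable c).
have j2 c : intg unitI (fun y => f (y, c) * unit_normal k (y, c)).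
  apply: (intg_mulb (M := 1) (i2 c)); last by move=> y; exact: unit_normal_le1.
  exact: measurableT_comp (measurable_unit_normal k) (pair2_measurable c).
rewrite Rint_boundary//; elim/ord2P: k {mf m1 m2 j1 j2} => /=.
- rewrite [X in _ + X + _](_ : _ = 0); last first.
    rewrite -[RHS](Rint_zero unitI); apply: Rint_ae_eq; apply: aeS (aeT_in 1) => y y01.
    by rewrite /unit_normal /crd /= z// mulr0.
  rewrite [X in _ + X](_ : _ = 0); last first.
    rewrite -[RHS](Rint_zero unitI); apply: Rint_ae_eq; apply: aeS (aeT_in 1) => y y01.
    by rewrite /unit_normal /crd /= z// mulr0.
  rewrite !addr0 RintB; [|exact: i1|exact: i1]; rewrite addrC; congr (_ + _).
    by apply: eq_Rintegral => y _; rewrite /unit_normal /crd /= eqxx oner_eq0 subr0 mulr1.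
  rewrite -RintN; last exact: i1.
  by apply: eq_Rintegral => y _;
    rewrite /unit_normal /crd /= eqxx [0 == 1]eq_sym oner_eq0 sub0r mulrN1.
- rewrite [X in X + _ + _ + _](_ : _ = 0); last first.
    rewrite -[RHS](Rint_zero unitI); apply: Rint_ae_eq; apply: aeS (aeT_in 1) => y y01.
    by rewrite /unit_normal /crd /= z// mulr0.
  rewrite [X in _ + X + _ + _](_ : _ = 0); last first.
    rewrite -[RHS](Rint_zero unitI); apply: Rint_ae_eq; apply: aeS (aeT_in 1) => y y01.
    by rewrite /unit_normal /crd /= z// mulr0.
  rewrite !add0r RintB; [|exact: i2|exact: i2]; rewrite addrC; congr (_ + _).
    by apply: eq_Rintegral => y _; rewrite /unit_normal /crd /= eqxx oner_eq0 subr0 mulr1.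
  rewrite -RintN; last exact: i2.
  by apply: eq_Rintegral => y _;
    rewrite /unit_normal /crd /= eqxx [0 == 1]eq_sym oner_eq0 sub0r mulrN1.
Qed.

Lemma cvg_cst_eq (c l : R) : (cst c : nat -> R) n @[n --> \oo] --> l -> c = l.
Proof. by move=> /cvg_lim <- //; rewrite lim_cst. Qed.

Let trace_alg (X Y Z A B C : R) : (X + A) + (Y + B) = Z + C -> X + Y - Z = C - A - B.
Proof. by move=> H; lra. Qed.

Let trace_alg0 (A B C : R) : C - A - B = 0 -> A + B = C.
Proof. by move=> H; lra. Qed.

(** The formula holds for the smooth approximants and passes to the limit: the H^1 norm controls the
    two interior terms, the L^2 norm on the boundary controls the trace term. *)
Lemma trace_by_parts k w g a da b db : is_trace w g -> smooth1 a -> smooth1 b ->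
  (forall y, dv a y (da y)) -> (forall y, dv b y (db y)) -> smooth1 da -> smooth1 db ->
  \int[lebO]_x (wderiv k w x * tens a b x) + \int[lebO]_x (w x * tens_deriv k a da b db x) =
  \int[boundary_measure]_x (g x * (tens a b x * unit_normal k x)).
Proof.
move=> [hw /Lfun2P sg [p [sp pw pg]]] sa sb Ha Hb sda sdb.
have ct := smooth1_tens_continuous sa sb.
have cdt : continuous (tens_deriv k a da b db).
  by rewrite /tens_deriv; case: eqP => _; exact: smooth1_tens_continuous.
have [/L2P sw _ _] := wderivP k hw; have [_ /L2P swd _] := wderivP k hw.
have st := sqint_continuous ct; have sdt := sqint_continuous cdt.
have cp n := smooth_continuous (sp n).
have cdp n := smooth_pderiv_continuous (k := k) (sp n).
have spn n := sqint_continuous (cp n).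
have hpw n : H1 (p n \- w).
  split; first by apply/L2P; exact: sqintB.
  move=> i; exists (fun x => pderiv i (p n) x + (-1) * wderiv i w x).
  have := is_wderivD (-1) (is_wderiv_smooth i (sp n)) (wderivP i hw).
  by congr is_wderiv; apply/funext => x /=; rewrite mulN1r.
pose v n := wderiv k (p n \- w).
have svn n : sqint lebO (v n) by have [_ /L2P] := wderivP k (hpw n).
have nv0 : normL2 (v n) @[n --> \oo] --> 0%E.
  apply: (squeeze_cvge _ (cvg_cst 0%E) pw); apply: nearW => n.
  by rewrite normL2_ge0 normL2_wderiv_le_normH1.
have np0 : normL2 (p n \- w) @[n --> \oo] --> 0%E.
  apply: (squeeze_cvge _ (cvg_cst 0%E) pw); apply: nearW => n.
  by rewrite normL2_ge0 normL2_le_normH1.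
(* The chosen weak derivative of a difference is not literally the difference of the chosen ones.
   Their agreement is recovered by testing and extended to [tens a b] by [test_uniq]. *)
have E1 n : \int[lebO]_x (pderiv k (p n) x * tens a b x) =
    \int[lebO]_x (v n x * tens a b x) + \int[lebO]_x (wderiv k w x * tens a b x).
  have i1 := intg_mul_continuous (svn n) ct; have i2 := intg_mul_continuous swd ct.
  have i3 := intg_mul_continuous (sqint_continuous (cdp n)) ct.
  apply/eqP; rewrite -subr_eq0 -(RintD i1 i2) -(RintB i3 (intgD i1 i2)).
  have W := is_wderivD (-1) (is_wderiv_smooth k (sp n)) (is_wderivD 1 (wderivP k (hpw n)) (wderivP
    k hw)).
  have sz : sqint lebO (fun x => pderiv k (p n) x + (-1) * (v n x + 1 * wderiv k w x)).
    by case: W => _ /L2P.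
  have := test_uniq sz _ sa sb.
  set J := Rintegral _ _ _ => HJ.
  rewrite [X in X == 0](_ : _ = J); last by apply: eq_Rintegral => x _; ring.
  apply/eqP/HJ => a1 b1 ta tb.
  have [da1 _ Ha1] := smooth1_deriv (proj1 ta); have [db1 _ Hb1] := smooth1_deriv (proj1 tb).
  have := is_wderiv_tens W ta tb Ha1 Hb1.
  under eq_Rintegral do rewrite /= mul1r subrK mulN1r subrr mul0r.
  by rewrite Rint_zero => /esym/eqP; rewrite oppr_eq0 => /eqP.
have E2 n : \int[lebO]_x (p n x * tens_deriv k a da b db x) =
    \int[lebO]_x ((p n \- w) x * tens_deriv k a da b db x) + \int[lebO]_x (w x * tens_deriv k a da
      b db x).
  have i1 := intg_mul_continuous (sqintB (spn n) sw) cdt; have i2 := intg_mul_continuous sw cdt.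
  rewrite -(RintD i1 i2); apply: eq_Rintegral => x _ /=; ring.
have snt : sqint boundary_measure (fun x => tens a b x * unit_normal k x).
  apply: (sqint_mulb (M := 1)); [exact: sqint_boundary_continuous|exact: measurable_unit_normal|].
  exact: unit_normal_le1.
have E3 n : \int[boundary_measure]_x (p n x * (tens a b x * unit_normal k x)) =
    \int[boundary_measure]_x ((p n \- g) x * (tens a b x * unit_normal k x)) +
    \int[boundary_measure]_x (g x * (tens a b x * unit_normal k x)).
  have i1 := sqint_mul (sqintB (sqint_boundary_continuous (cp n)) sg) snt.
  have i2 := sqint_mul sg snt.
  rewrite -(RintD i1 i2); apply: eq_Rintegral => x _ /=; ring.
have E4 n : \int[lebO]_x (pderiv k (p n) x * tens a b x) + \int[lebO]_x (p n x * tens_deriv k a da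
  b db x) =
    \int[boundary_measure]_x (p n x * (tens a b x * unit_normal k x)).
  have cpt : continuous (fun x => p n x * tens a b x).
    by move=> x; apply: cvgM; [exact: cp|exact: ct].
  rewrite (Rint_by_parts (cp n) (cdp n) ct cdt (fun x => smooth_is_derive k x (sp n))
    (fun x => is_derive_tens k x Ha Hb)).
  under [RHS]eq_Rintegral do rewrite mulrA.
  by rewrite (Rint_unit_normal k cpt).
have L1 : \int[lebO]_x (v n x * tens a b x) @[n --> \oo] --> (0 : R).
  by apply: (cvg0_ereal nv0) => n; exact: Rint_le_Lnorm2.
have L2 : \int[lebO]_x ((p n \- w) x * tens_deriv k a da b db x) @[n --> \oo] --> (0 : R).
  by apply: (cvg0_ereal np0) => n; apply: Rint_le_Lnorm2 => //; exact: sqintB.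
have L3 : \int[boundary_measure]_x ((p n \- g) x * (tens a b x * unit_normal k x)) @[n --> \oo] -->
  (0 : R).
  apply: (cvg0_ereal pg) => n; apply: Rint_le_Lnorm2 => //; apply: sqintB => //.
  exact: sqint_boundary_continuous.
set A := \int[lebO]_x _; set B := \int[lebO]_x _; set C := \int[boundary_measure]_x _.
have L : \int[lebO]_x (v n x * tens a b x) + \int[lebO]_x ((p n \- w) x * tens_deriv k a da b db x)
   - \int[boundary_measure]_x ((p n \- g) x * (tens a b x * unit_normal k x)) @[n --> \oo] --> 0 +
     0 - (0 : R).
  by apply: cvgB => //; apply: cvgD.
have E : (fun n => \int[lebO]_x (v n x * tens a b x) + \int[lebO]_x ((p n \- w) x * tens_deriv k a
  da b db x)
   - \int[boundary_measure]_x ((p n \- g) x * (tens a b x * unit_normal k x))) = cst (C - A - B).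
  by apply/funext => n; apply: trace_alg; rewrite -E1 -E2 -E3; exact: E4.
have {}L : cst (C - A - B) n @[n --> \oo] --> 0 + 0 - (0 : R) by rewrite -E.
by apply: trace_alg0; rewrite (cvg_cst_eq L) addr0 subr0.
Qed.

(** Only the first variable and separable test functions are retained. The second variable is
    brought to the first by exchanging coordinates, so the decay estimate is proved once. *)
Definition separable_wderiv0 f v := [/\ sqint lebO f, sqint lebO v &
  forall a b da, test1 a -> test1 b -> smooth1 da -> (forall y, dv a y (da y)) ->
  \int[lebO]_x (f x * tens da b x) = - \int[lebO]_x (v x * tens a b x)].

Lemma is_wderiv0_separable f v : is_wderiv 0 f v -> separable_wderiv0 f v.
Proof.
move=> W; have [/L2P sf /L2P sv _] := W; split => // a b da ta tb _ Ha.
by have [db _ Hb] := smooth1_deriv (proj1 tb); exact: is_wderiv_tens W ta tb Ha Hb.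
Qed.

Lemma sqint_swap2 f : sqint lebO f -> sqint lebO (f \o @swap2 R).
Proof.
move=> [mf fi]; split; first exact: measurableT_comp mf (@measurable_swap2 R).
by have [] := swap2O fi.
Qed.

Lemma is_wderiv1_separable f v : is_wderiv 1 f v -> separable_wderiv0 (f \o @swap2 R) (v \o @swap2
  R).
Proof.
move=> W; have [/L2P sf /L2P sv _] := W; split; [exact: sqint_swap2|exact: sqint_swap2|].
move=> a b da ta tb sda Ha; have [db _ Hb] := smooth1_deriv (proj1 tb).
have E := is_wderiv_tens W tb ta Hb Ha.
have c1 : continuous (tens b da) := smooth1_tens_continuous (proj1 tb) sda.
have c2 : continuous (tens b a) := smooth1_tens_continuous (proj1 tb) (proj1 ta).
have [_ S1] := swap2O (intg_mul_continuous sf c1).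
have [_ S2] := swap2O (intg_mul_continuous sv c2).
transitivity (\int[lebO]_x (f (swap2 x) * tens b da (swap2 x))).
  by apply: eq_Rintegral => x _; rewrite /tens /= [da _ * _]mulrC.
rewrite S1 [LHS]E -S2; congr (- _).
by apply: eq_Rintegral => x _; rewrite /tens /= [a _ * _]mulrC.
Qed.

(* For a factor r vanishing at both endpoints no trace of f is needed. *)
Lemma wderiv0_by_parts f v r dr b : separable_wderiv0 f v -> smooth1 r -> smooth1 dr ->
  (forall y, dv r y (dr y)) -> smooth1 b -> r 0 = 0 -> r 1 = 0 ->
  \int[lebO]_x (f x * (dr x.1 * b x.2)) + \int[lebO]_x (v x * (r x.1 * b x.2)) = 0.
Proof.
move=> [sf sv W] sr sdr rd sb r0 r1.
(* Mean value theorem from either endpoint: r vanishes there, so |r| is at most C times the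
   distance, which compensates the slope of the cutoffs. *)
have [C C0 HC] : exists2 C, 0 <= C & forall y, 0 < y < 1 -> `|r y| <= C * y /\ `|r y| <= C * (1 -
  y).
  have cdr2 : continuous (fun x : R * R => dr x.1).
    by move=> x; apply: (@continuous_comp _ _ _ fst dr); [exact: cvg_fst|exact: smooth1_continuous].
  have [M M0 HM] := continuous_bounded_square cdr2; exists M => // y /andP[y0 y1].
  have dM c : 0 <= c <= 1 -> `|dr c| <= M.
    by move=> c01; have := HM (c, 0) c01; apply; rewrite /= lexx ler01.
  have mvt (a b' : R) : a < b' -> exists2 c, c \in `]a, b'[ & r b' - r a = dr c * (b' - a).
    move=> ab; apply: (@MVT R r dr a b' ab) => [x _|]; first exact: rd.
    by apply: continuous_subspaceT; exact: smooth1_continuous.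
  split.
  - have [c /itvP ci] := mvt 0 y y0; rewrite r0 !subr0 => ->.
    rewrite normrM (gtr0_norm y0) ler_wpM2r ?(ltW y0)//; apply: dM.
    by rewrite ci /= (le_trans _ (ltW y1))// ci.
  - have [c /itvP ci] := mvt y 1 y1; rewrite r1 sub0r => /(congr1 Num.norm).
    have p : 0 < 1 - y by rewrite subr_gt0.
    rewrite normrN normrM (gtr0_norm p) => ->; rewrite ler_wpM2r ?(ltW p)//; apply: dM.
    by rewrite (le_trans (ltW y0)) ?ci.
pose c n := cutoff n.+1 : R -> R.
have H n : \int[lebO]_x (f x * ((dcutoff n.+1 x.1 * r x.1 + c n x.1 * dr x.1) * (c n x.2 * b x.2)))
   + \int[lebO]_x (v x * ((c n x.1 * r x.1) * (c n x.2 * b x.2))) = 0.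
  have ta := test1_cutoff n sr; have tb := test1_cutoff n sb.
  have [da sda Ha] := smooth1_deriv (proj1 ta).
  have := W _ _ _ ta tb sda Ha; rewrite /tens /= => E.
  have dE y : da y = dcutoff n.+1 y * r y + c n y * dr y.
    by rewrite -(dv_val (Ha y)); apply: dv_val; apply: dvM (dv_cutoff _ _) (rd y).
  under eq_Rintegral do rewrite -dE.
  by rewrite E addNr.
have sA : continuous (fun x : R * R => dr x.1 * b x.2) := smooth1_tens_continuous sdr sb.
have sB : continuous (fun x : R * R => r x.1 * b x.2) := smooth1_tens_continuous sr sb.
have [Mb Mb0 HMb] : exists2 M, 0 <= M & forall y, 0 < y < 1 -> `|b y| <= M.
  have cb2 : continuous (fun x : R * R => b x.1).
    by move=> x; apply: (@continuous_comp _ _ _ fst b); [exact: cvg_fst|exact: smooth1_continuous].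
  have [M M0 HM] := continuous_bounded_square cb2; exists M => // y /andP[y0 y1].
  by have := HM (y, 0); apply; rewrite /= ?lexx ?ler01// !ltW.
have ic := intg_norm (intg_mul_continuous sf sA).
have icv := intg_norm (intg_mul_continuous sv sB).
have L1 : \int[lebO]_x (f x * ((dcutoff n.+1 x.1 * r x.1 + c n x.1 * dr x.1) * (c n x.2 * b x.2)))
    @[n --> \oo] --> \int[lebO]_x (f x * (dr x.1 * b x.2)).
  (* The majorant is valid inside Omega only, while [Rint_dct_cvg] wants it everywhere. The
     indicator of Omega, equal to 1 almost everywhere for [lebO], reconciles the two. *)
  pose O := (@Omega R : set (R * R)).
  have mO : measurable_fun (setT : set P2) (\1_O : R * R -> R).
    by apply: measurable_indic; exact: measurable_Omega.
  have aO (F : R * R -> R) : \int[lebO]_x F x = \int[lebO]_x (\1_O x * F x).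
    by apply: Rint_ae_eq; apply: aeS (aeO_in R) => x Ox; rewrite indicE mem_set// mul1r.
  under eq_fun do rewrite aO.
  rewrite aO.
  have mcut n : continuous (fun x : R * R => (dcutoff n.+1 x.1 * r x.1 + c n x.1 * dr x.1) * (c n
    x.2 * b x.2)).
    have [da sda Ha] := smooth1_deriv (proj1 (test1_cutoff n sr)).
    have -> : (fun x : R * R => (dcutoff n.+1 x.1 * r x.1 + c n x.1 * dr x.1) * (c n x.2 * b x.2)) =
        tens da (fun y => c n y * b y).
      apply/funext => x; rewrite /tens; congr (_ * _).
      by rewrite -(dv_val (Ha x.1)); apply/esym/dv_val; apply: dvM (dv_cutoff _ _) (rd _).
    by apply: smooth1_tens_continuous => //; exact: (proj1 (test1_cutoff n sb)).
  apply: (@Rint_dct_cvg _ _ _ lebO (fun n x => \1_O x * (f x * ((dcutoff n.+1 x.1 * r x.1 + c n x.1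
    * dr x.1) * (c n x.2 * b x.2))))
     (fun x => \1_O x * (f x * (dr x.1 * b x.2)))
     (fun x => 6 * C * Mb * `|f x| + `|f x * (dr x.1 * b x.2)|)).
  - move=> n; apply: measurable_funM => //; apply: intg_meas; apply: intg_mul_continuous => //.
  - apply: measurable_funM => //; apply: intg_meas; exact: intg_mul_continuous.
  - apply: aeS (aeO_in R) => x /OmegaP[x1 x2]; apply: cvgM; first exact: cvg_cst.
    apply: cvgM; first exact: cvg_cst.
    apply: cvg_to_eq (_ : (0 * r x.1 + 1 * dr x.1) * (1 * b x.2) = _);
      last by rewrite mul0r add0r !mul1r.
    apply: cvgM; first (apply: cvgD; apply: cvgM;
      by [exact: dcutoff_cvg0|exact: cvg_cst|exact: cutoff_cvg1]).
    by apply: cvgM; [exact: cutoff_cvg1|exact: cvg_cst].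
  - by apply: intgD ic; apply: intgZ; apply: intg_norm; exact: sqintO_intg.
  - move=> n x; rewrite indicE; case: (boolP (x \in O)) => [|_]; last first.
      by rewrite mul0r normr0 addr_ge0// !mulr_ge0.
    rewrite inE => /OmegaP[x1 x2]; rewrite mul1r mulrDl mulrDr.
    apply: le_trans (ler_normD _ _) _; apply: lerD; last first.
      by apply: norm_mul_cut; exact: cutoff_norm.
    have [h1 h2] := HC _ x1; have W6 := dcutoff_weight n.+1 x1 C0 h1 h2.
    rewrite normrM mulrC ler_wpM2r// normrM ler_pM//.
    rewrite normrM -[leRHS]mul1r ler_pM// ?HMb//; exact: cutoff_norm.
have L2 : \int[lebO]_x (v x * ((c n x.1 * r x.1) * (c n x.2 * b x.2)))
    @[n --> \oo] --> \int[lebO]_x (v x * (r x.1 * b x.2)).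
  apply: (@Rint_dct_cvg _ _ _ lebO (fun n x => v x * ((c n x.1 * r x.1) * (c n x.2 * b x.2)))
     (fun x => v x * (r x.1 * b x.2)) (fun x => `|v x * (r x.1 * b x.2)|)) => //.
  - move=> n; apply: intg_meas; apply: intg_mul_continuous => //.
    apply: (smooth1_tens_continuous (a := fun y => c n y * r y) (b := fun y => c n y * b y)).
      exact: (proj1 (test1_cutoff n sr)).
    exact: (proj1 (test1_cutoff n sb)).
  - by apply: intg_meas; exact: intg_mul_continuous.
  - apply: aeS (aeO_in R) => x /OmegaP[x1 x2]; apply: cvgM; first exact: cvg_cst.
    apply: cvgM; (apply: cvg_to_eq (mul1r _); apply: cvgM; [exact: cutoff_cvg1|exact: cvg_cst]).
  - by move=> n x; apply: norm_mul_cut; exact: cutoff_norm.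
have L := cvgD L1 L2.
apply/esym; apply: cvg_cst_eq.
have {}L : \int[lebO]_x (f x * ((dcutoff n.+1 x.1 * r x.1 + c n x.1 * dr x.1) * (c n x.2 * b x.2)))
   + \int[lebO]_x (v x * ((c n x.1 * r x.1) * (c n x.2 * b x.2))) @[n --> \oo] -->
   \int[lebO]_x (f x * (dr x.1 * b x.2)) + \int[lebO]_x (v x * (r x.1 * b x.2)) by exact: L.
by move: L; under eq_fun do rewrite H.
Qed.

End traces.

(** * Fourier decay of H^1 functions *)

Section decay.
Context (R : realType).
Let mT := measurableTypeR R.
Let P2 := (mT * mT)%type.
Local Notation unitI := (unitI R).
Implicit Types (w v f g h : R * R -> R) (a b : R -> R) (x : R * R).

Let cvg_affine (c d : R) : continuous (fun x : R * R => c * x.1 + d).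
Proof.
move=> x; apply: cvgD; last exact: cvg_cst.
by apply: cvgM; [exact: cvg_cst|exact: cvg_fst].
Qed.

Let sqint_affine v (c d : R) : sqint lebO v -> sqint lebO (fun x => v x * (c * x.1 + d)).
Proof. by move=> sv; apply: sqint_mul_continuous => //; exact: cvg_affine. Qed.

(** For smooth f with first partial derivative v, the integrands are the derivatives of x f and of
    (x - 1) f in the first variable, so their slices integrate to f(1, y) and f(0, y). They replace
    the traces on the two vertical sides. Both weights have the shape c x + d, which is treated
    once. *)
Definition face1 f v x : R := f x + v x * (1 * x.1 + 0).
Definition face0 f v x : R := f x - v x * ((-1) * x.1 + 1).

Lemma sqint_face1 f v : sqint lebO f -> sqint lebO v -> sqint lebO (face1 f v).
Proof. by move=> sf sv; apply: sqintD => //; exact: sqint_affine. Qed.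

Lemma sqint_face0 f v : sqint lebO f -> sqint lebO v -> sqint lebO (face0 f v).
Proof. by move=> sf sv; apply: sqintB => //; exact: sqint_affine. Qed.

Let continuous_snd b : continuous b -> continuous (fun x : R * R => b x.2).
Proof.
by move=> cb x; apply: (@continuous_comp _ _ _ snd b); [exact: cvg_snd|exact: cb].
Qed.

Lemma separable_by_parts f v r dr b : separable_wderiv0 f v -> smooth1 r -> smooth1 dr ->
  (forall y, dv r y (dr y)) -> smooth1 b ->
  \int[lebO]_x (f x * (dr x.1 * b x.2)) + \int[lebO]_x (v x * (r x.1 * b x.2)) =
  r 1 * \int[lebO]_x (face1 f v x * b x.2) - r 0 * \int[lebO]_x (face0 f v x * b x.2).
Proof.
move=> W sr sdr rd sb; have [sf sv _] := W.
pose k := r 0 - r 1.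
(* r minus its affine interpolant between 0 and 1, which vanishes at both ends; the affine part
   produces the face integrals. *)
pose rho y := (r y + k * y) + (- r 0); pose drho y := dr y + k.
have srho : smooth1 rho.
  apply: smooth1_add; last exact: smooth1_cst.
  by apply: smooth1_add => //; apply: smooth1_mul; [exact: smooth1_cst|exact: smooth1_id].
have sdrho : smooth1 drho by apply: smooth1_add => //; exact: smooth1_cst.
have rhod y : dv rho y (drho y).
  apply: dv_eq (dvD (dvD (rd y) (dvZ k (dv_id y))) (dv_cst (- r 0) y)) _.
  by rewrite mulr1 addr0.
have rho0 : rho 0 = 0 by rewrite /rho mulr0 addr0 subrr.
have rho1 : rho 1 = 0 by rewrite /rho /k; ring.
have := wderiv0_by_parts W srho sdrho rhod sb rho0 rho1.
have cb := continuous_snd (smooth1_continuous sb).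
have s1 := sqint_affine 1 0 sv; have s2 := sqint_affine (-1) 1 sv.
have ct (a c : R -> R) : smooth1 a -> smooth1 c -> continuous (fun x : R * R => a x.1 * c x.2).
  by move=> sa sc; exact: smooth1_tens_continuous.
have J1 := intg_mul_continuous sf (ct _ _ sdr sb).
have J2 := intg_mul_continuous sv (ct _ _ sr sb).
have J3 := intg_mul_continuous sf cb.
have J4 := intg_mul_continuous s1 cb.
have J5 := intg_mul_continuous s2 cb.
have J6 := intg_mul_continuous sv cb.
have -> : \int[lebO]_x (f x * (drho x.1 * b x.2)) =
    \int[lebO]_x (f x * (dr x.1 * b x.2)) + k * \int[lebO]_x (f x * b x.2).
  rewrite -(RintZ k J3) -(RintD J1 (intgZ k J3)); apply: eq_Rintegral => x _.
  by rewrite /drho; ring.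
have -> : \int[lebO]_x (v x * (rho x.1 * b x.2)) =
    \int[lebO]_x (v x * (r x.1 * b x.2)) + k * \int[lebO]_x (v x * (1 * x.1 + 0) * b x.2)
    - r 0 * \int[lebO]_x (v x * b x.2).
  rewrite -(RintZ k J4) -(RintZ (r 0) J6) -(RintD J2 (intgZ k J4)).
  rewrite -(RintB (intgD J2 (intgZ k J4)) (intgZ (r 0) J6)); apply: eq_Rintegral => x _.
  by rewrite /rho; ring.
have -> : \int[lebO]_x (face1 f v x * b x.2) =
   \int[lebO]_x (f x * b x.2) + \int[lebO]_x (v x * (1 * x.1 + 0) * b x.2).
  by rewrite -(RintD J3 J4); apply: eq_Rintegral => x _; rewrite /face1; ring.
have -> : \int[lebO]_x (face0 f v x * b x.2) =
   \int[lebO]_x (f x * b x.2) + \int[lebO]_x (v x * (1 * x.1 + 0) * b x.2) - \int[lebO]_x (v x * b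
     x.2).
  rewrite -(RintD J3 J4) -(RintB (intgD J3 J4) J6); apply: eq_Rintegral => x _; rewrite /face0;
    ring.
set A := Rintegral _ _ _; set B := Rintegral _ _ _; set C := Rintegral _ _ _.
set D := Rintegral _ _ _; set E := Rintegral _ _ _; rewrite /k => H; lra.
Qed.

(** Integration by parts in the first variable after expanding the cosine. The first frequency
    enters the boundary terms only through bounded factors; the face integrals depend on the second
    frequency alone. *)
Lemma ctrM f v (a : R * R) : separable_wderiv0 f v ->
  a.1 * ctr f a = - str v a
   + sin a.1 * \int[lebO]_x (face1 f v x * cos (a.2 * x.2))
   + cos a.1 * \int[lebO]_x (face1 f v x * sin (a.2 * x.2))
   - \int[lebO]_x (face0 f v x * sin (a.2 * x.2)).
Proof.
move=> W; have [sf sv _] := W.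
have sc k : smooth1 (fun y : R => cos (k * y)) by exact: smooth1_cos.
have ss k : smooth1 (fun y : R => sin (k * y)) by exact: smooth1_sin.
have dk (k y : R) : dv (fun y => k * y) y k by apply: dv_eq (dvZ k (dv_id y)) _; rewrite mulr1.
have d1 y : dv (fun y => sin (a.1 * y)) y (a.1 * cos (a.1 * y)).
  by apply: dv_eq (dv_sin (dk a.1 y)) _; rewrite mulrC.
have d2 y : dv (fun y => cos (a.1 * y)) y (- a.1 * sin (a.1 * y)).
  by apply: dv_eq (dv_cos (dk a.1 y)) _; ring.
have sd1 : smooth1 (fun y => a.1 * cos (a.1 * y)) by apply: smooth1_mul => //; exact: smooth1_cst.
have sd2 : smooth1 (fun y => - a.1 * sin (a.1 * y)) by apply: smooth1_mul => //; exact: smooth1_cst.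
have := separable_by_parts W (ss a.1) sd1 d1 (sc a.2).
have := separable_by_parts W (sc a.1) sd2 d2 (ss a.2).
rewrite !mulr1 !mulr0 sin0 cos0 mul0r subr0 mul1r.
have ct (p q : R -> R) : smooth1 p -> smooth1 q -> continuous (fun x : R * R => p x.1 * q x.2).
  by move=> sa sb; exact: smooth1_tens_continuous.
have J1 := intg_mul_continuous sf (ct _ _ sd1 (sc a.2)).
have J2 := intg_mul_continuous sf (ct _ _ sd2 (ss a.2)).
have J3 := intg_mul_continuous sv (ct _ _ (ss a.1) (sc a.2)).
have J4 := intg_mul_continuous sv (ct _ _ (sc a.1) (ss a.2)).
have -> : str v a = \int[lebO]_x (v x * (sin (a.1 * x.1) * cos (a.2 * x.2)))
   + \int[lebO]_x (v x * (cos (a.1 * x.1) * sin (a.2 * x.2))).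
  rewrite -(RintD J3 J4); apply: eq_Rintegral => x _; rewrite dotE sinD; ring.
have -> : a.1 * ctr f a = \int[lebO]_x (f x * (a.1 * cos (a.1 * x.1) * cos (a.2 * x.2))) +
   \int[lebO]_x (f x * (- a.1 * sin (a.1 * x.1) * sin (a.2 * x.2))).
  rewrite -(RintD J1 J2) /ctr -RintZ; last first.
    apply: intg_mul_continuous => //.
    have -> : (fun x : R * R => cos (dot a x)) = fun x => cos (a.1 * x.1) * cos (a.2 * x.2)
       - sin (a.1 * x.1) * sin (a.2 * x.2) by apply/funext => x; rewrite dotE cosD.
    have h1 := ct _ _ (sc a.1) (sc a.2); have h2 := ct _ _ (ss a.1) (ss a.2).
    by move=> x; apply: cvgB; [exact: h1|exact: h2].
  by apply: eq_Rintegral => x _; rewrite dotE cosD; ring.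
by move: (Rintegral _ _ _) => A; move: (Rintegral _ _ _) => B; move: (Rintegral _ _ _) => C;
  move: (Rintegral _ _ _) => D; move: (Rintegral _ _ _) => E; move: (Rintegral _ _ _) => F;
  move: (Rintegral _ _ _) => G => h1 h2; lra.
Qed.

Lemma slice1_mul h (c : R -> R) (M : R) : intg lebO h -> measurable_fun setT c ->
  (forall y, `|c y| <= M) ->
  \int[lebO]_x (h x * c x.2) = \int[unitI]_y (slice1 h y * c y).
Proof.
move=> hi mc cM.
have mc2 : measurable_fun (setT : set P2) (fun x : P2 => c x.2).
  exact: measurableT_comp mc measurable_snd.
have [_ ->] := intg_slice1 (intg_mulb hi mc2 (fun x => cM x.2)).
apply: Rint_ae_eq; have := ae_integrable2 (intg_lebOE hi); apply: aeS => y iy.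
rewrite /slice1 mulrC -RintZ; last exact: iy.
by apply: eq_Rintegral => x _; rewrite mulrC.
Qed.

Lemma Rint_unitI1 : \int[unitI]__ (1 : R) = 1.
Proof. by rewrite Rint_unitI// /Rintegral integral_cst//= mul1e lebesgue_measure_itv /= lte_fin
  ltr01 oppr0 adde0. Qed.

(** Cauchy-Schwarz against the constant 1 on almost every slice, the slices having unit length. *)
Lemma slice1_sqint h : sqint lebO h ->
  sqint unitI (slice1 h) /\ \int[unitI]_y slice1 h y ^+ 2 <= \int[lebO]_x h x ^+ 2.
Proof.
move=> sh; have [mh h2] := sh; have h1 := sqintO_intg sh.
have [is1 _] := intg_slice1 h1; have [is2 E2] := intg_slice1 h2.
have ms := intg_meas is1.
have K : \forall y \ae unitI, slice1 h y ^+ 2 <= slice1 (fun x => h x ^+ 2) y.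
  have := aeI (ae_integrable2 (intg_lebOE h1)) (ae_integrable2 (intg_lebOE h2)).
  apply: aeS => y [i1 i2].
  have c1 : intg unitI (fun=> 1) by apply: intg_cst; exact: lebT_fin.
  have i3 : intg unitI (fun t : R => h (t, y) * 1) by apply: intg_eq i1 => t; rewrite mulr1.
  have c2 : intg unitI (fun=> 1 ^+ 2) by apply: intg_eq c1 => x; rewrite expr1n.
  have := Rint_cauchy_schwarz i2 c2 i3.
  rewrite /slice1; under eq_Rintegral do rewrite mulr1.
  by rewrite expr1n Rint_unitI1 mulr1.
have I : intg unitI (fun y => slice1 h y ^+ 2).
  apply: intg_ae_le is2; first exact: measurable_funX.
  by apply: aeS K => y; rewrite ger0_norm ?sqr_ge0.
split => //; rewrite E2.
rewrite -lee_fin -!intgE//; apply: ae_ge0_le_integral => //.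
- by move=> y _; rewrite lee_fin sqr_ge0.
- by apply/measurable_EFinP; exact: measurable_funX.
- by move=> y _; rewrite lee_fin; apply: Rint_ge0 => x; exact: sqr_ge0.
- by apply/measurable_EFinP; exact: intg_meas is2.
- by apply: aeS K => y Ky _; rewrite lee_fin.
Qed.

Let face_bound f v : sqint lebO f -> sqint lebO v ->
  \int[lebO]_x face1 f v x ^+ 2 + \int[lebO]_x face0 f v x ^+ 2 <=
  4 * (\int[lebO]_x f x ^+ 2 + \int[lebO]_x v x ^+ 2).
Proof.
move=> sf sv; have [_ i1] := sqint_face1 sf sv; have [_ i0] := sqint_face0 sf sv.
have [mf i2] := sf; have [mv i3] := sv.
rewrite -(RintD i1 i0) -(RintD i2 i3) -(RintZ 4 (intgD i2 i3)).
rewrite -lee_fin -(intgE (intgD i1 i0)) -(intgE (intgZ 4 (intgD i2 i3))).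
apply: ae_ge0_le_integral => //.
- by move=> x _; rewrite lee_fin addr_ge0 ?sqr_ge0.
- by apply/measurable_EFinP; exact: intg_meas (intgD i1 i0).
- by move=> x _; rewrite lee_fin mulr_ge0// addr_ge0 ?sqr_ge0.
- by apply/measurable_EFinP; exact: intg_meas (intgZ 4 (intgD i2 i3)).
apply: aeS (aeO_in R) => x /OmegaP[/andP[x0 x1] _] _; rewrite lee_fin /face1 /face0.
(* The first two bound each square by twice the sum of two squares; the last two replace x^2 and (1
   - x)^2 by 1. *)
have q1 : 0 <= (f x - v x * x.1) ^+ 2 by exact: sqr_ge0.
have q2 : 0 <= (f x + v x * (1 - x.1)) ^+ 2 by exact: sqr_ge0.
have q3 : 0 <= (1 - x.1) * (1 + x.1) * v x ^+ 2.
  by rewrite mulr_ge0 ?sqr_ge0// mulr_ge0//; lra.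
have q4 : 0 <= x.1 * (2 - x.1) * v x ^+ 2.
  by rewrite mulr_ge0 ?sqr_ge0// mulr_ge0//; lra.
nra.
Qed.

Let sqr_bound (S G1 G2 H1 H2 s c : R) : c ^+ 2 + s ^+ 2 = 1 ->
  (- S + s * G1 + c * G2 - H2) ^+ 2 <= 3 * S ^+ 2 + 3 * (G1 ^+ 2 + G2 ^+ 2 + (H1 ^+ 2 + H2 ^+ 2)).
Proof.
move=> cs; have q : (s * G1 + c * G2) ^+ 2 <= G1 ^+ 2 + G2 ^+ 2.
  have -> : G1 ^+ 2 + G2 ^+ 2 = (c ^+ 2 + s ^+ 2) * (G1 ^+ 2 + G2 ^+ 2) by rewrite cs mul1r.
  by have := sqr_ge0 (c * G1 - s * G2); nra.
set t := s * G1 + c * G2 in q *.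
have := sqr_ge0 (S + t); have := sqr_ge0 (S - H2); have := sqr_ge0 (t + H2); have := sqr_ge0 H1.
have -> : - S + s * G1 + c * G2 - H2 = - S + t - H2 by rewrite /t; ring.
nra.
Qed.

(** P comes from the interior term of [ctrM], Q from the face terms, in which a.1 only enters
    through the sine and cosine of one angle. Q is integrable by the Bessel inequality on the
    interval. In 24 pi, the 3 comes from squaring a sum of three terms, 2 pi from Bessel and 4 from
    [face_bound]. *)
Lemma H1_decay0 f v : separable_wderiv0 f v -> exists (P : P2 -> R) (Q : mT -> R),
  [/\ forall a : P2, 0 <= P a, forall b : R, 0 <= Q b, intg leb2 P & intg (@lebesgue_measure R) Q]
    /\
  [/\ forall a : R * R, (a.1 * ctr f a) ^+ 2 <= P a + Q a.2 &
    \int[@lebesgue_measure R]_b Q b <= 24 * pi * (\int[lebO]_x f x ^+ 2 + \int[lebO]_x v x ^+ 2)].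
Proof.
move=> W; have [sf sv _] := W.
have sf1 := sqint_face1 sf sv; have sf0 := sqint_face0 sf sv.
have [s1 l1] := slice1_sqint sf1; have [s0 l0] := slice1_sqint sf0.
have [[_ c1] [_ d1] b1] := bessel_unit s1; have [[_ c0] [_ d0] b0] := bessel_unit s0.
set g1 := slice1 (face1 f v) in s1 l1 c1 d1 b1; set g0 := slice1 (face0 f v) in s0 l0 c0 d0 b0.
pose Q (b : R) := 3 * (cos_unit g1 b ^+ 2 + sin_unit g1 b ^+ 2 + (cos_unit g0 b ^+ 2 + sin_unit g0
  b ^+ 2)).
exists (fun a : R * R => 3 * str v a ^+ 2), Q; split; split.
- by move=> a; rewrite mulr_ge0 ?sqr_ge0.
- by move=> b; rewrite mulr_ge0 ?addr_ge0 ?sqr_ge0.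
- by apply: intgZ; have [] := sqint_str sv.
- exact: (intgZ 3 (intgD (intgD c1 d1) (intgD c0 d0))).
- move=> a; rewrite (ctrM a W).
  have mc k : measurable_fun setT (fun y : mT => cos (k * y) : R).
    by have := @measurable_cosM R k; apply: eq_measurable_fun => y _; rewrite mulrC.
  have ms k : measurable_fun setT (fun y : mT => sin (k * y) : R).
    by have := @measurable_sinM R k; apply: eq_measurable_fun => y _; rewrite mulrC.
  rewrite (slice1_mul (sqintO_intg sf1) (mc a.2) (fun y => cos_max _)).
  rewrite (slice1_mul (sqintO_intg sf1) (ms a.2) (fun y => sin_max _)).
  rewrite (slice1_mul (sqintO_intg sf0) (ms a.2) (fun y => sin_max _)).
  exact: sqr_bound (cos2Dsin2 _).
- rewrite /Q (RintZ 3 (intgD (intgD c1 d1) (intgD c0 d0))).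
  rewrite (RintD (intgD c1 d1) (intgD c0 d0)) (RintD c1 d1) (RintD c0 d0).
  have F := face_bound sf sv; have p0 := pi_gt0 R;
    have p1 : 0 <= 2 * pi :> R by rewrite mulr_ge0 ?ltW.
  apply: le_trans (_ : _ <= 3 * (2 * pi * \int[lebO]_x face1 f v x ^+ 2 + 2 * pi * \int[lebO]_x
    face0 f v x ^+ 2)) _.
    rewrite ler_pM2l// lerD//.
      by apply: (le_trans b1); rewrite ler_wpM2l.
    by apply: (le_trans b0); rewrite ler_wpM2l.
  rewrite -mulrDr mulrA; apply: le_trans (ler_wpM2l _ F) _; first by rewrite mulr_ge0.
  by rewrite le_eqVlt; apply/orP; left; apply/eqP; ring.
Qed.

Lemma ctr_swap2 f (a : R * R) : intg lebO f -> ctr (f \o @swap2 R) a = ctr f (swap2 a).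
Proof.
move=> fi; have mc : measurable_fun setT (fun x : P2 => cos (dot (swap2 a) x)).
  exact: measurableT_comp (@measurable_cosk R) (pair1_measurable (swap2 a : P2)).
have [_ S] := swap2O (intg_mulb fi mc (fun x => cos_max _)).
apply: etrans S; by apply: eq_Rintegral => x _; rewrite /= !dotE /= addrC.
Qed.

Lemma normL2_sqr f : sqint lebO f -> (normL2 f ^+ 2 = (\int[lebO]_x f x ^+ 2)%:E)%E.
Proof. by move=> [_ fi]; rewrite -(intgE fi); exact: Lnorm2_sqr. Qed.

Let half_sum (A B C : R) : 0 <= B -> 0 <= C -> A + B + (A + C) <= 2 * (A + (B + C)).
Proof. by move=> B0 C0; lra. Qed.

(* Fourier decay of an H^1 function on the square: the boundary terms of the integration
   by parts only depend on the other frequency. *)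
Lemma H1_decay f : H1 f -> exists (P : P2 -> R) (Q1 Q2 : mT -> R) (N : R),
  [/\ forall a : P2, 0 <= P a, forall b : R, 0 <= Q1 b, forall b : R, 0 <= Q2 b & intg leb2 P] /\
  [/\ intg (@lebesgue_measure R) Q1, intg (@lebesgue_measure R) Q2,
      forall a : R * R, (a.1 * ctr f a) ^+ 2 <= P a + Q1 a.2,
      forall a : R * R, (a.2 * ctr f a) ^+ 2 <= P a + Q2 a.1 &
      sqnormH1 f = N%:E /\
      \int[@lebesgue_measure R]_b Q1 b + \int[@lebesgue_measure R]_b Q2 b <= 48 * pi * N].
Proof.
move=> hf; have W0 := wderivP 0 hf; have W1 := wderivP 1 hf.
have [/L2P sf /L2P sv0 _] := W0; have [_ /L2P sv1 _] := W1.
have [P1 [Q1 [[p1 q1 ip1 iq1] [e1 b1]]]] := H1_decay0 (is_wderiv0_separable W0).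
have [P2' [Q2 [[p2 q2 ip2 iq2] [e2 b2]]]] := H1_decay0 (is_wderiv1_separable W1).
have [_ isf] := sf; have [_ isv1] := sv1; have [_ isv0] := sv0.
have ssf := sqint_swap2 sf.
have mP2 : measurable_fun setT (P2' \o @swap2 R) by exact: measurableT_comp (intg_meas ip2)
  (@measurable_swap2 R).
exists (fun a : R * R => P1 a + P2' (swap2 a)), Q1, Q2,
  (\int[lebO]_x f x ^+ 2 + (\int[lebO]_x (wderiv 0 f) x ^+ 2 + \int[lebO]_x (wderiv 1 f) x ^+ 2)).
split; split => //.
- by move=> a; rewrite addr_ge0.
- exact: intgD ip1 (proj1 (swap2_leb2 ip2)).
- by move=> a; apply: le_trans (e1 a) _; rewrite lerD2r lerDl.
- move=> a; have := e2 (swap2 a); rewrite ctr_swap2 ?sqintO_intg// (_ : swap2 (swap2 a) = a);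
  last by case: a.
  by move=> /= /le_trans; apply; rewrite lerD2r lerDr.
- split.
    have l1 : lift ord0 ord0 = 1 :> 'I_2 by exact: val_inj.
    have l0 : ord0 = 0 :> 'I_2 by exact: val_inj.
    rewrite /sqnormH1 big_ord_recl big_ord1 l1 l0.
    exact: (congr2 adde (normL2_sqr sf) (congr2 adde (normL2_sqr sv0) (normL2_sqr sv1))).
  have [_ S1] := swap2O isf; have [_ S2] := swap2O isv1.
  have b2' : \int[@lebesgue_measure R]_b Q2 b <=
     24 * pi * (\int[lebO]_x f x ^+ 2 + \int[lebO]_x (wderiv 1 f) x ^+ 2).
    by move: b2; rewrite -S1 -S2.
  apply: le_trans (lerD b1 b2') _.
  have n0 : 0 <= \int[lebO]_x (wderiv 0 f) x ^+ 2 by apply: Rint_ge0 => x; exact: sqr_ge0.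
  have n1 : 0 <= \int[lebO]_x (wderiv 1 f) x ^+ 2 by apply: Rint_ge0 => x; exact: sqr_ge0.
  rewrite -mulrDr (_ : 48 * pi = 24 * pi * 2); last by ring.
  rewrite -[leRHS]mulrA ler_wpM2l//; first by rewrite mulr_ge0 ?pi_ge0.
  exact: half_sum n0 n1.
Qed.

End decay.

(** * The identity satisfied by exact data *)

Section trigonometric_pairing.
Context (R : realType).
Implicit Types (w v f g h : R * R -> R) (al x : R * R) (k j : 'I_2).

Lemma continuous_cos_dot al : continuous (fun x : R * R => cos (dot al x)).
Proof.
move=> x; apply: (@continuous_comp _ _ _ (fun x : R * R => dot al x) cos);
  last exact: continuous_cos.
have -> : (fun x : R * R => dot al x) = (fun x => dot x al).
  by apply/funext => y; rewrite !dotE; ring.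
exact: continuous_dot.
Qed.

Lemma continuous_sin_dot al : continuous (fun x : R * R => sin (dot al x)).
Proof.
move=> x; apply: (@continuous_comp _ _ _ (fun x : R * R => dot al x) sin);
  last exact: continuous_sin.
have -> : (fun x : R * R => dot al x) = (fun x => dot x al).
  by apply/funext => y; rewrite !dotE; ring.
exact: continuous_dot.
Qed.

Lemma intg_cos_dot al f : sqint lebO f -> intg lebO (fun x => f x * cos (dot al x)).
Proof. by move=> sf; apply: intg_mul_continuous => //; exact: continuous_cos_dot. Qed.

Lemma intg_sin_dot al f : sqint lebO f -> intg lebO (fun x => f x * sin (dot al x)).
Proof. by move=> sf; apply: intg_mul_continuous => //; exact: continuous_sin_dot. Qed.

Lemma ctr_lin (r s : R) f g al : sqint lebO f -> sqint lebO g ->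
  ctr (fun x => r * f x + s * g x) al = r * ctr f al + s * ctr g al.
Proof.
move=> sf sg; have i1 := intg_cos_dot al sf; have i2 := intg_cos_dot al sg.
rewrite /ctr -(RintZ r i1) -(RintZ s i2) -(RintD (intgZ r i1) (intgZ s i2)).
by apply: eq_Rintegral => x _; ring.
Qed.

Lemma str_lin (r s : R) f g al : sqint lebO f -> sqint lebO g ->
  str (fun x => r * f x + s * g x) al = r * str f al + s * str g al.
Proof.
move=> sf sg; have i1 := intg_sin_dot al sf; have i2 := intg_sin_dot al sg.
rewrite /str -(RintZ r i1) -(RintZ s i2) -(RintD (intgZ r i1) (intgZ s i2)).
by apply: eq_Rintegral => x _; ring.
Qed.

Lemma ctr_ext f g al : (forall x, f x = g x) -> ctr f al = ctr g al.
Proof. by move=> /funext ->. Qed.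

Lemma str_ext f g al : (forall x, f x = g x) -> str f al = str g al.
Proof. by move=> /funext ->. Qed.

Let sc (k : R) : smooth1 (fun y : R => cos (k * y)). Proof. exact: smooth1_cos. Qed.
Let ss (k : R) : smooth1 (fun y : R => sin (k * y)). Proof. exact: smooth1_sin. Qed.
Let dcos (k y : R) : R := - k * sin (k * y).
Let dsin (k y : R) : R := k * cos (k * y).
Let sdc (k : R) : smooth1 (dcos k). Proof. by apply: smooth1_mul => //; exact: smooth1_cst. Qed.
Let sds (k : R) : smooth1 (dsin k). Proof. by apply: smooth1_mul => //; exact: smooth1_cst. Qed.
Let dk (k y : R) : dv (fun y => k * y) y k.
Proof. by apply: dv_eq (dvZ k (dv_id y)) _; rewrite mulr1. Qed.
Let dc (k y : R) : dv (fun y => cos (k * y)) y (dcos k y).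
Proof. by apply: dv_eq (dv_cos (dk k y)) _; rewrite /dcos; ring. Qed.
Let ds (k y : R) : dv (fun y => sin (k * y)) y (dsin k y).
Proof. by apply: dv_eq (dv_sin (dk k y)) _; rewrite /dsin; ring. Qed.

Let cosE al x : cos (dot al x) = tens (fun y => cos (al.1 * y)) (fun y => cos (al.2 * y)) x
  - tens (fun y => sin (al.1 * y)) (fun y => sin (al.2 * y)) x.
Proof. by rewrite dotE cosD. Qed.

Let sinE al x : sin (dot al x) = tens (fun y => sin (al.1 * y)) (fun y => cos (al.2 * y)) x
  + tens (fun y => cos (al.1 * y)) (fun y => sin (al.2 * y)) x.
Proof. by rewrite dotE sinD. Qed.

Let dcosE k al x : - (crd k al * sin (dot al x)) =
  tens_deriv k (fun y => cos (al.1 * y)) (dcos al.1) (fun y => cos (al.2 * y)) (dcos al.2) x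
  - tens_deriv k (fun y => sin (al.1 * y)) (dsin al.1) (fun y => sin (al.2 * y)) (dsin al.2) x.
Proof. by rewrite dotE sinD; elim/ord2P: k; rewrite /tens_deriv /tens /crd /dcos /dsin /=;
  ring. Qed.

Let dsinE k al x : crd k al * cos (dot al x) =
  tens_deriv k (fun y => sin (al.1 * y)) (dsin al.1) (fun y => cos (al.2 * y)) (dcos al.2) x
  + tens_deriv k (fun y => cos (al.1 * y)) (dcos al.1) (fun y => sin (al.2 * y)) (dsin al.2) x.
Proof. by rewrite dotE cosD; elim/ord2P: k; rewrite /tens_deriv /tens /crd /dcos /dsin /=;
  ring. Qed.

Let ct (a b : R -> R) : smooth1 a -> smooth1 b -> continuous (tens a b).
Proof. exact: smooth1_tens_continuous. Qed.

Let cdt k (a b da db : R -> R) : smooth1 a -> smooth1 b -> smooth1 da -> smooth1 db ->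
  continuous (tens_deriv k a da b db).
Proof. by move=> sa sb sda sdb; rewrite /tens_deriv; case: eqP => _; exact: ct. Qed.

Let RintO2 (m : {measure set (measurableTypeR R * measurableTypeR R) -> \bar R}) f h1 h2 (s : R) :
  intg m (fun x => f x * h1 x) -> intg m (fun x => f x * h2 x) ->
  \int[m]_x (f x * (h1 x + s * h2 x)) = \int[m]_x (f x * h1 x) + s * \int[m]_x (f x * h2 x).
Proof.
move=> i1 i2; rewrite -(RintZ s i2) -(RintD i1 (intgZ s i2)).
by apply: eq_Rintegral => x _; ring.
Qed.

Let eqR (m : {measure set (measurableTypeR R * measurableTypeR R) -> \bar R}) f h :
  (forall x, f x = h x) -> \int[m]_x f x = \int[m]_x h x.
Proof. by move=> /funext ->. Qed.

Let cos_alg (A1 A2 B1 B2 C1 C2 : R) : A1 + B1 = C1 -> A2 + B2 = C2 ->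
  (A1 + (-1) * A2) + (B1 + (-1) * B2) = C1 + (-1) * C2.
Proof. by move=> <- <-; ring. Qed.

Let sin_alg (A1 A2 B1 B2 C1 C2 : R) : A1 + B1 = C1 -> A2 + B2 = C2 ->
  (A1 + 1 * A2) + (B1 + 1 * B2) = C1 + 1 * C2.
Proof. by move=> <- <-; ring. Qed.

(** The cosine of the inner product is a difference of two separable products, and [trace_by_parts]
    applies to each. *)
Lemma trace_ctr k w g al : is_trace w g ->
  ctr (wderiv k w) al = crd k al * str w al +
    \int[boundary_measure]_x (g x * (cos (dot al x) * unit_normal k x)).
Proof.
move=> wg; have [hw /Lfun2P sg _] := wg.
have [/L2P sw /L2P sv _] := wderivP k hw.
have H1 := trace_by_parts k wg (sc al.1) (sc al.2) (dc al.1) (dc al.2) (sdc _) (sdc _).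
have H2 := trace_by_parts k wg (ss al.1) (ss al.2) (ds al.1) (ds al.2) (sds _) (sds _).
have bi (a b : R -> R) : smooth1 a -> smooth1 b ->
    intg boundary_measure (fun x => g x * (tens a b x * unit_normal k x)).
  move=> sa sb; apply: sqint_mul => //; apply: (sqint_mulb (M := 1)).
  - by apply: sqint_boundary_continuous; exact: ct.
  - exact: measurable_unit_normal.
  - exact: unit_normal_le1.
have H := cos_alg H1 H2.
rewrite -(RintO2 (-1) (intg_mul_continuous sv (ct (sc _) (sc _))) (intg_mul_continuous sv (ct (ss
  _) (ss _)))) in H.
rewrite -(RintO2 (-1) (intg_mul_continuous sw (cdt (k := k) (sc _) (sc _) (sdc _) (sdc _)))
   (intg_mul_continuous sw (cdt (k := k) (ss _) (ss _) (sds _) (sds _)))) in H.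
rewrite -(RintO2 (-1) (bi _ _ (sc _) (sc _)) (bi _ _ (ss _) (ss _))) in H.
have E1 : ctr (wderiv k w) al = \int[lebO]_x (wderiv k w x * (tens (fun y => cos (al.1 * y)) (fun y
  => cos (al.2 * y)) x
    + (-1) * tens (fun y => sin (al.1 * y)) (fun y => sin (al.2 * y)) x)).
  by apply: eqR => x; rewrite cosE mulN1r.
have E2 : - (crd k al * str w al) = \int[lebO]_x (w x *
   (tens_deriv k (fun y => cos (al.1 * y)) (dcos al.1) (fun y => cos (al.2 * y)) (dcos al.2) x
   + (-1) * tens_deriv k (fun y => sin (al.1 * y)) (dsin al.1) (fun y => sin (al.2 * y)) (dsin
     al.2) x)).
  rewrite -mulNr -(RintZ _ (intg_sin_dot al sw)); apply: eqR => x.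
  by rewrite mulN1r -dcosE; ring.
rewrite -E1 -E2 in H.
have E3 : \int[boundary_measure]_x (g x * (cos (dot al x) * unit_normal k x)) =
  \int[boundary_measure]_x (g x * (tens (fun y => cos (al.1 * y)) (fun y => cos (al.2 * y)) x *
    unit_normal k x
    + (-1) * (tens (fun y => sin (al.1 * y)) (fun y => sin (al.2 * y)) x * unit_normal k x))).
  by apply: eqR => x; rewrite cosE; ring.
by rewrite E3 -H; ring.
Qed.

Lemma trace_str k w g al : is_trace w g ->
  str (wderiv k w) al = - (crd k al * ctr w al) +
    \int[boundary_measure]_x (g x * (sin (dot al x) * unit_normal k x)).
Proof.
move=> wg; have [hw /Lfun2P sg _] := wg.
have [/L2P sw /L2P sv _] := wderivP k hw.
have H1 := trace_by_parts k wg (ss al.1) (sc al.2) (ds al.1) (dc al.2) (sds _) (sdc _).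
have H2 := trace_by_parts k wg (sc al.1) (ss al.2) (dc al.1) (ds al.2) (sdc _) (sds _).
have bi (a b : R -> R) : smooth1 a -> smooth1 b ->
    intg boundary_measure (fun x => g x * (tens a b x * unit_normal k x)).
  move=> sa sb; apply: sqint_mul => //; apply: (sqint_mulb (M := 1)).
  - by apply: sqint_boundary_continuous; exact: ct.
  - exact: measurable_unit_normal.
  - exact: unit_normal_le1.
have H := sin_alg H1 H2.
rewrite -(RintO2 1 (intg_mul_continuous sv (ct (ss _) (sc _))) (intg_mul_continuous sv (ct (sc _)
  (ss _)))) in H.
rewrite -(RintO2 1 (intg_mul_continuous sw (cdt (k := k) (ss _) (sc _) (sds _) (sdc _)))
   (intg_mul_continuous sw (cdt (k := k) (sc _) (ss _) (sdc _) (sds _)))) in H.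
rewrite -(RintO2 1 (bi _ _ (ss _) (sc _)) (bi _ _ (sc _) (ss _))) in H.
have E1 : str (wderiv k w) al = \int[lebO]_x (wderiv k w x * (tens (fun y => sin (al.1 * y)) (fun y
  => cos (al.2 * y)) x
    + 1 * tens (fun y => cos (al.1 * y)) (fun y => sin (al.2 * y)) x)).
  by apply: eqR => x; rewrite sinE mul1r.
have E2 : crd k al * ctr w al = \int[lebO]_x (w x *
   (tens_deriv k (fun y => sin (al.1 * y)) (dsin al.1) (fun y => cos (al.2 * y)) (dcos al.2) x
   + 1 * tens_deriv k (fun y => cos (al.1 * y)) (dcos al.1) (fun y => sin (al.2 * y)) (dsin al.2)
     x)).
  rewrite -(RintZ _ (intg_cos_dot al sw)); apply: eqR => x.
  by rewrite mul1r -dsinE; ring.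
rewrite -E1 -E2 in H.
have E3 : \int[boundary_measure]_x (g x * (sin (dot al x) * unit_normal k x)) =
  \int[boundary_measure]_x (g x * (tens (fun y => sin (al.1 * y)) (fun y => cos (al.2 * y)) x *
    unit_normal k x
    + 1 * (tens (fun y => cos (al.1 * y)) (fun y => sin (al.2 * y)) x * unit_normal k x))).
  by apply: eqR => x; rewrite sinE; ring.
by rewrite E3 -H; ring.
Qed.

Lemma trace0_str k w al : is_trace w (cst 0) -> str (wderiv k w) al = - (crd k al * ctr w al).
Proof.
move=> /(trace_str k al) ->; rewrite [X in _ + X](_ : _ = 0) ?addr0//.
by rewrite -[RHS](Rint_zero (@boundary_measure R)); apply: eqR => x; rewrite mul0r.
Qed.

Lemma test_uniq_ctr v al : sqint lebO v ->
  (forall a b, test1 a -> test1 b -> \int[lebO]_x (v x * tens a b x) = 0) -> ctr v al = 0.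
Proof.
move=> sv H; have U a b := test_uniq sv H (a := a) (b := b).
have := RintO2 (-1) (intg_mul_continuous sv (ct (sc al.1) (sc al.2)))
  (intg_mul_continuous sv (ct (ss al.1) (ss al.2))).
rewrite (U _ _ (sc al.1) (sc al.2)) (U _ _ (ss al.1) (ss al.2)) mulr0 addr0 => <-.
by apply: eqR => x; rewrite cosE mulN1r.
Qed.

End trigonometric_pairing.

Lemma big_ord2 (V : nmodType) (G : 'I_2 -> V) : \sum_(k < 2) G k = G 0 + G 1.
Proof. by rewrite big_ord_recl big_ord1; congr (G _ + G _); exact: val_inj. Qed.

(** * The Lame operator under the cosine transform *)

Section elasticity.
Context (R : realType).
Variables (lam mu : R).
Implicit Types (f g h : R * R -> R) (al x : R * R) (k j : 'I_2) (w : 'I_2 -> R * R -> R).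

Lemma is_wderiv_sqint k f g : is_wderiv k f g -> sqint lebO f /\ sqint lebO g.
Proof. by case=> /L2P sf /L2P sg _. Qed.

Lemma is_wderiv_lin k (r s : R) f g f' g' : is_wderiv k f g -> is_wderiv k f' g' ->
  is_wderiv k (fun x => r * f x + s * f' x) (fun x => r * g x + s * g' x).
Proof.
move=> W W'; have [sf sg] := is_wderiv_sqint W.
have z : sqint lebO (cst 0 : R * R -> R) by apply: sqint_continuous; exact: cst_continuous.
have W0 : is_wderiv k (cst 0 : R * R -> R) (cst 0).
  split; [exact/L2P|exact/L2P|move=> h th].
  rewrite [X in _ = - X](_ : _ = 0) ?oppr0.
    by rewrite -[RHS](Rint_zero (@lebO R)); apply: eq_Rintegral => x _; rewrite mul0r.
  by rewrite -[RHS](Rint_zero (@lebO R)); apply: eq_Rintegral => x _; rewrite mul0r.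
have := is_wderivD s (is_wderivD r W0 W) W'.
congr is_wderiv; apply/funext => x /=; by rewrite add0r.
Qed.

Variable w : 'I_2 -> R * R -> R.
Hypothesis wH2 : forall j, H2 (w j).

Let A k i := wderiv k (w i).
Let hA k i : H1 (A k i). Proof. by have [_ H] := wH2 i; exact: H. Qed.
Let wA k i : is_wderiv k (w i) (A k i). Proof. by have [hw _] := wH2 i; exact: wderivP. Qed.
Let wB l k i : is_wderiv l (A k i) (wderiv l (A k i)). Proof. exact: (wderivP l (hA k i)). Qed.
Let sA k i : sqint lebO (A k i). Proof. by have [] := is_wderiv_sqint (wA k i). Qed.
Let sB l k i : sqint lebO (wderiv l (A k i)). Proof. by have [] := is_wderiv_sqint (wB l k i). Qed.

Let one2 (p q : R) : p + q = 1 * p + 1 * q. Proof. by rewrite !mul1r. Qed.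

Lemma divergenceE x : divergence w x = 1 * A 0 0 x + 1 * A 1 1 x.
Proof. exact: (etrans (big_ord2 (fun k => A k k x)) (one2 _ _)). Qed.

Lemma laplacianE j x : laplacian (w j) x = 1 * wderiv 0 (A 0 j) x + 1 * wderiv 1 (A 1 j) x.
Proof. exact: (etrans (big_ord2 (fun k => wderiv k (A k j) x)) (one2 _ _)). Qed.

Let wdiv k : is_wderiv k (divergence w) (wderiv k (divergence w)).
Proof.
apply: wderivP; split.
  have [/L2P sd _] := is_wderiv_sqint (is_wderiv_lin 1 1 (wB 0 0 0) (wB 0 1 1)).
  by congr L2: sd; apply/funext => x; rewrite divergenceE.
move=> i; exists (fun x => 1 * wderiv i (A 0 0) x + 1 * wderiv i (A 1 1) x).
have := is_wderiv_lin 1 1 (wB i 0 0) (wB i 1 1).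
by congr is_wderiv; apply/funext => x; rewrite divergenceE.
Qed.

Let sdiv : sqint lebO (divergence w). Proof. by have [] := is_wderiv_sqint (wdiv 0). Qed.

Definition lame_op j x := mu * laplacian (w j) x + (lam + mu) * wderiv j (divergence w) x.

Lemma sqint_lame_op j : sqint lebO (lame_op j).
Proof.
have sl : sqint lebO (laplacian (w j)).
  have := sqintD (sqintZ 1 (sB 0 0 j)) (sqintZ 1 (sB 1 1 j)).
  by congr sqint; apply/funext => x; rewrite laplacianE.
have [_ sd] := is_wderiv_sqint (wdiv j).
exact: (sqintD (sqintZ mu sl) (sqintZ (lam + mu) sd)).
Qed.

Hypothesis hsigma : forall j, H1 (sigma lam mu j w).
Hypothesis htau : H1 (tau mu w).

Definition other j : 'I_2 := if j == 0 then 1 else 0.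

(** The j-th component of the divergence of the stress tensor: the form of the operator whose
    integration by parts produces the traction. *)
Definition stress_div j x := wderiv j (sigma lam mu j w) x + wderiv (other j) (tau mu w) x.

Lemma sqint_stress_div j : sqint lebO (stress_div j).
Proof.
have [_ s1] := is_wderiv_sqint (wderivP j (hsigma j)).
have [_ s2] := is_wderiv_sqint (wderivP (other j) htau).
exact: (sqintD s1 s2).
Qed.

Let pairing_lin (r s : R) f g h : sqint lebO f -> sqint lebO g -> continuous h ->
  \int[lebO]_x ((r * f x + s * g x) * h x) =
  r * \int[lebO]_x (f x * h x) + s * \int[lebO]_x (g x * h x).
Proof.
move=> sf sg ch; have i1 := intg_mul_continuous sf ch; have i2 := intg_mul_continuous sg ch.
rewrite -(RintZ r i1) -(RintZ s i2) -(RintD (intgZ r i1) (intgZ s i2)).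
by apply: eq_Rintegral => x _; ring.
Qed.

Let pairing_ext f g h : (forall x, f x = g x) ->
  \int[lebO]_x (f x * h x) = \int[lebO]_x (g x * h x).
Proof. by move=> /funext ->. Qed.

Let pairing (r s p q : R) f g h F : (forall x, F x = r * f x + s * g x) ->
  sqint lebO f -> sqint lebO g -> continuous h ->
  \int[lebO]_x (f x * h x) = p -> \int[lebO]_x (g x * h x) = q ->
  \int[lebO]_x (F x * h x) = r * p + s * q.
Proof. by move=> E sf sg ch <- <-; rewrite -(pairing_lin r s sf sg ch); exact: pairing_ext. Qed.

Let ct a b : smooth1 a -> smooth1 b -> continuous (@tens R a b).
Proof. exact: smooth1_tens_continuous. Qed.

Section testing.
Variables (a b da db : R -> R).
Hypotheses (ta : test1 a) (tb : test1 b) (tda : test1 da) (tdb : test1 db).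
Hypotheses (Ha : forall y, dv a y (da y)) (Hb : forall y, dv b y (db y)).

Let D k := tens_deriv k a da b db.
Let cD k : continuous (D k).
Proof. by rewrite /D /tens_deriv; case: eqP => _; apply: ct;
  [case: tda|case: tb|case: ta|case: tdb]. Qed.
Let cT : continuous (tens a b). Proof. by apply: ct; [case: ta|case: tb]. Qed.
Let Y k i l : R := \int[lebO]_x (A k i x * D l x).

Let pB l k i : \int[lebO]_x (wderiv l (A k i) x * tens a b x) = - Y k i l.
Proof. by rewrite /Y (is_wderiv_tens (wB l k i) ta tb Ha Hb) opprK. Qed.

(** Both sides are minus the integral of w_i against the mixed second derivative of the test
    function. *)
Let Ysym i : Y 1 i 0 = Y 0 i 1.
Proof.
have [[sda _] [sdb _]] := (tda, tdb).
have [a' _ Ha'] := smooth1_deriv sda; have [b' _ Hb'] := smooth1_deriv sdb.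
have E1 := is_wderiv_tens (wA 1 i) tda tb Ha' Hb.
have E0 := is_wderiv_tens (wA 0 i) ta tdb Ha Hb'.
by apply: oppr_inj; rewrite /Y /D /tens_deriv /= in E0 E1 *; rewrite -E0 -E1.
Qed.

Let alg0 (l m y000 y101 y001 y110 y111 : R) : y110 = y001 ->
  m * (1 * (- y000) + 1 * (- y101)) + (l + m) * (- (1 * y000 + 1 * y110)) =
  - (l * (1 * y000 + 1 * y110) + 2 * m * y000) + - (m * y101 + m * y001).
Proof. by move=> ->; ring. Qed.

Let alg1 (l m y010 y111 y001 y100 : R) : y001 = y100 ->
  m * (1 * (- y010) + 1 * (- y111)) + (l + m) * (- (1 * y001 + 1 * y111)) =
  - (l * (1 * y001 + 1 * y111) + 2 * m * y111) + - (m * y100 + m * y010).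
Proof. by move=> ->; ring. Qed.

Let lapP j : \int[lebO]_x (laplacian (w j) x * tens a b x) =
  1 * (- Y 0 j 0) + 1 * (- Y 1 j 1).
Proof.
exact: (pairing (laplacianE j) (sB 0 0 j) (sB 1 1 j) cT (pB 0 0 j) (pB 1 1 j)).
Qed.

Let divP l : \int[lebO]_x (divergence w x * D l x) = 1 * Y 0 0 l + 1 * Y 1 1 l.
Proof. by rewrite (pairing_ext _ divergenceE) (pairing_lin 1 1 (sA 0 0) (sA 1 1) (@cD l)). Qed.

Let ddivP l : \int[lebO]_x (wderiv l (divergence w) x * tens a b x) = - (1 * Y 0 0 l + 1 * Y 1 1 l).
Proof. by rewrite -divP /D (is_wderiv_tens (wdiv l) ta tb Ha Hb) opprK. Qed.

Let slap j : sqint lebO (laplacian (w j)).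
Proof.
have := sqintD (sqintZ 1 (sB 0 0 j)) (sqintZ 1 (sB 1 1 j)).
by congr sqint; apply/funext => x; rewrite laplacianE.
Qed.

Let lameP j : \int[lebO]_x (lame_op j x * tens a b x) =
  mu * (1 * (- Y 0 j 0) + 1 * (- Y 1 j 1)) + (lam + mu) * (- (1 * Y 0 0 j + 1 * Y 1 1 j)).
Proof.
have [_ sd] := is_wderiv_sqint (wdiv j).
by rewrite (pairing_lin mu (lam + mu) (slap j) sd cT) lapP ddivP.
Qed.

Let sigmaP j : \int[lebO]_x (sigma lam mu j w x * D j x) =
  lam * (1 * Y 0 0 j + 1 * Y 1 1 j) + 2 * mu * Y j j j.
Proof. by rewrite (pairing_lin lam (2 * mu) sdiv (sA j j) (@cD j)) divP. Qed.

Let tauP k : \int[lebO]_x (tau mu w x * D k x) = mu * Y 1 0 k + mu * Y 0 1 k.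
Proof.
rewrite -(pairing_lin mu mu (sA 1 0) (sA 0 1) (@cD k)); apply: pairing_ext => x.
exact: mulrDr.
Qed.

Let stressP j : \int[lebO]_x (stress_div j x * tens a b x) =
  - (lam * (1 * Y 0 0 j + 1 * Y 1 1 j) + 2 * mu * Y j j j)
  + - (mu * Y 1 0 (other j) + mu * Y 0 1 (other j)).
Proof.
have W1 := wderivP j (hsigma j); have W2 := wderivP (other j) htau.
have [_ s1] := is_wderiv_sqint W1; have [_ s2] := is_wderiv_sqint W2.
have P1 := is_wderiv_tens W1 ta tb Ha Hb; have P2 := is_wderiv_tens W2 ta tb Ha Hb.
have E1 := etrans (esym (opprK _)) (f_equal -%R (etrans (esym P1) (sigmaP j))).
have E2 := etrans (esym (opprK _)) (f_equal -%R (etrans (esym P2) (tauP (other j)))).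
exact: (etrans (pairing (fun x => one2 _ _) s1 s2 cT E1 E2) (esym (one2 _ _))).
Qed.

Lemma lame_stress_tens j : \int[lebO]_x (lame_op j x * tens a b x) =
  \int[lebO]_x (stress_div j x * tens a b x).
Proof.
rewrite lameP stressP; elim/ord2P: j; rewrite /other /=.
  exact: alg0 (Ysym 1).
exact: alg1 (esym (Ysym 0)).
Qed.

End testing.

(** Formally the two operators agree by commuting mixed derivatives. Since weak derivatives are
    fixed only up to null sets, the agreement is obtained by testing and carried to the transforms
    by [test_uniq_ctr]. *)
Lemma ctr_lame_stress j al : ctr (lame_op j) al = ctr (stress_div j) al.
Proof.
have sl := sqint_lame_op j; have ss := sqint_stress_div j.
have := ctr_lin 1 (-1) al sl ss; rewrite test_uniq_ctr.
- by rewrite mul1r mulN1r => /esym/eqP; rewrite subr_eq0 => /eqP.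
- exact: (sqintD (sqintZ 1 sl) (sqintZ (-1) ss)).
move=> a b ta tb; have [[sa _] [sb _]] := (ta, tb).
have [a' sa' Ha] := smooth1_deriv sa; have [b' sb' Hb] := smooth1_deriv sb.
have ca := ct sa sb.
have E := lame_stress_tens ta tb (test1_deriv ta sa' Ha) (test1_deriv tb sb' Hb) Ha Hb j.
rewrite (pairing_lin 1 (-1) sl ss ca) E;
  exact: (etrans (f_equal2 _ (mul1r _) (mulN1r _)) (subrr _)).
Qed.

Hypothesis clamp : forall j, is_trace (w j) (cst 0).

Let str_div al : str (divergence w) al =
  1 * (- (crd 0 al * ctr (w 0) al)) + 1 * (- (crd 1 al * ctr (w 1) al)).
Proof.
rewrite -(trace0_str 0 al (clamp 0)) -(trace0_str 1 al (clamp 1)).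
by rewrite -(str_lin 1 1 al (sA 0 0) (sA 1 1)); apply: str_ext; exact: divergenceE.
Qed.

Let str_sigma j al : str (sigma lam mu j w) al =
  lam * (1 * (- (crd 0 al * ctr (w 0) al)) + 1 * (- (crd 1 al * ctr (w 1) al)))
  + 2 * mu * (- (crd j al * ctr (w j) al)).
Proof.
rewrite -str_div -(trace0_str j al (clamp j)).
exact: (str_lin lam (2 * mu) al sdiv (sA j j)).
Qed.

Let str_tau al : str (tau mu w) al =
  mu * (- (crd 1 al * ctr (w 0) al)) + mu * (- (crd 0 al * ctr (w 1) al)).
Proof.
rewrite -(trace0_str 1 al (clamp 0)) -(trace0_str 0 al (clamp 1)).
by rewrite -(str_lin mu mu al (sA 1 0) (sA 0 1)); apply: str_ext => x; exact: mulrDr.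
Qed.

Let transform_alg0 (l m p q U V x y z L M S N : R) : L = p * S + x -> M = q * N + y ->
  S = l * (1 * (- (p * U)) + 1 * (- (q * V))) + 2 * m * (- (p * U)) ->
  N = m * (- (q * U)) + m * (- (p * V)) -> x + y = z -> L + M =
  - ((l + m) * p * (p * U + q * V) + m * (p ^+ 2 + q ^+ 2) * U) + z.
Proof. by move=> -> -> -> -> <-; ring. Qed.

Let transform_alg1 (l m p q U V x y z L M S N : R) : L = q * S + x -> M = p * N + y ->
  S = l * (1 * (- (p * U)) + 1 * (- (q * V))) + 2 * m * (- (q * V)) ->
  N = m * (- (q * U)) + m * (- (p * V)) -> x + y = z -> L + M =
  - ((l + m) * q * (p * U + q * V) + m * (p ^+ 2 + q ^+ 2) * V) + z.
Proof. by move=> -> -> -> -> <-; ring. Qed.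

(** Two integrations by parts: the first takes the derivatives off the stress and leaves the
    traction, the second takes them off w and leaves no boundary term since w is clamped. What
    remains is the symbol of the operator. *)
Lemma ctr_lame_op (s : 'I_2 -> R * R -> R) r X j al :
  (forall k, is_trace (sigma lam mu k w) (s k)) -> is_trace (tau mu w) r ->
  (\forall x \ae boundary_measure, unit_normal j x * s j x + unit_normal (other j) x * r x = X x) ->
  ctr (lame_op j) al =
  - ((lam + mu) * crd j al * (crd 0 al * ctr (w 0) al + crd 1 al * ctr (w 1) al)
     + mu * (crd 0 al ^+ 2 + crd 1 al ^+ 2) * ctr (w j) al)
  + \int[boundary_measure]_x (X x * cos (dot al x)).
Proof.
move=> ts tr HX; rewrite ctr_lame_stress.
have W1 := wderivP j (hsigma j); have W2 := wderivP (other j) htau.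
have [_ s1] := is_wderiv_sqint W1; have [_ s2] := is_wderiv_sqint W2.
have -> : ctr (stress_div j) al = ctr (wderiv j (sigma lam mu j w)) al + ctr (wderiv (other j) (tau
  mu w)) al.
  apply: etrans (esym (one2 _ _)); apply: etrans (ctr_lin 1 1 al s1 s2).
  by apply: ctr_ext => x; exact: one2.
have bint (f g : R * R -> R) k : is_trace f g ->
    intg boundary_measure (fun x => g x * (cos (dot al x) * unit_normal k x)).
  move=> [_ /Lfun2P sg _]; apply: sqint_mul => //; apply: (sqint_mulb (M := 1)).
  - by apply: sqint_boundary_continuous; exact: continuous_cos_dot.
  - exact: measurable_unit_normal.
  - exact: unit_normal_le1.
have HB : \int[boundary_measure]_x (s j x * (cos (dot al x) * unit_normal j x)) +
  \int[boundary_measure]_x (r x * (cos (dot al x) * unit_normal (other j) x)) =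
  \int[boundary_measure]_x (X x * cos (dot al x)).
  rewrite -(RintD (bint _ _ j (ts j)) (bint _ _ (other j) tr)).
  apply: Rint_ae_eq; apply: aeS HX => x <-.
  ring.
have TS := trace_ctr j al (ts j); have TT := trace_ctr (other j) al tr.
have SS := str_sigma j al; have ST := str_tau al.
move: TS TT SS ST HB; clear W1 W2 s1 s2 HX; elim/ord2P: j.
  exact: transform_alg0.
exact: transform_alg1.
Qed.

End elasticity.

(** * From L^2-valued evolution to scalar functions of time *)

Section time_evolution.
Context (R : realType).
Implicit Types (v w : R -> R * R -> R) (al : R * R) (f g : R * R -> R).

(** The cosine is bounded by 1 and Omega has measure 1, so each frequency is a contraction from L^2
    to the reals; continuity and derivatives in time descend through it. *)
Lemma ctr_le_normL2 f al : sqint lebO f -> (`|ctr f al|%:E <= normL2 f)%E.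
Proof.
move=> sf; have sc : sqint lebO (fun x : R * R => cos (dot al x)).
  by apply: sqint_continuous; exact: continuous_cos_dot.
apply: (le_trans (Rint_le_Lnorm2 sf sc)).
rewrite -[leRHS]mule1; apply: lee_pmul => //; first exact: Lnorm_ge0.
rewrite lee_fin -[leRHS]sqrtr1; apply: ler_wsqrtr.
have H x : cos (dot al x) ^+ 2 <= (cst 1 : R * R -> R) x.
  by rewrite -(cos2Dsin2 (dot al x)) lerDl sqr_ge0.
apply: le_trans (Rint_le (proj2 sc) (intg_cst (lebO_fin R) 1) H) _.
by rewrite /cst Rintegral_cst// lebO_setT mul1r.
Qed.

Lemma cvg_le_ereal {I : Type} (F : set_system I) {FF : Filter F} (r : I -> R)
  (N : I -> \bar R) (l : R) : N @ F --> 0%E ->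
  (\forall i \near F, (`|r i - l|%:E <= N i)%E) -> r @ F --> l.
Proof.
move=> N0 rN; apply/cvgrPdist_lt => e e0.
have Ne : \forall i \near F, (N i < e%:E)%E.
  apply: (N0 [set y | (y < e%:E)%E]); apply: open_nbhs_nbhs.
  by split; [exact: open_ereal_lt_ereal|rewrite /= lte_fin].
apply: filterS2 rN Ne => i H1 H2.
by rewrite distrC -lte_fin; exact: le_lt_trans H1 H2.
Qed.

Variable T : R.
Hypothesis T0 : 0 < T.

(** Extends functions on [0, T] continuously to the whole line, so that continuity and measurability
    need no restriction to a subspace. *)
Definition clamp_time (t : R) : R := Num.max 0 (Num.min t T).

Lemma clamp_timeP t : `[0, T]%classic (clamp_time t).
Proof. by rewrite /clamp_time /= in_itv /= le_max lexx /= ge_max (ltW T0) ge_min lexx orbT. Qed.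

Lemma clamp_time_id t : 0 <= t <= T -> clamp_time t = t.
Proof. by move=> /andP[t0 tT]; rewrite /clamp_time (min_idPl tT) (max_idPr t0). Qed.

Lemma clamp_time_continuous : continuous clamp_time.
Proof.
move=> t; apply: (@continuous_max _ _ (cst 0 : R -> R^o) (id \min cst T : R -> R^o)).
  exact: cst_continuous.
by apply: continuous_min; [exact: cvg_id|exact: cst_continuous].
Qed.

Lemma ctrB f g al : sqint lebO f -> sqint lebO g ->
  ctr (fun x => f x - g x) al = ctr f al - ctr g al.
Proof.
move=> sf sg; rewrite -(RintB (intg_cos_dot al sf) (intg_cos_dot al sg)).
by apply: eq_Rintegral => x _; rewrite mulrBl.
Qed.

Lemma C0L2_ctr v al : C0L2 T v -> continuous (fun t => ctr (v (clamp_time t)) al).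
Proof.
move=> cv t; have [/L2P sv Hv] := cv _ (clamp_timeP t).
have L : clamp_time s @[s --> t] --> within `[0, T]%classic (nbhs (clamp_time t)).
  move=> P HP; have H := @clamp_time_continuous t _ HP.
  apply: (@filterS _ (nbhs t) _ (fun s => `[0, T]%classic (clamp_time s) -> P (clamp_time s)) _ _
    H).
  by move=> s; apply; exact: clamp_timeP.
have L2' := cvg_comp _ _ L Hv.
apply: (cvg_le_ereal L2'); near=> s.
have [/L2P ss _] := cv _ (clamp_timeP s).
by rewrite -(ctrB al ss sv); apply: ctr_le_normL2; exact: sqintB.
Unshelve. all: by end_near. Qed.

Lemma tderiv_ctr v w al (t : R) : is_tderiv T v w -> C0L2 T v -> 0 < t < T ->
  dv (fun s => ctr (v (clamp_time s)) al) t (ctr (w (clamp_time t)) al).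
Proof.
move=> dvw cv /andP[t0 tT].
have tI : `[0, T]%classic t by rewrite /= in_itv /= !ltW.
have tc : clamp_time t = t by apply: clamp_time_id; rewrite !ltW.
have [/L2P sw Hw] := dvw t tI; have [/L2P sv _] := cv t tI.
have near_in : \forall h \near (0 : R)^', 0 < t + h < T.
  have m0 : 0 < Num.min t (T - t) by rewrite lt_min t0 subr_gt0.
  apply: filterS (dnbhs0_lt m0) => h; rewrite lt_min !ltr_norml => /andP[/andP[h1 _] /andP[_ h2]];
    lra.
have L : h^-1 *: (ctr (v (clamp_time (h *: 1 + t))) al - ctr (v (clamp_time t)) al)
    @[h --> (0 : R)^'] --> ctr (w (clamp_time t)) al.
  have Hw' : normL2 (fun x => h^-1 * (v (t + h) x - v t x) - w t x) @[h --> (0 : R)^'] --> 0%E.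
    move=> P HP; have := Hw P HP; apply: filterS2 near_in => h /andP[h0 hT]; apply.
    by rewrite /= in_itv /= !ltW.
  apply: (cvg_le_ereal Hw'); apply: filterS near_in => h /andP[h0 hT].
  have thI : `[0, T]%classic (t + h) by rewrite /= in_itv /= !ltW.
  have [/L2P svh _] := cv _ thI.
  have -> : h *: 1 + t = t + h by rewrite addrC /GRing.scale /= mulr1.
  rewrite tc (clamp_time_id _) ?(ltW h0) ?(ltW hT)// /GRing.scale /= -(ctrB al svh sv).
  have sd : sqint lebO (fun x => h^-1 * (v (t + h) x - v t x)).
    exact: (sqintZ h^-1 (sqintB svh sv)).
  have -> : h^-1 * ctr (fun x => v (t + h) x - v t x) al = ctr (fun x => h^-1 * (v (t + h) x - v t
    x)) al.
    rewrite -(RintZ _ (intg_cos_dot al (sqintB svh sv))).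
    by apply: eq_Rintegral => x _; rewrite mulrA.
  by rewrite -(ctrB al sd sw); apply: ctr_le_normL2; exact: sqintB.
split; first by apply/cvg_ex; exists (ctr (w (clamp_time t)) al).
by apply: cvg_lim.
Qed.

Lemma Rint_lebT (g : R -> R) : measurable_fun setT g ->
  \int[lebT T]_x g x = \int[lebesgue_measure]_(x in `[0, T]) g x.
Proof.
move=> mg; have mg' : measurable_fun setT (EFin \o g) by exact/measurable_EFinP.
rewrite /Rintegral; congr fine; rewrite (integral_mrestr _ (measurable_interval T) mg').
by apply/esym; apply: (@integral_itv_bndoo R 0 T (EFin \o g) true false); exact: measurable_funTS.
Qed.

Lemma Rint_lebT_FTC (F dF : R -> R) : continuous F -> continuous dF ->
  (forall t, 0 < t < T -> dv F t (dF t)) -> \int[lebT T]_t dF t = F T - F 0.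
Proof.
move=> cF cdF FdF; rewrite Rint_lebT; last exact: continuous_measurable_fun.
rewrite /Rintegral (@continuous_FTC2 _ dF F 0 T T0)//.
- exact: continuous_subspaceT.
- split.
  + by move=> x; rewrite in_itv => /FdF/dv_derivable.
  + by apply: cvg_at_right_filter; exact: cF.
  + by apply: cvg_at_left_filter; exact: cF.
- by move=> x; rewrite in_itv => /FdF/dv_val.
Qed.

Lemma intg_lebT_continuous (g : R -> R) : continuous g -> intg (lebT T) g.
Proof.
move=> cg; have mg := continuous_measurable_fun cg.
have mg' : measurable_fun setT (fun x => `|(g x)%:E|%E).
  by apply: measurableT_comp => //; exact/measurable_EFinP.
have /integrableP[_ H] := @continuous_intg_oo R g 0 T cg.
apply/integrableP; split; first exact/measurable_EFinP.
rewrite (integral_mrestr _ (measurable_interval T) mg'); apply: le_lt_trans H.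
apply: ge0_subset_integral => //; first exact: measurable_funTS.
by move=> x; rewrite /= !in_itv /= => /andP[? ?]; rewrite !ltW.
Qed.

Let rho (t : measurableTypeR R) : measurableTypeR R := T - t.

Let mrho : measurable_fun setT rho.
Proof. by apply: measurable_funB => //; exact: measurable_cst. Qed.

Let rho_lebesgue (B : set R) : measurable B ->
  lebesgue_measure B = lebesgue_measure (rho @^-1` B).
Proof.
move=> mB.
rewrite -[RHS]/(pushforward lebesgue_measure rho B).
apply: lebesgue_measure_unique => //= _ [[a b]] _ <-.
rewrite /pushforward /=.
have -> : rho @^-1` `]a, b]%classic = `[T - b, T - a[%classic.
  by apply/seteqP; split => x; rewrite /= !in_itv /= /rho => /andP[? ?]; apply/andP; split; lra.
rewrite !lebesgue_measure_itv /= !lte_fin.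
by rewrite ltrD2l ltrN2 -!EFinD; congr (if _ then _%:E else _); ring.
Qed.

Let rho_lebT (B : set R) : measurable B -> lebT T B = pushforward (lebT T) rho B.
Proof.
move=> mB; rewrite /pushforward /=.
rewrite -[LHS]/(lebesgue_measure (B `&` `]0, T[)) -[RHS]/(lebesgue_measure (rho @^-1` B `&` `]0,
  T[)).
rewrite rho_lebesgue; last by apply: measurableI => //; exact: measurable_itv.
congr lebesgue_measure; apply/seteqP; split => x; rewrite /= !in_itv /= /rho => -[? /andP[? ?]];
  (split; [by []|apply/andP; split; lra]).
Qed.

Lemma Rint_reflect (f : R -> R) : intg (lebT T) f ->
  intg (lebT T) (fun t => f (T - t)) /\ \int[lebT T]_t f (T - t) = \int[lebT T]_t f t.
Proof.
by apply: (Rint_invariant mrho) => B mB; exact/esym/rho_lebT.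
Qed.

End time_evolution.

Section exact_identity.
Context (R : realType).
Variables (T lam mu : R) (u : 'I_2 -> R -> R * R -> R) (f : 'I_2 -> R * R -> R) (I : data R).
Hypotheses (T0 : 0 < T) (dataI : is_data T I) (sol : inverse_solution T lam mu I u f).
Hypotheses (uC2 : forall j, C2L2 T (u j)) (uH2 : forall j, L2H2 T (u j)) (fL2 : forall j, L2 (f j)).

Let sf j : sqint lebO (f j). Proof. exact/L2P. Qed.

Lemma ae_ord2 (S : 'I_2 -> R -> Prop) : (forall j, \forall t \ae lebT T, S j t) ->
  \forall t \ae lebT T, forall j, S j t.
Proof. by move=> H; apply: aeS (aeI (H 0) (H 1)) => t [? ?]; exact: ord2P. Qed.

Lemma ctr_acceleration j al : \forall t \ae lebT T,
  ctr (tderiv T (tderiv T (u j)) t) al =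
  - ((lam + mu) * crd j al * (crd 0 al * ctr (u 0 t) al + crd 1 al * ctr (u 1 t) al)
     + mu * (crd 0 al ^+ 2 + crd 1 al ^+ 2) * ctr (u j t) al)
  + \int[boundary_measure]_x (bX I j t x * cos (dot al x)) + phi I t * ctr (f j) al.
Proof.
have [eqn clp _ trac] := sol.
have hH2 : \forall t \ae lebT T, forall j, H2 (u j t).
  by apply: ae_ord2 => i; have [_ H _] := uH2 i.
apply: aeS (aeI (aeI hH2 (ae_ord2 clp)) (aeI trac (eqn j))) => t [[wH cl] [[s [r [ts tr bx]]] eqj]].
have sl := sqint_lame_op lam mu wH j.
have E1 : ctr (tderiv T (tderiv T (u j)) t) al =
    ctr (fun x => 1 * lame_op lam mu (fun k => u k t) j x + phi I t * f j x) al.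
  apply: Rint_ae_eq; apply: aeS eqj => x ->; congr (_ * _).
  by rewrite mul1r.
rewrite E1 (ctr_lin 1 (phi I t) al sl (sf j)); congr (_ + _).
apply: etrans (mul1r _) _.
have hs k : H1 (sigma lam mu k (fun k => u k t)) by have [] := ts k.
have ht : H1 (tau mu (fun k => u k t)) by have [] := tr.
apply: (ctr_lame_op wH hs ht cl al ts tr).
apply: aeS bx => x [b0 b1]; clear -b0 b1; elim/ord2P: j; [exact: b0|exact: b1].
Qed.

(** The coefficients p form an eigenvector of the symbol of the Lame operator for the eigenvalue (c
    |al|)^2. Two cases will occur: p = al with c = sqrt(lam + 2 mu), the compressional wave, and a
    row of |al|^2 Id - al al^T with c = sqrt mu, the shear wave. Either way the combination of
    transforms is a forced scalar oscillator. *)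
Variables (c : R) (al : R * R) (p : 'I_2 -> R) (P : ('I_2 -> R * R -> R) -> R * R -> R).
Hypothesis PE : forall w x, P w x = p 0 * w 0 x + p 1 * w 1 x.
Hypothesis eigen : forall U : 'I_2 -> R,
  p 0 * ((lam + mu) * crd 0 al * (crd 0 al * U 0 + crd 1 al * U 1)
     + mu * (crd 0 al ^+ 2 + crd 1 al ^+ 2) * U 0) +
  p 1 * ((lam + mu) * crd 1 al * (crd 0 al * U 0 + crd 1 al * U 1)
     + mu * (crd 0 al ^+ 2 + crd 1 al ^+ 2) * U 1) =
  (c * enorm al) ^+ 2 * (p 0 * U 0 + p 1 * U 1).

Let k := c * enorm al.
Let mean (v : 'I_2 -> R -> R * R -> R) (t : R) : R :=
  p 0 * ctr (v 0 (clamp_time T t)) al + p 1 * ctr (v 1 (clamp_time T t)) al.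
Let W := mean u.
Let V := mean (fun j => tderiv T (u j)).
Let Z := mean (fun j => tderiv T (tderiv T (u j))).
Let sn (t : R) : R := sin (k * (T - t)).
Let cs (t : R) : R := cos (k * (T - t)).
(** The Wronskian of [W] with the free oscillation sin(k (T - t)), which vanishes at T. Its
    derivative [dF] retains only the forcing, made of the source and the traction. *)
Let F t := V t * sn t + k * (W t * cs t).
Let dF t := (Z t + k ^+ 2 * W t) * sn t.
Let Fp : R := p 0 * ctr (f 0) al + p 1 * ctr (f 1) al.

Let mean_continuous v : (forall j, C0L2 T (v j)) -> continuous (mean v).
Proof.
move=> cv t; apply: cvgD; apply: cvgM; try exact: cvg_cst.
  exact: (@C0L2_ctr R T T0 _ al (cv 0) t). exact: (@C0L2_ctr R T T0 _ al (cv 1) t).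
Qed.

Let mean_dv v w t : (forall j, C0L2 T (v j)) -> (forall j, is_tderiv T (v j) (w j)) -> 0 < t < T ->
  dv (mean v) t (mean w t).
Proof.
move=> cv dvw tT; apply: dvD; apply: dvZ.
  exact: (tderiv_ctr al (dvw 0) (cv 0) tT). exact: (tderiv_ctr al (dvw 1) (cv 1) tT).
Qed.

Let dk t : dv (fun t => k * (T - t)) t (- k).
Proof. by apply: dv_eq (dvZ k (dvB (dv_cst T t) (dv_id t))) _; rewrite sub0r mulrN1. Qed.

Let dsn t : dv sn t (- k * cs t). Proof. by apply: dv_eq (dv_sin (dk t)) _; rewrite mulrC. Qed.
Let dcs t : dv cs t (k * sn t). Proof. by apply: dv_eq (dv_cos (dk t)) _; rewrite /sn; ring. Qed.
Let csn : continuous sn. Proof. exact: dv_continuous dsn. Qed.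
Let ccs : continuous cs. Proof. exact: dv_continuous dcs. Qed.

Let cW : continuous W. Proof. by apply: mean_continuous => j; have [] := uC2 j. Qed.
Let cV : continuous V. Proof. by apply: mean_continuous => j; have [] := uC2 j. Qed.
Let cZ : continuous Z. Proof. by apply: mean_continuous => j; have [] := uC2 j. Qed.

Let cF : continuous F.
Proof.
move=> t; apply: cvgD; first by apply: cvgM; [exact: cV|exact: csn].
by apply: cvgM; [exact: cvg_cst|apply: cvgM; [exact: cW|exact: ccs]].
Qed.

Let cdF : continuous dF.
Proof.
move=> t; apply: cvgM; last exact: csn.
by apply: cvgD; [exact: cZ|apply: cvgM; [exact: cvg_cst|exact: cW]].
Qed.

Let FdF t : 0 < t < T -> dv F t (dF t).
Proof.
move=> tT.
have dW : dv W t (V t) by apply: mean_dv tT => j; have [] := uC2 j.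
have dV : dv V t (Z t) by apply: mean_dv tT => j; have [] := uC2 j.
apply: dv_eq (dvD (dvM dV (dsn t)) (dvZ k (dvM dW (dcs t)))) _.
by rewrite /dF; ring.
Qed.

Let bt (t : R) : R := \int[boundary_measure]_x (sn t * P (fun k => bX I k t) x * cos (dot al x)).

Let intX j t : L1b (bX I j t) -> intg boundary_measure (fun x => bX I j t x * cos (dot al x)).
Proof.
move=> HX; apply: (intg_mulb (M := 1)).
- by move: HX; rewrite /L1b /= => /Lfun1_integrable.
- by apply: continuous_measurable2; exact: continuous_cos_dot.
- by move=> x; exact: cos_max.
Qed.

Let alg (p0 p1 A0 A1 B0 B1 C0 C1 Z0 Z1 ph s K W0 : R) : Z0 = - A0 + B0 + ph * C0 ->
  Z1 = - A1 + B1 + ph * C1 -> p0 * A0 + p1 * A1 = K * W0 ->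
  (p0 * Z0 + p1 * Z1 + K * W0) * s = ph * s * (p0 * C0 + p1 * C1) + s * (p0 * B0 + p1 * B1).
Proof. by move=> -> -> <-; ring. Qed.

Let dF_ae : \forall t \ae lebT T, dF t = phi I t * sn t * Fp + bt t.
Proof.
have HX : \forall t \ae lebT T, forall j, L1b (bX I j t).
  by apply: ae_ord2 => j; have [_ H] := dataI; have [[_ ? _] _ _ _] := H j.
have HZ := ae_ord2 (fun j => ctr_acceleration j al).
apply: aeS (aeI (aeI HX HZ) (aeT_in T)) => t [[bx Ht] /andP[t0 tT]].
have tc : clamp_time T t = t by apply: clamp_time_id; rewrite !ltW.
have i0 := intX (bx 0); have i1 := intX (bx 1).
have -> : bt t = sn t * (p 0 * \int[boundary_measure]_x (bX I 0 t x * cos (dot al x))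
    + p 1 * \int[boundary_measure]_x (bX I 1 t x * cos (dot al x))).
  rewrite -(RintZ (p 0) i0) -(RintZ (p 1) i1) -(RintD (intgZ (p 0) i0) (intgZ (p 1) i1)).
  rewrite -(RintZ _ (intgD (intgZ (p 0) i0) (intgZ (p 1) i1))).
  by apply: eq_Rintegral => x _; rewrite PE; ring.
rewrite /dF /Z /W /mean tc.
exact: (alg _ (Ht 0) (Ht 1) (eigen (fun j => ctr (u j t) al))).
Qed.

Let alg2 (s V0 K WT co W0 VT J : R) :
  - s * V0 + K * WT - K * co * W0 - (VT * 0 + K * (WT * 1) - (V0 * s + K * (W0 * co)) - J) = J.
Proof. by ring. Qed.

(** The fundamental theorem of calculus for [F] on [0, T]: the end values are the initial and final
    terms of [hgen], and [dF_ae] splits the integral into the source and the boundary term. *)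
Lemma hgen_exact : hgen T c P I al =
  \int[lebT T]_t (phi I (T - t) * sin (c * enorm al * t)) * Fp.
Proof.
have [_ _ ini _] := sol.
have iphi : intg (lebT T) (phi I).
  by have [+ _] := dataI; move=> /Lfun1_integrable.
have isn : intg (lebT T) (fun t => phi I t * sn t).
  apply: (intg_mulb (M := 1)) => //; first exact: continuous_measurable_fun.
  by move=> t; exact: sin_max.
have idF : intg (lebT T) dF by exact: intg_lebT_continuous.
have bE : \int[lebT T]_t bt t = \int[lebT T]_t dF t - \int[lebT T]_t (phi I t * sn t) * Fp.
  rewrite (mulrC _ Fp) -(RintZ Fp isn) -(RintB idF (intgZ Fp isn)).
  by apply: Rint_ae_eq; apply: aeS dF_ae => t ->; ring.
have refl : \int[lebT T]_t (phi I (T - t) * sin (c * enorm al * t)) = \int[lebT T]_t (phi I t * sn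
  t).
  have [_ <-] := Rint_reflect isn.
  by apply: eq_Rintegral => t _; rewrite /sn opprB addrCA subrr addr0.
have clT : clamp_time T T = T by apply: clamp_time_id; rewrite lexx ltW.
have cl0 : clamp_time T 0 = 0 by apply: clamp_time_id; rewrite lexx ltW.
have E (w w' : 'I_2 -> R * R -> R) : (forall j, sqint lebO (w j)) ->
    (forall j, \forall x \ae lebO, w j x = w' j x) ->
    \int[lebO]_x (P w' x * cos (dot al x)) = p 0 * ctr (w 0) al + p 1 * ctr (w 1) al.
  move=> sw ww'.
  rewrite -(ctr_lin (p 0) (p 1) al (sw 0) (sw 1)); apply: Rint_ae_eq.
  by apply: aeS (aeI (ww' 0) (ww' 1)) => x [e0 e1]; rewrite PE e0 e1.
have TI : `[0, T]%classic T by rewrite /= in_itv /= lexx ltW.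
have OI : `[0, T]%classic 0 by rewrite /= in_itv /= lexx ltW.
have su j t : `[0, T]%classic t -> sqint lebO (u j t).
  by move=> tI; have [H _ _ _ _] := uC2 j; have [/L2P] := H t tI.
have sdu j : sqint lebO (tderiv T (u j) 0).
  by have [_ _ H _ _] := uC2 j; have [/L2P] := H 0 OI.
have E0 := E (fun j => u j 0) (u0 I) (fun j => su j _ OI)
  (fun j => aeS (fun x H => let: And3 h _ _ := H in h) (ini j)).
have E1 := E (fun j => tderiv T (u j) 0) (u0s I) sdu
  (fun j => aeS (fun x H => let: And3 _ h _ := H in h) (ini j)).
have ET := E (fun j => u j T) (uT I) (fun j => su j _ TI)
  (fun j => aeS (fun x H => let: And3 _ _ h := H in h) (ini j)).
rewrite /hgen E0 E1 ET -/bt bE (Rint_lebT_FTC T0 cF cdF FdF) refl.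
rewrite /F /V /W /mean /sn /cs clT cl0 subrr mulr0 sin0 cos0 subr0 -/k.
exact: alg2.
Qed.

End exact_identity.

(** * Mass carried by the exceptional sets *)

Section plane_weight.
Context (R : realType).
Local Notation mT := (measurableTypeR R).
Local Notation P2 := (mT * mT)%type.
Local Notation leb := (@lebesgue_measure R).
Implicit Types (K P w : R * R -> R) (Q : R -> R) (S : set (R * R)).

(** As Q depends on the second coordinate only, Tonelli integrates w along horizontal lines first,
    where its mass is at most c. *)
Lemma plane_weight K P Q w (r c : R) :
  measurable_fun (setT : set P2) K -> measurable_fun (setT : set P2) w -> 0 <= r -> 0 <= c ->
  (forall a, 0 <= K a) -> (forall a, 0 <= w a) -> (forall a, 0 <= P a) -> (forall y, 0 <= Q y) ->
  intg leb2 P -> intg leb Q ->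
  (forall y, (\int[leb]_x (w (x, y))%:E <= c%:E)%E) ->
  (forall a, K a <= r * P a + Q a.2 * w a) ->
  intg leb2 K /\ \int[leb2]_a K a <= r * \int[leb2]_a P a + c * \int[leb]_y Q y.
Proof.
move=> mK mw r0 c0 K0 w0 P0 Q0 iP iQ wc KPQ.
have mQ : measurable_fun (setT : set P2) (fun a : P2 => Q a.2).
  exact: measurableT_comp (intg_meas iQ) measurable_snd.
have mQE : measurable_fun setT (fun y : mT => (Q y)%:E).
  by apply/measurable_EFinP; exact: intg_meas iQ.
have mQw : measurable_fun (setT : set P2) (fun a : P2 => (Q a.2 * w a)%:E).
  by apply/measurable_EFinP; exact: measurable_funM.
have E : (\int[leb2]_a (Q a.2 * w a)%:E <= (c * \int[leb]_y Q y)%:E)%E.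
  rewrite (fubini_tonelli2 (m1 := lebesgue R) (m2 := lebesgue R)) //; last first.
    by move=> a; rewrite lee_fin mulr_ge0.
  rewrite EFinM -(intgE iQ) -ge0_integralZl//; last first.
    by move=> y _; rewrite lee_fin.
  apply: ge0_le_integral => //.
  - by move=> y _; apply: integral_ge0 => x _; rewrite lee_fin mulr_ge0.
  - by apply: measurable_fun_fubini_tonelli_G => // a; rewrite lee_fin mulr_ge0.
  - by exact: measurable_funeM.
  move=> y _; rewrite /fubini_G /=.
  under eq_integral do rewrite EFinM.
  have mwy : measurable_fun setT (fun x : mT => (w (x, y))%:E).
    by apply/measurable_EFinP; exact: measurableT_comp mw (measurable_pair2 y).
  have wy0 (x : mT) : setT x -> (0 <= (w (x, y))%:E)%E by rewrite lee_fin.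
  by rewrite (ge0_integralZl _ measurableT mwy wy0) ?lee_fin// muleC lee_wpmul2r ?lee_fin.
have mP := intg_meas iP.
have E2 : (\int[leb2]_a (K a)%:E <= (r * \int[leb2]_a P a + c * \int[leb]_y Q y)%:E)%E.
  apply: (@le_trans _ _ (\int[leb2]_a ((r * P a)%:E + (Q a.2 * w a)%:E)%E)%E).
    apply: ge0_le_integral => //.
    - by move=> a _; rewrite lee_fin.
    - exact/measurable_EFinP.
    - by apply: emeasurable_funD => //; apply/measurable_EFinP; exact: measurable_funM.
    - by move=> a _; rewrite -EFinD lee_fin.
  rewrite ge0_integralD//.
  - by rewrite EFinD leeD// (intgE (intgZ r iP)) (RintZ r iP).
  - by move=> a _; rewrite lee_fin mulr_ge0.
  - by apply/measurable_EFinP; exact: measurable_funM.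
  - by move=> a _; rewrite lee_fin mulr_ge0.
have iK : intg leb2 K.
  apply/integrableP; split; first exact/measurable_EFinP.
  under eq_integral do rewrite gee0_abs ?lee_fin//.
  by apply: le_lt_trans E2 _; rewrite ltry.
by split => //; rewrite -lee_fin -intgE.
Qed.

Let tailf (h x : R) : R := (h <= x)%R%:R / x ^+ 2.

Let Rint_tailf (h : R) : 0 < h -> intg leb (tailf h) /\ \int[leb]_x tailf h x = h^-1.
Proof.
move=> h0.
have E x : (tailf h x)%:E = ((fun x => (x ^- 2)%:E) \_ `[h, +oo[%classic) x.
  rewrite patchE /tailf; case: ifPn => [|]; rewrite ?notin_setE ?inE /= in_itv /= andbT.
    by move=> ->; rewrite div1r.
  by move=> /negP/negbTE ->; rewrite mul0r.
have Hy : (\int[leb]_(x in `[h, +oo[) (x ^- 2)%:E = (h^-1)%:E)%E.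
  rewrite (@ge0_continuous_FTC2y _ (fun x => x ^- 2) (fun x => - x^-1) h 0).
  - by rewrite sub0e -EFinN opprK.
  - by move=> x _; rewrite invr_ge0 sqr_ge0.
  - apply: continuous_in_subspaceT => x; rewrite inE /= in_itv /= andbT => hx.
    apply: cvgV; first by rewrite expf_neq0// gt_eqF// (lt_le_trans h0).
    exact: exprn_continuous.
  - rewrite -[X in _ --> X]oppr0; apply: cvgN; apply/gtr0_cvgV0; last exact: cvg_id.
    by apply: nbhs_pinfty_gt; rewrite num_real.
  - move=> x hx; apply: derivableN; apply: derivableV => //; by rewrite gt_eqF// (lt_trans h0).
  - apply: cvgN; apply: cvg_at_right_filter; apply: cvgV; [by rewrite gt_eqF|exact: cvg_id].
  - move=> x; rewrite in_itv /= andbT => hx; have x0 : x != 0 by rewrite gt_eqF// (lt_trans h0).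
    rewrite derive1E deriveN; last exact: derivableV.
    by rewrite deriveV// derive_id /GRing.scale /= mulr1 opprK.
have mt : measurable_fun setT (tailf h).
  have -> : tailf h = (fun x => \1_(`[h, +oo[%classic) x * (Num.max h x) ^- 2).
    apply/funext => x; rewrite /tailf indicE mem_setE in_itv /= andbT.
    by case: leP => hx; rewrite ?mul0r.
  apply: measurable_funM; first by apply: measurable_indic; exact: measurable_itv.
  apply: continuous_measurable_fun => x; apply: cvgV.
    by rewrite expf_neq0// gt_eqF// lt_max h0.
  apply: (@continuous_comp _ _ _ (fun x => Num.max h x) (fun x => x ^+ 2));
    last exact: exprn_continuous.
  by apply: (@continuous_max _ _ (cst h : R -> R^o) id); [exact: cst_continuous|exact: cvg_id].
have EI : (\int[leb]_x (tailf h x)%:E = (h^-1)%:E)%E.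
  by rewrite -Hy [RHS]integral_mkcond; apply: eq_integral => x _; exact: E.
have it : intg leb (tailf h).
  apply/integrableP; split; first exact/measurable_EFinP.
  rewrite (_ : (\int[leb]_x _)%E = (h^-1)%:E) ?ltry// -EI; apply: eq_integral => x _ /=.
  by rewrite ger0_norm// /tailf mulr_ge0 ?invr_ge0 ?sqr_ge0.
by split => //; rewrite /Rintegral EI.
Qed.

Lemma Rint_inv_sqr (h : R) : 0 < h ->
  (\int[leb]_x ((h <= `|x|)%R%:R / x ^+ 2)%:E <= (2 / h)%:E)%E.
Proof.
move=> h0; have [it It] := Rint_tailf h0.
have mo : measurable_fun setT (-%R : mT -> mT) by exact: oppr_measurable.
have [itN ItN] := Rint_invariant mo (@lebesgue_measureN R) it.
have E x : (h <= `|x|)%R%:R / x ^+ 2 = tailf h x + tailf h (- x).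
  rewrite /tailf sqrrN -mulrDl -natrD; congr (_%:R / _).
  case: (ger0P x) => x0; first by rewrite addnC (_ : (h <= - x) = false) //; apply/negbTE;
    rewrite -ltNge; lra.
  by rewrite (_ : (h <= x) = false) //; apply/negbTE; rewrite -ltNge; lra.
under eq_integral do rewrite E.
by rewrite (intgE (intgD it itN)) (RintD it itN) ItN It lee_fin mulrDl mul1r.
Qed.

Lemma enormE (a : R * R) : enorm a = Num.sqrt (a.1 ^+ 2 + a.2 ^+ 2).
Proof. by rewrite /enorm dotE !expr2. Qed.

Lemma enorm_swap2 (a : R * R) : enorm (swap2 a) = enorm a.
Proof. by rewrite !enormE addrC. Qed.

Lemma continuous_enorm : continuous (@enorm R).
Proof.
have -> : @enorm R = (fun a => Num.sqrt (a.1 ^+ 2 + a.2 ^+ 2)) by apply/funext => a; exact: enormE.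
move=> a; apply: (@continuous_comp _ _ _ (fun a : R * R => a.1 ^+ 2 + a.2 ^+ 2) Num.sqrt);
  last exact: sqrt_continuous.
apply: cvgD.
  by apply: (@continuous_comp _ _ _ fst (fun x : R => x ^+ 2));
    [exact: cvg_fst|exact: exprn_continuous].
by apply: (@continuous_comp _ _ _ snd (fun x : R => x ^+ 2));
  [exact: cvg_snd|exact: exprn_continuous].
Qed.

Lemma measurable_enorm : measurable_fun (setT : set P2) (@enorm R).
Proof. exact: continuous_measurable2 continuous_enorm. Qed.

Lemma measurable_natr_bool d (U : measurableType d) (b : U -> bool) :
  measurable_fun setT b -> measurable_fun setT (fun x => (b x)%:R : R).
Proof.
move=> mb; rewrite (_ : (fun x => _) = (fun x => if b x then cst 1 x else cst 0 x)); last first.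
  by apply/funext => x; case: (b x).
exact: measurable_fun_ifT.
Qed.

Lemma natr01 (b : bool) : 0 <= (b%:R : R) <= 1.
Proof. by case: b; rewrite !lexx ler01. Qed.

(** The double cone where a.1^2 is at least half of |a|^2, so that one can divide by a.1^2 there;
    exchanging the coordinates covers the rest of the plane. *)
Definition wide (a : R * R) : R := (`|a.2| <= `|a.1|)%R%:R.

Lemma measurable_wide : measurable_fun (setT : set P2) wide.
Proof.
apply: measurable_natr_bool; apply: measurable_fun_ler.
  exact: measurableT_comp (@normr_measurable R setT) measurable_snd.
exact: measurableT_comp (@normr_measurable R setT) measurable_fst.
Qed.

(** Reflection in the diagonal preserves the norm and maps the complement of the cone into the cone,
    so a radial weight is handled by two estimates on the cone. *)
Lemma radial_halves K (e : R -> R) (X1 X2 : R) : measurable_fun (setT : set P2) K -> (forall a, 0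
  <= K a) ->
  measurable_fun (setT : set mT) e -> (forall s, 0 <= e s) ->
  intg leb2 (fun a => K a * e (enorm a) * wide a) /\ \int[leb2]_a (K a * e (enorm a) * wide a) <=
    X1 ->
  intg leb2 (fun a => K (swap2 a) * e (enorm a) * wide a) /\
    \int[leb2]_a (K (swap2 a) * e (enorm a) * wide a) <= X2 ->
  intg leb2 (fun a => K a * e (enorm a)) /\ \int[leb2]_a (K a * e (enorm a)) <= X1 + X2.
Proof.
move=> mK K0 me e0 [i1 l1] [i2 l2].
have [i3 E3] := swap2_leb2 i2.
have LE a : K a * e (enorm a) <= K a * e (enorm a) * wide a
    + ((fun a => K (swap2 a) * e (enorm a) * wide a) \o @swap2 R) a.
  rewrite /= enorm_swap2 (_ : swap2 (swap2 a) = a); last by case: a.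
  rewrite -mulrDr ler_peMr ?mulr_ge0// /wide /= -natrD ler1n.
  by case: leP => // /ltW ->.
have mKe : measurable_fun (setT : set P2) (fun a => K a * e (enorm a)).
  by apply: measurable_funM => //; exact: measurableT_comp me measurable_enorm.
have iKe : intg leb2 (fun a => K a * e (enorm a)).
  apply: intg_le (intgD i1 i3) => // a.
  by rewrite ger0_norm ?mulr_ge0//; exact: LE.
split => //; apply: (le_trans (Rint_le iKe (intgD i1 i3) LE)).
by rewrite (RintD i1 i3) E3 lerD.
Qed.

Lemma wide_fst (a : R * R) (h : R) : 0 <= h -> wide a != 0 -> h <= enorm a ->
  h ^+ 2 / 2 <= a.1 ^+ 2.
Proof.
move=> h0 wa ha; have {wa} la : a.2 ^+ 2 <= a.1 ^+ 2.
  move: wa; rewrite /wide; case: leP => [|_]; last by rewrite eqxx.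
  by rewrite -ler_sqr ?nnegrE// !real_normK ?num_real.
have : h ^+ 2 <= enorm a ^+ 2 by rewrite ler_sqr ?nnegrE ?sqrtr_ge0.
rewrite enormE sqr_sqrtr ?addr_ge0 ?sqr_ge0// => H; lra.
Qed.

(** For K = (ctr f)^2 this is what [H1_decay] provides in one coordinate. *)
Definition decay K P Q := [/\ measurable_fun (setT : set P2) K, forall a, 0 <= K a,
    forall a, 0 <= P a & forall y, 0 <= Q y] /\
  [/\ intg leb2 P, intg leb Q & forall a, a.1 ^+ 2 * K a <= P a + Q a.2].

Let decay_alg (p q A v h : R) : 0 < h -> h ^+ 2 / 2 <= A -> 0 <= p -> 0 <= v -> v <= 1 ->
  (p + q) / A * v <= 2 / h ^+ 2 * p + q * (v / A).
Proof.
move=> h0 hA p0 v0 v1; have h2 : 0 < h ^+ 2 / 2 by rewrite divr_gt0 ?exprn_gt0.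
have A0 : 0 < A by apply: lt_le_trans hA.
rewrite mulrDl mulrDl -[q / A * v]mulrA (mulrC A^-1) lerD2r -mulrA mulrC ler_wpM2r//.
rewrite mulrC ler_pdivrMr//; apply: (le_trans v1).
by rewrite -invf_div mulrC ler_pdivlMr// mul1r.
Qed.

Lemma decay_half K P Q (e : R -> R) (h c : R) : decay K P Q -> 0 < h -> 0 <= c ->
  measurable_fun (setT : set mT) e -> (forall s, 0 <= e s <= 1) -> (forall s, s < h -> e s = 0) ->
  (forall y, (\int[leb]_x (e (enorm (x, y)) * wide (x, y) / x ^+ 2)%:E <= c%:E)%E) ->
  intg leb2 (fun a => K a * e (enorm a) * wide a) /\
  \int[leb2]_a (K a * e (enorm a) * wide a) <= 2 / h ^+ 2 * \int[leb2]_a P a + c * \int[leb]_y Q y.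
Proof.
move=> [[mK K0 P0 Q0] [iP iQ KPQ]] h0 c0 me e01 eh wc.
have e0 s : 0 <= e s by have /andP[] := e01 s.
have w01 a : 0 <= e (enorm a) * wide a <= 1.
  have /andP[p0 p1] := natr01 (`|a.2| <= `|a.1|); have /andP[q0 q1] := e01 (enorm a).
  by rewrite mulr_ge0 ?mulr_ile1.
have big a : e (enorm a) * wide a != 0 -> h ^+ 2 / 2 <= a.1 ^+ 2.
  rewrite mulf_eq0 negb_or => /andP[ea wa]; apply: wide_fst wa _; first exact: ltW.
  by rewrite leNgt; apply: contra ea => /eh ->.
(* The maximum is continuous and never 0, which makes the weight measurable; wherever the numerator
   is nonzero it equals a.1^2. *)
pose q (a : R * R) : R := Num.max (h ^+ 2 / 2) (a.1 ^+ 2).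
have h2 : 0 < h ^+ 2 / 2 by rewrite divr_gt0 ?exprn_gt0.
have q0 a : 0 < q a by rewrite /q lt_max h2.
pose w a := e (enorm a) * wide a / q a.
have wE a : w a = e (enorm a) * wide a / a.1 ^+ 2.
  rewrite /w; have [->|/big ha] := eqVneq (e (enorm a) * wide a) 0; first by rewrite !mul0r.
  by rewrite /q (max_idPr ha).
have cq : continuous q.
  move=> a; apply: (@continuous_max _ _ (cst (h ^+ 2 / 2) : _ -> R^o) (fun a : R * R => a.1 ^+ 2 :
    R^o)).
    exact: cst_continuous.
  by apply: (@continuous_comp _ _ _ fst (fun x : R => x ^+ 2));
    [exact: cvg_fst|exact: exprn_continuous].
have mw : measurable_fun (setT : set P2) w.
  apply: measurable_funM.
    by apply: measurable_funM measurable_wide; exact: measurableT_comp me measurable_enorm.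
  apply: continuous_measurable2 => a; apply: cvgV; last exact: cq.
  by rewrite gt_eqF.
have w0 a : 0 <= w a by rewrite /w divr_ge0 ?(ltW (q0 a))//; have /andP[] := w01 a.
apply: (@plane_weight _ P Q w) => //.
- apply: measurable_funM measurable_wide; apply: measurable_funM => //.
  exact: measurableT_comp me measurable_enorm.
- by rewrite divr_ge0 ?sqr_ge0.
- by move=> a; rewrite -mulrA mulr_ge0//; have /andP[] := w01 a.
- by move=> y; under eq_integral do rewrite wE.
move=> a; have /andP[v0 v1] := w01 a; rewrite -mulrA.
have [v00|nz] := eqVneq (e (enorm a) * wide a) 0.
  by rewrite /w v00 mul0r !mulr0 addr0 mulr_ge0 ?divr_ge0 ?sqr_ge0.
have ha := big a nz; have a0 : 0 < a.1 ^+ 2 by apply: lt_le_trans ha.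
rewrite wE; move: (e _ * wide a) v0 v1 {nz} => v v0 v1.
apply: (@le_trans _ _ ((P a + Q a.2) / a.1 ^+ 2 * v)).
  by rewrite ler_wpM2r// ler_pdivlMr// mulrC.
exact: decay_alg.
Qed.

Lemma decay_tail K P Q1 Q2 (r : R) : decay K P Q1 -> decay (K \o @swap2 R) (P \o @swap2 R) Q2 -> 0
  < r ->
  intg leb2 (fun a => K a * (r <= enorm a)%R%:R) /\
  \int[leb2]_a (K a * (r <= enorm a)%R%:R) <=
    4 / r ^+ 2 * \int[leb2]_a P a + 4 / r * (\int[leb]_y Q1 y + \int[leb]_y Q2 y).
Proof.
move=> D1 D2 r0; pose e (s : R) : R := (r <= s)%R%:R.
have me : measurable_fun (setT : set mT) e.
  by apply: measurable_natr_bool; apply: measurable_fun_ler.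
have e01 s : 0 <= e s <= 1 by exact: natr01.
have er s : s < r -> e s = 0 by rewrite ltNge /e => /negbTE ->.
have wc y : (\int[leb]_x (e (enorm (x, y)) * wide (x, y) / x ^+ 2)%:E <= (4 / r)%:E)%E.
  (* In the cone, |a| >= r forces |a.1| >= r / sqrt 2; the rounder r / 2 gives 2 / (r / 2) = 4 /
     r. *)
  apply: (@le_trans _ _ (\int[leb]_x ((r / 2 <= `|x|)%R%:R / x ^+ 2)%:E)%E); last first.
    apply: le_trans (Rint_inv_sqr _) _; first by rewrite divr_gt0.
    by rewrite lee_fin invf_div mulrA -natrM.
  apply: ge0_ae_le_lower_integral => [x|x|].
  - by rewrite lee_fin divr_ge0 ?sqr_ge0// mulr_ge0.
  - by rewrite lee_fin divr_ge0 ?sqr_ge0.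
  apply: aeW => x; rewrite lee_fin ler_wpM2r ?invr_ge0 ?sqr_ge0// /e /wide -natrM mulnb ler_nat.
  case: andP => // -[rn yx]; rewrite lt0b; rewrite /= in yx.
  rewrite leNgt; apply/negP => xr; move: rn; apply/negP; rewrite -ltNge.
  rewrite -ltr_sqr ?nnegrE ?sqrtr_ge0 ?(ltW r0)// enormE sqr_sqrtr ?addr_ge0 ?sqr_ge0//=.
  have h1 : y ^+ 2 <= x ^+ 2 by rewrite -(real_normK (num_real y)) -(real_normK (num_real x))
    ler_sqr ?nnegrE.
  have h2 : x ^+ 2 < (r / 2) ^+ 2.
    by rewrite -(real_normK (num_real x)) ltr_sqr ?nnegrE// ltW// divr_gt0.
  have r2 : 0 < r ^+ 2 by rewrite exprn_gt0.
  have E4 : (r / 2) ^+ 2 = r ^+ 2 / 4 by field.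
  rewrite E4 in h2; lra.
have c0 : 0 <= 4 / r by rewrite divr_ge0// ltW.
have [i1 l1] := decay_half D1 r0 c0 me e01 er wc.
have [i2 l2] := decay_half D2 r0 c0 me e01 er wc.
have [[mK K0 _ _] [iP _ _]] := D1.
have e0 s : 0 <= e s by have /andP[] := e01 s.
have [i l] := radial_halves mK K0 me e0 (conj i1 l1) (conj i2 l2).
split => //; apply: le_trans l _.
have [_ EP] := swap2_leb2 iP; rewrite EP.
rewrite le_eqVlt; apply/orP; left; apply/eqP.
by field; rewrite gt_eqF.
Qed.

End plane_weight.

(** * Small divisors: the set where a sine transform is tiny *)

Section small_divisors.
Context (R : realType).
Local Notation mT := (measurableTypeR R).
Local Notation P2 := (mT * mT)%type.
Local Notation leb := (@lebesgue_measure R).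
Variables (F : nat -> R -> R) (A B x0 kap : R).
Hypotheses (dF : forall k y, is_derive y (1 : R) (F k) (F k.+1 y)).
Hypotheses (FAB : forall n y, `|F n y| <= A * B ^+ n) (B0 : 0 <= B).
Hypotheses (Fx0 : F 0 x0 != 0) (x00 : 0 <= x0) (kap0 : 0 < kap).
Implicit Types (K P : R * R -> R) (Q : R -> R).

(** The level is tied to r and not to the radius lam r; this is what makes a small lam
    profitable. *)
Definition small (lam r s : R) : R :=
  ((`|F 0 s| <= expR (- (kap * r * ln r))) && (s <= lam * r))%R%:R.

Lemma measurable_small lam r : measurable_fun (setT : set mT) (small lam r).
Proof.
have cF : continuous (F 0) by exact: dv_continuous (dF 0).
apply: measurable_natr_bool; apply: measurable_and; apply: measurable_fun_ler => //.
by apply: measurableT_comp (@normr_measurable R setT) _; exact: continuous_measurable_fun.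
Qed.

Lemma small01 lam r s : 0 <= small lam r s <= 1. Proof. exact: natr01. Qed.

Let rho (y x : R) : R := enorm (x, y).

(** Along a horizontal line inside the cone the norm grows with slope at least 1/2, the separation
    hypothesis of [small_values_asymptotic]. *)
Let rho_incr (y u v : R) : 0 <= u -> 0 <= v -> `|y| <= u -> u <= v -> (v - u) / 2 <= rho y v - rho
  y u.
Proof.
move=> u0 v0 yu uv; rewrite /rho !enormE /=.
have y2 : y ^+ 2 <= u ^+ 2 by rewrite -(real_normK (num_real y)) ler_sqr ?nnegrE.
have uv2 : u ^+ 2 <= v ^+ 2 by rewrite ler_sqr ?nnegrE.
set p := Num.sqrt (v ^+ 2 + y ^+ 2); set q := Num.sqrt _.
have p0 : 0 <= p by exact: sqrtr_ge0. have q0 : 0 <= q by exact: sqrtr_ge0.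
have p2 : p ^+ 2 = v ^+ 2 + y ^+ 2 by rewrite sqr_sqrtr// addr_ge0 ?sqr_ge0.
have q2 : q ^+ 2 = u ^+ 2 + y ^+ 2 by rewrite sqr_sqrtr// addr_ge0 ?sqr_ge0.
have pv : p <= 2 * v.
  by rewrite -ler_sqr ?nnegrE ?mulr_ge0// p2 exprMn; have := sqr_ge0 v; lra.
have qu : q <= 2 * u.
  by rewrite -ler_sqr ?nnegrE ?mulr_ge0// q2 exprMn; have := sqr_ge0 u; lra.
have qp : q <= p by rewrite ler_wsqrtr// lerD2r.
have E : (p - q) * (p + q) = (v - u) * (v + u) by rewrite -!subr_sqr p2 q2; ring.
have [v00|vpos] := eqVneq v 0.
  have u00 : u = 0 by lra.
  by rewrite v00 u00 subrr mul0r subr_ge0.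
have vp : 0 < v + u by rewrite ltr_pwDl// lt_def vpos.
rewrite ler_pdivrMr// -(ler_pM2r vp) -E -mulrA ler_wpM2l ?subr_ge0//; lra.
Qed.

Lemma small_slice (lam nu c : R) p : 0 < lam -> 0 < nu -> B * expR 2 * lam <= nu ->
  p%:R * nu < kap -> 0 < c ->
  \forall r \near +oo, forall y, (\int[leb]_x (small lam r (enorm (x, y)) * wide (x, y))%:E <=
    (2 * (c * r / r ^+ p))%:E)%E.
Proof.
move=> lam0 nu0 Bnu pnu c0.
have H := small_values_asymptotic dF FAB B0 Fx0 x00 kap0 c0 lam0 nu0 Bnu pnu.
apply: filterS H => r H y.
(* Only x >= 0, where the norm increases; the other half is its mirror image, whence the factor
   2. *)
pose S := [set x : R | (0 <= x) && ((`|F 0 (rho y x)| <= expR (- (kap * r * ln r)))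
    && (rho y x <= lam * r) && (`|y| <= `|x|))].
have mrho : measurable_fun (setT : set mT) (rho y : mT -> R).
  exact: measurableT_comp (@measurable_enorm R) (pair2_measurable (y : mT)).
have mS : measurable (S : set mT).
  have mb : measurable_fun (setT : set mT) (fun x : R => (0 <= x) && ((`|F 0 (rho y x)| <= expR (-
    (kap * r * ln r)))
      && (rho y x <= lam * r) && (`|y| <= `|x|))).
    have cF : continuous (F 0) by exact: dv_continuous (dF 0).
    repeat apply: measurable_and; apply: measurable_fun_ler => //.
    apply: measurableT_comp (@normr_measurable R setT) _; apply: measurableT_comp mrho.
    exact: continuous_measurable_fun.
  by have := mb measurableT [set true] I; rewrite setTI.
have sym x : rho y (- x) = rho y x by rewrite /rho !enormE /= sqrrN.
have HS : (leb S <= (c * r / r ^+ p)%:E)%E.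
  apply: (H S (rho y)) => //.
  - by move=> x /andP[].
  - move=> u v /andP[u0 /andP[_ yu]] /andP[v0 _] uv; apply: rho_incr => //.
    by rewrite (ger0_norm u0) in yu.
  - by move=> x /andP[_ /andP[/andP[_ ->] _]]; rewrite sqrtr_ge0.
  - by move=> x /andP[_ /andP[/andP[]]].
have IS : (\int[leb]_x (\1_S x)%:E = leb S)%E by rewrite integral_indic// setIT.
have iS : intg leb (\1_S : R -> R).
  apply/integrableP; split; first by apply/measurable_EFinP; exact: measurable_indic.
  rewrite (_ : (\int[leb]_x _)%E = leb S); last first.
    by rewrite -IS; apply: eq_integral => x _ /=; rewrite ger0_norm// indicE.
  by apply: le_lt_trans HS _; rewrite ltry.
have mo : measurable_fun setT (-%R : mT -> mT) by exact: oppr_measurable.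
have [iSN ISN] := Rint_invariant mo (@lebesgue_measureN R) iS.
apply: (@le_trans _ _ (\int[leb]_x (\1_S x + \1_S (- x))%:E)%E).
  apply: ge0_ae_le_lower_integral => [x|x|].
  - by rewrite lee_fin mulr_ge0//; have /andP[] := small01 lam r (enorm (x, y)).
  - by rewrite lee_fin addr_ge0.
  apply: aeW => x; rewrite lee_fin -natrM mulnb !indicE -natrD ler_nat.
  case: andP => // -[/andP[b1 b2] b3]; rewrite /= in b3.
  case: (lerP 0 x) => xs; [rewrite mem_set//|rewrite addnC mem_set//].
    by rewrite /S /= xs b1 b2 b3.
  by rewrite /S /= oppr_ge0 (ltW xs) sym normrN b1 b2 b3.
rewrite (intgE (intgD iS iSN)) (RintD iS iSN) ISN lee_fin.
have -> : \int[leb]_x \1_S x = fine (leb S) by rewrite /Rintegral IS.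
have : fine (leb S) <= c * r / r ^+ p.
  by rewrite -lee_fin fineK// ge0_fin_numE//; apply: le_lt_trans HS _; rewrite ltry.
lra.
Qed.

(* Inside the disc of radius theta r the exceptional set has slices of size O(r^-2). *)
Lemma small_inner : exists2 th : R, 0 < th &
  forall c, 0 < c -> \forall r \near +oo, forall y,
    (\int[leb]_x (small th r (enorm (x, y)) * wide (x, y))%:E <= (2 * (c * r / r ^+ 3))%:E)%E.
Proof.
have e2 : 0 < expR 2 :> R by exact: expR_gt0.
pose D := B * expR 2 + 1.
have D0 : 0 < D by rewrite ltr_wpDl// mulr_ge0// ltW.
(* With nu = kap / 4 the constraint p nu < kap holds for p = 3, and lam = nu / D satisfies B e^2 lam
   <= nu. The summand 1 in D keeps it positive. *)
exists (kap / 4 / D); first by rewrite !divr_gt0.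
move=> c c0; apply: (@small_slice _ (kap / 4)) => //; rewrite ?divr_gt0//; last first.
  by have := kap0; lra.
rewrite mulrA ler_pdivrMr// mulrC ler_wpM2l//; first by rewrite divr_ge0 ?ltW.
by rewrite /D lerDl.
Qed.

(** For p = 0 the constraint p nu < kap is void, so nu can be taken large enough for lam = 1; the
    gain is only that c is arbitrary. *)
Lemma small_outer c : 0 < c -> \forall r \near +oo, forall y,
  (\int[leb]_x (small 1 r (enorm (x, y)) * wide (x, y))%:E <= (2 * (c * r))%:E)%E.
Proof.
move=> c0; have e2 : 0 <= expR 2 :> R by exact: expR_ge0.
have := @small_slice 1 (B * expR 2 + 1) c 0 ltr01 _ _ _ c0.
rewrite mulr1 mul0r => H; have {H} := H _ _ kap0.
case=> [||M [Mr H]]; [by rewrite ltr_wpDl// mulr_ge0|by rewrite lerDl|].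
by exists M; split => // r Mr' y; have := H r Mr' y; rewrite expr0 divr1.
Qed.

Let e_small lam r : measurable_fun (setT : set P2) (fun a => small lam r (enorm a)).
Proof. exact: measurableT_comp (@measurable_small lam r) (@measurable_enorm R). Qed.

Let fraction_alg (m e r : R) : 0 <= m -> 0 < e -> 0 < r ->
  4 * m * (e / (8 * (m + 1))) / r <= e / (2 * r).
Proof.
move=> m0 e0 r0; have m1 : 0 < m + 1 by rewrite ltr_wpDl.
rewrite (_ : 4 * m * _ / r = e / (2 * r) * (m / (m + 1))); last by field; rewrite !gt_eqF.
apply: ler_piMr; first by rewrite divr_ge0 ?mulr_ge0 ?(ltW e0) ?(ltW r0).
by rewrite ler_pdivrMr// mul1r lerDl.
Qed.

(** Boundedness of K suffices: the slices have length of order c r^-2 and only |a.2| <= th r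
    matters, so the mass is at most a constant times M c / r, with c at will. *)
Lemma small_inner_mass : exists2 th : R, 0 < th & forall K M, measurable_fun (setT : set P2) K ->
  (forall a, 0 <= K a <= M) -> forall eta, 0 < eta -> \forall r \near +oo,
  intg leb2 (fun a => K a * small th r (enorm a)) /\
  \int[leb2]_a (K a * small th r (enorm a)) <= eta / r.
Proof.
have [th th0 Hth] := small_inner; exists th => // K M mK KM eta eta0.
have M0 : 0 <= M by have /andP[] := KM 0; exact: le_trans.
pose c := eta / (8 * (M * th + 1)).
have Mt : 0 < M * th + 1 by rewrite ltr_wpDl// mulr_ge0// ltW.
have c0 : 0 < c by rewrite divr_gt0// mulr_gt0.
have r0 : \forall r \near +oo%R, 0 < r :> R by exact: nbhs_pinfty_gt.
apply: filterS2 r0 (Hth c c0) => r r0 Hr.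
pose Q (y : R) : R := M * \1_(`[- (th * r), th * r]%classic) y.
have mI : measurable (`[- (th * r), th * r]%classic : set mT) by exact: measurable_itv.
have thr : 0 < th * r by rewrite mulr_gt0.
have LI : (\int[leb]_x (\1_(`[- (th * r), th * r]%classic) x)%:E = (2 * (th * r))%:E)%E.
  rewrite integral_indic// setIT; apply: etrans (lebesgue_measure_itv _) _; rewrite /= lte_fin.
  by rewrite gtrN// opprK -EFinD; congr _%:E; lra.
have iI : intg leb (\1_(`[- (th * r), th * r]%classic) : R -> R).
  apply/integrableP; split; first by apply/measurable_EFinP; exact: measurable_indic.
  rewrite (_ : (\int[leb]_x _)%E = (2 * (th * r))%:E) ?ltry// -LI.
  by apply: eq_integral => x _ /=; rewrite ger0_norm// indicE.
have iQ : intg leb Q by exact: intgZ.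
have EQ : \int[leb]_y Q y = M * (2 * (th * r)).
  by rewrite (RintZ M iI); congr (_ * _); rewrite /Rintegral LI.
have half (G : R * R -> R) : measurable_fun (setT : set P2) G -> (forall a, 0 <= G a <= M) ->
    intg leb2 (fun a => G a * small th r (enorm a) * wide a) /\
    \int[leb2]_a (G a * small th r (enorm a) * wide a) <= eta / (2 * r).
  move=> mG GM.
  have i0 : intg (@leb2 R) (cst 0) by exact: integrable0.
  have := @plane_weight R (fun a => G a * small th r (enorm a) * wide a) (cst 0) Q
    (fun a => small th r (enorm a) * wide a) 0 (2 * (c * r / r ^+ 3)).
  case=> //.
  - by apply: measurable_funM (@measurable_wide R); exact: measurable_funM.
  - exact: measurable_funM (e_small th r) (@measurable_wide R).
  - apply: mulr_ge0 => //; apply: divr_ge0; first by apply: mulr_ge0; exact: ltW.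
    by apply: exprn_ge0; exact: ltW.
  - move=> a; have /andP[g0 _] := GM a; have /andP[s0 _] := small01 th r (enorm a).
    by rewrite !mulr_ge0.
  - by move=> a; have /andP[s0 _] := small01 th r (enorm a); rewrite mulr_ge0.
  - by move=> y; rewrite /Q mulr_ge0.
  - move=> a; have /andP[g0 gM] := GM a; rewrite mul0r add0r -mulrA.
    have [sw|sw] := boolP ((`|F 0 (enorm a)| <= expR (- (kap * r * ln r))) && (enorm a <= th * r));
      last first.
      by rewrite /small (negbTE sw) !mul0r !mulr0.
    rewrite /Q indicE mem_set ?mulr1; first by rewrite ler_wpM2r// mulr_ge0//;
      have /andP[] := small01 th r (enorm a).
    have /andP[_ le] := sw; rewrite /= in_itv /= -ler_norml; apply: le_trans le.
    by rewrite enormE -(sqrtr_sqr a.2) ler_wsqrtr// lerDr sqr_ge0.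
  move=> i; rewrite Rint_zero mulr0 add0r EQ => l; split => //; apply: (le_trans l).
  rewrite (_ : 2 * (c * r / r ^+ 3) * _ = 4 * (M * th) * c / r); last by field; rewrite gt_eqF.
  by apply: fraction_alg => //; apply: mulr_ge0 => //; exact: ltW.
have mKs : measurable_fun (setT : set P2) (K \o @swap2 R) by exact: measurableT_comp mK
  (@measurable_swap2 R).
have K0 a : 0 <= K a by have /andP[] := KM a.
have s0 s : 0 <= small th r s by have /andP[] := small01 th r s.
have [i l] := radial_halves mK K0 (@measurable_small th r) s0 (half _ mK KM) (half _ mKs (fun a =>
  KM (swap2 a))).
split => //; apply: (le_trans l).
rewrite le_eqVlt; apply/orP; left; apply/eqP; field; rewrite gt_eqF//.
Qed.

Let small_split th r s : 0 <= th -> small 1 r s <= small th r s + (th * r <= s)%R%:R * small 1 r s.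
Proof.
move=> th0; have /andP[p0 p1] := small01 th r s; have /andP[q0 q1] := small01 1 r s.
case: (leP (th * r) s) => ths; first by rewrite mul1r lerDr.
by rewrite mul0r addr0 /small (ltW ths) andbT ler_nat; case: (_ <= _); case: (_ <= _).
Qed.

Let measurable_e_tail (h : R) : measurable_fun (setT : set mT) (fun s : R => (h <= s)%R%:R : R).
Proof. by apply: measurable_natr_bool; exact: measurable_fun_ler. Qed.

Let outer_bound K (th r X Y : R) : measurable_fun (setT : set P2) K -> (forall a, 0 <= K a) -> 0 <=
  th ->
  intg leb2 (fun a => K a * small th r (enorm a)) /\
    \int[leb2]_a (K a * small th r (enorm a)) <= X ->
  intg leb2 (fun a => K a * ((th * r <= enorm a)%R%:R * small 1 r (enorm a))) /\
    \int[leb2]_a (K a * ((th * r <= enorm a)%R%:R * small 1 r (enorm a))) <= Y ->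
  intg leb2 (fun a => K a * small 1 r (enorm a)) /\
  \int[leb2]_a (K a * small 1 r (enorm a)) <= X + Y.
Proof.
move=> mK K0 th0 [i1 l1] [i2 l2].
have LE a : K a * small 1 r (enorm a) <= K a * small th r (enorm a)
    + K a * ((th * r <= enorm a)%R%:R * small 1 r (enorm a)).
  by rewrite -mulrDr ler_wpM2l//; exact: small_split.
have iKe : intg leb2 (fun a => K a * small 1 r (enorm a)).
  apply: intg_le (intgD i1 i2); first by exact: measurable_funM.
  move=> a; rewrite ger0_norm; first exact: LE.
  by rewrite mulr_ge0//; have /andP[] := small01 1 r (enorm a).
split => //; apply: (le_trans (Rint_le iKe (intgD i1 i2) LE)).
by rewrite (RintD i1 i2) lerD.
Qed.

Lemma Rint_tail_cvg0 K : intg leb2 K -> (forall a, 0 <= K a) -> forall eta, 0 < eta ->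
  \forall r \near +oo, intg leb2 (fun a => K a * (r <= enorm a)%R%:R) /\
    \int[leb2]_a (K a * (r <= enorm a)%R%:R) <= eta.
Proof.
move=> iK K0 eta eta0; have mK := intg_meas iK.
pose G (s : R) a := K a * (s <= enorm a)%R%:R.
have mG s : measurable_fun (setT : set P2) (G s).
  apply: measurable_funM => //; exact: measurableT_comp (measurable_e_tail s) (@measurable_enorm R).
have GK s a : `|G s a| <= K a.
  by rewrite ger0_norm ?mulr_ge0// ler_piMr//; have /andP[] := natr01 R (s <= enorm a).
have iG s : intg leb2 (G s) by exact: intg_le iK.
have lim : \int[leb2]_a G n%:R a @[n --> \oo] --> \int[leb2]_a (cst 0 a : R).
  apply: (Rint_dct_cvg _ _ _ iK) => //.
  apply: aeW => a; apply: cvg_near_cst; near=> n.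
  have : enorm a < n%:R by near: n; exact: nbhs_infty_gtr.
  by rewrite ltNge /G => /negbTE ->; rewrite mulr0.
rewrite /cst Rint_zero in lim.
have [n _ Hn] : \forall n \near \oo, \int[leb2]_a G n%:R a < eta.
  by have /cvgrPdist_lt/(_ _ eta0) := lim; apply: filterS => n; rewrite sub0r normrN;
    exact: le_lt_trans (ler_norm _).
near=> r; split; first exact: iG.
apply: le_trans (ltW (Hn n _)) => //=; apply: Rint_le; [exact: iG|exact: iG|].
move=> a; rewrite /G ler_wpM2l// ler_nat; case: (leP r (enorm a)) => // ra.
rewrite (le_trans _ ra)//; near: r; apply: nbhs_pinfty_ge; exact: num_real.
Unshelve. all: by end_near. Qed.

(** Within radius th r by [small_inner_mass], beyond it by the vanishing tail of an integrable
    function. *)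
Lemma small_mass K M : measurable_fun (setT : set P2) K -> (forall a, 0 <= K a <= M) -> intg leb2 K
  ->
  forall eta, 0 < eta -> \forall r \near +oo,
  intg leb2 (fun a => K a * small 1 r (enorm a)) /\
  \int[leb2]_a (K a * small 1 r (enorm a)) <= eta.
Proof.
move=> mK KM iK eta eta0; have [th th0 Hin] := small_inner_mass.
have K0 a : 0 <= K a by have /andP[] := KM a.
have e20 : 0 < eta / 2 by rewrite divr_gt0.
have [N [Nr HN]] := Rint_tail_cvg0 iK K0 e20.
have H1 := Hin K M mK KM (eta / 2) e20.
have H2 : \forall r \near +oo, N < th * r.
  near=> r; rewrite mulrC -ltr_pdivrMr//; near: r; apply: nbhs_pinfty_gt; exact: num_real.
have H3 : \forall r \near +oo, 1 <= r :> R by apply: nbhs_pinfty_ge; exact: num_real.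
near=> r; have [i1 l1] : intg leb2 (fun a => K a * small th r (enorm a)) /\
  \int[leb2]_a (K a * small th r (enorm a)) <= eta / 2 / r by near: r.
have Nth : N < th * r by near: r.
have r1 : 1 <= r by near: r.
have [i2 l2] := HN _ Nth.
rewrite [X in _ <= X](splitr eta); apply: (outer_bound mK K0 (ltW th0)).
  split => //; apply: le_trans l1 _; rewrite ler_pdivrMr ?(lt_le_trans ltr01)//.
  by rewrite ler_peMr// ltW.
have LE a : K a * ((th * r <= enorm a)%R%:R * small 1 r (enorm a)) <= K a * (th * r <= enorm
  a)%R%:R.
  have X : (th * r <= enorm a)%R%:R * small 1 r (enorm a) <= (th * r <= enorm a)%R%:R.
    by case: (th * r <= _); rewrite ?mul0r// mul1r; have /andP[] := small01 1 r (enorm a).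
  by have /andP[K0a _] := KM a; exact: ler_wpM2l K0a _ _ X.
have i3 : intg leb2 (fun a => K a * ((th * r <= enorm a)%R%:R * small 1 r (enorm a))).
  apply: intg_le i2.
    have mt := measurableT_comp (measurable_e_tail (th * r)) (@measurable_enorm R).
    exact: measurable_funM mK (measurable_funM mt (e_small 1 r)).
  move=> a; rewrite ger0_norm; first exact: LE.
  by rewrite !mulr_ge0//; have /andP[] := small01 1 r (enorm a).
by split => //; apply: le_trans l2; exact: Rint_le.
Unshelve. all: by end_near. Qed.

Let alg_outer (p q th r c eta : R) : 0 < th -> 0 < r -> 0 < eta -> 0 <= p -> 0 <= q ->
  16 * p / (th ^+ 2 * eta) <= r -> c = eta * th ^+ 2 / (16 * (q + 1)) ->
  4 / (th * r) ^+ 2 * p + 2 / (th * r) ^+ 2 * (2 * (c * r)) * q <= eta / 2 / r.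
Proof.
move=> th0 r0 eta0 p0 q0 pr ->.
have q1 : 0 < q + 1 by rewrite ltr_wpDl.
have t2 : 0 < th ^+ 2 * eta by rewrite mulr_gt0// exprn_gt0.
have E1 : 4 / (th * r) ^+ 2 * p <= eta / 4 / r.
  rewrite (_ : 4 / _ * p = (16 * p / (th ^+ 2 * eta)) * (eta / 4 / r ^+ 2)); last first.
    by field; rewrite !gt_eqF.
  rewrite (_ : eta / 4 / r = r * (eta / 4 / r ^+ 2)); last by field; rewrite gt_eqF.
  by rewrite ler_wpM2r// !divr_ge0 ?exprn_ge0 ?(ltW eta0) ?(ltW r0).
have E2 : 2 / (th * r) ^+ 2 * (2 * (eta * th ^+ 2 / (16 * (q + 1)) * r)) * q <= eta / 4 / r.
  rewrite (_ : _ * q = eta / 4 / r * (q / (q + 1))); last by field; rewrite !gt_eqF.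
  apply: ler_piMr; first by rewrite !divr_ge0 ?(ltW eta0) ?(ltW r0).
  by rewrite ler_pdivrMr// mul1r lerDl.
have -> : eta / 2 / r = eta / 4 / r + eta / 4 / r by field; rewrite gt_eqF.
exact: lerD.
Qed.

(** Beyond radius th r, in the cone, 1 / a.1^2 is at most 2 / (th r)^2 and the slices of the
    exceptional set have length at most 2 c r. The Q part thus contributes a multiple of c / r with
    c free, and the P part O(r^-2). *)
Lemma small_mass_decay K M P Q1 Q2 : decay K P Q1 -> decay (K \o @swap2 R) (P \o @swap2 R) Q2 ->
  (forall a, K a <= M) -> forall eta, 0 < eta -> \forall r \near +oo,
  intg leb2 (fun a => K a * small 1 r (enorm a)) /\
  \int[leb2]_a (K a * small 1 r (enorm a)) <= eta / r.
Proof.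
move=> D1 D2 KM eta eta0; have [th th0 Hin] := small_inner_mass.
have [[mK K0 P0 Q10] [iP iQ1 _]] := D1; have [[_ _ _ Q20] [_ iQ2 _]] := D2.
have e20 : 0 < eta / 2 by rewrite divr_gt0.
have KM' a : 0 <= K a <= M by rewrite K0 KM.
set p := \int[leb2]_a P a; set q := \int[leb]_y Q1 y + \int[leb]_y Q2 y.
have p0 : 0 <= p by exact: Rint_ge0.
have q0 : 0 <= q by apply: addr_ge0; exact: Rint_ge0.
pose c := eta * th ^+ 2 / (16 * (q + 1)).
have q1 : 0 < q + 1 by rewrite ltr_wpDl.
have c0 : 0 < c by rewrite divr_gt0 ?mulr_gt0 ?exprn_gt0.
have R1 : \forall r \near +oo, 16 * p / (th ^+ 2 * eta) <= r by apply: nbhs_pinfty_ge;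
  exact: num_real.
have R2 : \forall r \near +oo%R, 0 < r :> R by exact: nbhs_pinfty_gt.
have HA := Hin K M mK KM' (eta / 2) e20; have HB := small_outer c0.
near=> r; have pr : 16 * p / (th ^+ 2 * eta) <= r by near: r.
have r0 : 0 < r by near: r.
have [i1 l1] : intg leb2 (fun a => K a * small th r (enorm a)) /\
    \int[leb2]_a (K a * small th r (enorm a)) <= eta / 2 / r by near: r.
have Hout : forall y, (\int[leb]_x (small 1 r (enorm (x, y)) * wide (x, y))%:E <= (2 * (c *
  r))%:E)%E.
  by near: r.
rewrite (_ : eta / r = eta / 2 / r + eta / 2 / r); last by field; rewrite gt_eqF.
apply: (outer_bound mK K0 (ltW th0) (conj i1 l1)).
pose e (s : R) : R := (th * r <= s)%R%:R * small 1 r s.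
have me : measurable_fun (setT : set mT) e by exact: measurable_funM (measurable_e_tail _)
  (measurable_small _ _).
have e01 s : 0 <= e s <= 1.
  have /andP[u0 u1] := natr01 R (th * r <= s); have /andP[v0 v1] := small01 1 r s.
  by rewrite mulr_ge0 ?mulr_ile1.
have e0 s : 0 <= e s by have /andP[] := e01 s.
have er s : s < th * r -> e s = 0 by rewrite ltNge /e => /negbTE ->; rewrite mul0r.
have thr : 0 < th * r by rewrite mulr_gt0.
have c2 : 0 <= 2 / (th * r) ^+ 2 * (2 * (c * r)).
  apply: mulr_ge0; first by rewrite divr_ge0 ?exprn_ge0 ?(ltW thr).
  by apply: mulr_ge0 => //; apply: mulr_ge0; exact: ltW.
have wc y : (\int[leb]_x (e (enorm (x, y)) * wide (x, y) / x ^+ 2)%:E <= (2 / (th * r) ^+ 2 * (2 *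
  (c * r)))%:E)%E.
  apply: (@le_trans _ _ (\int[leb]_x ((2 / (th * r) ^+ 2)%:E * (small 1 r (enorm (x, y)) * wide (x,
    y))%:E)%E)%E).
    apply: ge0_ae_le_lower_integral => [x|x|].
    - by rewrite lee_fin divr_ge0 ?sqr_ge0// mulr_ge0// e0.
    - by rewrite -EFinM lee_fin mulr_ge0 ?divr_ge0 ?exprn_ge0 ?(ltW thr)// mulr_ge0//;
      have /andP[] := small01 1 r (enorm (x, y)).
    apply: aeW => x; rewrite -EFinM lee_fin /e.
    have /andP[v0 _] := small01 1 r (enorm (x, y)).
    have [->|wn] := eqVneq (wide (x, y)) 0; first by rewrite !mulr0 mul0r.
    case: (leP (th * r) (enorm (x, y))) => xr; last first.
      by rewrite !mul0r mulr_ge0 ?divr_ge0 ?exprn_ge0 ?(ltW thr)// mulr_ge0.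
    have := wide_fst (ltW thr) wn xr; rewrite /= => xb.
    have b0 : 0 < (th * r) ^+ 2 / 2 by rewrite divr_gt0 ?exprn_gt0.
    rewrite mul1r mulrC; apply: ler_wpM2r; first exact: mulr_ge0.
    by rewrite -[2 / _]invf_div lef_pV2 ?posrE//; exact: lt_le_trans xb.
  have mw : measurable_fun setT (fun x : mT => (small 1 r (enorm (x, y)) * wide (x, y))%:E).
    apply/measurable_EFinP;
      apply: (measurableT_comp (f := fun a : P2 => small 1 r (enorm a) * wide a)).
      exact: measurable_funM (e_small 1 r) (@measurable_wide R).
    exact: pair2_measurable.
  have w0 (x : mT) : setT x -> (0 <= (small 1 r (enorm (x, y)) * wide (x, y))%:E)%E.
    by move=> _; rewrite lee_fin mulr_ge0//; have /andP[] := small01 1 r (enorm (x, y)).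
  rewrite (ge0_integralZl _ measurableT mw w0) ?lee_fin;
    last by rewrite divr_ge0 ?exprn_ge0 ?(ltW thr).
  by rewrite [leRHS]EFinM; apply: lee_wpmul2l;
    [rewrite lee_fin divr_ge0 ?exprn_ge0 ?(ltW thr)|exact: Hout].
have [i2 l2] := decay_half D1 thr c2 me e01 er wc.
have [i3 l3] := decay_half D2 thr c2 me e01 er wc.
have [i l] := radial_halves mK K0 me e0 (conj i2 l2) (conj i3 l3).
split; first exact: i.
apply: (le_trans l); have [_ EP] := swap2_leb2 iP; rewrite EP.
apply: le_trans (alg_outer th0 r0 eta0 p0 q0 pr erefl).
rewrite le_eqVlt; apply/orP; left; apply/eqP; rewrite /q /p -/c; ring.
Unshelve. all: by end_near. Qed.

End small_divisors.

(** * Injectivity of the sine transform *)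

Section lipschitz.
Context (R : realType).

Lemma dv_lipschitz (f df : R -> R) M (x y : R) : (forall t, dv f t (df t)) ->
  (forall t, `|df t| <= M) -> `|f x - f y| <= M * `|x - y|.
Proof.
move=> fd dM; have cf : continuous f by exact: dv_continuous fd.
have M0 : 0 <= M by apply: le_trans (dM 0).
wlog xy : x y / y <= x.
  by move=> W; have [/W//|/ltW/W] := leP y x; rewrite distrC (distrC y).
have [c _ ->] := MVT_segment xy (fun t _ => fd t) (continuous_subspaceT cf).
by rewrite normrM ler_wpM2r.
Qed.

Lemma sin_lipschitz (x y : R) : `|sin x - sin y| <= `|x - y|.
Proof.
have := @dv_lipschitz sin cos 1 x y (fun t => is_derive_sin t) (fun t => cos_max t).
by rewrite mul1r.
Qed.

Lemma cos_lipschitz (x y : R) : `|cos x - cos y| <= `|x - y|.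
Proof.
have := @dv_lipschitz cos (fun t => - sin t) 1 x y (fun t => is_derive_cos t).
by rewrite mul1r; apply => t; rewrite normrN; exact: sin_max.
Qed.

Lemma sin_le_norm (x : R) : `|sin x| <= `|x|.
Proof. by have := sin_lipschitz x 0; rewrite sin0 !subr0. Qed.

End lipschitz.

Definition lebTf (R : realType) (T : R) : {finite_measure set (measurableTypeR R) -> \bar R} :=
  HB.pack (Measure.sort (@lebT R T))
    (Measure_isFinite.Build _ _ _ (Measure.sort (@lebT R T)) (fin_num_of_lt (@lebT_fin R T))).

Section sine_transform.
Context (R : realType).
Local Notation mT := (measurableTypeR R).
Variables (T : R).
Hypothesis T0 : 0 < T.
Variable psi : R -> R.
Hypothesis ipsi : intg (lebT T) psi.

Section derivatives.
Variable c : R.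
Hypothesis c0 : 0 <= c.

(** The n-th derivative of the sine transform, taken under the integral: each derivative shifts the
    phase by pi / 2. Clamping the time makes the kernel continuous and bounded for all t without
    affecting the integral. The geometric growth of the bounds in n is what the interpolation
    argument uses. *)
Definition sine_deriv (n : nat) (y : R) : R :=
  \int[lebT T]_t (psi t * ((c * clamp_time T t) ^+ n * sin (c * y * clamp_time T t + n%:R * (pi /
    2)))).

Let tau (t : R) : R := c * clamp_time T t.
Let ker (n : nat) (y t : R) : R := tau t ^+ n * sin (c * y * clamp_time T t + n%:R * (pi / 2)).

Let tau_bound t : 0 <= tau t <= c * T.
Proof.
have := clamp_timeP T0 t; rewrite /= in_itv /= => /andP[h1 h2].
by rewrite /tau mulr_ge0//= ler_wpM2l.
Qed.

Let ker_bound n y t : `|ker n y t| <= (c * T) ^+ n.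
Proof.
have /andP[h1 h2] := tau_bound t.
rewrite normrM normrX (ger0_norm h1) -[leRHS]mulr1; apply: ler_pM => //; first exact: exprn_ge0.
  by apply: lerXn2r => //; rewrite nnegrE; apply: mulr_ge0 => //; exact: ltW.
exact: sin_max.
Qed.

Let ker_continuous n y : continuous (ker n y).
Proof.
have cc := @clamp_time_continuous R T.
move=> t; apply: cvgM.
  apply: (@continuous_comp _ _ _ tau (fun x : R => x ^+ n)); last exact: exprn_continuous.
  by apply: cvgM; [exact: cvg_cst|exact: cc].
apply: (@continuous_comp _ _ _ (fun t => c * y * clamp_time T t + n%:R * (pi / 2)) sin);
  last exact: continuous_sin.
by apply: cvgD; [apply: cvgM; [exact: cvg_cst|exact: cc]|exact: cvg_cst].
Qed.

Let ker_intg n y : intg (lebT T) (fun t => psi t * ker n y t).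
Proof.
exact: (intg_mulb ipsi (continuous_measurable_fun (@ker_continuous n y)) (ker_bound n y)).
Qed.

Let ker_dv n y t : dv (fun y => ker n y t) y (ker n.+1 y t).
Proof.
have d1 : dv (fun y => c * y * clamp_time T t + n%:R * (pi / 2)) y (tau t).
  apply: dv_eq (dvD (dvM (dvZ c (dv_id y)) (dv_cst (clamp_time T t) y)) (dv_cst _ y)) _.
  by rewrite /tau; ring.
apply: dv_eq (dvZ (tau t ^+ n) (dv_sin d1)) _.
rewrite /ker (_ : n.+1%:R * (pi / 2) = n%:R * (pi / 2) + pi / 2);
  last by rewrite -natr1 mulrDl mul1r.
by rewrite addrA sinDpihalf exprSr mulrA mulrAC.
Qed.

Lemma sine_deriv_bound n y : `|sine_deriv n y| <= (\int[lebT T]_t `|psi t|) * (c * T) ^+ n.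
Proof.
rewrite mulrC; apply: (Rint_normM ipsi _ (ker_bound n y)).
exact: continuous_measurable_fun (@ker_continuous n y).
Qed.

Lemma is_derive_sine_deriv n y : is_derive y (1 : R) (sine_deriv n) (sine_deriv n.+1 y).
Proof.
have dk x t : dv (fun x => psi t * ker n x t) x (psi t * ker n.+1 x t).
  exact: (dvZ (psi t) (ker_dv n x t)).
have Iy : `]y - 1, y + 1[%classic y by rewrite /= in_itv /=; apply/andP; split; lra.
have part x t : partial1of2 (fun x t => psi t * ker n x t) x t = psi t * ker n.+1 x t.
  by rewrite partial1of2E; have [_ ->] := dk x t.
have ii x : (`]y - 1, y + 1[%classic : set R) x -> (lebT T).-integrable setT (EFin \o (fun t => psi
  t * ker n x t)).
  by move=> _; exact: ker_intg.
have dd x t : (`]y - 1, y + 1[%classic : set R) x -> setT t -> derivable (fun x => psi t * ker n x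
  t) x 1.
  by move=> _ _; exact: dv_derivable (dk x t).
pose G t := `|psi t| * (c * T) ^+ n.+1.
have G0 t : 0 <= G t.
  by apply: mulr_ge0 => //; apply: exprn_ge0; apply: mulr_ge0 => //; exact: ltW.
have iG : (lebT T).-integrable setT (EFin \o G).
  by apply: intg_eq (intgZ ((c * T) ^+ n.+1) (intg_norm ipsi)) => t; rewrite /G mulrC.
have Gb x t : (`]y - 1, y + 1[%classic : set R) x -> setT t ->
    `|partial1of2 (fun x t => psi t * ker n x t) x t| <= G t.
  by move=> _ _; rewrite part normrM ler_wpM2l//; exact: ker_bound.
have D := @derivable_under_integral R _ _ (lebT T) _ setT measurableT y _ _ Iy ii dd G G0 iG Gb.
have E := @differentiation_under_integral R _ _ (lebT T) _ setT measurableT y _ _ Iy ii dd G G0 iG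
  Gb.
split; first exact: D.
rewrite -derive1E; apply: etrans E _.
by apply: eq_Rintegral => t _; exact: part.
Qed.

End derivatives.

Lemma sine_deriv0 c s : sine_deriv c 0 s = \int[lebT T]_t (psi t * sin (c * s * t)).
Proof.
apply: Rint_ae_eq; apply: aeS (aeT_in T) => t /andP[t0 tT].
by rewrite mul0r addr0 expr0 mul1r clamp_time_id// !ltW.
Qed.

Hypothesis zero : forall s, \int[lebT T]_t (psi t * sin (s * t)) = 0.

Let leb := lebesgue R.

Let pk (e x t : R) : R := pker e (x - t) - pker e (x + t).

Let pkb e x t : 0 < e -> `|pk e x t| <= 2 / e.
Proof.
move=> e0; have h1 := pker_ge0 (x - t) e0; have h2 := pker_ge0 (x + t) e0.
have h3 := pker_le (x - t) e0; have h4 := pker_le (x + t) e0.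
by rewrite ler_norml /pk; apply/andP; split; lra.
Qed.

Let mpk2 e : 0 < e -> measurable_fun setT (fun z : mT * mT => pk e z.1 z.2).
Proof.
move=> e0; have mp : measurable_fun setT (pker e : mT -> R).
  by have := measurable_pker 0 e0; apply: eq_measurable_fun => x _; rewrite subr0.
apply: measurable_funB; apply: (measurableT_comp (f := pker e : mT -> R)) => //.
  by apply: measurable_funB; [exact: measurable_fst|exact: measurable_snd].
by apply: measurable_funD; [exact: measurable_fst|exact: measurable_snd].
Qed.

Let ipk e x : 0 < e -> intg (lebT T) (fun t => psi t * pk e x t).
Proof.
move=> e0; apply: (intg_mulb ipsi _ (fun t => pkb x t e0)).
exact: (measurableT_comp (mpk2 e0) (pair1_measurable (x : mT))).
Qed.

(** The vanishing sine transform is integrated against exp(-e |a|) sin(a x) and the integrals are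
    exchanged: a product of two sines gives half the difference of two Poisson kernels, the kernel
    of odd extensions. *)
Let poisson_zero e x : 0 < e -> \int[lebT T]_t (psi t * pk e x t) = 0.
Proof.
move=> e0; have ig := intg_expsin x e0.
have mk : measurable_fun setT (fun z : mT * mT => sin (z.1 * z.2)).
  apply: continuous_measurable2 => z;
    apply: (@continuous_comp _ _ _ (fun z : R * R => z.1 * z.2) sin).
    by apply: cvgM; [exact: cvg_fst|exact: cvg_snd].
  exact: continuous_sin.
have [_ _ E] := @Rint_swap _ _ mT mT R leb (lebTf T) _ psi (fun z => sin (z.1 * z.2)) 1 ig ipsi mk
  (fun z => sin_max _).
have L : \int[leb]_a (expabs e a * sin (a * x) * \int[lebTf T]_t (psi t * sin (a * t))) = 0.
  rewrite -[RHS](Rint_zero leb); apply: eq_Rintegral => a _.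
  by rewrite (zero a) mulr0.
have := etrans (esym E) L.
have K t : \int[leb]_a (expabs e a * sin (a * x) * sin (a * t)) = 2^-1 * (pker e (x - t) - pker e
  (x + t)).
  have i1 := intg_expcos (x - t) e0; have i2 := intg_expcos (x + t) e0.
  rewrite -(Rint_expcos (x - t) e0) -(Rint_expcos (x + t) e0) -(RintB i1 i2) -(RintZ 2^-1 (intgB i1
    i2)).
  apply: eq_Rintegral => a _; by rewrite (mulrBr a x t) (mulrDr a x t) cosB cosD; field.
move=> H; apply: (@mulfI _ (2^-1)); first by rewrite invr_eq0.
rewrite mulr0 -[RHS]H -(RintZ _ (ipk x e0)).
by apply: eq_Rintegral => t _; rewrite /= K mulrCA.
Qed.

Let Rint_indic_pker e y z : 0 < e -> 0 <= y ->
  intg leb (fun a => \1_(`[0, y]%classic : set mT) a * pker e (a - z)) /\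
  \int[leb]_a (\1_(`[0, y]%classic : set mT) a * pker e (a - z)) =
    2 * (atan ((y - z) / e) - atan ((0 - z) / e)).
Proof.
move=> e0 y0.
have E : (\int[leb]_a (\1_(`[0, y]%classic : set mT) a * pker e (a - z))%:E =
    (2 * (atan ((y - z) / e) - atan ((0 - z) / e)))%:E)%E.
  rewrite -(pker_intervalE _ e0 y0) [RHS]integral_mkcond; apply: eq_integral => a _.
  by rewrite patchE indicE; case: ifP; rewrite ?mul1r ?mul0r.
split; last by rewrite /Rintegral E.
apply/integrableP; split.
  apply/measurable_EFinP; apply: measurable_funM; last exact: measurable_pker.
  by apply: measurable_indic; exact: measurable_itv.
rewrite (_ : (\int[leb]_a _)%E = (2 * (atan ((y - z) / e) - atan ((0 - z) / e)))%:E) ?ltry//.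
by rewrite -E; apply: eq_integral => a _ /=; rewrite ger0_norm// mulr_ge0 ?pker_ge0.
Qed.

(** The integral of [pk] over x in [0, y], written with arctangents. *)
Let cumulative e y t : R := 2 * (atan ((y - t) / e) - atan ((0 - t) / e)) - 2 * (atan ((y + t) / e)
  - atan ((0 + t) / e)).

Let cumulative_zero e y : 0 < e -> 0 <= y -> \int[lebT T]_t (psi t * cumulative e y t) = 0.
Proof.
move=> e0 y0.
have mI : measurable (`[0, y]%classic : set mT) by exact: measurable_itv.
have iI : intg leb (\1_(`[0, y]%classic : set mT)).
  apply/integrableP; split; first by apply/measurable_EFinP; exact: measurable_indic.
  rewrite (_ : (\int[leb]_x _)%E = leb `[0, y]%classic); last first.
    rewrite -[X in leb X]setIT -integral_indic//; apply: eq_integral => x _ /=.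
    by rewrite ger0_norm// indicE.
  apply: le_lt_trans (ltry y); apply: le_trans (_ : ((y - 0)%:E <= _)%E); last by rewrite subr0.
  rewrite (_ : leb _ = if (0%:E < y%:E)%E then (y - 0)%:E else 0%E);
    last exact: lebesgue_measure_itv.
  by case: ifP => // _; rewrite subr0 lee_fin.
have [_ _ E] := @Rint_swap _ _ mT mT R leb (lebTf T) _ psi (fun z => pk e z.1 z.2) (2 / e) iI ipsi
  (mpk2 e0) (fun z => pkb _ _ e0).
have L : \int[leb]_a (\1_(`[0, y]%classic : set mT) a * \int[lebTf T]_t (psi t * pk e a t)) = 0.
  rewrite -[RHS](Rint_zero leb); apply: eq_Rintegral => a _.
  by rewrite (poisson_zero a e0) mulr0.
rewrite -[RHS](etrans (esym E) L); apply: eq_Rintegral => t _; congr (_ * _); apply/esym.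
have [i1 E1] := Rint_indic_pker t e0 y0; have [i2 E2] := Rint_indic_pker (- t) e0 y0.
rewrite /cumulative -[y + t](congr1 (+%R y) (opprK t)) -[0 + t](congr1 (+%R 0) (opprK t)) -E1 -E2
  -(RintB i1 i2).
by apply: eq_Rintegral => a _; rewrite /pk /= opprK mulrBr.
Qed.

Let hs (z : R) : R := if 0 < z then pi / 2 else if z < 0 then - (pi / 2) else 0.

(** As e tends to 0, [cumulative] tends on ]0, T[ to 2 pi times the indicator of ]0, y], except at t
    = y, and it stays below 4 pi. *)
Let interval_zero y : 0 <= y -> \int[lebT T]_t (psi t * \1_(`]0, y]%classic : set mT) t) = 0.
Proof.
move=> y0.
pose l t := 2 * (hs (y - t) - hs (0 - t)) - 2 * (hs (y + t) - hs (0 + t)).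
have L : \int[lebT T]_t (psi t * cumulative n.+1%:R^-1 y t) @[n --> \oo] --> \int[lebT T]_t (psi t
  * l t).
  have at_ z : `|atan z| <= pi / 2 :> R by rewrite ler_norml !ltW ?atan_gtNpi2 ?atan_ltpi2.
  have cb n t : `|cumulative n.+1%:R^-1 y t| <= 4 * pi.
    have := (at_ ((y - t) / n.+1%:R^-1), at_ ((0 - t) / n.+1%:R^-1), at_ ((y + t) / n.+1%:R^-1),
      at_ ((0 + t) / n.+1%:R^-1)).
    rewrite /cumulative !ler_norml => -[[[/andP[? ?] /andP[? ?]] /andP[? ?]] /andP[? ?]].
    by apply/andP; split; lra.
  have lim t : cumulative n.+1%:R^-1 y t @[n --> \oo] --> l t.
    by apply: cvgB; apply: cvgM; first [exact: cvg_cst|apply: cvgB; exact: cvg_atan_scaled].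
  have mc n : measurable_fun (setT : set mT) (cumulative n.+1%:R^-1 y).
    have ca (g : R -> R) : continuous g -> continuous (fun t => atan (g t / n.+1%:R^-1)).
      move=> cg t; apply: (@continuous_comp _ _ _ (fun t => g t / n.+1%:R^-1) atan);
        last exact: continuous_atan.
      by apply: cvgM; [exact: cg|exact: cvg_cst].
    have cm r : continuous (fun t : R => r - t) by move=> t; apply: cvgB;
      [exact: cvg_cst|exact: cvg_id].
    have cp r : continuous (fun t : R => r + t) by move=> t; apply: cvgD;
      [exact: cvg_cst|exact: cvg_id].
    have [cm1 cm0 cp1 cp0] := And4 (cm y) (cm 0) (cp y) (cp 0).
    apply: continuous_measurable_fun => t; apply: cvgB; apply: cvgM; try exact: cvg_cst.
      by apply: cvgB; [exact: (ca (fun t => y - t) cm1 t)|exact: (ca (fun t => 0 - t) cm0 t)].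
    by apply: cvgB; [exact: (ca (fun t => y + t) cp1 t)|exact: (ca (fun t => 0 + t) cp0 t)].
  have ml : measurable_fun (setT : set mT) l.
    by apply: (measurable_fun_cvg (h := fun n => cumulative n.+1%:R^-1 y)) => // t _; exact: lim.
  have mpsi := intg_meas ipsi.
  apply: (@Rint_dct_cvg _ _ _ (lebT T) _ _ (fun t => 4 * pi * `|psi t|)).
  - by move=> n; exact: measurable_funM.
  - exact: measurable_funM.
  - by apply: aeW => t; apply: cvgM; [exact: cvg_cst|exact: lim].
  - exact: intgZ (intg_norm ipsi).
  - by move=> n t; rewrite normrM mulrC ler_wpM2r.
have Z : \int[lebT T]_t (psi t * l t) = 0.
  have H n : \int[lebT T]_t (psi t * cumulative n.+1%:R^-1 y t) = 0 by rewrite cumulative_zero//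
    invr_gt0.
  move: L; under eq_fun do rewrite H.
  by move=> /cvg_lim <- //; rewrite lim_cst.
have pi0 : 2 * pi != 0 :> R by rewrite mulf_neq0 ?gt_eqF ?pi_gt0.
have mI : measurable (`]0, y]%classic : set mT) by exact: measurable_itv.
have I1 t : `|\1_(`]0, y]%classic : set mT) t| <= 1 :> R.
  by rewrite indicE normr_nat; have /andP[] := natr01 R (t \in (`]0, y]%classic : set mT)).
apply: (mulfI pi0); rewrite mulr0 -[RHS]Z -(RintZ _ (intg_mulb ipsi (measurable_indic mI) I1)).
apply: Rint_ae_eq.
have ne : \forall t \ae lebT T, t <> y.
    exists [set y]; split.
    - exact: measurable_set1.
    - apply/eqP; rewrite -measure_le0; apply: (@le_trans _ _ (lebesgue_measure [set y])).
        by rewrite -[leLHS]/(lebesgue_measure ([set y] `&` `]0, T[)); apply: le_measure => //;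
          [rewrite inE; apply: measurableI => //; exact: measurable_itv|by rewrite inE;
          exact: measurable_set1].
      by rewrite lebesgue_measure_set1.
    - by move=> t /= /contrapT.
apply: aeS (aeI ne (aeT_in T)) => t [ty /andP[t0 tT]]; rewrite mulrCA; congr (_ * _).
have cE : (t \in (`]0, y]%classic : set mT)) = (t <= y) by rewrite mem_setE in_itv /= t0.
have tn : (t < 0) = false by apply/negbTE; rewrite -leNgt ltW.
rewrite indicE cE /l /hs sub0r add0r oppr_gt0 oppr_lt0 t0 tn.
rewrite !subr_gt0 subr_lt0 (_ : 0 < y + t); last by rewrite ltr_wpDl.
by case: ltgtP ty => // _ _; rewrite ?mulr1 ?mulr0; move: pi => p; lra.
Qed.

(** The primitive of psi vanishes identically, so Lebesgue differentiation gives psi = 0 almost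
    everywhere. *)
Lemma sine_transform_injective : \forall t \ae lebT T, psi t = 0.
Proof.
pose f (t : R) : R := psi t * \1_(`]0, T[%classic : set mT) t.
have mI : measurable (`]0, T[%classic : set mT) by exact: measurable_itv.
have mpsi := intg_meas ipsi.
have mf : measurable_fun (setT : set mT) f by apply: measurable_funM => //; exact: measurable_indic.
have if_ : intg leb f.
  apply/integrableP; split; first exact/measurable_EFinP.
  have /integrableP[_] := ipsi.
  rewrite (integral_mrestr leb mI); last by apply: measurableT_comp => //; exact/measurable_EFinP.
  rewrite integral_mkcond; apply: le_lt_trans; rewrite le_eqVlt; apply/orP; left; apply/eqP.
  apply: eq_integral => t _; rewrite patchE /= /f indicE.
  by case: ifP; rewrite ?mulr1// mulr0 normr0.
have FZ y : \int[leb]_(t in [set` Interval (BRight 0) (BRight y)]) f t = 0.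
  have [y0|y0] := leP 0 y; last first.
    by rewrite set_itv_ge ?Rintegral_set0// bnd_simp -leNgt ltW.
  rewrite -[RHS](interval_zero y0) /Rintegral; congr fine.
  have mg : measurable_fun (setT : set mT) (EFin \o (fun t => psi t * \1_(`]0, y]%classic : set mT)
    t)).
    apply/measurable_EFinP; apply: measurable_funM => //; apply: measurable_indic;
      exact: measurable_itv.
  rewrite (integral_mrestr leb mI mg) [LHS]integral_mkcond [RHS]integral_mkcond.
  apply: eq_integral => t _; rewrite !patchE /f /= !indicE.
  by case: (t \in _); case: (t \in _); rewrite ?mulr0 ?mulr1.
have if_y y : leb.-integrable [set` Interval (BRight 0) (BRight y)] (EFin \o f).
  by apply: integrableS if_ => //; exact: measurable_itv.
have lf : locally_integrable [set: R] f.
  exact: (open_integrable_locally openT if_).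
have H := FTC1 if_y lf.
apply: aeS (aeI (ae_mrestr mI H) (aeT_in T)) => t [Ht /andP[t0 tT]].
have [_ E] := Ht t0.
have ft : f t = psi t by rewrite /f indicE mem_set ?mulr1// /= in_itv /= t0.
rewrite -ft -E (_ : (fun x => _) = cst 0); last by apply/funext => y; exact: FZ.
by rewrite derive1_cst.
Qed.

End sine_transform.

(** * Dependence on the data *)

Section boundary_functional.
Context (R : realType).
Local Notation mT := (measurableTypeR R).
Local Notation P2 := (mT * mT)%type.
Variable T : R.
Hypothesis T0 : 0 < T.
Implicit Types (X Y : R -> R * R -> R) (v psi : R * R -> R).

Lemma L1b_intg v : L1b v -> intg boundary_measure v.
Proof. by rewrite /L1b /= => /Lfun1_integrable. Qed.

Lemma normL1bE v : intg boundary_measure v -> normL1b v = (\int[boundary_measure]_x `|v x|)%:E.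
Proof. by move=> iv; rewrite /normL1b Lnorm1 -(intgE (intg_norm iv)). Qed.

Lemma normL1b_ge0 v : (0 <= normL1b v)%E. Proof. exact: Lnorm_ge0. Qed.

Lemma pairing_le v psi M : intg boundary_measure v -> measurable_fun (setT : set P2) psi ->
  (forall x, `|psi x| <= M) -> (`|\int[boundary_measure]_x (v x * psi x)|%:E <= M%:E * normL1b v)%E.
Proof. by move=> iv mp pM; rewrite normL1bE// -EFinM lee_fin; exact: Rint_normM. Qed.

(** N is not assumed measurable, as the norm of a Bochner function enters here without a
    measurability proof; a measurable g below it is still controlled by the lower integral. *)
Lemma lower_integral_bound (g : R -> R) (N : R -> \bar R) (K r : R) : intg (lebT T) g -> 0 <= r ->
  (forall t, (0 <= N t)%E) -> (\forall t \ae lebT T, (`|g t|%:E <= r%:E * N t)%E) ->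
  (\int[lebT T]_t N t <= K%:E)%E -> \int[lebT T]_t `|g t| <= r * K.
Proof.
move=> ig; rewrite le_eqVlt => /predU1P[<-|r0] N0 gN NK.
  rewrite mul0r le_eqVlt; apply/orP; left; apply/eqP.
  rewrite -[RHS](Rint_zero (lebT T)); apply: Rint_ae_eq; apply: aeS gN => t.
  by rewrite mul0e lee_fin => g0; apply/eqP; rewrite eq_le g0 normr_ge0.
have ih : intg (lebT T) (fun t => r^-1 * `|g t|) by exact: intgZ (intg_norm ig).
rewrite mulrC -ler_pdivrMr// mulrC -(RintZ r^-1 (intg_norm ig)) -lee_fin -(intgE ih).
apply: le_trans NK; apply: ge0_ae_le_lower_integral => [t|//|].
  by rewrite lee_fin mulr_ge0 ?invr_ge0 ?(ltW r0).
apply: aeS gN => t H; rewrite EFinM -(@lee_pmul2l _ r%:E)// ?lte_fin//.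
by rewrite -!EFinM mulrA divff ?gt_eqF// mul1r.
Qed.

Variable X : R -> R * R -> R.
Hypothesis LX : L1L1b T X.

Definition boundary_norm : R := fine (\int[lebT T]_t normL1b (X t))%E.

Lemma boundary_normP : (\int[lebT T]_t normL1b (X t) <= boundary_norm%:E)%E.
Proof.
have [_ _ fin] := LX; move: fin; rewrite /normLp Lnorm1.
under eq_integral => t _ do rewrite gee0_abs ?normL1b_ge0//.
move=> fin; rewrite /boundary_norm fineK//.
by rewrite ge0_fin_numE//; apply: integral_ge0 => t _; exact: normL1b_ge0.
Qed.

Lemma ae_L1b : \forall t \ae lebT T, intg boundary_measure (X t).
Proof. by have [_ H _] := LX; apply: aeS H => t; exact: L1b_intg. Qed.

(** Strong measurability: the pairings of the approximating simple functions are measurable in time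
    and converge almost everywhere. A version [g] is returned because the pairing itself is
    controlled only up to a null set. *)
Lemma boundary_pairing psi M : measurable_fun (setT : set P2) psi -> (forall x, `|psi x| <= M) ->
  exists g, intg (lebT T) g /\ \forall t \ae lebT T, \int[boundary_measure]_x (X t x * psi x) = g t.
Proof.
move=> mp pM; have [[m [A [c [mA cL lim]]]] _ _] := LX.
have M0 : 0 <= M by apply: le_trans (pM (0, 0)).
pose b n (t : R) : R := \sum_(i < m n) \1_(A n i) t * \int[boundary_measure]_x (c n i x * psi x).
pose beta t := \int[boundary_measure]_x (X t x * psi x).
have ic n i : intg boundary_measure (c n i) by exact: L1b_intg.
have mb n : measurable_fun (setT : set mT) (b n).
  apply: measurable_sum => i; apply: measurable_funM => //.
  by apply: measurable_indic; exact: mA.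
have bE n t : b n t = \int[boundary_measure]_x ((\sum_(i < m n) \1_(A n i) t * c n i x) * psi x).
  have icp (i : 'I_(m n)) : intg boundary_measure (fun x => \1_(A n i) t * (c n i x * psi x)).
    by apply: intgZ; exact: (intg_mulb (ic n i) mp pM).
  rewrite /b; under [RHS]eq_Rintegral => x _.
    rewrite mulr_suml; under eq_bigr => i _ do rewrite -mulrA.
    over.
  rewrite (Rint_sum _ icp); apply: eq_bigr => i _.
  by rewrite (RintZ _ (intg_mulb (ic n i) mp pM)).
have cv : \forall t \ae lebT T, b n t @[n --> \oo] --> beta t.
  apply: aeS (aeI ae_L1b lim) => t [iX L].
  have isum n : intg boundary_measure (fun x => \sum_(i < m n) \1_(A n i) t * c n i x).
    by apply: intg_sum => i; exact: intgZ.
  apply: (@cvg_le_ereal _ _ _ _ _ (fun n => M%:E * normL1b (fun x => X t x - \sum_(i < m n) \1_(A n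
    i) t * c n i x)%R)%E).
    rewrite -[X in _ --> X](mule0 M%:E); apply: cvgeZl => //.
  apply: nearW => n; rewrite bE distrC /beta -(RintB (intg_mulb iX mp pM) (intg_mulb (isum n) mp
    pM)).
  under eq_Rintegral => x _ do rewrite -mulrBl.
  exact: (pairing_le (intgB iX (isum n)) mp pM).
(* The upper limit is measurable at every t, also where the approximation fails. *)
pose g t := fine (limn_esup (fun n => (b n t)%:E)).
have mg : measurable_fun (setT : set mT) g.
  apply: measurableT_comp; first exact: fine_measurable.
  by apply: measurable_fun_limn_esup => n; exact/measurable_EFinP.
have gE : \forall t \ae lebT T, beta t = g t.
  apply: aeS cv => t L; rewrite /g.
  have /cvg_limn_einf_sup[_ ->] // : (b n t)%:E @[n --> \oo] --> (beta t)%:E.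
  by apply/fine_cvgP; split; [exact: nearW|exact: L].
have gb : \forall t \ae lebT T, (`|g t|%:E <= M%:E * normL1b (X t))%E.
  by apply: aeS (aeI ae_L1b gE) => t [iX <-]; exact: pairing_le.
have M1 : 0 < M + 1 by rewrite ltr_wpDl.
exists g; split => //.
(* M may be 0, so the comparison with the norm is divided by M + 1. *)
have ih : intg (lebT T) (fun t => (M + 1)^-1 * g t).
  apply/integrableP; split; first by apply/measurable_EFinP; exact: measurable_funM.
  apply: le_lt_trans (ltry boundary_norm); apply: le_trans boundary_normP.
  apply: ge0_ae_le_lower_integral => [t|t|]; [exact: abse_ge0|exact: normL1b_ge0|].
  apply: aeS gb => t H /=; rewrite normrM gtr0_norm ?invr_gt0// EFinM.
  rewrite -(@lee_pmul2l _ (M + 1)%:E) ?lte_fin// -EFinM -EFinM mulrA divff ?gt_eqF// mul1r.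
  apply: (le_trans H); apply: lee_wpmul2r; first exact: normL1b_ge0.
  by rewrite lee_fin lerDl.
by apply: intg_eq (intgZ (M + 1) ih) => t; rewrite mulrA divff ?mul1r// gt_eqF.
Qed.

End boundary_functional.

Section boundary_terms.
Context (R : realType).
Local Notation mT := (measurableTypeR R).
Local Notation P2 := (mT * mT)%type.
Variables (T c : R).
Hypotheses (T0 : 0 < T) (c0 : 0 <= c).
Implicit Types (X Y : R -> R * R -> R) (a : R * R).

Definition boundary_term X a : R :=
  \int[lebT T]_t (sin (c * enorm a * (T - t)) * \int[boundary_measure]_x (X t x * cos (dot a x))).

Let kap a (t : R) : R := sin (c * enorm a * (T - clamp_time T t)).

Let remaining t : 0 <= T - clamp_time T t <= T.
Proof. by have := clamp_timeP T0 t; rewrite /= in_itv /= => /andP[? ?]; apply/andP; split; lra. Qed.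

(** Bounding the sine by its argument rather than by 1 yields a factor |a|, which compensates the
    division by |a|^2 in g_j near the origin. *)
Let kap_bound a t : `|kap a t| <= c * enorm a * T.
Proof.
have /andP[h1 h2] := remaining t; apply: le_trans (sin_le_norm _) _.
have ca : 0 <= c * enorm a by rewrite mulr_ge0 ?sqrtr_ge0.
rewrite ger0_norm; last exact: mulr_ge0.
exact: ler_wpM2l.
Qed.

Let kap_lip a b t : `|kap a t - kap b t| <= c * T * `|enorm a - enorm b|.
Proof.
have /andP[h1 h2] := remaining t; apply: le_trans (sin_lipschitz _ _) _.
rewrite -mulrBl -mulrBr normrM normrM (ger0_norm c0) (ger0_norm h1) mulrAC ler_wpM2r//.
by rewrite ler_wpM2l.
Qed.

Let kap_measurable a : measurable_fun (setT : set mT) (kap a).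
Proof.
apply: continuous_measurable_fun => t;
  apply: (@continuous_comp _ _ _ (fun t => c * enorm a * (T - clamp_time T t)) sin);
  last exact: continuous_sin.
apply: cvgM; first exact: cvg_cst.
by apply: cvgB; [exact: cvg_cst|exact: clamp_time_continuous].
Qed.

Let boundary_termE X a g : (\forall t \ae lebT T, \int[boundary_measure]_x (X t x * cos (dot a x))
  = g t) ->
  boundary_term X a = \int[lebT T]_t (g t * kap a t).
Proof.
move=> Xg; apply: Rint_ae_eq; apply: aeS (aeI Xg (aeT_in T)) => t [-> /andP[t0 tT]].
by rewrite /kap clamp_time_id ?ltW// mulrC.
Qed.

Let mcos a : measurable_fun (setT : set P2) (fun x => cos (dot a x)).
Proof. exact: continuous_measurable2 (@continuous_cos_dot R a). Qed.

Let version X a : L1L1b T X -> exists g, intg (lebT T) g /\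
  \forall t \ae lebT T, \int[boundary_measure]_x (X t x * cos (dot a x)) = g t.
Proof. by move=> LX; exact: (boundary_pairing LX (mcos a) (fun x => cos_max _)). Qed.

Let lin_alg (p q s A B : R) : p * (A * s) + q * (B * s) = s * (p * A + q * B).
Proof. by ring. Qed.

Lemma boundary_term_lin X Y (Z : R -> R * R -> R) (p q : R) a : L1L1b T X -> L1L1b T Y ->
  (forall t x, Z t x = p * X t x + q * Y t x) ->
  \int[lebT T]_t \int[boundary_measure]_x (sin (c * enorm a * (T - t)) * Z t x * cos (dot a x)) =
  p * boundary_term X a + q * boundary_term Y a.
Proof.
move=> LX LY ZE; have [g [ig gE]] := version a LX; have [h [ih hE]] := version a LY.
rewrite (boundary_termE gE) (boundary_termE hE).
have i1 := intg_mulb ig (kap_measurable a) (kap_bound a).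
have i2 := intg_mulb ih (kap_measurable a) (kap_bound a).
rewrite -(RintZ p i1) -(RintZ q i2) -(RintD (intgZ p i1) (intgZ q i2)).
apply: Rint_ae_eq.
apply: aeS (aeI (aeI (aeI (ae_L1b LX) (ae_L1b LY)) (aeI gE hE)) (aeT_in T)) => t [[[iX iY] [<- <-]]
  /andP[t0 tT]].
have jX := intg_mulb iX (mcos a) (fun=> cos_max _);
  have jY := intg_mulb iY (mcos a) (fun=> cos_max _).
rewrite /kap clamp_time_id ?ltW//; set s := sin _.
rewrite lin_alg -(RintZ p jX) -(RintZ q jY) -(RintD (intgZ p jX) (intgZ q jY)).
rewrite -(RintZ s (intgD (intgZ p jX) (intgZ q jY))).
by apply: eq_Rintegral => x _; rewrite ZE; ring.
Qed.

Lemma boundary_term_sub X Y eps a : L1L1b T X -> L1L1b T Y ->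
  (\int[lebT T]_t normL1b (fun x => X t x - Y t x)%R <= eps%:E)%E ->
  `|boundary_term X a - boundary_term Y a| <= c * enorm a * T * eps.
Proof.
move=> LX LY He; have [g [ig gE]] := version a LX; have [h [ih hE]] := version a LY.
rewrite (boundary_termE gE) (boundary_termE hE).
have i1 := intg_mulb ig (kap_measurable a) (kap_bound a).
have i2 := intg_mulb ih (kap_measurable a) (kap_bound a).
rewrite -(RintB i1 i2) (_ : \int[_]__ _ = \int[lebT T]_t ((g t - h t) * kap a t)); last first.
  by apply: eq_Rintegral => t _; rewrite mulrBl.
apply: le_trans (Rint_normM (intgB ig ih) (kap_measurable a) (kap_bound a)) _.
apply: ler_wpM2l; first by rewrite !mulr_ge0 ?sqrtr_ge0 ?(ltW T0).
rewrite -[eps]mul1r; apply: (lower_integral_bound (intgB ig ih) ler01 _ _ He) => [t|].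
  exact: normL1b_ge0.
apply: aeS (aeI (aeI (ae_L1b LX) (ae_L1b LY)) (aeI gE hE)) => t [[iX iY] [<- <-]].
rewrite -(RintB (intg_mulb iX (mcos a) (fun=> cos_max _)) (intg_mulb iY (mcos a) (fun=> cos_max
  _))).
under eq_Rintegral => x _ do rewrite -mulrBl.
exact: (pairing_le (intgB iX iY) (mcos a) (fun=> cos_max _)).
Qed.

Lemma boundary_term_bound X a : L1L1b T X -> `|boundary_term X a| <= c * enorm a * T *
  boundary_norm T X.
Proof.
move=> LX; have [g [ig gE]] := version a LX; rewrite (boundary_termE gE).
apply: le_trans (Rint_normM ig (kap_measurable a) (kap_bound a)) _.
apply: ler_wpM2l; first by rewrite !mulr_ge0 ?sqrtr_ge0 ?(ltW T0).
rewrite -[X in _ <= X]mul1r; apply: (lower_integral_bound ig ler01 _ _ (boundary_normP LX)) => [t|].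
  exact: normL1b_ge0.
apply: aeS (aeI (ae_L1b LX) gE) => t [iX <-].
exact: (pairing_le iX (mcos a) (fun=> cos_max _)).
Qed.

(** Projection onto the closed square, where the boundary measure lives: there cos(a.x) is Lipschitz
    in a uniformly in x. *)
Let clamp2 (x : R * R) : R * R := (clamp_time 1 x.1, clamp_time 1 x.2).

Let cos_clamp_lip a b x : `|cos (dot a (clamp2 x)) - cos (dot b (clamp2 x))| <= `|a.1 - b.1| +
  `|a.2 - b.2|.
Proof.
apply: le_trans (cos_lipschitz _ _) _; rewrite !dotE /=.
have := clamp_timeP (@ltr01 R) x.1; have := clamp_timeP (@ltr01 R) x.2.
rewrite /= !in_itv /= => /andP[p0 p1] /andP[q0 q1].
set p := clamp_time 1 x.1; set q := clamp_time 1 x.2.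
rewrite (_ : _ - _ = (a.1 - b.1) * p + (a.2 - b.2) * q); last by ring.
apply: le_trans (ler_normD _ _) _; rewrite !normrM (ger0_norm p0) (ger0_norm q0).
by rewrite lerD// ler_piMr.
Qed.

(** Gives continuity in the frequency and thereby the measurability of [mode]. The two terms come
    from varying the frequency in the time factor and in the cosine. *)
Lemma boundary_term_lip X a b : L1L1b T X ->
  `|boundary_term X a - boundary_term X b| <=
    (c * T * `|enorm a - enorm b| + c * enorm b * T * (`|a.1 - b.1| + `|a.2 - b.2|)) *
      boundary_norm T X.
Proof.
move=> LX; have [g [ig gE]] := version a LX; have [h [ih hE]] := version b LX.
rewrite (boundary_termE gE) (boundary_termE hE).
have mk : measurable_fun (setT : set mT) (fun t => kap a t - kap b t) by exact: measurable_funB.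
have i1 := intg_mulb ig mk (kap_lip a b).
have i2 := intg_mulb (intgB ig ih) (kap_measurable b) (kap_bound b).
have i1' := intg_mulb ig (kap_measurable a) (kap_bound a).
have i2' := intg_mulb ih (kap_measurable b) (kap_bound b).
rewrite -(RintB i1' i2').
rewrite (_ : \int[_]__ _ = \int[lebT T]_t (g t * (kap a t - kap b t) + (g t - h t) * kap b t));
  last first.
  by apply: eq_Rintegral => t _; ring.
rewrite (RintD i1 i2) mulrDl; apply: le_trans (ler_normD _ _) _; apply: lerD.
  apply: le_trans (Rint_normM ig mk (kap_lip a b)) _; apply: ler_wpM2l.
    by rewrite !mulr_ge0 ?(ltW T0).
  rewrite -[X in _ <= X]mul1r;
    apply: (lower_integral_bound ig ler01 _ _ (boundary_normP LX)) => [t|].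
    exact: normL1b_ge0.
  apply: aeS (aeI (ae_L1b LX) gE) => t [iX <-].
  exact: (pairing_le iX (mcos a) (fun=> cos_max _)).
apply: le_trans (Rint_normM (intgB ig ih) (kap_measurable b) (kap_bound b)) _.
rewrite -[X in _ <= X]mulrA; apply: ler_wpM2l; first by rewrite !mulr_ge0 ?sqrtr_ge0 ?(ltW T0).
apply: (lower_integral_bound (intgB ig ih) _ _ _ (boundary_normP LX)) => [|t|];
  first exact: addr_ge0.
  exact: normL1b_ge0.
apply: aeS (aeI (ae_L1b LX) (aeI gE hE)) => t [iX [<- <-]].
rewrite -(RintB (intg_mulb iX (mcos a) (fun=> cos_max _)) (intg_mulb iX (mcos b) (fun=> cos_max
  _))).
have cc : continuous clamp2.
  move=> x; apply: (@cvg_pair _ _ _ (nbhs x) (nbhs (clamp_time 1 x.1)) (nbhs (clamp_time 1 x.2))).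
    apply: (@continuous_comp _ _ _ fst (clamp_time 1));
      [exact: cvg_fst|exact: clamp_time_continuous].
  apply: (@continuous_comp _ _ _ snd (clamp_time 1)); [exact: cvg_snd|exact: clamp_time_continuous].
have mcc a' : measurable_fun (setT : set P2) (fun x => cos (dot a' (clamp2 x))).
  apply: continuous_measurable2 => x.
  by apply: (@continuous_comp _ _ _ clamp2 (fun x => cos (dot a' x)));
    [exact: cc|exact: continuous_cos_dot].
rewrite (_ : \int[_]__ _ = \int[boundary_measure]_x (X t x * (cos (dot a (clamp2 x)) - cos (dot b
  (clamp2 x))))).
  exact: (pairing_le iX (measurable_funB (mcc a) (mcc b)) (cos_clamp_lip a b)).
apply: Rint_ae_eq; apply: aeS (@ae_boundary_square R) => x [x1 x2].
by rewrite /clamp2 !clamp_time_id// -surjective_pairing mulrBr.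
Qed.

Lemma boundary_term_continuous X : L1L1b T X -> continuous (boundary_term X).
Proof.
move=> LX b.
pose G (a : R * R) : R := (c * T * `|enorm a - enorm b| + c * enorm b * T * (`|a.1 - b.1| + `|a.2 -
  b.2|)) * boundary_norm T X.
have cst_ (r : R) : r @[a --> b] --> r by exact: cvg_cst.
have G0 : G a @[a --> b] --> G b.
  apply: cvgM; last exact: cst_; apply: cvgD; apply: cvgM; try exact: cst_.
    by apply: cvg_norm; apply: cvgB; [exact: continuous_enorm|exact: cst_].
  apply: cvgD; apply: cvg_norm; apply: cvgB; try exact: cst_.
    exact: cvg_fst. exact: cvg_snd.
have Gb : G b = 0 by rewrite /G !subrr !normr0 addr0 !mulr0 addr0 mul0r.
rewrite Gb in G0.
apply/cvgrPdist_lt => e e0; have /cvgrPdist_lt/(_ e e0) := G0.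
apply: filterS => a; rewrite sub0r normrN distrC => /(le_lt_trans (ler_norm _)); apply: le_lt_trans.
exact: boundary_term_lip.
Qed.

End boundary_terms.

Section data_functionals.
Context (R : realType).
Local Notation mT := (measurableTypeR R).
Local Notation P2 := (mT * mT)%type.
Variables (T c : R).
Hypotheses (T0 : 0 < T) (c0 : 0 <= c).
Implicit Types (I J : data R) (a : R * R) (k : 'I_2) (w v : R * R -> R).

Lemma L1_intg w : L1 w -> intg lebO w.
Proof. by rewrite /L1 /= => /Lfun1_integrable. Qed.

Let mcos a : measurable_fun (setT : set P2) (fun x => cos (dot a x)).
Proof. exact: continuous_measurable2 (@continuous_cos_dot R a). Qed.

Lemma ctr_bound w a : intg lebO w -> `|ctr w a| <= \int[lebO]_x `|w x|.
Proof. by move=> iw; rewrite -[leRHS]mul1r; exact: (Rint_normM iw (mcos a) (fun=> cos_max _)). Qed.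

Lemma ctr_sub w v eps a : intg lebO w -> intg lebO v -> (normL1 (w \- v)%R <= eps%:E)%E ->
  `|ctr w a - ctr v a| <= eps.
Proof.
move=> iw iv; rewrite /normL1 Lnorm1 -/(EFin \o _).
rewrite (_ : (\int[_]__ _)%E = (\int[lebO]_x `|w x - v x|)%:E);
  last by rewrite -(intgE (intg_norm (intgB iw iv))).
rewrite lee_fin; apply: le_trans.
have := ctr_bound a (intgB iw iv); congr (`|_| <= _).
rewrite /ctr -(RintB (intg_mulb iw (mcos a) (fun=> cos_max _)) (intg_mulb iv (mcos a) (fun=>
  cos_max _))).
by apply: eq_Rintegral => x _; rewrite mulrBl.
Qed.

Definition divisor I a : R := \int[lebT T]_t (phi I (T - t) * sin (c * enorm a * t)).

(** Contribution of the k-th components of the data to [hgen]: h_0 and h_j combine the modes with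
    the coefficients of [along] and [across], for their respective wave speeds c. *)
Definition mode I k a : R :=
  - sin (c * enorm a * T) * ctr (u0s I k) a + c * enorm a * ctr (uT I k) a
  - c * enorm a * cos (c * enorm a * T) * ctr (u0 I k) a - boundary_term T c (bX I k) a.

Lemma data_phi I : is_data T I -> intg (lebT T) (phi I).
Proof. by case=> /Lfun1_integrable. Qed.

Lemma hgenE (P : ('I_2 -> R * R -> R) -> R * R -> R) (p : 'I_2 -> R) I a : is_data T I ->
  (forall (w : 'I_2 -> R * R -> R) x, P w x = p 0 * w 0 x + p 1 * w 1 x) ->
  hgen T c P I a = p 0 * mode I 0 a + p 1 * mode I 1 a.
Proof.
move=> dI PE; have [_ H] := dI.
have [LX0 /L1_intg a0 /L1_intg b0 /L1_intg d0] := H 0;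
  have [LX1 /L1_intg a1 /L1_intg b1 /L1_intg d1] := H 1.
have E (w : 'I_2 -> R * R -> R) : intg lebO (w 0) -> intg lebO (w 1) ->
    \int[lebO]_x (P w x * cos (dot a x)) = p 0 * ctr (w 0) a + p 1 * ctr (w 1) a.
  move=> i0 i1; have j0 := intg_mulb i0 (mcos a) (fun=> cos_max _);
    have j1 := intg_mulb i1 (mcos a) (fun=> cos_max _).
  rewrite -(RintZ (p 0) j0) -(RintZ (p 1) j1) -(RintD (intgZ _ j0) (intgZ _ j1)).
  by apply: eq_Rintegral => x _; rewrite PE; ring.
have B : \int[lebT T]_t \int[boundary_measure]_x
      (sin (c * enorm a * (T - t)) * P (fun k => bX I k t) x * cos (dot a x)) =
    p 0 * boundary_term T c (bX I 0) a + p 1 * boundary_term T c (bX I 1) a.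
  exact: (boundary_term_lin T0 c0 a LX0 LX1 (fun t x => PE (fun k => bX I k t) x)).
rewrite /hgen (E (u0s I))// (E (uT I))// (E (u0 I))// B /mode.
move: (boundary_term _ _ _ _) (boundary_term _ _ _ _) (ctr _ _) (ctr _ _) (ctr _ _) (ctr _ _) (ctr
  _ _) (ctr _ _).
move=> *; ring.
Qed.

Lemma mode_bound I : is_data T I -> exists2 K, 0 <= K & forall k a, `|mode I k a| <= K * enorm a.
Proof.
move=> [_ H].
pose K k := c * T * (\int[lebO]_x `|u0s I k x|) + c * (\int[lebO]_x `|uT I k x|) +
  c * (\int[lebO]_x `|u0 I k x|) + c * T * boundary_norm T (bX I k).
have KP k a : `|mode I k a| <= K k * enorm a.
  have [LX /L1_intg i0 /L1_intg i1 /L1_intg i2] := H k.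
  have a0 : 0 <= enorm a by exact: sqrtr_ge0.
  have ca : 0 <= c * enorm a by rewrite mulr_ge0.
  have s1 : `|sin (c * enorm a * T)| <= c * enorm a * T.
    by apply: le_trans (sin_le_norm _) _; rewrite ger0_norm// mulr_ge0// ltW.
  have h1 := ctr_bound a i0; have h2 := ctr_bound a i1; have h3 := ctr_bound a i2.
  have h4 := boundary_term_bound T0 c0 a LX.
  rewrite /mode; apply: le_trans (ler_normB _ _) _.
  rewrite (_ : K k * enorm a = c * enorm a * T * (\int[lebO]_x `|u0s I k x|) + c * enorm a *
    (\int[lebO]_x `|uT I k x|)
    + c * enorm a * (\int[lebO]_x `|u0 I k x|) + c * enorm a * T * boundary_norm T (bX I k));
      last by rewrite /K; ring.
  apply: lerD => //; apply: le_trans (ler_normB _ _) _; apply: lerD.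
    apply: le_trans (ler_normD _ _) _; apply: lerD.
      by rewrite normrM normrN ler_pM.
    by rewrite normrM (ger0_norm ca) ler_wpM2l.
  rewrite normrM ler_pM// normrM (ger0_norm ca) ler_piMr//; exact: cos_max.
exists (`|K 0| + `|K 1|); first by rewrite addr_ge0.
move=> k a; apply: le_trans (KP k a) _; apply: ler_wpM2r; first exact: sqrtr_ge0.
apply: le_trans (ler_norm _) _; clear KP; elim/ord2P: k; by rewrite ?lerDl ?lerDr.
Qed.

Let sub_alg (s A B C D A' B' C' D' S Co : R) : `|- S * A + s * B - s * Co * C - D - (- S * A' + s *
  B' - s * Co * C' - D')| <=
   `|S| * `|A - A'| + `|s| * `|B - B'| + `|s * Co| * `|C - C'| + `|D - D'|.
Proof.
rewrite (_ : _ - _ = - (S * (A - A')) + s * (B - B') - s * Co * (C - C') - (D - D')); last by ring.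
apply: le_trans (ler_normB _ _) _; rewrite lerD2r.
apply: le_trans (ler_normB _ _) _; rewrite -!normrM lerD2r.
by apply: le_trans (ler_normD _ _) _; rewrite normrN.
Qed.

Lemma mode_sub I J eps k a : is_data T I -> is_data T J -> data_close T eps I J ->
  `|mode I k a - mode J k a| <= c * (2 * T + 2) * eps * enorm a.
Proof.
move=> [_ HI] [_ HJ] [_ HC].
have [LX /L1_intg i0 /L1_intg i1 /L1_intg i2] := HI k.
have [LY /L1_intg j0 /L1_intg j1 /L1_intg j2] := HJ k.
have [e1 e2 e3 e4] := HC k.
have e1' : (\int[lebT T]_t normL1b (fun x => bX I k t x - bX J k t x)%R <= eps%:E)%E.
  apply: le_trans e1; rewrite /normLp Lnorm1.
  by under [leRHS]eq_integral => t _ do rewrite gee0_abs ?normL1b_ge0//.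
have a0 : 0 <= enorm a by exact: sqrtr_ge0.
have ca : 0 <= c * enorm a by rewrite mulr_ge0.
have s1 : `|sin (c * enorm a * T)| <= c * enorm a * T.
  by apply: le_trans (sin_le_norm _) _; rewrite ger0_norm// mulr_ge0// ltW.
have h1 := ctr_sub a i1 j1 e3; have h2 := ctr_sub a i2 j2 e4; have h3 := ctr_sub a i0 j0 e2.
have h4 := boundary_term_sub T0 c0 a LX LY e1'.
rewrite /mode; apply: le_trans (sub_alg _ _ _ _ _ _ _ _ _ _ _) _.
rewrite (_ : c * (2 * T + 2) * eps * enorm a = c * enorm a * T * eps + c * enorm a * eps + c *
  enorm a * eps + c * enorm a * T * eps); last by ring.
apply: lerD => //; apply: lerD; first by apply: lerD;
  [exact: ler_pM|rewrite (ger0_norm ca) ler_wpM2l].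
apply: ler_pM => //; rewrite normrM (ger0_norm ca) ler_piMr//; exact: cos_max.
Qed.

Lemma measurable_mode I k : is_data T I -> measurable_fun (setT : set P2) (mode I k).
Proof.
move=> [_ HI]; have [LX /L1_intg i0 /L1_intg i1 /L1_intg i2] := HI k.
have ce : continuous (fun a : R * R => c * enorm a).
  by move=> a; apply: cvgM; [exact: cvg_cst|exact: continuous_enorm].
have ceT : continuous (fun a : R * R => c * enorm a * T).
  by move=> a; apply: cvgM; [exact: ce|exact: cvg_cst].
have cs : continuous (fun a : R * R => - sin (c * enorm a * T)).
  move=> a; apply: cvgN; apply: (@continuous_comp _ _ _ (fun a : R * R => c * enorm a * T) sin);
    [exact: ceT|exact: continuous_sin].
have cc : continuous (fun a : R * R => c * enorm a * cos (c * enorm a * T)).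
  move=> a; apply: cvgM; first exact: ce.
  apply: (@continuous_comp _ _ _ (fun a : R * R => c * enorm a * T) cos);
    [exact: ceT|exact: continuous_cos].
apply: measurable_funB; last exact: continuous_measurable2 (boundary_term_continuous T0 c0 LX).
apply: measurable_funB; last by apply: measurable_funM (measurable_ctr i0);
  exact: continuous_measurable2 cc.
apply: measurable_funD; apply: measurable_funM; try exact: measurable_ctr.
  exact: continuous_measurable2 cs. exact: continuous_measurable2 ce.
Qed.

Let dotN a (x : R * R) : dot (- a) x = - dot a x.
Proof. by rewrite !dotE /=; ring. Qed.

Lemma enormN a : enorm (- a) = enorm a.
Proof. by rewrite !enormE /= !sqrrN. Qed.

Lemma ctrN w a : ctr w (- a) = ctr w a.
Proof. by apply: eq_Rintegral => x _; rewrite dotN cosN. Qed.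

Lemma modeN I k a : mode I k (- a) = mode I k a.
Proof.
have B : boundary_term T c (bX I k) (- a) = boundary_term T c (bX I k) a.
  apply: eq_Rintegral => t _; rewrite enormN; apply: (congr1 (fun z => _ * z)).
  by apply: eq_Rintegral => x _; rewrite dotN cosN.
by rewrite /mode enormN !ctrN B.
Qed.

Lemma divisorN I a : divisor I (- a) = divisor I a.
Proof. by rewrite /divisor enormN. Qed.

Let kap a (t : R) : R := sin (c * enorm a * clamp_time T t).

Let kap_bound a t : `|kap a t| <= c * enorm a * T.
Proof.
have := clamp_timeP T0 t; rewrite /= in_itv /= => /andP[h1 h2].
have ca : 0 <= c * enorm a by rewrite mulr_ge0 ?sqrtr_ge0.
apply: le_trans (sin_le_norm _) _; rewrite ger0_norm; last exact: mulr_ge0.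
exact: ler_wpM2l.
Qed.

Let kap_measurable a : measurable_fun (setT : set mT) (kap a).
Proof.
apply: continuous_measurable_fun => t;
  apply: (@continuous_comp _ _ _ (fun t => c * enorm a * clamp_time T t) sin);
  last exact: continuous_sin.
by apply: cvgM; [exact: cvg_cst|exact: clamp_time_continuous].
Qed.

Let divisorE I a : divisor I a = \int[lebT T]_t (phi I (T - t) * kap a t).
Proof.
apply: Rint_ae_eq; apply: aeS (aeT_in T) => t /andP[t0 tT].
by rewrite /kap clamp_time_id// !ltW.
Qed.

Lemma divisor_bound I a : is_data T I -> `|divisor I a| <= c * T * (\int[lebT T]_t `|phi I t|) *
  enorm a.
Proof.
move=> /data_phi ip; have [ipr _] := Rint_reflect ip; have [_ E] := Rint_reflect (intg_norm ip).
rewrite divisorE -E (_ : _ * enorm a = c * enorm a * T * \int[lebT T]_t `|phi I (T - t)|);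
  last by ring.
exact: (Rint_normM ipr (kap_measurable a) (kap_bound a)).
Qed.

Lemma divisor_sub I J eps a : is_data T I -> is_data T J -> data_close T eps I J ->
  `|divisor I a - divisor J a| <= c * T * eps * enorm a.
Proof.
move=> /data_phi ip /data_phi jp [He _].
have [ipr _] := Rint_reflect ip; have [jpr _] := Rint_reflect jp.
have [_ E] := Rint_reflect (intg_norm (intgB ip jp)).
rewrite !divisorE -(RintB (intg_mulb ipr (kap_measurable a) (kap_bound a)) (intg_mulb jpr
  (kap_measurable a) (kap_bound a))).
rewrite (_ : \int[_]__ _ = \int[lebT T]_t ((phi I (T - t) - phi J (T - t)) * kap a t)); last first.
  by apply: eq_Rintegral => t _; rewrite mulrBl.
apply: le_trans (Rint_normM (intgB ipr jpr) (kap_measurable a) (kap_bound a)) _.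
rewrite (_ : c * T * eps * enorm a = c * enorm a * T * eps); last by ring.
apply: ler_wpM2l; first by rewrite !mulr_ge0 ?sqrtr_ge0 ?(ltW T0).
move: He; rewrite Lnorm1 (_ : (\int[_]__ _)%E = (\int[lebT T]_t `|phi I t - phi J t|)%:E);
  last first.
  by rewrite -(intgE (intg_norm (intgB ip jp))).
by rewrite lee_fin -E.
Qed.

Lemma divisor_sine_deriv I a : is_data T I -> divisor I a = sine_deriv T (fun t => phi I (T - t)) c
  0 (enorm a).
Proof. by move=> dI; rewrite sine_deriv0. Qed.

Lemma measurable_divisor I : is_data T I -> measurable_fun (setT : set P2) (divisor I).
Proof.
move=> dI; have [ipr _] := Rint_reflect (data_phi dI).
have -> : divisor I = sine_deriv T (fun t => phi I (T - t)) c 0 \o @enorm R.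
  by apply/funext => a; exact: divisor_sine_deriv.
apply: measurableT_comp (@measurable_enorm R); apply: continuous_measurable_fun.
exact: dv_continuous (is_derive_sine_deriv T0 ipr c0 0).
Qed.

End data_functionals.

(** * The reconstruction formula and its stability *)

Section reconstruction_formula.
Context (R : realType).
Local Notation mT := (measurableTypeR R).
Local Notation P2 := (mT * mT)%type.

(* The dependence of g_j on the data: d1, d2 are the divisors and m, m' the
   modes of the compressional and of the shear part. *)
Definition gform (n aj x y p q d1 d2 m0 m1 m0' m1' : R) : R :=
  2 / n ^+ 2 * (aj * d2 * (x * m0 + y * m1) + d1 * (p * m0' + q * m1')).

Let prod_sub (u v u' v' U V du dv : R) : `|u'| <= U -> `|v| <= V -> `|u - u'| <= du -> `|v - v'| <=
  dv ->
  `|u * v - u' * v'| <= du * V + U * dv.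
Proof.
move=> hu hv hdu hdv; rewrite (_ : _ - _ = (u - u') * v + u' * (v - v')); last by ring.
by apply: le_trans (ler_normD _ _) _; rewrite !normrM lerD// ler_pM.
Qed.

Let comb_bound (x y m0 m1 X M : R) : `|x| <= X -> `|y| <= X -> `|m0| <= M -> `|m1| <= M ->
  `|x * m0 + y * m1| <= 2 * X * M.
Proof.
move=> hx hy h0 h1; apply: le_trans (ler_normD _ _) _; rewrite !normrM.
by rewrite (_ : 2 * X * M = X * M + X * M); [rewrite lerD// ler_pM|ring].
Qed.

(** Replacing factors one at a time costs 4 K e n^4 for the compressional product and 8 K e n^4 for
    the shear product; the prefactor 2 / n^2 gives 24 K e n^2. *)
Lemma gform_sub (n aj x y p q K e : R) (d1 d2 m0 m1 m0' m1' b1 b2 k0 k1 k0' k1' : R) :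
  0 <= n -> 0 <= K -> 0 <= e -> `|aj| <= n -> `|x| <= n -> `|y| <= n -> `|p| <= 2 * n ^+ 2 -> `|q|
    <= 2 * n ^+ 2 ->
  [/\ `|d1| <= K * n, `|d2| <= K * n, `|m0| <= K * n & `|m1| <= K * n] -> `|m0'| <= K * n -> `|m1'|
    <= K * n ->
  `|b1| <= K * n -> `|b2| <= K * n ->
  [/\ `|d1 - b1| <= e * n, `|d2 - b2| <= e * n, `|m0 - k0| <= e * n & `|m1 - k1| <= e * n] ->
  `|m0' - k0'| <= e * n -> `|m1' - k1'| <= e * n ->
  `|gform n aj x y p q d1 d2 m0 m1 m0' m1' - gform n aj x y p q b1 b2 k0 k1 k0' k1'| <= 24 * K * e
    * n ^+ 2.
Proof.
move=> n0 K0 e0 haj hx hy hp hq [hd1 hd2 hm0 hm1] hm0' hm1' hb1 hb2 [ed1 ed2 em0 em1] em0' em1'.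
(* For n = 0 the prefactor is 0, the inverse of 0 being 0. *)
have [->|nn] := eqVneq n 0.
  by rewrite /gform !expr0n /= invr0 !mulr0 !mul0r subrr normr0.
have np : 0 < n by rewrite lt_def nn.
rewrite /gform -mulrBr normrM ger0_norm ?divr_ge0 ?sqr_ge0//.
set S1 := x * m0 + y * m1; set S2 := p * m0' + q * m1'.
set T1 := x * k0 + y * k1; set T2 := p * k0' + q * k1'.
have s1 : `|S1| <= 2 * n * (K * n) by exact: comb_bound.
have s2 : `|S2| <= 2 * (2 * n ^+ 2) * (K * n) by exact: comb_bound.
have t1 : `|S1 - T1| <= 2 * n * (e * n).
  by rewrite (_ : S1 - T1 = x * (m0 - k0) + y * (m1 - k1)); [exact: comb_bound|rewrite /S1 /T1;
    ring].
have t2 : `|S2 - T2| <= 2 * (2 * n ^+ 2) * (e * n).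
  by rewrite (_ : S2 - T2 = p * (m0' - k0') + q * (m1' - k1')); [exact: comb_bound|rewrite /S2 /T2;
    ring].
have h1 : `|aj * (d2 * S1 - b2 * T1)| <= n * (e * n * (2 * n * (K * n)) + K * n * (2 * n * (e *
  n))).
  by rewrite normrM ler_pM//; exact: prod_sub.
have h2 : `|d1 * S2 - b1 * T2| <= e * n * (2 * (2 * n ^+ 2) * (K * n)) + K * n * (2 * (2 * n ^+ 2)
  * (e * n)).
  exact: prod_sub.
rewrite (_ : _ - (_ + _) = aj * (d2 * S1 - b2 * T1) + (d1 * S2 - b1 * T2)); last by ring.
apply: (@le_trans _ _ (2 / n ^+ 2 * (n * (e * n * (2 * n * (K * n)) + K * n * (2 * n * (e * n))) +
   (e * n * (2 * (2 * n ^+ 2) * (K * n)) + K * n * (2 * (2 * n ^+ 2) * (e * n)))))).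
  apply: ler_wpM2l; first by rewrite divr_ge0 ?sqr_ge0.
  by apply: le_trans (ler_normD _ _) _; exact: lerD.
by rewrite le_eqVlt; apply/orP; left; apply/eqP; field.
Qed.

Lemma divisor_prod_sub (n K e d1 d2 b1 b2 : R) : `|d2| <= K * n -> `|b1| <= K * n ->
  `|d1 - b1| <= e * n -> `|d2 - b2| <= e * n -> `|d1 * d2 - b1 * b2| <= 2 * K * e * n ^+ 2.
Proof.
move=> h1 h2 h3 h4; apply: le_trans (prod_sub h2 h1 h3 h4) _.
by rewrite le_eqVlt; apply/orP; left; apply/eqP; ring.
Qed.

Variables (T lam mu : R).
Hypotheses (T0 : 0 < T) (mu0 : 0 < mu) (lam2mu0 : 0 < lam + 2 * mu).
Implicit Types (I J : data R) (a : R * R) (j k : 'I_2).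

Let c1 := Num.sqrt (lam + 2 * mu).
Let c2 := Num.sqrt mu.
Let c10 : 0 <= c1. Proof. exact: sqrtr_ge0. Qed.
Let c20 : 0 <= c2. Proof. exact: sqrtr_ge0. Qed.

(** Entry of |a|^2 Id - a a^T, that is |a|^2 times the projection orthogonal to a. *)
Definition shear_coef j a k : R := enorm a ^+ 2 * (k == j)%:R - crd j a * crd k a.

Let enorm2 a : enorm a ^+ 2 = crd 0 a ^+ 2 + crd 1 a ^+ 2.
Proof. by rewrite enormE sqr_sqrtr// addr_ge0 ?sqr_ge0. Qed.

Let alongE a (w : 'I_2 -> R * R -> R) x : along a w x = crd 0 a * w 0 x + crd 1 a * w 1 x.
Proof. exact: big_ord2. Qed.

Let across_alg0 (N A B u v : R) : N * u - A * (A * u + B * v) = (N * 1 - A * A) * u + (N * 0 - A *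
  B) * v.
Proof. by ring. Qed.

Let across_alg1 (N A B u v : R) : N * v - B * (A * u + B * v) = (N * 0 - B * A) * u + (N * 1 - B *
  B) * v.
Proof. by ring. Qed.

Let acrossE j a (w : 'I_2 -> R * R -> R) x :
  across j a w x = shear_coef j a 0 * w 0 x + shear_coef j a 1 * w 1 x.
Proof.
rewrite /across alongE /shear_coef; elim/ord2P: j.
  exact: across_alg0. exact: across_alg1.
Qed.

Lemma gjE j I a : is_data T I -> gj T lam mu j I a =
  gform (enorm a) (crd j a) (crd 0 a) (crd 1 a) (shear_coef j a 0) (shear_coef j a 1)
    (divisor T c1 I a) (divisor T c2 I a) (mode T c1 I 0 a) (mode T c1 I 1 a) (mode T c2 I 0 a)
      (mode T c2 I 1 a).
Proof.
move=> dI; rewrite /gj /h0 /hj.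
by rewrite (hgenE (p := fun k => crd k a) T0 c10 a dI (alongE a)) (hgenE (p := shear_coef j a) T0
  c20 a dI (acrossE j a)).
Qed.

Lemma crd_le_enorm k a : `|crd k a| <= enorm a.
Proof.
rewrite enormE -(sqrtr_sqr (crd k a)); apply: ler_wsqrtr; elim/ord2P: k; rewrite /crd /=.
  by rewrite lerDl sqr_ge0.
by rewrite lerDr sqr_ge0.
Qed.

Lemma shear_coef_le j a k : `|shear_coef j a k| <= 2 * enorm a ^+ 2.
Proof.
have a0 : 0 <= enorm a by exact: sqrtr_ge0.
have h1 : `|enorm a ^+ 2 * (k == j)%:R| <= enorm a ^+ 2.
  by rewrite ger0_norm ?mulr_ge0 ?sqr_ge0// ler_piMr ?sqr_ge0//; case: (k == j).
have h2 : `|crd j a * crd k a| <= enorm a ^+ 2 by rewrite normrM expr2 ler_pM ?crd_le_enorm.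
apply: le_trans (ler_normB _ _) _; lra.
Qed.

Let eigen_along (l m A B U V : R) (c n : R) : c ^+ 2 = l + 2 * m -> n ^+ 2 = A ^+ 2 + B ^+ 2 ->
  A * ((l + m) * A * (A * U + B * V) + m * (A ^+ 2 + B ^+ 2) * U) +
  B * ((l + m) * B * (A * U + B * V) + m * (A ^+ 2 + B ^+ 2) * V) = (c * n) ^+ 2 * (A * U + B * V).
Proof. by move=> hc hn; rewrite exprMn hc hn; ring. Qed.

Let eigen_across0 (l m A B U V : R) (c n : R) : c ^+ 2 = m -> n ^+ 2 = A ^+ 2 + B ^+ 2 ->
  (n ^+ 2 * 1 - A * A) * ((l + m) * A * (A * U + B * V) + m * (A ^+ 2 + B ^+ 2) * U) +
  (n ^+ 2 * 0 - A * B) * ((l + m) * B * (A * U + B * V) + m * (A ^+ 2 + B ^+ 2) * V) =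
  (c * n) ^+ 2 * ((n ^+ 2 * 1 - A * A) * U + (n ^+ 2 * 0 - A * B) * V).
Proof. by move=> hc hn; rewrite exprMn hc hn; ring. Qed.

Let eigen_across1 (l m A B U V : R) (c n : R) : c ^+ 2 = m -> n ^+ 2 = A ^+ 2 + B ^+ 2 ->
  (n ^+ 2 * 0 - B * A) * ((l + m) * A * (A * U + B * V) + m * (A ^+ 2 + B ^+ 2) * U) +
  (n ^+ 2 * 1 - B * B) * ((l + m) * B * (A * U + B * V) + m * (A ^+ 2 + B ^+ 2) * V) =
  (c * n) ^+ 2 * ((n ^+ 2 * 0 - B * A) * U + (n ^+ 2 * 1 - B * B) * V).
Proof. by move=> hc hn; rewrite exprMn hc hn; ring. Qed.

Let exact_alg0 (n A B d1 d2 U V : R) : n != 0 -> n ^+ 2 = A ^+ 2 + B ^+ 2 ->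
  2 / n ^+ 2 * (A * d2 * (d1 * (A * U + B * V)) + d1 * (d2 * ((n ^+ 2 * 1 - A * A) * U + (n ^+ 2 *
    0 - A * B) * V)))
  = 2 * (d1 * d2) * U.
Proof. by move=> n0 hn; rewrite -(@mulKf _ (n ^+ 2) _ (2 * (d1 * d2) * U)) ?expf_neq0//; field. Qed.

Let exact_alg1 (n A B d1 d2 U V : R) : n != 0 -> n ^+ 2 = A ^+ 2 + B ^+ 2 ->
  2 / n ^+ 2 * (B * d2 * (d1 * (A * U + B * V)) + d1 * (d2 * ((n ^+ 2 * 0 - B * A) * U + (n ^+ 2 *
    1 - B * B) * V)))
  = 2 * (d1 * d2) * V.
Proof. by move=> n0 hn; rewrite -(@mulKf _ (n ^+ 2) _ (2 * (d1 * d2) * V)) ?expf_neq0//; field. Qed.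

(** The compressional and shear parts recombine by a_j (a.f) + (|a|^2 f_j - a_j (a.f)) = |a|^2 f_j,
    which cancels the division by |a|^2. *)
Lemma gj_exact (u : 'I_2 -> R -> R * R -> R) (f : 'I_2 -> R * R -> R) I j a : is_data T I ->
  inverse_solution T lam mu I u f -> (forall k, C2L2 T (u k)) -> (forall k, L2H2 T (u k)) ->
    (forall k, L2 (f k)) ->
  gj T lam mu j I a = 2 * D T lam mu I a * ctr (f j) a.
Proof.
move=> dI sol uC2 uH2 fL2.
(* At frequency 0 the inverse in g_j is 0 by convention, and D vanishes as well. *)
have [a0|a0] := eqVneq (enorm a) 0.
  rewrite /gj a0 expr0n /= invr0 mulr0 mul0r (_ : D T lam mu I a = 0) ?mulr0 ?mul0r//.
  rewrite /D (_ : D1 T lam mu I a = 0) ?mul0r// -[RHS](Rint_zero (lebT T)).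
  by apply: eq_Rintegral => t _; rewrite a0 mulr0 mul0r sin0 mulr0.
have cc1 : c1 ^+ 2 = lam + 2 * mu by rewrite sqr_sqrtr// ltW.
have cc2 : c2 ^+ 2 = mu by rewrite sqr_sqrtr// ltW.
have E0 := hgen_exact T0 dI sol uC2 uH2 fL2 (p := fun k => crd k a) (alongE a)
  (fun U => eigen_along (U 0) (U 1) cc1 (enorm2 a)).
have Ej : hgen T c2 (across j a) I a = D2 T mu I a * (shear_coef j a 0 * ctr (f 0) a + shear_coef j
  a 1 * ctr (f 1) a).
  apply: (hgen_exact T0 dI sol uC2 uH2 fL2 (p := shear_coef j a) (acrossE j a)) => U.
  clear E0; rewrite /shear_coef; elim/ord2P: j.
    exact: eigen_across0 cc2 (enorm2 a).
  exact: eigen_across1 cc2 (enorm2 a).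
rewrite /gj /h0 /hj E0 Ej /D.
clear E0 Ej; rewrite /shear_coef; elim/ord2P: j.
  exact: exact_alg0 a0 (enorm2 a).
exact: exact_alg1 a0 (enorm2 a).
Qed.

End reconstruction_formula.

(** * The regularized solution *)

Section disc_supported.
Context (R : realType).
Local Notation mT := (measurableTypeR R).
Local Notation P2 := (mT * mT)%type.
Local Notation leb := (@lebesgue_measure R).
Implicit Types (a x : R * R) (q C f : R * R -> R).

(** Pointwise limit of g / (g^2 + 1 / (n + 1)); where g vanishes both the limit and the inverse are
    0. *)
Lemma measurable_inv d (U : measurableType d) (g : U -> R) : measurable_fun setT g ->
  measurable_fun setT (fun z => (g z)^-1).
Proof.
move=> mg; pose h (n : nat) (z : U) : R := g z * (g z ^+ 2 + n.+1%:R^-1)^-1.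
have pos n (y : R) : 0 < y ^+ 2 + n.+1%:R^-1 by rewrite ltr_wpDl ?sqr_ge0// invr_gt0.
apply: (measurable_fun_cvg (h := h)) => [n|z _].
  apply: (measurableT_comp (f := fun y : R => y * (y ^+ 2 + n.+1%:R^-1)^-1)) => //.
  apply: continuous_measurable_fun => y; apply: cvgM; first exact: cvg_id.
  apply: cvgV; first by rewrite gt_eqF.
  by apply: cvgD; [exact: exprn_continuous|exact: cvg_cst].
have [g0|g0] := eqVneq (g z) 0.
  by rewrite /h g0 invr0; under eq_fun do rewrite mul0r; exact: cvg_cst.
have -> : (g z)^-1 = g z * (g z ^+ 2 + 0)^-1 by field.
apply: cvgM; first exact: cvg_cst.
apply: cvgV; first by rewrite addr0 expf_neq0.
apply: cvgD; first exact: cvg_cst.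
exact: cvg_harmonic.
Qed.

Variable r : R.
Hypothesis r0 : 0 < r.

Definition disc a : R := (enorm a < r)%R%:R.

Lemma measurable_disc : measurable_fun (setT : set P2) disc.
Proof.
apply: measurable_natr_bool; apply: measurable_fun_ltr => //.
exact: measurable_enorm.
Qed.

Let box (y : R) : R := \1_(`[- r, r]%classic : set mT) y.

Let box_intg : intg leb box /\ \int[leb]_y box y = 2 * r.
Proof.
have mI : measurable (`[- r, r]%classic : set mT) by exact: measurable_itv.
have L : (\int[leb]_x (box x)%:E = (2 * r)%:E)%E.
  rewrite integral_indic// setIT; apply: etrans (lebesgue_measure_itv _) _; rewrite /= lte_fin.
  by rewrite gtrN// opprK -EFinD; congr _%:E; lra.
split; last by rewrite /Rintegral L.
apply/integrableP; split; first by apply/measurable_EFinP; exact: measurable_indic.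
rewrite (_ : (\int[leb]_x _)%E = (2 * r)%:E) ?ltry// -L.
by apply: eq_integral => x _ /=; rewrite ger0_norm// /box indicE.
Qed.

Lemma disc_intg : intg leb2 disc /\ \int[leb2]_a disc a <= 4 * r ^+ 2.
Proof.
have [ib Eb] := box_intg.
have i2 : intg leb2 (fun a : P2 => box a.1 * box a.2) by exact: (intg_prod (m := lebesgue R) (nu :=
  lebesgue R) ib ib).
have le a : disc a <= box a.1 * box a.2.
  rewrite /disc /box !indicE -natrM mulnb ler_nat.
  case: ltP => // ar; rewrite !mem_set//= in_itv /= -ler_norml; apply: le_trans (ltW ar).
    exact: (crd_le_enorm 1 a).
  exact: (crd_le_enorm 0 a).
have d0 a : 0 <= disc a by have /andP[] := natr01 R (enorm a < r).
have id_ : intg leb2 disc.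
  by apply: intg_le i2 => [|a]; [exact: measurable_disc|rewrite ger0_norm].
split => //; apply: (le_trans (Rint_le id_ i2 le)).
have E := @Rint_prod _ _ mT mT R (lebesgue R) (lebesgue R) box box ib ib.
rewrite (_ : \int[leb2]_x _ = 2 * r * (2 * r)); last by apply: etrans E _; rewrite Eb.
by rewrite le_eqVlt; apply/orP; left; apply/eqP; ring.
Qed.

Variables (q : R * R -> R) (Q : R).
Hypothesis mq : measurable_fun (setT : set P2) q.
Hypothesis qQ : forall a, enorm a < r -> `|q a| <= Q.

Let G a : R := disc a * q a.

Let Q0 : 0 <= Q.
Proof. by apply: le_trans (qQ (a := (0, 0)) _) => //; rewrite enormE /= expr0n /= addr0 sqrtr0. Qed.

Let mG : measurable_fun (setT : set P2) G.
Proof. exact: measurable_funM measurable_disc mq. Qed.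

Let Gb a : `|G a| <= Q * disc a.
Proof.
rewrite /G /disc; case: ltP => [ar|_]; last by rewrite mul0r mulr0 normr0.
by rewrite mul1r mulr1; exact: qQ.
Qed.

Lemma disc_mul_intg : intg leb2 G.
Proof. by have [id_ _] := disc_intg; apply: intg_le (intgZ Q id_). Qed.

Lemma disc_mul_sqint : sqint leb2 G.
Proof.
split => //; have [id_ _] := disc_intg; apply: intg_le (intgZ (Q ^+ 2) id_);
  first exact: measurable_funX.
move=> a; rewrite ger0_norm ?sqr_ge0// -(real_normK (num_real (G a))).
apply: le_trans (_ : (Q * disc a) ^+ 2 <= _);
  first by rewrite ler_sqr ?nnegrE// (le_trans _ (Gb a)).
by rewrite exprMn /disc; case: ltP; rewrite ?expr1n ?expr0n.
Qed.

Lemma icos_lipschitz x y : `|icos G x - icos G y| <=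
  r * (`|x.1 - y.1| + `|x.2 - y.2|) * \int[leb2]_a `|G a|.
Proof.
have iG := disc_mul_intg.
have mc z : measurable_fun (setT : set P2) (fun a : P2 => cos (dot a z)).
  apply: continuous_measurable2 => a.
  by apply: (@continuous_comp _ _ _ (fun a => dot a z) cos);
    [exact: continuous_dot|exact: continuous_cos].
have j z : intg leb2 (fun a => G a * cos (dot a z)) by exact: (intg_mulb iG (mc z) (fun=> cos_max
  _)).
have jB := intgB (j x) (j y).
rewrite /icos -(RintB (j x) (j y)); apply: le_trans (Rint_norm jB) _.
rewrite -(RintZ _ (intg_norm iG)); apply: Rint_le (intg_norm jB) (intgZ _ (intg_norm iG)) _ => a.
rewrite -mulrBr normrM mulrC /G /disc; case: ltP => ar; last by rewrite !mul0r normr0 !mulr0.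
apply: ler_wpM2r; first exact: normr_ge0.
apply: le_trans (cos_lipschitz _ _) _; rewrite !dotE.
rewrite (_ : _ - _ = a.1 * (x.1 - y.1) + a.2 * (x.2 - y.2)); last by ring.
apply: le_trans (ler_normD _ _) _; rewrite !normrM mulrDr; apply: lerD; apply: ler_wpM2r => //.
  exact: le_trans (crd_le_enorm 0 a) (ltW ar).
exact: le_trans (crd_le_enorm 1 a) (ltW ar).
Qed.

Lemma icos_continuous : continuous (icos G).
Proof.
move=> y; pose B (x : R * R) : R := r * (`|x.1 - y.1| + `|x.2 - y.2|) * \int[leb2]_a `|G a|.
have cst_ (s : R) : s @[x --> y] --> s by exact: cvg_cst.
have B0 : B x @[x --> y] --> B y.
  apply: cvgM; last exact: cst_; apply: cvgM; first exact: cst_.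
  apply: cvgD; apply: cvg_norm; apply: cvgB; try exact: cst_.
    exact: cvg_fst. exact: cvg_snd.
have By : B y = 0 by rewrite /B !subrr !normr0 addr0 mulr0 mul0r.
rewrite By in B0.
apply/cvgrPdist_lt => e e0; have /cvgrPdist_lt/(_ e e0) := B0.
apply: filterS => x; rewrite sub0r normrN distrC => /(le_lt_trans (ler_norm _)); apply: le_lt_trans.
exact: icos_lipschitz.
Qed.

Let opp2 (a : P2) : P2 := (- a.1, - a.2).

Let mopp2 : measurable_fun setT opp2.
Proof.
apply: measurable_fun_pair.
  by apply: (measurableT_comp (f := -%R : mT -> mT));
    [exact: oppr_measurable|exact: measurable_fst].
by apply: (measurableT_comp (f := -%R : mT -> mT)); [exact: oppr_measurable|exact: measurable_snd].
Qed.

Let opp2_leb2 (B : set P2) : measurable B -> leb2 (opp2 @^-1` B) = leb2 B.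
Proof.
move=> mB; have H := @product_measure_unique _ _ _ _ R (lebesgue R) (lebesgue R) (pushforward
  (@leb2 R) opp2).
apply/esym; apply: H => // A1 A2 m1 m2.
have mo : measurable_fun setT (-%R : mT -> mT) by exact: oppr_measurable.
have mp (A : set mT) : measurable A -> measurable ((-%R : mT -> mT) @^-1` A).
  by move=> mA; rewrite -[X in measurable X]setTI; exact: mo.
rewrite [LHS](_ : _ = (lebesgue R \x lebesgue R)%E (((-%R : mT -> mT) @^-1` A1) `*` ((-%R : mT ->
  mT) @^-1` A2))); last first.
  by congr (product_measure1 _ _); apply/seteqP; split => -[a b].
rewrite product_measure1E; [|exact: mp|exact: mp].
by congr (_ * _)%E; exact: lebesgue_measureN.
Qed.

Lemma Rint_odd f : intg leb2 f -> (forall a, f (- a) = - f a) -> \int[leb2]_a f a = 0.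
Proof.
move=> fi fN; have [_] := Rint_invariant mopp2 opp2_leb2 fi.
rewrite (_ : \int[leb2]_x _ = - \int[leb2]_a f a); first lra.
rewrite -(RintN fi); apply: eq_Rintegral => a _; rewrite -fN; congr f.
Qed.

End disc_supported.

Section regularized_error.
Context (R : realType).
Local Notation mT := (measurableTypeR R).
Local Notation P2 := (mT * mT)%type.
Implicit Types (a x : R * R).

(** Tikhonov filtering: the error is d (g - 2 d C) / (delta + d^2), the propagated residual, minus 2
    C delta / (delta + d^2), the bias. *)
Lemma regularized_pointwise (g d C delta w t : R) : 0 < delta -> `|g - 2 * d * C| <= w ->
  delta / (delta + d ^+ 2) <= t ->
  (g * d / (delta + d ^+ 2) - 2 * C) ^+ 2 <= w ^+ 2 / (2 * delta) + 8 * C ^+ 2 * t ^+ 2.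
Proof.
move=> dl0 hw ht; have den : 0 < delta + d ^+ 2 by rewrite ltr_pwDl ?sqr_ge0.
set A := d * (g - 2 * d * C) / (delta + d ^+ 2); set B := 2 * C * (delta / (delta + d ^+ 2)).
rewrite (_ : _ - 2 * C = A - B); last by rewrite /A /B; field; rewrite gt_eqF.
have AB : (A - B) ^+ 2 <= 2 * A ^+ 2 + 2 * B ^+ 2.
  by have := sqr_ge0 (A + B); rewrite sqrrD sqrrB; lra.
apply: (le_trans AB); apply: lerD.
  rewrite /A !exprMn exprVn.
  have w2 : (g - 2 * d * C) ^+ 2 <= w ^+ 2.
    by rewrite -(real_normK (num_real (g - _))) ler_sqr ?nnegrE// (le_trans _ hw).
  (* Arithmetic-geometric mean: (delta + d^2)^2 >= 4 delta d^2. *)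
  have d2 : d ^+ 2 / (delta + d ^+ 2) ^+ 2 <= 1 / (4 * delta).
    rewrite ler_pdivrMr ?exprn_gt0// mulrAC mul1r ler_pdivlMr ?mulr_gt0//.
    by have := sqr_ge0 (delta - d ^+ 2); rewrite sqrrB sqrrD; lra.
  rewrite (_ : w ^+ 2 / (2 * delta) = 2 * ((1 / (4 * delta)) * w ^+ 2)); last by field;
    rewrite gt_eqF.
  rewrite ler_pM2l// mulrAC; apply: ler_pM => //; rewrite ?sqr_ge0//.
  by rewrite divr_ge0 ?sqr_ge0.
have t0 : 0 <= delta / (delta + d ^+ 2) by rewrite divr_ge0 ?ltW.
rewrite /B !exprMn (_ : 8 * C ^+ 2 * t ^+ 2 = 2 * (2 ^+ 2 * C ^+ 2 * t ^+ 2)); last by ring.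
rewrite ler_pM2l//; apply: ler_wpM2l; first by apply: mulr_ge0; exact: sqr_ge0.
rewrite -exprMn ler_sqr ?nnegrE//; exact: le_trans t0 ht.
Qed.

(** q will be the regularized quotient, w the residual of the data, s a bound of the filter factor
    off the exceptional set, e the weight of that set, S and Tl the masses of (ctr f)^2 on it and
    outside the disc. The four terms of the final bound follow this list. *)
Variables (f : R * R -> R) (q e : R * R -> R) (r w delta s Q S Tl : R).
Hypotheses (sf : sqint lebO f) (r0 : 0 < r) (delta0 : 0 < delta).
Hypotheses (mq : measurable_fun (setT : set P2) q) (qQ : forall a, enorm a < r -> `|q a| <= Q).
Hypothesis qe : forall a, enorm a < r ->
  (q a - 2 * ctr f a) ^+ 2 <= w ^+ 2 / (2 * delta) + 8 * ctr f a ^+ 2 * (s ^+ 2 + e a).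
Hypotheses (e0 : forall a, 0 <= e a).
Hypotheses (ie : intg leb2 (fun a => ctr f a ^+ 2 * e a)) (Se : \int[leb2]_a (ctr f a ^+ 2 * e a)
  <= S).
Hypotheses (iT : intg leb2 (fun a => ctr f a ^+ 2 * (r <= enorm a)%R%:R))
  (Te : \int[leb2]_a (ctr f a ^+ 2 * (r <= enorm a)%R%:R) <= Tl).

Let G a : R := disc r a * q a.

Let inside_alg (v W c s2 z : R) (x : R) : (v - 2 * x) ^+ 2 <= W + 8 * c * (s2 + z) ->
  (1 * v - 2 * x) ^+ 2 <= W * 1 + 8 * s2 * c + 8 * (c * z) + 4 * (c * 0).
Proof. by rewrite mul1r mulr1 !mulr0 addr0 => H; apply: le_trans H _; rewrite le_eqVlt; apply/orP;
  left; apply/eqP; ring. Qed.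

Let outside_alg (v W s2 z x : R) : 0 <= s2 * x ^+ 2 -> 0 <= x ^+ 2 * z ->
  (0 * v - 2 * x) ^+ 2 <= W * 0 + 8 * s2 * x ^+ 2 + 8 * (x ^+ 2 * z) + 4 * (x ^+ 2 * 1).
Proof. by move=> h1 h2; rewrite mul0r sub0r sqrrN exprMn mulr0 mulr1; lra. Qed.

Lemma regularized_error : sqint lebO (icos G) /\
  \int[lebO]_x ((4 * pi ^+ 2)^-1 * icos G x - f x) ^+ 2 <= (8 * pi ^+ 2)^-1 *
    (2 * w ^+ 2 * r ^+ 2 / delta + 16 * pi ^+ 2 * s ^+ 2 * (\int[lebO]_x f x ^+ 2) + 8 * S + 4 *
      Tl).
Proof.
have iG := disc_mul_intg r0 mq qQ; have sG := disc_mul_sqint r0 mq qQ.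
have [sI err] := icos_error iG sG sf; split => //; apply: (le_trans err).
apply: ler_wpM2l; first by rewrite invr_ge0 mulr_ge0 ?sqr_ge0.
have [id_ ld] := disc_intg r0; have [mC iC] := sqint_ctr sf.
pose h1 a := w ^+ 2 / (2 * delta) * disc r a.
pose h2 a := 8 * s ^+ 2 * ctr f a ^+ 2.
pose h3 a := 8 * (ctr f a ^+ 2 * e a).
pose h4 a := 4 * (ctr f a ^+ 2 * (r <= enorm a)%R%:R).
have i1 : intg leb2 h1 := intgZ _ id_.
have i2 : intg leb2 h2 := intgZ _ iC.
have i3 : intg leb2 h3 := intgZ _ ie.
have i4 : intg leb2 h4 := intgZ _ iT.
have i12 := intgD i1 i2; have i123 := intgD i12 i3; have i1234 := intgD i123 i4.
have sd : sqint leb2 (fun a => G a - 2 * ctr f a) by exact: (sqintB sG (sqintZ 2 (sqint_ctr sf))).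
have c0 : 0 <= w ^+ 2 / (2 * delta) by rewrite divr_ge0 ?sqr_ge0 ?mulr_ge0 ?(ltW delta0).
have le a : (G a - 2 * ctr f a) ^+ 2 <= h1 a + h2 a + h3 a + h4 a.
  have C2 := sqr_ge0 (ctr f a); have Ce := mulr_ge0 C2 (e0 a); have sC := mulr_ge0 (sqr_ge0 s) C2.
  rewrite /G /h1 /h2 /h3 /h4 /disc; case: (ltP (enorm a) r) => ar.
    exact: inside_alg (qe ar).
  exact: outside_alg sC Ce.
apply: (le_trans (Rint_le (proj2 sd) i1234 le)).
rewrite (RintD i123 i4) (RintD i12 i3) (RintD i1 i2) (RintZ _ id_) (RintZ _ iC) (RintZ _ ie) (RintZ
  _ iT) (ctr_square sf).
have H1 : w ^+ 2 / (2 * delta) * \int[leb2]_a disc r a <= 2 * w ^+ 2 * r ^+ 2 / delta.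
  apply: le_trans (ler_wpM2l c0 ld) _; rewrite le_eqVlt; apply/orP; left; apply/eqP.
  by field; rewrite gt_eqF.
apply: lerD; last by rewrite ler_pM2l.
apply: lerD; last by rewrite ler_pM2l.
apply: lerD; first exact: H1.
rewrite le_eqVlt; apply/orP; left; apply/eqP; move: (\int[lebO]_x _) (pi ^+ 2) => F p2; ring.
Qed.

End regularized_error.

Section regularized_solution.
Context (R : realType).
Local Notation mT := (measurableTypeR R).
Local Notation P2 := (mT * mT)%type.
Variables (T lam mu : R).
Hypotheses (T0 : 0 < T) (mu0 : 0 < mu) (lam2mu0 : 0 < lam + 2 * mu).
Implicit Types (I J : data R) (a : R * R) (j k : 'I_2).

Let c1 := Num.sqrt (lam + 2 * mu).
Let c2 := Num.sqrt mu.
Let c10 : 0 <= c1. Proof. exact: sqrtr_ge0. Qed.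
Let c20 : 0 <= c2. Proof. exact: sqrtr_ge0. Qed.

Definition spectral_bound I K := forall a, [/\ `|divisor T c1 I a| <= K * enorm a, `|divisor T c2 I
  a| <= K * enorm a,
  forall k, `|mode T c1 I k a| <= K * enorm a & forall k, `|mode T c2 I k a| <= K * enorm a].

Let enorm_ge0 a : 0 <= enorm a. Proof. exact: sqrtr_ge0. Qed.

Lemma spectral_bound_exists I : is_data T I -> exists2 K, 0 <= K & spectral_bound I K.
Proof.
move=> dI; have [K1 K10 H1] := mode_bound T0 c10 dI; have [K2 K20 H2] := mode_bound T0 c20 dI.
set F := \int[lebT T]_t `|phi I t|; have F0 : 0 <= F by exact: Rint_ge0.
have m1 : 0 <= c1 * T * F by rewrite !mulr_ge0// ltW.
have m2 : 0 <= c2 * T * F by rewrite !mulr_ge0// ltW.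
exists (K1 + K2 + c1 * T * F + c2 * T * F); first by rewrite !addr_ge0.
move=> a; have W (x y : R) : x <= y -> x * enorm a <= y * enorm a by exact: ler_wpM2r.
split=> [||k|k].
- by apply: le_trans (divisor_bound T0 c10 a dI) _; apply: W; rewrite -/F; lra.
- by apply: le_trans (divisor_bound T0 c20 a dI) _; apply: W; rewrite -/F; lra.
- by apply: le_trans (H1 k a) _; apply: W; lra.
- by apply: le_trans (H2 k a) _; apply: W; lra.
Qed.

Let shift_bound (x y B D E n eps : R) : `|y| <= B * n -> `|x - y| <= D * eps * n -> D <= E -> 0 <=
  E -> 0 <= n ->
  0 <= eps <= 1 -> `|x| <= (B + E) * n.
Proof.
move=> hy hxy DE E0 n0 /andP[e0 e1]; rewrite -[x](subrK y); apply: le_trans (ler_normD _ _) _.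
rewrite addrC mulrDl; apply: lerD => //; apply: (le_trans hxy); apply: ler_wpM2r => //.
by apply: le_trans (ler_wpM2r e0 DE) _; rewrite ler_piMr.
Qed.

Let weaken (x D K eps n : R) : x <= D * eps * n -> D <= K -> 0 <= eps -> 0 <= n -> x <= K * eps * n.
Proof. by move=> h DK e0 n0; apply: (le_trans h); do 2 apply: ler_wpM2r => //. Qed.

Let stability_const1 (K e n2 : R) : 0 <= K -> 0 <= e -> 0 <= n2 -> 24 * K * (K * e) * n2 <= (26 * K
  * K + 1) * e * n2.
Proof.
move=> K0 e0 n0; apply: ler_wpM2r => //; have := mulr_ge0 (mulr_ge0 K0 K0) e0 => h.
rewrite (_ : 24 * K * (K * e) = 24 * (K * K * e)); last by ring.
rewrite (_ : (26 * K * K + 1) * e = 26 * (K * K * e) + e); last by ring.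
by lra.
Qed.

Let stability_const2 (K e n2 : R) : 0 <= K -> 0 <= e -> 0 <= n2 -> 2 * K * (K * e) * n2 <= (26 * K
  * K + 1) * e * n2.
Proof.
move=> K0 e0 n0; apply: le_trans (stability_const1 K0 e0 n0); apply: ler_wpM2r => //;
  apply: ler_wpM2r; first exact: mulr_ge0.
by apply: ler_wpM2r => //; lra.
Qed.

Let gformN (n aj x y p q d1 d2 m0 m1 m0' m1' : R) :
  gform n (- aj) (- x) (- y) p q d1 d2 m0 m1 m0' m1' = gform n aj x y p q d1 d2 m0 m1 m0' m1'.
Proof. by rewrite /gform; congr (_ * (_ + _)); ring. Qed.

(** The constant depends on the exact data only: as eps <= 1, the perturbed divisors and modes obey
    bounds of the same form, enlarged by E. *)
Lemma data_stability Iex : is_data T Iex -> exists2 K, 0 < K & forall eps I, 0 <= eps <= 1 ->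
  is_data T I -> data_close T eps I Iex -> forall j a,
  `|gj T lam mu j I a - gj T lam mu j Iex a| <= K * eps * enorm a ^+ 2 /\
  `|D T lam mu I a - D T lam mu Iex a| <= K * eps * enorm a ^+ 2.
Proof.
move=> dJ; have [B B0 HB] := spectral_bound_exists dJ.
pose E := (c1 + c2) * (3 * T + 2).
have cT (c : R) : 0 <= c -> c * T <= c * (2 * T + 2).
  by move=> c0; rewrite ler_wpM2l//; have := T0; lra.
have E1 : c1 * (2 * T + 2) <= E.
  apply: ler_pM => //; [by have := T0; lra|by rewrite lerDl|by have := T0; lra].
have E2 : c2 * (2 * T + 2) <= E.
  apply: ler_pM => //; [by have := T0; lra|by rewrite lerDr|by have := T0; lra].
have E0 : 0 <= E by rewrite mulr_ge0 ?addr_ge0 ?mulr_ge0 ?(ltW T0).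
pose K0 := B + E; have K00 : 0 <= K0 by rewrite addr_ge0.
have BK : B <= K0 by rewrite lerDl. have EK : E <= K0 by rewrite lerDr.
exists (26 * K0 * K0 + 1); first by rewrite ltr_wpDl ?mulr_ge0.
move=> eps I e01 dI cl j a; have /andP[e0 e1] := e01.
have n0 := enorm_ge0 a; have [b1 b2 b3 b4] := HB a.
have s1 := divisor_sub T0 c10 a dI dJ cl; have s2 := divisor_sub T0 c20 a dI dJ cl.
have s3 k := mode_sub T0 c10 k a dI dJ cl; have s4 k := mode_sub T0 c20 k a dI dJ cl.
have E1' := le_trans (cT c1 c10) E1; have E2' := le_trans (cT c2 c20) E2.
have d1 := shift_bound b1 s1 E1' E0 n0 e01; have d2 := shift_bound b2 s2 E2' E0 n0 e01.
have d3 k := shift_bound (b3 k) (s3 k) E1 E0 n0 e01;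
  have d4 k := shift_bound (b4 k) (s4 k) E2 E0 n0 e01.
have w1 := weaken s1 (le_trans E1' EK) e0 n0; have w2 := weaken s2 (le_trans E2' EK) e0 n0.
have w3 k := weaken (s3 k) (le_trans E1 EK) e0 n0;
  have w4 k := weaken (s4 k) (le_trans E2 EK) e0 n0.
have b1' := le_trans b1 (ler_wpM2r n0 BK); have b2' := le_trans b2 (ler_wpM2r n0 BK).
have ke : 0 <= K0 * eps by rewrite mulr_ge0.
have pos : 0 <= K0 * K0 * eps by rewrite !mulr_ge0.
split.
  rewrite !gjE//.
  apply: le_trans (gform_sub n0 K00 ke (crd_le_enorm j a) (crd_le_enorm 0 a) (crd_le_enorm 1 a)
    (shear_coef_le j a 0) (shear_coef_le j a 1) (And4 d1 d2 (d3 0) (d3 1)) (d4 0) (d4 1) b1' b2'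
    (And4 w1 w2 (w3 0) (w3 1)) (w4 0) (w4 1)) _.
  exact: stability_const1 K00 e0 (sqr_ge0 _).
apply: le_trans (divisor_prod_sub d2 b1' w1 w2) _.
exact: stability_const2 K00 e0 (sqr_ge0 _).
Qed.

(** The stability estimate [gform_sub] with zero as the second argument. *)
Lemma gj_bound I : is_data T I -> exists2 K, 0 <= K & forall j a, `|gj T lam mu j I a| <= K * enorm
  a ^+ 2.
Proof.
move=> dI; have [K K0 HK] := spectral_bound_exists dI; exists (24 * K * K);
  first by rewrite !mulr_ge0.
move=> j a; have [b1 b2 b3 b4] := HK a; rewrite gjE//.
have n0 := enorm_ge0 a.
have z : `|(0:R)| <= K * enorm a by rewrite normr0 mulr_ge0.
have sb (x : R) : `|x| <= K * enorm a -> `|x - 0| <= K * enorm a by rewrite subr0.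
have := gform_sub n0 K0 K0 (crd_le_enorm j a) (crd_le_enorm 0 a) (crd_le_enorm 1 a)
    (shear_coef_le j a 0) (shear_coef_le j a 1) (And4 b1 b2 (b3 0) (b3 1)) (b4 0) (b4 1) z z
    (And4 (sb _ b1) (sb _ b2) (sb _ (b3 0)) (sb _ (b3 1))) (sb _ (b4 0)) (sb _ (b4 1)).
by rewrite [X in `|_ - X|]/gform !mulr0 !mul0r !addr0 mulr0 subr0.
Qed.

Let measurable_crd k : measurable_fun (setT : set P2) (crd k : R * R -> R).
Proof. by rewrite /crd; case: (k == 0); [exact: measurable_fst|exact: measurable_snd]. Qed.

Lemma measurable_D I : is_data T I -> measurable_fun (setT : set P2) (D T lam mu I).
Proof. by move=> dI; exact: measurable_funM (measurable_divisor T0 c10 dI) (measurable_divisor T0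
  c20 dI). Qed.

Lemma measurable_gj j I : is_data T I -> measurable_fun (setT : set P2) (gj T lam mu j I).
Proof.
move=> dI; have -> : gj T lam mu j I = fun a => gform (enorm a) (crd j a) (crd 0 a) (crd 1 a)
  (shear_coef j a 0) (shear_coef j a 1)
    (divisor T c1 I a) (divisor T c2 I a) (mode T c1 I 0 a) (mode T c1 I 1 a) (mode T c2 I 0 a)
      (mode T c2 I 1 a).
  by apply/funext => a; exact: gjE.
have me2 : measurable_fun (setT : set P2) (fun a : R * R => enorm a ^+ 2).
  by apply: measurable_funX; exact: measurable_enorm.
have ms k : measurable_fun (setT : set P2) (fun a : R * R => shear_coef j a k).
  by apply: measurable_funB; apply: measurable_funM.
have md1 := measurable_divisor T0 c10 dI; have md2 := measurable_divisor T0 c20 dI.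
have mm1 k := measurable_mode T0 c10 k dI; have mm2 k := measurable_mode T0 c20 k dI.
apply: measurable_funM; first by apply: measurable_funM => //; exact: measurable_inv.
apply: measurable_funD.
  apply: measurable_funM; first exact: measurable_funM.
  by apply: measurable_funD; exact: measurable_funM.
by apply: measurable_funM => //; apply: measurable_funD; exact: measurable_funM.
Qed.

Definition quotient j I (dl : R) a : R := gj T lam mu j I a * D T lam mu I a / (dl + D T lam mu I a
  ^+ 2).

Lemma measurable_quotient j I dl : is_data T I -> measurable_fun (setT : set P2) (quotient j I dl).
Proof.
move=> dI; have mD := measurable_D dI; have mg := measurable_gj j dI.
apply: measurable_funM; first exact: measurable_funM.
by apply: measurable_inv; apply: measurable_funD => //; exact: measurable_funX.
Qed.

Lemma quotient_bound j I dl r : is_data T I -> 0 < dl -> 0 < r ->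
  exists Q, forall a, enorm a < r -> `|quotient j I dl a| <= Q.
Proof.
move=> dI dl0 r0; have [K K0 HK] := gj_bound dI; exists (K * r ^+ 2 * (1 + dl^-1)) => a ar.
have den : 0 < dl + D T lam mu I a ^+ 2 by rewrite ltr_pwDl ?sqr_ge0.
rewrite /quotient -mulrA normrM; apply: ler_pM => //.
  apply: le_trans (HK j a) _; apply: ler_wpM2l => //.
  by rewrite ler_sqr ?nnegrE ?(ltW r0)// ltW.
rewrite normrM normfV (gtr0_norm den); move: (D _ _ _ _ _) den => d den.
rewrite ler_pdivrMr// mulrDl mul1r.
have h1 : `|d| <= 1 + d ^+ 2.
  by have := sqr_ge0 (`|d| - 1); rewrite sqrrB real_normK ?num_real//; have := normr_ge0 d; lra.
apply: (le_trans h1); rewrite addrC; apply: lerD; first by rewrite lerDr ltW.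
by rewrite mulrC ler_pdivlMr// mul1r lerDl sqr_ge0.
Qed.

(** Evenness makes the sine part of the inverse transform the integral of an odd function, so the
    regularized solution is real. *)
Lemma quotientN j I dl a : is_data T I -> quotient j I dl (- a) = quotient j I dl a.
Proof.
move=> dI; have DN : D T lam mu I (- a) = D T lam mu I a by rewrite /D /D1 /D2 !enormN.
have cN k : crd k (- a) = - crd k a by rewrite /crd; case: ifP.
have sN k : shear_coef j (- a) k = shear_coef j a k by rewrite /shear_coef enormN !cN mulrNN.
have gN : gj T lam mu j I (- a) = gj T lam mu j I a.
  have gE b := gjE lam mu T0 j b dI.
  rewrite (gE (- a)) (gE a).
  have e1 := divisorN T c1 I a; have e2 := divisorN T c2 I a.
  have f1 k := modeN T c1 I k a; have f2 k := modeN T c2 I k a.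
  rewrite (enormN a) e1 e2 (f1 0) (f1 1) (f2 0) (f2 1) (cN j) (cN 0) (cN 1) (sN 0) (sN 1).
  exact: gformN.
by rewrite /quotient DN gN.
Qed.

Let q_mulC j I dl a (xi : R * R) : ((gj T lam mu j I a * D T lam mu I a / (dl + D T lam mu I a ^+
  2))%:C)%C * expi (dot xi a) =
  ((quotient j I dl a * cos (dot a xi)) +i* (quotient j I dl a * sin (dot a xi)))%C.
Proof.
have -> : dot xi a = dot a xi by rewrite !dotE; ring.
rewrite /quotient /expi; move: (_ / _) (dot a xi) => q t.
by rewrite /GRing.mul /= !mul0r subr0 addr0.
Qed.

Let Rint_disc (r : R) (h : R * R -> R) : \int[leb2]_(a in [set a | enorm a < r]) h a = \int[leb2]_a
  (disc r a * h a).
Proof.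
rewrite /Rintegral; congr fine; rewrite integral_mkcond; apply: eq_integral => a _.
rewrite patchE /disc; case: ifPn => [|]; rewrite ?notin_setE ?inE /=.
  by move=> ->; rewrite mul1r.
by move=> /negP/negbTE ->; rewrite mul0r.
Qed.

Let ReM (k x y : R) : complex.Re ((k%:C)%C * (x +i* y)%C) = k * x.
Proof. by rewrite /GRing.mul /= mul0r subr0. Qed.

Let ImM (k x y : R) : complex.Im ((k%:C)%C * (x +i* y)%C) = k * y.
Proof. by rewrite /GRing.mul /= mul0r addr0. Qed.

Lemma fregE j I eps xi :
  complex.Re (freg T lam mu j I eps xi) =
    (4 * pi ^+ 2)^-1 * icos (fun a => disc (Reps T eps) a * quotient j I (delta eps) a) xi /\
  complex.Im (freg T lam mu j I eps xi) =
    (4 * pi ^+ 2)^-1 * \int[leb2]_a (disc (Reps T eps) a * quotient j I (delta eps) a * sin (dot a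
      xi)).
Proof.
rewrite /freg /Cintegral /icos.
under [in X in (X +i* _)%C]eq_Rintegral => a _ do rewrite q_mulC /=.
under [in X in (_ +i* X)%C]eq_Rintegral => a _ do rewrite q_mulC /=.
rewrite !Rint_disc ReM ImM div1r.
by split; congr (_ * _); apply: eq_Rintegral => a _; exact: mulrA.
Qed.

Lemma freg_real_continuous j I eps : is_data T I -> 0 < delta eps -> 0 < Reps T eps ->
  (forall xi, complex.Im (freg T lam mu j I eps xi) = 0) /\
  {within closure Omega, continuous (fregR T lam mu j I eps)}.
Proof.
move=> dI dl0 r0; have [Q HQ] := quotient_bound j dI dl0 r0;
  have mq := measurable_quotient j (delta eps) dI.
have iG := disc_mul_intg r0 mq HQ.
split=> [xi|].
  rewrite (proj2 (fregE _ _ _ _)) (Rint_odd (f := fun a => disc (Reps T eps) a * quotient j I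
    (delta eps) a * sin (dot a xi))) ?mulr0//.
    apply: (intg_mulb iG _ (fun=> sin_max _)); apply: continuous_measurable2 => a.
    by apply: (@continuous_comp _ _ _ (fun a => dot a xi) sin);
      [exact: continuous_dot|exact: continuous_sin].
  move=> a; rewrite /disc enormN quotientN// -mulrN -sinN; congr (_ * sin _).
  by rewrite !dotE /=; ring.
apply: continuous_subspaceT => x; rewrite /fregR.
under [fun xi => _]eq_fun do rewrite (proj1 (fregE _ _ _ _)).
have := @icos_continuous R (Reps T eps) r0 _ Q mq HQ x.
by move=> H; apply: cvgM; [exact: cvg_cst|exact: H].
Qed.

End regularized_solution.

(** * Asymptotics of the parameters in L = ln(1/eps) *)

Section asymptotics.
Context (R : realType).
Implicit Types C L M eta : R.

Lemma near_pinfty_gt0 : \forall L \near +oo, (0 : R) < L.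
Proof. by apply: nbhs_pinfty_gt; exact: num_real. Qed.

(** The seventh power covers the L^6 of the error bound and one more factor L, which allows a
    comparison with 1/r. *)
Lemma pow_expR_small C eta : 0 < eta -> \forall L \near +oo, C * (L ^+ 7 * expR (- (L / 2))) <= eta.
Proof.
move=> eta0; have [f f0 Hf] : exists2 f : R, 0 < f & forall x, 0 <= x -> x ^+ 8 / f <= expR x.
  exists (7.+1)`!%:R => [|x x0]; first by rewrite ltr0n fact_gt0.
  by apply: le_trans (expR_ge1Dxn 7 x0); rewrite lerDr; exact: ler01.
pose k : R := 2 ^+ 8 * f; have k0 : 0 < k by rewrite mulr_gt0// exprn_gt0.
near=> L.
have L0 : 0 < L by near: L; exact: near_pinfty_gt0.
have LC : `|C| * k / eta <= L by near: L; apply: nbhs_pinfty_ge; exact: num_real.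
have H : L ^+ 8 / k <= expR (L / 2).
  apply: le_trans (Hf (L / 2) _); last by rewrite divr_ge0 ?ltW.
  by rewrite expr_div_n /k invfM mulrA.
have E0 : 0 < expR (L / 2) by exact: expR_gt0.
apply: le_trans (ler_wpM2r _ (ler_norm C)) _; first by rewrite mulr_ge0 ?expR_ge0 ?exprn_ge0 ?ltW.
rewrite expRN mulrA ler_pdivrMr//; apply: le_trans (ler_wpM2l (ltW eta0) H).
rewrite (_ : eta * (L ^+ 8 / k) = (L * eta / k) * L ^+ 7); last by rewrite exprS; ring.
apply: ler_wpM2r; first by rewrite exprn_ge0 ?ltW.
by rewrite ler_pdivlMr// -ler_pdivrMr.
Unshelve. all: by end_near. Qed.

Lemma ln_near_ge M : \forall L \near +oo, M <= ln L.
Proof.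
near=> L; have L1 : expR M <= L by near: L; apply: nbhs_pinfty_ge; exact: num_real.
by rewrite -[M]expRK ler_ln ?posrE ?expR_gt0 ?(lt_le_trans (expR_gt0 M) L1).
Unshelve. all: by end_near. Qed.

Lemma log_inv_cvg : ln eps^-1 @[eps --> (0 : R)^'+] --> +oo.
Proof.
apply/cvgryPger => A _; near=> eps.
have e0 : 0 < eps by near: eps; exact: nbhs_right_gt.
have eA : eps < expR (- A) by near: eps; apply: nbhs_right_lt; exact: expR_gt0.
by rewrite lnV ?posrE// lerNr -[- A]expRK ler_ln ?posrE ?expR_gt0 ?ltW.
Unshelve. all: by end_near. Qed.

Variables (T : R).
Hypothesis T0 : 0 < T.

(** [Reps] as a function of L = ln(1/eps). *)
Definition radius L : R := (1 / 7) / (9 * expR 1 * T) * (L / ln L).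

Let k0 : 0 < (1 / 7) / (9 * expR 1 * T) :> R.
Proof. by rewrite divr_gt0 ?mulr_gt0 ?expR_gt0. Qed.

Lemma radius_gt0 L : 1 < L -> 0 < radius L.
Proof. by move=> L1; rewrite mulr_gt0// divr_gt0 ?ln_gt0// (lt_trans ltr01 L1). Qed.

Lemma radius_inv L : 1 < L -> (radius L)^-1 = 63 * expR 1 * T * (ln L / L).
Proof.
move=> L1; have l0 := ln_gt0 L1; have L0 : 0 < L by exact: lt_trans ltr01 L1.
have e0 := expR_gt0 (1 : R); rewrite /radius; field.
by rewrite !gt_eqF.
Qed.

Lemma radius_cvg : radius L @[L --> +oo] --> +oo.
Proof.
apply/cvgryPger => A _; near=> L.
have l0 : 1 <= ln L by near: L; exact: ln_near_ge.
have lA : 2 * A / ((1 / 7) / (9 * expR 1 * T)) <= ln L by near: L; exact: ln_near_ge.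
have L0 : 0 < L by near: L; exact: near_pinfty_gt0.
have H : ln L ^+ 2 / 2 <= L.
  have := expR_ge1Dxn 1 (le_trans ler01 l0); rewrite lnK ?posrE// => H.
  by apply: le_trans H; rewrite lerDr.
have ll : 0 < ln L by exact: lt_le_trans l0.
rewrite /radius; apply: le_trans (ler_wpM2l (ltW k0) (_ : ln L / 2 <= _)).
  by move: lA; rewrite ler_pdivrMr//; lra.
by rewrite ler_pdivlMr// mulrAC -expr2.
Unshelve. all: by end_near. Qed.

Lemma radius_le : \forall L \near +oo, radius L <= L.
Proof.
near=> L; have l0 : 1 <= ln L by near: L; exact: ln_near_ge.
have lA : (1 / 7) / (9 * expR 1 * T) <= ln L by near: L; exact: ln_near_ge.
have L0 : 0 < L by near: L; exact: near_pinfty_gt0.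
have ll : 0 < ln L by exact: lt_le_trans l0.
by rewrite /radius mulrA ler_pdivrMr// mulrC; apply: ler_wpM2l => //; exact: ltW.
Unshelve. all: by end_near. Qed.

Definition threshold L : R := expR (- (expR 1 * T * radius L * ln (radius L))).

(** The factor e T cancels in e T radius = L / (63 ln L), and ln radius <= ln L cancels the
    logarithm. In terms of eps, the level of the exceptional sets stays above eps^(1/63). *)
Lemma threshold_ge : \forall L \near +oo, expR (- (L / 63)) <= threshold L.
Proof.
near=> L; have L1 : 1 < L by near: L; apply: nbhs_pinfty_gt; exact: num_real.
have rL : radius L <= L by near: L; exact: radius_le.
have r0 := radius_gt0 L1; have L0 : 0 < L by exact: lt_trans ltr01 L1.
have ll := ln_gt0 L1.
rewrite /threshold ler_expR lerN2 (_ : expR 1 * T * radius L = L / 63 / ln L).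
  rewrite mulrAC -mulrA mulrC -ler_pdivlMr; last by rewrite divr_gt0.
  by rewrite divff ?gt_eqF ?divr_gt0// ler_pdivrMr// mul1r ler_ln ?posrE.
rewrite /radius; have e0 := expR_gt0 (1 : R); field.
by rewrite !gt_eqF.
Unshelve. all: by end_near. Qed.

(** K will be the stability constant of the data; the last clause lets half a power of eps absorb it
    together with the powers of r. *)
Definition deep K L := [/\ 1 < L, radius L <= L, expR (- (L / 63)) <= threshold L &
  2 * K * (L ^+ 7 * expR (- (L / 2))) <= 1].

Lemma deep_near K : \forall L \near +oo, deep K L.
Proof.
near=> L; split; [near: L; apply: nbhs_pinfty_gt; exact: num_real|near: L;
  exact: radius_le|near: L; exact: threshold_ge|].
near: L; exact: pow_expR_small.
Unshelve. all: by end_near. Qed.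

Lemma deltaE (eps : R) : 0 < eps -> delta eps = expR (- (13 / 14 * ln eps^-1)).
Proof.
by move=> e0; rewrite /delta /powR gt_eqF// lnV ?posrE//; congr expR; field.
Qed.

(** Off both exceptional sets |d1 d2| >= m^2 while the perturbation is at most m^2 / 2, so De^2 >=
    m^4 / 4 and the filter factor is at most 4 dl / m^4. On either set the factor is at most 1,
    which an indicator absorbs. *)
Lemma fit_bound (dl s m b d1 d2 De : R) : 0 < dl -> 0 < m -> `|De - d1 * d2| <= b -> b <= m ^+ 2 /
  2 ->
  4 * dl / m ^+ 4 <= s ->
  (dl / (dl + De ^+ 2)) ^+ 2 <= s ^+ 2 + ((`|d1| <= m)%R%:R + (`|d2| <= m)%R%:R).
Proof.
move=> dl0 m0 hb hm hs; have D0 : 0 < dl + De ^+ 2 by rewrite ltr_pwDl ?sqr_ge0.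
set t := dl / _; have t0 : 0 <= t by rewrite divr_ge0 ?ltW.
have t1 : t <= 1 by rewrite ler_pdivrMr// mul1r lerDl sqr_ge0.
have t2 : t ^+ 2 <= 1 by rewrite expr_le1.
have s2 : 0 <= s ^+ 2 := sqr_ge0 s.
have [h1|h1] := leP `|d1| m; first by have := natr01 R (`|d2| <= m) => /andP[? _];
  rewrite (_ : true%:R = 1 :> R)//; lra.
have [h2|h2] := leP `|d2| m; first by rewrite (_ : true%:R = 1 :> R)// (_ : false%:R = 0 :> R)//;
  lra.
rewrite (_ : false%:R = 0 :> R)// !addr0.
have h : m ^+ 2 <= `|d1 * d2| by rewrite normrM expr2; apply: ler_pM; rewrite ?ltW.
have hD : m ^+ 2 / 2 <= `|De|.
  have H : `|d1 * d2| <= `|De| + `|De - d1 * d2| by have := ler_normB De (De - d1 * d2);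
    rewrite subKr.
  by move: h hb hm H; move: `|d1 * d2| `|De - _| `|De| (m ^+ 2) => *; lra.
have hD2 : m ^+ 4 / 4 <= De ^+ 2.
  rewrite (_ : m ^+ 4 / 4 = (m ^+ 2 / 2) ^+ 2); last by field.
  by rewrite -[leRHS]real_normK ?num_real// ler_sqr ?nnegrE// divr_ge0 ?sqr_ge0.
have m4 : 0 < m ^+ 4 by rewrite exprn_gt0.
rewrite ler_sqr ?nnegrE//; last by apply: le_trans hs; rewrite divr_ge0 ?mulr_ge0 ?ltW.
apply: le_trans hs; rewrite ler_pdivrMr//; apply: (@le_trans _ _ (4 * dl / m ^+ 4 * (m ^+ 4 / 4))).
  by rewrite le_eqVlt; apply/orP; left; apply/eqP; field; rewrite gt_eqF.
apply: ler_wpM2l; first by rewrite divr_ge0 ?mulr_ge0 ?ltW.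
by apply: (le_trans hD2); rewrite lerDr ltW.
Qed.

End asymptotics.

(** Injectivity is used twice: for the reflected function t -> phi(T - t), negative frequencies
    being covered by oddness, and then for phi itself, which avoids carrying null sets through the
    reflection. *)
Lemma sine_transform_neq0 (R : realType) (T c : R) (I : data R) : 0 < T -> 0 < c -> is_data T I ->
  ~ (phi I = cst 0 %[ae lebT T]) ->
  exists2 x, 0 <= x & sine_deriv T (fun t => phi I (T - t)) c 0 x != 0.
Proof.
move=> T0 c0 dI phi0; have [ipr _] := Rint_reflect (data_phi dI).
apply: contrapT => N; apply: phi0.
have pos s : 0 <= s -> \int[lebT T]_t (phi I (T - t) * sin (s * t)) = 0.
  move=> s0; apply: contrapT => ne; apply: N; exists (s / c); first by rewrite divr_ge0// ltW.
  have e : c * (s / c) = s by rewrite mulrC divfK ?gt_eqF.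
  by apply/eqP; rewrite sine_deriv0 e.
have psi0 : \forall t \ae lebT T, phi I (T - t) = 0.
  apply: (sine_transform_injective ipr) => s; have [/pos//|s0] := leP 0 s.
  have := pos (- s); rewrite oppr_ge0 ltW// => /(_ isT) H.
  rewrite -[RHS]oppr0 -[in RHS]H -RintN.
    by apply: eq_Rintegral => t _; rewrite mulNr sinN mulrN opprK.
  have m : measurable_fun setT (fun t : R => sin (- s * t)).
    by apply: continuous_measurable_fun => t; apply: (@continuous_comp _ _ _ ( *%R (- s)) sin);
      [exact: mulrl_continuous|exact: continuous_sin].
  exact: (intg_mulb ipr m (fun t => sin_max _)).
suff H : \forall t \ae lebT T, phi I t = 0 by apply: aeS H => t + _.
apply: (sine_transform_injective (data_phi dI)) => s.
have m : measurable_fun setT (fun t : R => sin (s * t)).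
  by apply: continuous_measurable_fun => t; apply: (@continuous_comp _ _ _ ( *%R s) sin);
    [exact: mulrl_continuous|exact: continuous_sin].
have [_ <-] := Rint_reflect (intg_mulb (data_phi dI) m (fun t => sin_max _)).
rewrite -[RHS](mul0r (\int[lebT T]_t (0:R))) mul0r.
rewrite (@Rint_ae_eq _ _ _ _ _ (cst 0)); first by rewrite /Rintegral integral0.
by apply: aeS psi0 => t ->; rewrite mul0r.
Qed.

Lemma sqr_ereal_sqrt (R : realType) (x : \bar R) (y : R) : (0 <= x)%E -> (x ^+ 2 = y%:E)%E -> x =
  (Num.sqrt y)%:E.
Proof.
case: x => [r| |] //=.
by rewrite lee_fin => r0 [<-]; rewrite sqrtr_sqr ger0_norm.
Qed.

(** * Convergence and rate of the regularized solutions *)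

Section convergence.
Context (R : realType).
Local Notation mT := (measurableTypeR R).
Local Notation P2 := (mT * mT)%type.
Variables (T lam mu : R).
Hypotheses (T_gt0 : 0 < T) (mu_gt0 : 0 < mu) (lam2mu_gt0 : 0 < lam + 2 * mu).
Variables (uex : 'I_2 -> R -> R * R -> R) (fex : 'I_2 -> R * R -> R) (Iex : data R).
Hypotheses (dataIex : is_data T Iex) (sol : inverse_solution T lam mu Iex uex fex).
Hypotheses (uexC2 : forall j, C2L2 T (uex j)) (uexH2 : forall j, L2H2 T (uex j)) (fexL2 : forall j,
  L2 (fex j)).
Hypothesis phi_neq0 : ~ (phi Iex = cst 0 %[ae lebT T]).
Variable I : R -> data R.
Hypothesis dataI : forall eps, 0 < eps < expR (- 1) -> is_data T (I eps) /\ data_close T eps (I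
  eps) Iex.
Implicit Types (j : 'I_2) (eps : R).

Let c1 := Num.sqrt (lam + 2 * mu).
Let c2 := Num.sqrt mu.
Let c10 : 0 < c1. Proof. by rewrite sqrtr_gt0. Qed.
Let c20 : 0 < c2. Proof. by rewrite sqrtr_gt0. Qed.
Let psi (t : R) := phi Iex (T - t).
Let F1 n y := sine_deriv T psi c1 n y.
Let F2 n y := sine_deriv T psi c2 n y.
(** Chosen so that exp(-kap r ln r) at r = R_eps is [threshold]: e T cancels the same factor in the
    denominator of R_eps. *)
Let kap : R := expR 1 * T.
Let kap0 : 0 < kap. Proof. by rewrite mulr_gt0 ?expR_gt0. Qed.

Let z1 (r : R) (a : R * R) : R := small F1 kap 1 r (enorm a).
Let z2 (r : R) (a : R * R) : R := small F2 kap 1 r (enorm a).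

Let sf j : sqint lebO (fex j). Proof. exact/L2P. Qed.

Let logs eps : 0 < eps < expR (- 1) -> [/\ 0 < eps, eps <= 1, 1 < ln eps^-1 & eps = expR (- ln
  eps^-1)].
Proof.
move=> /andP[e0 e1]; split => //.
- by apply: ltW; apply: (lt_le_trans e1); rewrite -[leRHS]expR0 ler_expR lerN10.
- by rewrite lnV ?posrE// ltrNr -[- 1]expRK ltr_ln ?posrE ?expR_gt0.
- by rewrite lnV ?posrE// opprK lnK ?posrE.
Qed.

(** The exponent 6 collects r^4 from the squared data residual and r^2 from the area of the disc. *)
Let weight_alg (K1 ep r L dl E F pi2 s X : R) : 0 <= K1 -> 0 <= F -> 0 <= pi2 -> 0 < dl -> 0 <= ep
  -> 0 <= r <= L -> 1 <= L ->
  ep ^+ 2 / dl <= E -> s ^+ 2 <= 16 * E ->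
  2 * (K1 * ep * r ^+ 2) ^+ 2 * r ^+ 2 / dl + 16 * pi2 * s ^+ 2 * F + X <=
  (2 * K1 ^+ 2 + 256 * pi2 * F) * (L ^+ 6 * E) + X.
Proof.
move=> K0 F0 p0 d0 e0 /andP[r0 rL] L1 hE hs; rewrite lerD2r (mulrDl (2 * K1 ^+ 2)); apply: lerD.
  rewrite (_ : 2 * _ * _ / dl = 2 * K1 ^+ 2 * (r ^+ 6 * (ep ^+ 2 / dl))); last by ring.
  apply: ler_wpM2l; first by rewrite mulr_ge0 ?sqr_ge0.
  apply: ler_pM => //; [exact: exprn_ge0|by rewrite divr_ge0 ?sqr_ge0// ltW|].
  by rewrite lerXn2r ?nnegrE// (le_trans r0).
have E0 : 0 <= E by apply: le_trans hE; rewrite divr_ge0 ?sqr_ge0 ?ltW.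
rewrite (_ : 16 * pi2 * s ^+ 2 * F = 16 * pi2 * F * s ^+ 2); last by ring.
rewrite (_ : 256 * pi2 * F * _ = 16 * pi2 * F * (16 * (L ^+ 6 * E))); last by ring.
apply: ler_wpM2l; first by rewrite !mulr_ge0.
apply: (le_trans hs); rewrite ler_pM2l// ler_peMl// exprn_ege1//.
Qed.

Let weight_ge0 (a b F : R) : 0 <= F -> 0 <= 2 * a ^+ 2 + 256 * b ^+ 2 * F.
Proof.
move=> F0; have := sqr_ge0 a; have := mulr_ge0 (sqr_ge0 b) F0; rewrite -mulrA.
by move: (b ^+ 2 * F) (a ^+ 2) => x y; lra.
Qed.

Let sigma_alg (m4 dl L : R) : dl = expR (- (13 / 14 * L)) -> 0 <= L -> expR (- (4 / 63 * L)) <= m4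
  -> 0 < m4 ->
  4 * dl / m4 <= 4 * expR (- (L / 2)).
Proof.
move=> -> L0 hm m0; rewrite -mulrA ler_pM2l// ler_pdivrMr//.
apply: le_trans (ler_wpM2l (expR_ge0 _) hm); rewrite -expRD ler_expR; lra.
Qed.

Let sigma_sqr (L : R) : 0 < L -> (4 * expR (- (L / 2))) ^+ 2 <= 16 * expR (- (L / 2)).
Proof.
move=> L0; rewrite exprMn (_ : 4 ^+ 2 = 16); last by ring.
by rewrite ler_pM2l// expr2 ler_piMl ?expR_ge0// -expR0 ler_expR oppr_le0 divr_ge0 ?ltW.
Qed.

(** In powers of eps: delta = eps^(13/14) and m >= eps^(1/63), so eps / m^2, delta / m^4 and eps^2 /
    delta have exponents at least 61/63, 109/126 and 15/14. All are rounded down to 1/2. *)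
Lemma deep_bounds K L eps : 0 <= K -> 0 < eps -> ln eps^-1 = L -> eps = expR (- L) -> deep T K L ->
  [/\ K * eps * radius T L ^+ 2 <= threshold T L ^+ 2 / 2,
   4 * delta eps / threshold T L ^+ 4 <= 4 * expR (- (L / 2)),
   eps ^+ 2 / delta eps <= expR (- (L / 2)) & 0 < delta eps].
Proof.
move=> K0 e0 lE eE [L1 rL hm hK]; have L0 : 0 < L by exact: lt_trans ltr01 L1.
have dE : delta eps = expR (- (13 / 14 * L)) by rewrite deltaE// lE.
have m0 : 0 < threshold T L by exact: expR_gt0.
have r0 := radius_gt0 T_gt0 L1.
have mX n : expR (- (n%:R / 63 * L)) <= threshold T L ^+ n.
  rewrite (_ : - (n%:R / 63 * L) = n%:R * - (L / 63)); last by ring.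
  by rewrite expRM_natl; apply: lerXn2r; rewrite ?nnegrE ?expR_ge0 ?(ltW m0).
split.
- have h2 : radius T L ^+ 2 <= L ^+ 7.
    apply: (@le_trans _ _ (L ^+ 2)); first by rewrite lerXn2r ?nnegrE ?(ltW r0) ?(ltW L0).
    by rewrite ler_eXn2l.
  have h3 : eps <= expR (- (L / 2)) * threshold T L ^+ 2.
    by apply: le_trans (ler_wpM2l (expR_ge0 _) (mX 2)); rewrite eE -expRD ler_expR; lra.
  have h4 : K * eps * radius T L ^+ 2 <= K * (expR (- (L / 2)) * threshold T L ^+ 2) * L ^+ 7.
    by apply: ler_pM => //; [rewrite mulr_ge0// ltW|exact: sqr_ge0|exact: ler_wpM2l].
  apply: (le_trans h4).
  rewrite (_ : K * _ * _ = (2 * K * (L ^+ 7 * expR (- (L / 2)))) * (threshold T L ^+ 2 / 2));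
    last by field.
  by apply: ler_piMl => //; rewrite divr_ge0 ?sqr_ge0.
- by apply: (sigma_alg dE (ltW L0) (mX 4)); rewrite exprn_gt0.
- by rewrite dE ler_pdivrMr ?expR_gt0// eE -expRM_natl -expRD ler_expR; lra.
- by rewrite dE expR_gt0.
Qed.

(** Since gx = 2 Dx C for exact data, the residual is (ge - gx) - 2 (De - Dx) C. *)
Let perturbed_alg (ge gx De Dx C M K e n r : R) : gx = 2 * Dx * C -> `|ge - gx| <= K * e * n ^+ 2 ->
  `|De - Dx| <= K * e * n ^+ 2 -> `|C| <= M -> 0 <= K -> 0 <= e -> 0 <= n -> n <= r ->
  `|ge - 2 * De * C| <= (K + 2 * K * M) * e * r ^+ 2.
Proof.
move=> E h1 h2 hC K0 e0 n0 nr; have M0 : 0 <= M := le_trans (normr_ge0 C) hC.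
have hr : n ^+ 2 <= r ^+ 2 by rewrite lerXn2r ?nnegrE// (le_trans n0).
have b : K * e * n ^+ 2 <= K * e * r ^+ 2 by apply: ler_wpM2l => //; rewrite mulr_ge0.
rewrite (_ : ge - 2 * De * C = (ge - gx) - 2 * ((De - Dx) * C)); last by rewrite E; ring.
apply: le_trans (ler_normB _ _) _; rewrite normrM (ger0_norm (_ : 0 <= 2))// normrM.
have h3 : `|De - Dx| * `|C| <= K * e * r ^+ 2 * M by apply: ler_pM => //; exact: le_trans h2 b.
have h4 := le_trans h1 b.
rewrite (_ : _ * e * r ^+ 2 = K * e * r ^+ 2 + 2 * (K * e * r ^+ 2 * M)); last by ring.
by apply: lerD => //; rewrite ler_pM2l.
Qed.

(** K precedes j because [deep] refers to it; W depends on the norms of f_j. The data enter the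
    bound only through the power of eps, and the masses S and Tl remain parameters, to be estimated
    differently with and without H^1 regularity. *)
Lemma error_bound : exists K, forall j, exists2 W, 0 <= W & forall eps S Tl, 0 < eps < expR (- 1)
  -> deep T K (ln eps^-1) ->
  let r := Reps T eps in
  intg leb2 (fun a => ctr (fex j) a ^+ 2 * (z1 r a + z2 r a)) ->
  \int[leb2]_a (ctr (fex j) a ^+ 2 * (z1 r a + z2 r a)) <= S ->
  intg leb2 (fun a => ctr (fex j) a ^+ 2 * (r <= enorm a)%R%:R) ->
  \int[leb2]_a (ctr (fex j) a ^+ 2 * (r <= enorm a)%R%:R) <= Tl ->
  exists2 err : R, (normL2 (fregR T lam mu j (I eps) eps \- fex j)%R ^+ 2 = err%:E)%E &
    err <= (8 * pi ^+ 2)^-1 * (W * (ln eps^-1 ^+ 6 * expR (- (ln eps^-1 / 2))) + 8 * S + 4 * Tl).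
Proof.
have [K K0 HK] := data_stability lam mu T_gt0 dataIex; exists K => j.
set M := \int[lebO]_x `|fex j x|; set F := \int[lebO]_x fex j x ^+ 2.
have hM a : `|ctr (fex j) a| <= M by exact: ctr_bound (sqintO_intg (sf j)).
have M0 : 0 <= M by exact: Rint_ge0.
have F0 : 0 <= F by apply: Rint_ge0 => x; exact: sqr_ge0.
have K0' := ltW K0; have K10 : 0 <= K + 2 * K * M by rewrite addr_ge0// !mulr_ge0.
exists (2 * (K + 2 * K * M) ^+ 2 + 256 * pi ^+ 2 * F).
  exact: weight_ge0.
move=> eps S Tl ee good r iS hS iT hT; have [e0 e1 L1 eE] := logs ee.
have [dI cl] := dataI ee.
have rE : r = radius T (ln eps^-1) by [].
have [_ rL _ _] := good; have r0 := radius_gt0 T_gt0 L1; rewrite -rE in rL r0.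
have [b1 b2 b3 dl0] := deep_bounds K0' e0 erefl eE good.
set m := threshold T (ln eps^-1) in b1 b2; have m0 : 0 < m by exact: expR_gt0.
rewrite -rE in b1.
have mq := measurable_quotient lam mu T_gt0 j (delta eps) dI.
have [Q HQ] := quotient_bound lam mu T_gt0 j dI dl0 r0.
have e01 : 0 <= eps <= 1 by rewrite ltW.
have step a : enorm a < r -> (quotient T lam mu j (I eps) (delta eps) a - 2 * ctr (fex j) a) ^+ 2 <=
    ((K + 2 * K * M) * eps * r ^+ 2) ^+ 2 / (2 * delta eps) +
    8 * ctr (fex j) a ^+ 2 * ((4 * expR (- (ln eps^-1 / 2))) ^+ 2 + (z1 r a + z2 r a)).
  move=> ar; have n0 : 0 <= enorm a by exact: sqrtr_ge0.
  have [s1 s2] := HK eps (I eps) e01 dI cl j a.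
  have gx := gj_exact T_gt0 mu_gt0 lam2mu_gt0 j a dataIex sol uexC2 uexH2 fexL2.
  have hw := perturbed_alg gx s1 s2 (hM a) K0' (ltW e0) n0 (ltW ar).
  have hD : `|D T lam mu (I eps) a - F1 0 (enorm a) * F2 0 (enorm a)| <= K * eps * r ^+ 2.
    rewrite /F1 /F2 -!divisor_sine_deriv//; apply: (le_trans s2); apply: ler_wpM2l;
      first by rewrite mulr_ge0// ltW.
    by rewrite lerXn2r ?nnegrE ?(ltW r0)// ltW.
  have hf := fit_bound dl0 m0 hD b1 b2.
  apply: le_trans (regularized_pointwise dl0 hw (lexx _)) _; rewrite lerD2l; apply: ler_wpM2l.
    by apply: mulr_ge0 => //; exact: sqr_ge0.
  apply: (le_trans hf); rewrite /z1 /z2 /small mul1r (ltW ar) !andbT //.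
have z01 a : 0 <= z1 r a + z2 r a.
  by apply: addr_ge0; [have /andP[] := small01 F1 kap 1 r (enorm a)|have /andP[] := small01 F2 kap
    1 r (enorm a)].
have [sI err] := regularized_error (sf j) r0 dl0 mq HQ step z01 iS hS iT hT.
have fE : fregR T lam mu j (I eps) eps = fun x => (4 * pi ^+ 2)^-1 * icos (fun a => disc r a *
  quotient T lam mu j (I eps) (delta eps) a) x.
  by apply/funext => x; rewrite /fregR (proj1 (fregE _ _ _ _ _ _ _)).
have se := sqintB (sqintZ (4 * pi ^+ 2)^-1 sI) (sf j).
exists (\int[lebO]_x ((4 * pi ^+ 2)^-1 * icos (fun a => disc r a * quotient T lam mu j (I eps)
  (delta eps) a) x - fex j x) ^+ 2).
  by rewrite fE; exact: normL2_sqr se.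
apply: (le_trans err); apply: ler_wpM2l; first by rewrite invr_ge0 mulr_ge0 ?sqr_ge0.
rewrite -!(addrA _ (8 * S));
  apply: (weight_alg (8 * S + 4 * Tl) K10 F0 (sqr_ge0 pi) dl0 (ltW e0) _ (ltW L1) b3).
  by rewrite (ltW r0).
have L0 : 0 < ln eps^-1 := lt_trans ltr01 L1.
by move: (ln _) L0 => L L0; exact: sigma_sqr.
Qed.

Let near_log (P : R -> Prop) : (\forall L \near +oo, P L) -> \forall eps \near (0 : R)^'+, P (ln
  eps^-1).
Proof. by move=> hP; exact: (@log_inv_cvg R _ hP). Qed.

Let near_cutoff (P : R -> Prop) : (\forall r \near +oo, P r) -> \forall eps \near (0 : R)^'+, P
  (Reps T eps).
Proof. by move=> hP; exact: (near_log (P := fun L => P (radius T L)) (radius_cvg T_gt0 hP)). Qed.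

Let near_pinfty_mono2 (P Q S : R -> Prop) : (forall r, P r -> Q r -> S r) ->
  (\forall r \near +oo, P r) -> (\forall r \near +oo, Q r) -> \forall r \near +oo, S r.
Proof.
move=> h h1 h2; near=> r; apply: h; near: r => //.
Unshelve. all: by end_near. Qed.

Let near0_mono (P S : R -> Prop) : (forall e, P e -> S e) ->
  (\forall e \near (0 : R)^'+, P e) -> \forall e \near (0 : R)^'+, S e.
Proof. by move=> h hP; exact: (filterS h hP). Qed.

Let near0_mono5 (P1 P2 P3 P4 P5 S : R -> Prop) : (forall e, P1 e -> P2 e -> P3 e -> P4 e -> P5 e ->
  S e) ->
  (\forall e \near (0 : R)^'+, P1 e) -> (\forall e \near (0 : R)^'+, P2 e) -> (\forall e \near (0 :
    R)^'+, P3 e) ->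
  (\forall e \near (0 : R)^'+, P4 e) -> (\forall e \near (0 : R)^'+, P5 e) -> \forall e \near (0 :
    R)^'+, S e.
Proof.
move=> h h1 h2 h3 h4 h5; near=> e; apply: h; near: e => //.
Unshelve. all: by end_near. Qed.

Let near_unit : \forall eps \near (0 : R)^'+, 0 < eps < expR (- 1).
Proof.
near=> eps; apply/andP; split; near: eps; first exact: nbhs_right_gt.
by apply: nbhs_right_lt; exact: expR_gt0.
Unshelve. all: by end_near. Qed.

Let psi_intg : intg (lebT T) psi.
Proof. by have [] := Rint_reflect (data_phi dataIex). Qed.

Let double_le (x : R) : x + x <= 2 * x. Proof. by rewrite mulr_natl mulr2n. Qed.

Let small_sum (K : R * R -> R) (S : R -> R) :
  (\forall r \near +oo, intg leb2 (fun a => K a * z1 r a) /\ \int[leb2]_a (K a * z1 r a) <= S r) ->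
  (\forall r \near +oo, intg leb2 (fun a => K a * z2 r a) /\ \int[leb2]_a (K a * z2 r a) <= S r) ->
  \forall r \near +oo, intg leb2 (fun a => K a * (z1 r a + z2 r a)) /\ \int[leb2]_a (K a * (z1 r a
    + z2 r a)) <= 2 * S r.
Proof.
move=> H1 H2; apply: (near_pinfty_mono2 _ H1 H2) => r [i1 b1] [i2 b2].
have E : (fun a => K a * (z1 r a + z2 r a)) = fun a => K a * z1 r a + K a * z2 r a.
  by apply/funext => a; rewrite mulrDr.
rewrite E; split; first exact: intgD.
by rewrite (RintD i1 i2); apply: le_trans (lerD b1 b2) _; exact: double_le.
Qed.

Let dF1 k y := is_derive_sine_deriv T_gt0 psi_intg (ltW c10) k y.
Let dF2 k y := is_derive_sine_deriv T_gt0 psi_intg (ltW c20) k y.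
Let bF1 k y := sine_deriv_bound T_gt0 psi_intg (ltW c10) k y.
Let bF2 k y := sine_deriv_bound T_gt0 psi_intg (ltW c20) k y.
Let cT1 : 0 <= c1 * T. Proof. by rewrite mulr_ge0 ?ltW. Qed.
Let cT2 : 0 <= c2 * T. Proof. by rewrite mulr_ge0 ?ltW. Qed.

Let K j a := ctr (fex j) a ^+ 2.

Let measurable_K j : measurable_fun (setT : set P2) (K j).
Proof. by apply: measurable_funX; exact: measurable_ctr (sqintO_intg (sf j)). Qed.

Let K_bound j a : 0 <= K j a <= (\int[lebO]_x `|fex j x|) ^+ 2.
Proof.
rewrite /K sqr_ge0 -[X in X <= _]real_normK ?num_real// ler_sqr ?nnegrE//; last exact: Rint_ge0.
exact: ctr_bound (sqintO_intg (sf j)).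
Qed.

Let K_ge0 j a : 0 <= K j a. Proof. by have /andP[] := K_bound j a. Qed.

Let K_intg j : intg leb2 (K j). Proof. by have [] := sqint_ctr (sf j). Qed.

Lemma small_sum_mass j eta : 0 < eta -> \forall r \near +oo,
  intg leb2 (fun a => K j a * (z1 r a + z2 r a)) /\ \int[leb2]_a (K j a * (z1 r a + z2 r a)) <= 2 *
    eta.
Proof.
move=> eta0; have [x1 x10 F1x] := sine_transform_neq0 T_gt0 c10 dataIex phi_neq0.
have [x2 x20 F2x] := sine_transform_neq0 T_gt0 c20 dataIex phi_neq0.
have H1 := small_mass dF1 bF1 cT1 F1x x10 kap0 (measurable_K j) (K_bound j) (K_intg j) eta0.
have H2 := small_mass dF2 bF2 cT2 F2x x20 kap0 (measurable_K j) (K_bound j) (K_intg j) eta0.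
exact: (small_sum (S := fun=> eta) H1 H2).
Qed.

Lemma small_sum_mass_decay j P Q1 Q2 eta : decay (K j) P Q1 -> decay (K j \o @swap2 R) (P \o @swap2
  R) Q2 -> 0 < eta ->
  \forall r \near +oo,
  intg leb2 (fun a => K j a * (z1 r a + z2 r a)) /\ \int[leb2]_a (K j a * (z1 r a + z2 r a)) <= 2 *
    (eta / r).
Proof.
move=> d1 d2 eta0; have [x1 x10 F1x] := sine_transform_neq0 T_gt0 c10 dataIex phi_neq0.
have [x2 x20 F2x] := sine_transform_neq0 T_gt0 c20 dataIex phi_neq0.
have KM a : K j a <= (\int[lebO]_x `|fex j x|) ^+ 2 by have /andP[] := K_bound j a.
have H1 := small_mass_decay dF1 bF1 cT1 F1x x10 kap0 d1 d2 KM eta0.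
have H2 := small_mass_decay dF2 bF2 cT2 F2x x20 kap0 d1 d2 KM eta0.
exact: (small_sum (S := fun r => eta / r) H1 H2).
Qed.

Let pi_sqr : (1 : R) <= 8 * pi ^+ 2.
Proof. by have := pi_ge2 R; move: pi => x x2; nra. Qed.

Let limit_alg (p X Y S Tl err eta : R) : 1 <= p -> 0 < eta -> err <= p^-1 * (X + 8 * S + 4 * Tl) ->
  X <= Y -> Y <= eta / 4 -> S <= 2 * (eta / 64) ->
  Tl <= eta / 16 -> err <= eta.
Proof.
move=> p1 eta0 h hX hY hS hT; have p0 : 0 < p := lt_le_trans ltr01 p1; apply: (le_trans h);
  rewrite ler_pdivrMl//.
by apply: le_trans (ler_wpM2r (ltW eta0) p1); lra.
Qed.

Let weight_step (W L : R) : 0 <= W -> 1 < L -> L * (W * (L ^+ 6 * expR (- (L / 2)))) = W * (L ^+ 7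
  * expR (- (L / 2))).
Proof. by move=> W0 L1; rewrite (exprS L 6); ring. Qed.

Lemma error_small j eta : 0 < eta -> \forall eps \near (0 : R)^'+,
  exists2 err : R, (normL2 (fregR T lam mu j (I eps) eps \- fex j)%R ^+ 2 = err%:E)%E & err <= eta.
Proof.
move=> eta0; have [K0 HK] := error_bound; have [W W0 HW] := HK j.
(* The shares add up to eta / 4 + 8 (2 eta / 64) + 4 (eta / 16) = 3 eta / 4, and the prefactor 1 /
   (8 pi^2) is at most 1. *)
have e4 : 0 < eta / 4 by rewrite divr_gt0.
have e64 : 0 < eta / 64 by rewrite divr_gt0.
have e16 : 0 < eta / 16 by rewrite divr_gt0.
have A1 := near_log (deep_near T_gt0 K0); have A2 := near_log (pow_expR_small W e4).
have A3 := near_cutoff (small_sum_mass j e64);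
  have A4 := near_cutoff (Rint_tail_cvg0 (K_intg j) (K_ge0 j) e16).
apply: (near0_mono5 _ near_unit A1 A2 A3 A4) => eps ee good hW [i3 h3] [i4 h4].
have [err Eerr herr] := HW eps _ _ ee good i3 h3 i4 h4; exists err => //.
have [L1 _ _ _] := good; rewrite -(weight_step W0 L1) in hW.
apply: (limit_alg pi_sqr eta0 herr _ hW (lexx _) (lexx _)).
by rewrite ler_peMl ?(ltW L1)// !mulr_ge0 ?expR_ge0 ?exprn_ge0 ?(ltW (lt_trans ltr01 L1)).
Qed.

(** The norm is extended-real: near 0 it is finite, because [error_small] exhibits its square as a
    real number, and the limit is then taken in the reals. *)
Lemma convergence_L2 j : normL2 (fregR T lam mu j (I eps) eps \- fex j) @[eps --> (0 : R)^'+] -->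
  0%E.
Proof.
pose E eps := fine (normL2 (fregR T lam mu j (I eps) eps \- fex j)).
have H (eta : R) : 0 < eta -> \forall eps \near (0 : R)^'+,
    normL2 (fregR T lam mu j (I eps) eps \- fex j) = (E eps)%:E /\ `|E eps| <= eta.
  move=> eta0; have := error_small j (exprn_gt0 2 eta0); apply: near0_mono => eps [err Eerr herr].
  have Es := sqr_ereal_sqrt (normL2_ge0 _) Eerr; rewrite /E Es /=; split => //.
  by rewrite ger0_norm ?sqrtr_ge0// -[leRHS]ger0_norm ?(ltW eta0)// -sqrtr_sqr ler_wsqrtr.
apply: cvg_trans (_ : (E eps)%:E @[eps --> (0 : R)^'+] --> 0%E).
  by apply: near_eq_cvg; apply: near0_mono (H 1 ltr01) => eps [-> _].
apply: cvg_EFin; first by near=> eps.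
apply/cvgrPdist_le => eta eta0; apply: near0_mono (H eta eta0) => eps [_].
by rewrite sub0r normrN.
Unshelve. all: by end_near. Qed.

(** Multiply the goal by 8 p^2 r with p = pi. The terms X and S give 1/2 each and 16 P / r is at
    most 1: together they fill 8 p^2 (2 p)^-2 = 2. The tail gives 16 J <= 768 p N <= 384 p^2 N as p
    >= 2, below 528 p^2 N = 8 p^2 (66 N). *)
Let rate_alg (p r N P J X S Tl err : R) : 2 <= p -> 0 < r -> 0 <= N -> err <= (8 * p ^+ 2)^-1 * (X
  + 8 * S + 4 * Tl) ->
  X <= 2^-1 / r -> S <= 2 * (32^-1 / r) -> Tl <= 4 / r ^+ 2 * P + 4 / r * J -> J <= 48 * p * N ->
    16 * P <= r ->
  err <= (66 * N + (2 * p) ^- 2) * r^-1.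
Proof.
move=> p2 r0 N0 h hX hS hT hJ hP; have p0 : 0 < p by exact: lt_le_trans p2.
apply: (le_trans h); rewrite ler_pdivrMl ?mulr_gt0 ?exprn_gt0//.
have u0 : 0 < r^-1 by rewrite invr_gt0.
have -> : 8 * p ^+ 2 * ((66 * N + (2 * p) ^- 2) * r^-1) = r^-1 * (528 * (p ^+ 2 * N) + 2).
  by field; rewrite !gt_eqF.
have pN : 2 * (p * N) <= p ^+ 2 * N by rewrite expr2 mulrA; apply: ler_wpM2r => //;
  by rewrite ler_pM2r.
have pN0 : 0 <= p * N by rewrite mulr_ge0// ltW.
have hP' : 16 * P * r^-1 <= 1 by rewrite ler_pdivrMr ?mul1r.
have hJ' : 16 * J <= 768 * (p * N) by lra.
apply: (@le_trans _ _ (r^-1 * (1 + 16 * P * r^-1 + 16 * J))).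
  rewrite (_ : r^-1 * _ = 2^-1 / r + 8 * (2 * (32^-1 / r)) + 4 * (4 / r ^+ 2 * P + 4 / r * J));
    last by field; rewrite gt_eqF.
  by lra.
by apply: ler_wpM2l; [exact: ltW|lra].
Qed.

Let H1_decay_pair j : H1 (fex j) -> exists P Q1 Q2 N, [/\ decay (K j) P Q1, decay (K j \o @swap2 R)
  (P \o @swap2 R) Q2,
  0 <= N, sqnormH1 (fex j) = N%:E &
  \int[@lebesgue_measure R]_y Q1 y + \int[@lebesgue_measure R]_y Q2 y <= 48 * pi * N].
Proof.
move=> /H1_decay[P [Q1 [Q2 [N [[P0 Q10 Q20 iP] [iQ1 iQ2 h1 h2 [EN hN]]]]]]]; exists P, Q1, Q2, N.
have N0 : 0 <= N.
  have := addr_ge0 (Rint_ge0 (@lebesgue_measure R) Q10) (Rint_ge0 (@lebesgue_measure R) Q20).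
  by move=> /le_trans/(_ hN); rewrite pmulr_rge0// mulr_gt0 ?pi_gt0.
split => //.
- by split; [split => //; exact: measurable_K|split => // a; rewrite /K -exprMn].
- split; split => //.
  + by apply: measurableT_comp (measurable_K j) _; exact: measurable_swap2.
  + by move=> a; exact: K_ge0.
  + by move=> a; exact: P0.
  + by have [] := swap2_leb2 iP.
  + by move=> a; rewrite /= /K -exprMn; exact: (h2 (swap2 a)).
Qed.

Lemma convergence_rate j : H1 (fex j) -> \forall eps \near (0 : R)^'+,
  (normL2 (fregR T lam mu j (I eps) eps \- fex j)%R ^+ 2 <=
   (63 * expR 1 * T)%:E * (66%:E * sqnormH1 (fex j) + ((2 * pi) ^- 2)%:E) * (ln (ln eps^-1) / ln
     eps^-1)%:E)%E.
Proof.
move=> /H1_decay_pair[P [Q1 [Q2 [N [d1 d2 N0 EN hN]]]]].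
have [K0 HK] := error_bound; have [W W0 HW] := HK j.
have h2 : 0 < 2^-1 :> R by rewrite invr_gt0.
have h32 : 0 < 32^-1 :> R by rewrite invr_gt0.
have A1 := near_log (deep_near T_gt0 K0); have A2 := near_log (pow_expR_small W h2).
have A3 := near_cutoff (small_sum_mass_decay d1 d2 h32).
have A4 : \forall eps \near (0 : R)^'+, 16 * \int[leb2]_a P a <= Reps T eps.
  by apply: (near_cutoff (P := fun r => 16 * \int[leb2]_a P a <= r)); apply: nbhs_pinfty_ge;
    exact: num_real.
apply: (near0_mono5 _ near_unit A1 A2 A3 A4) => eps ee good hW [i3 h3] h4.
have [L1 rL _ _] := good; rewrite -(weight_step W0 L1) in hW.
have r0 : 0 < Reps T eps := radius_gt0 T_gt0 L1.
have [i5 h5] := decay_tail d1 d2 r0.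
have [err -> herr] := HW eps _ _ ee good i3 h3 i5 h5.
have hX : W * (ln eps^-1 ^+ 6 * expR (- (ln eps^-1 / 2))) <= 2^-1 / Reps T eps.
  rewrite ler_pdivlMr// mulrC; apply: le_trans hW; apply: ler_wpM2r; last exact: rL.
  by rewrite !mulr_ge0 ?expR_ge0 ?exprn_ge0 ?(ltW (lt_trans ltr01 L1)).
have := rate_alg (pi_ge2 R) r0 N0 herr hX (lexx _) (lexx _) hN h4.
rewrite (_ : (Reps T eps)^-1 = 63 * expR 1 * T * (ln (ln eps^-1) / ln eps^-1));
  last exact: radius_inv.
rewrite EN -(EFinM 66 N) -(EFinD (66 * N)) -(EFinM (63 * expR 1 * T)) -EFinM lee_fin.
by rewrite mulrA [X in _ <= X * _]mulrC.
Qed.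

End convergence.

Unset Implicit Arguments.

Theorem theorem2 (R : realType) (T lam mu : R)
    (T_gt0 : 0 < T) (mu_gt0 : 0 < mu) (lam2mu_gt0 : 0 < lam + 2 * mu)
    (uex : 'I_2 -> R -> R * R -> R) (fex : 'I_2 -> R * R -> R) (Iex : data R)
    (dataIex : is_data T Iex)
    (sol : inverse_solution T lam mu Iex uex fex)
    (uexC2 : forall j, C2L2 T (uex j)) (uexH2 : forall j, L2H2 T (uex j))
    (fexL2 : forall j, L2 (fex j))
    (phi_neq0 : ~ (phi Iex = cst 0 %[ae lebT T]))
    (I : R -> data R)
    (dataI : forall eps, 0 < eps < expR (- 1) ->
       is_data T (I eps) /\ data_close T eps (I eps) Iex) :
  [/\ forall eps, 0 < eps < expR (- 1) -> forall j,
        (forall xi, complex.Im (freg T lam mu j (I eps) eps xi) = 0) /\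
        {within closure Omega, continuous (fregR T lam mu j (I eps) eps)},
      forall j,
        normL2 (fregR T lam mu j (I eps) eps \- fex j) @[eps --> 0^'+] --> 0%E &
      (forall j, H1 (fex j)) ->
        \forall eps \near 0^'+, forall j,
          (normL2 (fregR T lam mu j (I eps) eps \- fex j)%R ^+ 2 <=
           (63 * expR 1 * T)%:E * (66%:E * sqnormH1 (fex j) + ((2 * pi) ^- 2)%:E)
             * (ln (ln eps^-1) / ln eps^-1)%:E)%E].
Proof.
split.
- move=> eps /[dup] ee /andP[e0 e1] j; have [dI _] := dataI _ ee.
  have L1 : 1 < ln eps^-1 by rewrite lnV ?posrE// ltrNr -[- 1]expRK ltr_ln ?posrE ?expR_gt0.
  apply: freg_real_continuous => //; first by rewrite /delta powR_gt0.
  exact: (radius_gt0 T_gt0 L1).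
- exact: (convergence_L2 T_gt0 mu_gt0 lam2mu_gt0 dataIex sol uexC2 uexH2 fexL2 phi_neq0 dataI).
- move=> fH1; apply: filter_forall => j.
  exact: (convergence_rate T_gt0 mu_gt0 lam2mu_gt0 dataIex sol uexC2 uexH2 fexL2 phi_neq0 dataI (fH1 j)).
Qed.
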